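(* If $X$ is a non-amenable metric space with bounded geometry and it has asymptotic dimension at most one, then $K_0(B^p_u(X))=0$ for all $p\in[1,\infty)$.
   Context: A metric space $(X,d)$ has bounded geometry if for any $R>0$ there exists $N_R>0$ such that $|B_R(x)|\le N_R$ for all $x\in X$, where $B_R(x)$ is the closed ball of radius $R$ centered at $x$. For $T\in B(\ell^p(X))$ write $T_{xy}=(T\delta_y)(x)$ and $\mathrm{prop}(T)=\sup\{d(x,y):x,y\in X,\ T_{xy}\neq 0\}\in[0,\infty]$. The $\ell^p$ uniform Roe algebra $B^p_u(X)$ is the operator norm closure in $B(\ell^p(X))$ of the algebra of all bounded operators on $\ell^p(X)$ with finite propagation. Amenability: for $A\subset X$ and $R>0$ let $\partial_R(A)=\{x\in X: d(x,A)\le R\text{ and }d(x,X\setminus A)\le R\}$ (with $d(x,\emptyset)=\infty$). A nonempty finite set $F\subset X$ is an $(R,\varepsilon)$-Følner set if $|\partial_R(F)|/|F|\le\varepsilon$. $(X,d)$ is amenable if there exists an $(R,\varepsilon)$-Følner set for every $R>0$ and $\varepsilon>0$; otherwise it is non-amenable. A collection $\mathcal{U}$ of subsets of a metric space is $r$-separated if $d(A,B)>r$ for all distinct $A,B\in\mathcal{U}$. A metric space $X$ with bounded geometry has asymptotic dimension at most $d$ if for any $r>0$ there is a decomposition $X=U_0\sqcup\cdots\sqcup U_d$, where each $U_i$ in turn decomposes into a uniformly bounded (i.e. with uniformly bounded diameters) collection of $r$-separated subsets. *)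

(* Defs.v *)
From HB Require Import structures.
From mathcomp Require Import all_boot all_order all_algebra generic_quotient.
From mathcomp Require Import finmap complex.
From mathcomp Require Import all_classical all_reals all_analysis.

Set Implicit Arguments.
Unset Strict Implicit.
Unset Printing Implicit Defensive.

Import Order.TTheory GRing.Theory Num.Theory.
Import ComplexField.Normc.

Local Open Scope classical_set_scope.
Local Open Scope card_scope.
Local Open Scope ring_scope.

Section CoarseGeometry.
Context {R : realType} (X : metricType R).
Implicit Types (x y : X) (A B F : set X) (r e : R).

Definition closed_mball x r : set X := [set y | mdist x y <= r].

Definition bounded_geometry := forall r, 0 < r ->
  exists2 N : nat, (0 < N)%N & forall x, closed_mball x r #<= `I_N.

(* The infimum is taken in \bar R, so that the distance to set0 is +oo. *)
Definition pdist x A : \bar R := ereal_inf [set (mdist x a)%:E | a in A].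

Definition set_dist A B : \bar R :=
  ereal_inf [set (mdist a b)%:E | a in A & b in B].

Definition Rboundary r A : set X :=
  [set x | (pdist x A <= r%:E)%E /\ (pdist x (~` A) <= r%:E)%E].

(* [counting A] is the cardinality of A, equal to +oo if A is infinite. *)
Definition folner_set r e F :=
  [/\ finite_set F, F !=set0 & (counting (Rboundary r F) / counting F <= e%:E)%E].

Definition amenable := forall r e, 0 < r -> 0 < e -> exists F, folner_set r e F.

Definition separated_family r (U : set (set X)) :=
  forall A B, U A -> U B -> A <> B -> (r%:E < set_dist A B)%E.

Definition diameter A : \bar R :=
  ereal_sup [set (mdist a b)%:E | a in A & b in A].

Definition uniformly_bounded (U : set (set X)) :=
  exists D : R, forall A, U A -> (diameter A <= D%:E)%E.

(* Distinct members of an r-separated family with r > 0 are disjoint, so V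
   below is indeed a decomposition of U i. *)
Definition asdim_le (n : nat) := forall r, 0 < r ->
  exists U : 'I_n.+1 -> set X,
    [/\ trivIset [set: 'I_n.+1] U, \bigcup_(i in [set: 'I_n.+1]) U i = [set: X]
      & forall i, exists V : set (set X),
          [/\ \bigcup_(A in V) A = U i, uniformly_bounded V
            & separated_family r V]].

End CoarseGeometry.

Section EllP.
Context {R : realType} {X : choiceType}.
Implicit Types (p : R) (f g h : X -> R[i]).

(* normc : R[i] -> R is the complex modulus. *)
Definition pow_sum p f : \bar R := \esum_(x in [set: X]) (normc (f x) `^ p)%:E.

Lemma normc_ge0 (z : R[i]) : 0 <= normc z.
Proof. by case: z => a b; exact: sqrtr_ge0. Qed.

Lemma pow_sum_ge0 p f : (0 <= pow_sum p f)%E.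
Proof. by apply: esum_ge0 => x _; rewrite lee_fin powR_ge0. Qed.

Lemma pow_sum_ge_fset p f (F : {fset X}) :
  ((\sum_(x <- F) normc (f x) `^ p)%:E <= pow_sum p f)%E.
Proof.
apply: esum_ge; exists [set` F]; first by split=> //; exact: finite_fset.
by rewrite fsbig_finite ?set_fsetK /=; [rewrite sumEFin|exact: finite_fset].
Qed.

Lemma pow_sum_leP p f (M : R) :
  (forall F : {fset X}, \sum_(x <- F) normc (f x) `^ p <= M) <->
  (pow_sum p f <= M%:E)%E.
Proof.
split=> [h|h F]; last first.
  by rewrite -lee_fin; apply: le_trans h; exact: pow_sum_ge_fset.
apply: ge_ereal_sup => _ [A [finA _] <-].
by rewrite fsbig_finite //= sumEFin lee_fin.
Qed.

Lemma pow_sum_comb p (a b A B : R) f g h : 0 <= a -> 0 <= b ->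
  (forall x, normc (h x) `^ p <= a * normc (f x) `^ p + b * normc (g x) `^ p) ->
  (pow_sum p f <= A%:E)%E -> (pow_sum p g <= B%:E)%E ->
  (pow_sum p h <= (a * A + b * B)%:E)%E.
Proof.
move=> a0 b0 hfg /pow_sum_leP fA /pow_sum_leP gB; apply/pow_sum_leP => F.
apply: le_trans (ler_sum _ (fun x _ => hfg x)) _.
by rewrite big_split /= -!mulr_sumr lerD // ler_wpM2l.
Qed.

(* The proof of 1 <= p is an argument, here and below, so that the algebraic
   structures on ellp, bop and uniform_roe can be inferred from the type. *)
Definition in_ellp p (p1 : 1 <= p) : {pred X -> R[i]} :=
  fun f => `[< (pow_sum p f < +oo)%E >].

Lemma in_ellpP p (p1 : 1 <= p) f :
  reflect (exists M : R, (pow_sum p f <= M%:E)%E) (f \in in_ellp p1).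
Proof.
apply: (iffP idP); rewrite unfold_in.
  move=> /asboolP h; exists (fine (pow_sum p f)); rewrite fineK // fin_numElt h.
  by rewrite andbT; apply: lt_le_trans (pow_sum_ge0 _ _); exact: ltNyr.
by move=> [M h]; apply/asboolP; exact: le_lt_trans h (ltry _).
Qed.

Lemma powR_conv p (t u v : R) : 1 <= p -> 0 <= t <= 1 -> 0 <= u -> 0 <= v ->
  (t * u + (1 - t) * v) `^ p <= t * u `^ p + (1 - t) * v `^ p.
Proof.
move=> p1 /andP[t0 t1] u0 v0.
have := @convex_powR R p p1 (Itv01 t0 t1) u v.
rewrite !inE/= !in_itv/= u0 v0 => /(_ erefl erefl).
by rewrite !convRE.
Qed.

Lemma in_ellp_submod p (p1 : 1 <= p) : submod_closed (in_ellp p1).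
Proof.
have p0 : 0 < p by rewrite (lt_le_trans _ p1).
split.
  apply/in_ellpP; exists 0; apply/pow_sum_leP => F; rewrite big1 // => x _.
  by have -> : normc ((0 : X -> R[i]) x) = 0 by [exact: normc0]; rewrite powR0 ?gt_eqF.
move=> c f g /in_ellpP[A fA] /in_ellpP[B gB]; apply/in_ellpP.
exists ((2 * normc c) `^ p * A + 2 `^ p * B).
apply: (pow_sum_comb _ _ _ fA gB); rewrite ?powR_ge0 // => x.
rewrite -!powRM ?mulr_ge0 ?normc_ge0 // -mulrA -normcM.
have := le_normcD (c * f x) (g x).
set u := normc _ ; set v := normc (c * f x); set w := normc (g x) => uvw.
have [? ?] : 0 <= v /\ 0 <= w by rewrite !normc_ge0.
have := @powR_conv p 2^-1 (2 * v) (2 * w) p1.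
have -> : 1 - 2^-1 = 2^-1 :> R by rewrite [X in X - _](splitr 1) div1r addrK.
have half (z : R) : 2^-1 * (2 * z) = z by rewrite mulrA mulVf ?mul1r ?pnatr_eq0.
rewrite !half => conv; apply: (@le_trans _ _ ((v + w) `^ p)).
  by rewrite ge0_ler_powR ?nnegrE ?addr_ge0 ?normc_ge0 ?(ltW p0).
apply: le_trans (conv _ _ _) _; rewrite ?mulr_ge0 //.
  by rewrite invr_ge0 ler0n invf_le1 ?ler1n.
by rewrite -mulrDr ler_piMl ?addr_ge0 ?powR_ge0 // invf_le1 ?ler1n.
Qed.

HB.instance Definition _ p (p1 : 1 <= p) :=
  GRing.isSubmodClosed.Build _ _ (in_ellp p1) (in_ellp_submod p1).

Record ellp p (p1 : 1 <= p) := Ellp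
  { ellp_fun :> X -> R[i]; _ : ellp_fun \in in_ellp p1 }.

HB.instance Definition _ p (p1 : 1 <= p) := [isSub for @ellp_fun p p1].
HB.instance Definition _ p (p1 : 1 <= p) := [Choice of ellp p1 by <:].
HB.instance Definition _ p (p1 : 1 <= p) :=
  [SubChoice_isSubLmodule of ellp p1 by <:].
End EllP.

Arguments ellp {R} X {p} p1.

Section EllPNorm.
Context {R : realType} {X : choiceType} {p : R} (p1 : 1 <= p).
Local Notation E := (ellp X p1).
Implicit Types (u v w : E) (x y : X).

Definition ellp_norm u : R := fine (pow_sum p u) `^ p^-1.

Let p0 : 0 < p. Proof. by rewrite (lt_le_trans _ p1). Qed.

Let powpV (a : R) : 0 <= a -> (a `^ p^-1) `^ p = a.
Proof. by move=> a0; rewrite -powRrM mulVf ?gt_eqF // powRr1. Qed.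

Let powVp (a : R) : 0 <= a -> (a `^ p) `^ p^-1 = a.
Proof. by move=> a0; rewrite -powRrM mulfV ?gt_eqF // powRr1. Qed.

Let powRV (a : R) : 0 <= a -> a^-1 `^ p = (a `^ p)^-1.
Proof. by move=> a0; rewrite -powR_inv1 // -powRrM mulN1r powRN. Qed.

Lemma ellp_norm_ge0 u : 0 <= ellp_norm u.
Proof. exact: powR_ge0. Qed.

Lemma pow_sumE u : pow_sum p u = (ellp_norm u `^ p)%:E.
Proof.
have ge0 := pow_sum_ge0 p u.
rewrite powpV ?fine_ge0 // fineK // fin_numElt (lt_le_trans (ltNyr 0) ge0) /=.
by case: u {ge0} => u /=; rewrite unfold_in => /asboolP.
Qed.

Lemma ellp_norm_leP u (M : R) : 0 <= M ->
  (ellp_norm u <= M) <-> (pow_sum p u <= (M `^ p)%:E)%E.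
Proof.
move=> M0; rewrite pow_sumE lee_fin; split=> h.
  by rewrite ge0_ler_powR ?nnegrE ?ellp_norm_ge0 ?(ltW p0).
rewrite -(powVp M0) -(powVp (ellp_norm_ge0 u)).
by rewrite ge0_ler_powR ?nnegrE ?powR_ge0 ?invr_ge0 ?(ltW p0).
Qed.

Lemma ellp_normZ_le (c : R[i]) u : ellp_norm (c *: u) <= normc c * ellp_norm u.
Proof.
apply/ellp_norm_leP; first by rewrite mulr_ge0 ?normc_ge0 ?ellp_norm_ge0.
rewrite powRM ?normc_ge0 ?ellp_norm_ge0 // -[_ * _]addr0 -[X in _ + X](mul0r 0).
have hu : (pow_sum p u <= (ellp_norm u `^ p)%:E)%E by rewrite pow_sumE.
have h0 : (pow_sum p (0 : E)%R <= 0%:E)%E.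
  apply/pow_sum_leP => F; rewrite big1 // => x _.
  have -> : normc ((0 : E) x) = 0 by exact: normc0.
  by rewrite powR0 ?gt_eqF.
apply: (pow_sum_comb _ _ _ hu h0); rewrite ?powR_ge0 // => x.
by rewrite mul0r addr0 -powRM ?normc_ge0 // -normcM.
Qed.

Lemma ellp_normD_le u v : ellp_norm (u + v) <= ellp_norm u + ellp_norm v.
Proof.
set a := ellp_norm u; set b := ellp_norm v.
suff main (a' b' : R) : a < a' -> b < b' -> ellp_norm (u + v) <= a' + b'.
  apply/ler_addgt0Pr => e e0; rewrite [e]splitr addrACA.
  by apply: main; rewrite ltrDl divr_gt0.
move=> aa' bb'.
have a0 : 0 < a' by apply: le_lt_trans aa'; exact: ellp_norm_ge0.
have b0 : 0 < b' by apply: le_lt_trans bb'; exact: ellp_norm_ge0.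
have ab0 : 0 < a' + b' by rewrite addr_gt0.
apply/ellp_norm_leP; first exact: ltW.
pose t := a' / (a' + b').
have t01 : 0 <= t <= 1.
  by rewrite divr_ge0 ?(ltW a0) ?(ltW ab0) //= ler_pdivrMr // mul1r lerDl ltW.
have t'E : 1 - t = b' / (a' + b').
  by rewrite -(@divff _ (a' + b')) ?gt_eqF // -mulrBl addrC addKr.
have tE : t = a' / (a' + b') by [].
clearbody t.
have /ellp_norm_leP ua := ltW aa'; have {ua}ua := ua (ltW a0).
have /ellp_norm_leP vb := ltW bb'; have {vb}vb := vb (ltW b0).
have pa : 0 < a' `^ p by rewrite powR_gt0.
have pb : 0 < b' `^ p by rewrite powR_gt0.
set k := (a' + b') `^ p.
have kE : k = (k * t / a' `^ p) * a' `^ p + (k * (1 - t) / b' `^ p) * b' `^ p.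
  by rewrite -!mulrA !mulVf ?gt_eqF // !mulr1 -mulrDr addrCA subrr addr0 mulr1.
have [t0 t1] := andP t01; have k0 : 0 <= k by exact: powR_ge0.
rewrite kE; apply: (pow_sum_comb _ _ _ ua vb).
- by rewrite !mulr_ge0 ?invr_ge0 ?powR_ge0.
- by rewrite !mulr_ge0 ?invr_ge0 ?powR_ge0 ?subr_ge0.
move=> x; have hx : normc ((u + v) x) <= normc (u x) + normc (v x) by exact: le_normcD.
apply: (@le_trans _ _ ((normc (u x) + normc (v x)) `^ p)).
  by rewrite ge0_ler_powR ?nnegrE ?addr_ge0 ?normc_ge0 ?(ltW p0).
have -> : normc (u x) + normc (v x) =
    (a' + b') * (t * (normc (u x) / a') + (1 - t) * (normc (v x) / b')).
  have aux (c s z : R) : 0 < c -> 0 < s -> z = s * (c / s * (z / c)).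
    move=> c0 s0; rewrite mulrA [s * _]mulrC divfK ?gt_eqF //.
    by rewrite mulrC divfK ?gt_eqF.
  by rewrite t'E mulrDr tE -!aux.
have ua0 : 0 <= normc (u x) / a' by rewrite divr_ge0 ?normc_ge0 ?(ltW a0).
have vb0 : 0 <= normc (v x) / b' by rewrite divr_ge0 ?normc_ge0 ?(ltW b0).
rewrite powRM ?(ltW ab0) ?addr_ge0 ?mulr_ge0 ?subr_ge0 // -/k.
apply: le_trans (ler_wpM2l (powR_ge0 _ _) (powR_conv p1 t01 ua0 vb0)) _.
rewrite !powRM ?normc_ge0 ?invr_ge0 ?(ltW a0) ?(ltW b0) //.
rewrite !powRV ?(ltW a0) ?(ltW b0) // mulrDr.
by rewrite le_eqVlt; apply/orP; left; apply/eqP; congr (_ + _);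
  rewrite !mulrA mulrAC.
all: by rewrite ?normc_ge0 ?invr_ge0 ?(ltW a0) ?(ltW b0).
Qed.

Lemma normc_le_ellp_norm u x : normc (u x) <= ellp_norm u.
Proof.
have := pow_sum_ge_fset p u [fset x]%fset.
rewrite pow_sumE lee_fin big_seq_fset1 => h.
rewrite -(powVp (normc_ge0 (u x))) -(powVp (ellp_norm_ge0 u)).
by rewrite ge0_ler_powR ?nnegrE ?powR_ge0 ?invr_ge0 ?(ltW p0).
Qed.

Definition delta_fun y : X -> R[i] := fun x => (x == y)%:R.

Lemma delta_in_ellp y : delta_fun y \in in_ellp p1.
Proof.
apply/in_ellpP; exists 1; apply/pow_sum_leP => F.
rewrite (eq_bigr (fun x => (x == y)%:R)); last first.
  move=> x _; rewrite /delta_fun; case: (x == y).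
    by have -> : normc (true%:R : R[i]) = 1 by [exact: normc1]; rewrite powR1.
  by have -> : normc (false%:R : R[i]) = 0 by [exact: normc0]; rewrite powR0 ?gt_eqF.
have [yF|yF] := boolP (y \in F).
  rewrite (big_fsetD1 y) //= eqxx big_seq big1 ?addr0 // => x.
  by rewrite !inE => /andP[/negbTE ->].
by rewrite big_seq big1 // => x xF; case: eqP xF yF => // -> ->.
Qed.

Definition ellp_delta y : E := Ellp (delta_in_ellp y).

Lemma ellp_truncation u (F : {fset X}) (e : R) : 0 <= e ->
    (forall G : {fset X}, [disjoint F & G]%fset ->
      \sum_(x <- G) normc (u x) `^ p <= e `^ p) ->
  ellp_norm (u - \sum_(y <- F) u y *: ellp_delta y) <= e.
Proof.
move=> e0 h; apply/ellp_norm_leP => //; apply/pow_sum_leP => G.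
set w := u - _.
have wE x : w x = if x \in F then 0 else u x.
  have -> : w x = u x - \sum_(y <- F) u y * (x == y)%:R.
    rewrite /w; congr (_ - _).
    elim/big_rec2: _ => // y _ v _ <-.
    by [].
  have [xF|xF] := boolP (x \in F).
    rewrite (big_fsetD1 x) //= eqxx mulr1 big_seq big1 ?addr0 ?subrr // => y.
    by rewrite !inE eq_sym => /andP[/negbTE ->]; rewrite mulr0.
  rewrite big_seq big1 ?subr0 // => y yF.
  by case: eqP yF xF => [-> ->|]; rewrite ?mulr0.
move: (w) wE => {}w wE.
rewrite (bigID (mem F)) /= big1 ?add0r; last first.
  move=> x xF; rewrite wE xF.
  by have -> : normc (0 : R[i]) = 0 by [exact: normc0]; rewrite powR0 ?gt_eqF.
have FG : [disjoint F & G `\` F]%fset.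
  by apply/fdisjointP => x xF; rewrite in_fsetD xF.
have := h _ FG.
apply: le_trans.
rewrite [leRHS](_ : _ = \sum_(x <- G | x \notin F) normc (u x) `^ p).
  by apply: ler_sum => x /negbTE xF; rewrite wE xF.
rewrite -[RHS]big_filter; apply: perm_big; apply: uniq_perm => //.
  by rewrite filter_uniq.
by move=> x; rewrite mem_filter in_fsetD.
Qed.

Lemma ellp_approx u (e : R) : 0 < e -> exists F : {fset X},
  ellp_norm (u - \sum_(y <- F) u y *: ellp_delta y) <= e.
Proof.
move=> e0; have ep : 0 < e `^ p by rewrite powR_gt0.
pose N := ellp_norm u `^ p.
have [F hF] : exists F : {fset X}, N - e `^ p < \sum_(x <- F) normc (u x) `^ p.
  apply: contrapT => /forallNP h.
  have /pow_sum_leP : forall F : {fset X},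
      \sum_(x <- F) normc (u x) `^ p <= N - e `^ p.
    by move=> F; rewrite leNgt; apply/negP/h.
  by rewrite pow_sumE lee_fin leNgt ltrBlDr ltrDl ep.
exists F; apply: ellp_truncation (ltW e0) _ => G FG.
have : \sum_(x <- (F `|` G)%fset) normc (u x) `^ p <= N.
  by rewrite -lee_fin -pow_sumE pow_sum_ge_fset.
rewrite (perm_big (F ++ G)%SEQ) ?big_cat /=; last first.
  apply: uniq_perm => //; last by move=> x; rewrite in_fsetU mem_cat.
  rewrite cat_uniq !fset_uniq /= andbT; apply/hasPn => x xG.
  by move/fdisjointP : FG => /(_ x)/contraL; apply.
move=> hN; have := lt_le_trans (ltr_leD hF (lexx _)) hN.
by rewrite addrAC ltrBlDr ltrD2l => /ltW.
Qed.
End EllPNorm.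

Section BoundedOperators.
Context {R : realType} {X : choiceType} {p : R} (p1 : 1 <= p).
Local Notation E := (ellp X p1).
Implicit Types (u v : E) (x y : X).

Definition bounded_linear : {pred E -> E} := fun T =>
  `[< linear T /\ exists M : R, forall u, ellp_norm (T u) <= M * ellp_norm u >].

Lemma ellp_normN u : ellp_norm (- u) = ellp_norm u.
Proof.
have le v : ellp_norm (- v) <= ellp_norm v.
  rewrite -scaleN1r (le_trans (ellp_normZ_le _ _)) // normcN.
  by have -> : normc (1 : R[i]) = 1 by [exact: normc1]; rewrite mul1r.
have h := le (- u); rewrite opprK in h.
by apply: le_anti; apply/andP; split; [exact: le|exact: h].
Qed.

Lemma ellp_norm0 : ellp_norm (0 : E) = 0.
Proof.
apply: le_anti; rewrite ellp_norm_ge0 andbT -(scale0r (0 : E)).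
apply: (le_trans (ellp_normZ_le _ _)).
by have -> : normc (0 : R[i]) = 0 by [exact: normc0]; rewrite mul0r.
Qed.

Lemma bounded_linearP (T : E -> E) : reflect
  (linear T /\ exists2 M : R, 0 <= M & forall u, ellp_norm (T u) <= M * ellp_norm u)
  (T \in bounded_linear).
Proof.
apply: (iffP idP); rewrite unfold_in.
  move=> /asboolP[linT [M hM]]; split=> //; exists (Num.max 0 M).
    by rewrite le_max lexx.
  by move=> u; apply: le_trans (hM u) _; rewrite ler_wpM2r ?ellp_norm_ge0 // le_max lexx orbT.
by move=> [linT [M _ hM]]; apply/asboolP; split=> //; exists M.
Qed.

Lemma bounded_linear_zmod_closed : zmod_closed bounded_linear.
Proof.
split.
  apply/bounded_linearP; split; first by move=> a u v; rewrite scaler0 addr0.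
  by exists 0 => // u; rewrite mul0r ellp_norm0.
move=> S T /bounded_linearP[linS [M M0 hM]] /bounded_linearP[linT [N N0 hN]].
apply/bounded_linearP; split.
  move=> a u v; rewrite !fctE linS linT scalerBr opprD !addrA.
  by congr (_ + _); rewrite addrAC.
exists (M + N); first exact: addr_ge0.
move=> u; apply: le_trans (ellp_normD_le _ _) _.
by rewrite ellp_normN mulrDl lerD.
Qed.
HB.instance Definition _ :=
  GRing.isZmodClosed.Build _ bounded_linear bounded_linear_zmod_closed.

Record bop := Bop { bop_fun :> E -> E; _ : bop_fun \in bounded_linear }.

HB.instance Definition _ := [isSub for bop_fun].
HB.instance Definition _ := [Choice of bop by <:].
HB.instance Definition _ := [SubChoice_isSubZmodule of bop by <:].
Implicit Types S T : bop.

Lemma bop_linear T : linear T.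
Proof. by case: T => T /= /bounded_linearP[]. Qed.
HB.instance Definition _ T := GRing.isLinear.Build _ _ _ _ T (bop_linear T).

Lemma bop_bounded T :
  exists2 M : R, 0 <= M & forall u, ellp_norm (T u) <= M * ellp_norm u.
Proof. by case: T => T /= /bounded_linearP[]. Qed.

Lemma bop_ext S T : (S : E -> E) =1 T -> S = T.
Proof. by move=> ST; apply/val_inj/funext. Qed.

Lemma bop_id_subproof : (id : E -> E) \in bounded_linear.
Proof. by apply/bounded_linearP; split=> //; exists 1 => // u; rewrite mul1r. Qed.

Lemma bop_comp_subproof S T : (S \o T) \in bounded_linear.
Proof.
apply/bounded_linearP; split; first by move=> a u v; rewrite /= !linearP.
have [M M0 hM] := bop_bounded S; have [N N0 hN] := bop_bounded T.
exists (M * N); first exact: mulr_ge0.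
by move=> u; apply: le_trans (hM _) _; rewrite -mulrA ler_wpM2l.
Qed.

Definition bop_one : bop := Bop bop_id_subproof.
Definition bop_mul S T : bop := Bop (bop_comp_subproof S T).

Lemma bop_mulA : associative bop_mul. Proof. by move=> *; apply: bop_ext. Qed.
Lemma bop_mul1l : left_id bop_one bop_mul. Proof. by move=> *; apply: bop_ext. Qed.
Lemma bop_mul1r : right_id bop_one bop_mul. Proof. by move=> *; apply: bop_ext. Qed.
Lemma bop_mulDl : left_distributive bop_mul +%R.
Proof. by move=> *; apply: bop_ext. Qed.
Lemma bop_mulDr : right_distributive bop_mul +%R.
Proof. by move=> S T U; apply: bop_ext => u; exact: (raddfD S). Qed.

HB.instance Definition _ := GRing.Zmodule_isPzRing.Build bop
  bop_mulA bop_mul1l bop_mul1r bop_mulDl bop_mulDr.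

Definition opnorm T : R := sup [set ellp_norm (T u) | u in [set u | ellp_norm u <= 1]].

Lemma opnorm_has_sup T :
  has_sup [set ellp_norm (T u) | u in [set u | ellp_norm u <= 1]].
Proof.
split; first by exists (ellp_norm (T 0)), 0 => //=; rewrite ellp_norm0 ler01.
have [M M0 hM] := bop_bounded T; exists M => _ [u /= u1 <-].
by apply: le_trans (hM u) _; rewrite -[leRHS]mulr1 ler_wpM2l.
Qed.

Lemma opnorm_ge0 T : 0 <= opnorm T.
Proof.
apply: (le_trans (ellp_norm_ge0 (T 0))).
by apply: (sup_upper_bound (opnorm_has_sup T)); exists 0 => //=; rewrite ellp_norm0 ler01.
Qed.

Lemma le_opnorm T u : ellp_norm (T u) <= opnorm T * ellp_norm u.
Proof.
have [u0|] := eqVneq (ellp_norm u) 0.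
  by have [M _ hM] := bop_bounded T; rewrite u0 mulr0 (le_trans (hM u)) ?u0 ?mulr0.
move=> un0; have u_gt0 : 0 < ellp_norm u by rewrite lt_def un0 ellp_norm_ge0.
have nC (a : R) : 0 <= a -> normc (a%:C)%C = a.
  by move=> a0; rewrite /= expr0n /= addr0 sqrtr_sqr ger0_norm.
pose c : R[i] := ((ellp_norm u)%:C)%C.
have c0 : c != 0 by apply: contraNneq un0 => /(congr1 (@complex.Re R)) /= ->.
have nc : normc c = ellp_norm u by apply: nC; exact: ellp_norm_ge0.
move: c c0 nc => c c0 nc.
have -> : T u = c *: T (c^-1 *: u) by rewrite -linearZ scalerA mulfV ?scale1r.
apply: (le_trans (ellp_normZ_le c (T (c^-1 *: u)))).
rewrite nc [leRHS]mulrC ler_wpM2l ?ellp_norm_ge0 //.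
apply: (sup_upper_bound (opnorm_has_sup T)).
apply: (@imageP _ _ (fun v => ellp_norm (T v)) _ (c^-1 *: u)).
rewrite /mkset.
apply: (le_trans (ellp_normZ_le c^-1 u)).
by rewrite normcV nc mulVf.
Qed.

Lemma opnorm_leP T (M : R) : 0 <= M ->
  (forall u, ellp_norm (T u) <= M * ellp_norm u) <-> opnorm T <= M.
Proof.
move=> M0; split=> h; last first.
  by move=> u; apply: le_trans (le_opnorm T u) _; rewrite ler_wpM2r ?ellp_norm_ge0.
apply: ge_sup => [|_ [u /= u1 <-]]; first by case: (opnorm_has_sup T).
by apply: le_trans (h u) _; rewrite -[leRHS]mulr1 ler_wpM2l.
Qed.

Lemma opnormB_le S T : opnorm (S - T) <= opnorm S + opnorm T.
Proof.
apply/opnorm_leP; first by rewrite addr_ge0 ?opnorm_ge0.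
move=> u; apply: le_trans (ellp_normD_le (S u) (- T u)) _.
by rewrite ellp_normN mulrDl lerD ?le_opnorm.
Qed.

Lemma opnormM_le S T : opnorm (S * T) <= opnorm S * opnorm T.
Proof.
apply/opnorm_leP; first by rewrite mulr_ge0 ?opnorm_ge0.
move=> u; apply: le_trans (le_opnorm S (T u)) _.
by rewrite -mulrA ler_wpM2l ?opnorm_ge0 ?le_opnorm.
Qed.

Lemma opnormBC S T : opnorm (S - T) = opnorm (T - S).
Proof.
have le U V : opnorm (U - V) <= opnorm (V - U).
  apply/opnorm_leP => [|u]; first exact: opnorm_ge0.
  have -> : (U - V) u = - ((V - U) u) by rewrite -[RHS]/(- (V u - U u)) opprB.
  by rewrite ellp_normN; exact: le_opnorm.
by apply: le_anti; apply/andP; split; exact: le.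
Qed.

(* The matrix coefficient T_xy = (T delta_y)(x). *)
Definition mcoef T x y : R[i] := T (ellp_delta p1 y) x.

Lemma bop_coef0 T u x :
  (forall y, u y != 0 -> mcoef T x y = 0) -> T u x = 0.
Proof.
move=> h; apply: eq0_normc; apply: le_anti; rewrite normc_ge0 andbT.
have [M M0 hM] := bop_bounded T.
apply/ler_addgt0Pr => e e0; rewrite add0r.
have d0 : 0 < e / (M + 1) by rewrite divr_gt0 ?ltr_wpDl.
have [F hF] := ellp_approx u d0.
have key : T u x = T (u - \sum_(y <- F) u y *: ellp_delta p1 y) x.
  have -> : \sum_(y <- F) u y *: ellp_delta p1 y = \sum_(y <- F | u y != 0) u y *: ellp_delta p1 y.
    rewrite [RHS]big_mkcond; apply: eq_bigr => y _.
    by case: eqP => [->|]; rewrite ?scale0r.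
  rewrite linearB linear_sum.
  have -> : (T u - \sum_(y <- F | u y != 0) T (u y *: ellp_delta p1 y)) x =
            T u x - (\sum_(y <- F | u y != 0) T (u y *: ellp_delta p1 y)) x by [].
  suff -> : (\sum_(y <- F | u y != 0) T (u y *: ellp_delta p1 y)) x = 0 by rewrite subr0.
  elim/big_rec: _ => // y v uy0 v0.
  have -> : (T (u y *: ellp_delta p1 y) + v) x = T (u y *: ellp_delta p1 y) x + v x by [].
  rewrite v0 addr0 linearZ.
  have -> : (u y *: T (ellp_delta p1 y)) x = u y * mcoef T x y by [].
  by rewrite h ?mulr0.
rewrite key (le_trans (normc_le_ellp_norm _ _)) // (le_trans (hM _)) //.
apply: (le_trans (ler_wpM2l M0 hF)).
rewrite mulrCA ger_pMr // ler_pdivrMr ?mul1r ?ltr_wpDl //.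
by rewrite lerDl.
Qed.
End BoundedOperators.
Arguments bop {R} X {p} p1.

Lemma subrBB (V : zmodType) (a b c d : V) : a - b - (c - d) = (a - c) - (b - d).
Proof. by rewrite !opprB [d - c]addrC addrACA [- b + d]addrC. Qed.

(* Unification otherwise compares norms by unfolding the suprema. *)
#[local] Opaque opnorm ellp_norm.

Section UniformRoe.
Context {R : realType} (X : metricType R) {p : R} (p1 : 1 <= p).
Local Notation B := (bop X p1).
Implicit Types (S T : B) (x y z : X).

(* The element 0 makes the supremum of the empty set 0, as the propagation
   takes values in [0, +oo]. *)
Definition propagation T : \bar R :=
  ereal_sup (0%E |` [set (mdist xy.1 xy.2)%:E |
                     xy in [set xy : X * X | mcoef T xy.1 xy.2 != 0]]).

Definition finite_propagation T := (propagation T < +oo)%E.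

Lemma finite_propagationP T : finite_propagation T <->
  exists2 r : R, 0 <= r & forall x y, mcoef T x y != 0 -> mdist x y <= r.
Proof.
rewrite /finite_propagation; split.
  have : (0 <= propagation T)%E by apply: ereal_sup_ubound; left.
  have : forall x y, mcoef T x y != 0 -> ((mdist x y)%:E <= propagation T)%E.
    by move=> x y xy; apply: ereal_sup_ubound; right; exists (x, y).
  case: (propagation T) => [r|//|] h r0 _; last by [].
  by exists r => // x y /h.
move=> [r r0 h]; apply: (@le_lt_trans _ _ r%:E); last exact: ltry.
by apply: ge_ereal_sup => _ [->|[[x y] /= xy <-]]; rewrite lee_fin //; exact: h.
Qed.

(* The operator-norm closure of the bounded operators of finite propagation. *)
Definition roe_closure : {pred B} := fun T =>
  `[< forall e : R, 0 < e -> exists2 S, finite_propagation S & opnorm (T - S) < e >].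

Lemma finite_propagation1 : finite_propagation 1.
Proof.
apply/finite_propagationP; exists 0 => // x y.
have -> : mcoef 1 x y = (x == y)%:R :> R[i] by [].
by have [->|_] := eqVneq x y; rewrite ?mdistxx ?eqxx.
Qed.

Lemma finite_propagationB S T :
  finite_propagation S -> finite_propagation T -> finite_propagation (S - T).
Proof.
move=> /finite_propagationP[r r0 hr] /finite_propagationP[s s0 hs].
apply/finite_propagationP; exists (r + s); first exact: addr_ge0.
move=> x y; have -> : mcoef (S - T) x y = mcoef S x y - mcoef T x y by [].
have [->|S0 _] := eqVneq (mcoef S x y) 0; last by rewrite (le_trans (hr _ _ S0)) ?lerDl.
by rewrite sub0r oppr_eq0 => /hs /le_trans; apply; rewrite lerDr.
Qed.

Lemma finite_propagationM S T :
  finite_propagation S -> finite_propagation T -> finite_propagation (S * T).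
Proof.
move=> /finite_propagationP[r r0 hr] /finite_propagationP[s s0 hs].
apply/finite_propagationP; exists (r + s); first exact: addr_ge0.
move=> x z; apply: contra_neqT; rewrite -ltNge => rs.
have -> : mcoef (S * T) x z = S (T (ellp_delta p1 z)) x by [].
apply: bop_coef0 => y yz; have {}yz := hs _ _ yz.
have [//|xy] := eqVneq (mcoef S x y) 0; have {}xy := hr _ _ xy.
have := lt_le_trans rs (metric_triangle x y z).
by rewrite ltNge lerD.
Qed.

Lemma roe_closure_subring : subring_closed roe_closure.
Proof.
split.
- rewrite unfold_in; apply/asboolP => e e0; exists 1; first exact: finite_propagation1.
  by rewrite subrr (le_lt_trans _ e0) //; apply/opnorm_leP => // u; rewrite mul0r ellp_norm0.
- move=> S T; rewrite !unfold_in => /asboolP hS /asboolP hT; apply/asboolP => e e0.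
  have e20 : 0 < e / 2 by rewrite divr_gt0.
  have [S' S'f S'e] := hS _ e20; have [T' T'f T'e] := hT _ e20.
  exists (S' - T'); first exact: finite_propagationB.
  have -> : S - T - (S' - T') = (S - S') - (T - T').
    exact: subrBB.
  apply: (le_lt_trans (opnormB_le (S - S') (T - T'))).
  by rewrite (splitr e); exact: (ltrD S'e T'e).
- move=> S T; rewrite !unfold_in => /asboolP hS /asboolP hT; apply/asboolP => e e0.
  have e20 : 0 < e / 2 by rewrite divr_gt0.
  have T0 : 0 < opnorm T + 1 by rewrite ltr_wpDl ?opnorm_ge0.
  have [S' S'f S'e] := hS _ (divr_gt0 e20 T0).
  have S'0 : 0 < opnorm S' + 1 by rewrite ltr_wpDl ?opnorm_ge0.
  have [T' T'f T'e] := hT _ (divr_gt0 e20 S'0).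
  exists (S' * T'); first exact: finite_propagationM.
  have -> : S * T - S' * T' = (S - S') * T - S' * (T' - T).
    by rewrite mulrBl mulrBr opprB addrA subrK.
  apply: (le_lt_trans (opnormB_le ((S - S') * T) (S' * (T' - T)))).
  rewrite (splitr e).
  apply: ltrD.
    apply: (le_lt_trans (opnormM_le (S - S') T)).
    apply: (@le_lt_trans _ _ (opnorm (S - S') * (opnorm T + 1))).
      by rewrite ler_wpM2l ?opnorm_ge0 ?lerDl.
    by rewrite -(ltr_pdivlMr _ _ T0); exact: S'e.
  apply: (le_lt_trans (opnormM_le S' (T' - T))).
  apply: (@le_lt_trans _ _ ((opnorm S' + 1) * opnorm (T' - T))).
    by rewrite ler_wpM2r ?opnorm_ge0 ?lerDl.
  by rewrite opnormBC mulrC -(ltr_pdivlMr _ _ S'0); exact: T'e.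
Qed.
HB.instance Definition _ :=
  GRing.isSubringClosed.Build _ roe_closure roe_closure_subring.

Record uniform_roe := UniformRoe { roe_op :> B; _ : roe_op \in roe_closure }.
HB.instance Definition _ := [isSub for roe_op].
HB.instance Definition _ := [Choice of uniform_roe by <:].
HB.instance Definition _ :=
  GRing.SubChoice_isSubPzRing.Build B roe_closure uniform_roe roe_closure_subring.
End UniformRoe.

Section MurrayVonNeumann.
Local Open Scope quotient_scope.
Variable A : pzRingType.

(* Idempotents of M_oo(A), each with a size of matrix that contains it. *)
Definition idemp := {n : nat & {e : 'M[A]_n | e *m e == e}}.

Definition idemp_dim (e : idemp) : nat := tag e.
Definition idemp_mx (e : idemp) : 'M[A]_(idemp_dim e) := sval (tagged e).

Lemma idemp_mxK e : idemp_mx e *m idemp_mx e = idemp_mx e.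
Proof. by apply/eqP; rewrite /idemp_mx; case: (tagged e). Qed.

Definition mk_idemp n (e : 'M[A]_n) (he : e *m e = e) : idemp :=
  existT _ n (exist _ e (introT eqP he)).

(* Murray-von Neumann (algebraic) equivalence. Rectangular matrices over a
   unital ring give the same relation as square matrices in M_oo(A). *)
Definition mvn_equiv (e f : idemp) : Prop :=
  exists x : 'M[A]_(idemp_dim e, idemp_dim f),
  exists y : 'M[A]_(idemp_dim f, idemp_dim e),
  x *m y = idemp_mx e /\ y *m x = idemp_mx f.

Lemma mvn_refl e : mvn_equiv e e.
Proof. by exists (idemp_mx e), (idemp_mx e); rewrite !idemp_mxK. Qed.

Lemma mvn_sym e f : mvn_equiv e f -> mvn_equiv f e.
Proof. by move=> [x [y [xy yx]]]; exists y, x. Qed.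

Lemma mvn_trans f e g : mvn_equiv e f -> mvn_equiv f g -> mvn_equiv e g.
Proof.
move=> [x [y [xy yx]]] [z [w [zw wz]]]; exists (x *m z), (w *m y); split.
  by rewrite mulmxA -(mulmxA x) zw -yx mulmxA xy -mulmxA xy idemp_mxK.
by rewrite mulmxA -(mulmxA w) yx -zw mulmxA wz -mulmxA wz idemp_mxK.
Qed.

Lemma idemp_sum_subproof e f :
  let g := block_mx (idemp_mx e) 0 0 (idemp_mx f) in g *m g = g.
Proof. by rewrite /= mulmx_block !idemp_mxK !mulmx0 !mul0mx !addr0 !add0r. Qed.

Definition idemp_sum e f : idemp := mk_idemp (idemp_sum_subproof e f).

Definition idemp_zero : idemp := mk_idemp (mulmx0 0 (0 : 'M[A]_0)).

Lemma mvn_sum e e' f f' : mvn_equiv e e' -> mvn_equiv f f' ->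
  mvn_equiv (idemp_sum e f) (idemp_sum e' f').
Proof.
move=> [x [y [xy yx]]] [z [w [zw wz]]].
exists (block_mx x 0 0 z), (block_mx y 0 0 w).
by rewrite !mulmx_block !(mulmx0, mul0mx, addr0, add0r) xy yx zw wz.
Qed.

Lemma mvn_sumC e f : mvn_equiv (idemp_sum e f) (idemp_sum f e).
Proof.
exists (block_mx 0 (idemp_mx e) (idemp_mx f) 0).
exists (block_mx 0 (idemp_mx f) (idemp_mx e) 0).
by rewrite !mulmx_block !(mulmx0, mul0mx, addr0, add0r) !idemp_mxK.
Qed.

Lemma mvn_eq_mx n m (g : 'M[A]_n) (h : 'M[A]_m) hg hh (en : n = m) :
  castmx (en, en) g = h -> mvn_equiv (@mk_idemp n g hg) (@mk_idemp m h hh).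
Proof.
case: m / en h hh => h hh; rewrite castmx_id => gh.
by exists g, g; rewrite /idemp_mx /= hg -gh.
Qed.

Lemma mvn_sumA e f g :
  mvn_equiv (idemp_sum e (idemp_sum f g)) (idemp_sum (idemp_sum e f) g).
Proof.
apply: (@mvn_eq_mx _ _ _ _ _ _ (addnA _ _ _)).
set E := idemp_mx e; set F := idemp_mx f; set G := idemp_mx g.
rewrite /idemp_mx /= -/E -/F -/G.
have -> : (0 : 'M[A]_(idemp_dim e, idemp_dim f + idemp_dim g)) = row_mx 0 0.
  by rewrite row_mx0.
have -> : (0 : 'M[A]_(idemp_dim f + idemp_dim g, idemp_dim e)) = col_mx 0 0.
  by rewrite col_mx0.
by rewrite block_mxA row_mx0 col_mx0 castmx_comp castmx_id.
Qed.

Lemma mvn_sum0 e : mvn_equiv (idemp_sum idemp_zero e) e.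
Proof.
exists (col_mx 0 (idemp_mx e)), (row_mx 0 (idemp_mx e)); split.
  by rewrite mul_col_row !(mulmx0, mul0mx) idemp_mxK; congr block_mx; apply/matrixP => -[].
by rewrite mul_row_col mulmx0 add0r idemp_mxK.
Qed.

Definition mvn : rel idemp := fun e f => `[< mvn_equiv e f >].

Lemma mvn_equiv_rel : equiv_class_of mvn.
Proof.
split=> [e|e f|f e g].
- exact/asboolP/mvn_refl.
- by apply/asboolP/asboolP; apply: mvn_sym.
- by move=> /asboolP ef /asboolP fg; apply/asboolP; apply: mvn_trans fg.
Qed.

Canonical mvn_equivRel := EquivRelPack mvn_equiv_rel.

(* The abelian monoid V(A), with the block sum as addition. *)
Definition Vmon := {eq_quot mvn}.
HB.instance Definition _ := Choice.on Vmon.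
HB.instance Definition _ : EqQuotient _ mvn Vmon := EqQuotient.on Vmon.

Lemma VmonP (e f : idemp) : \pi_Vmon e = \pi_Vmon f <-> mvn_equiv e f.
Proof. by split=> [/eqP|h]; [rewrite piE => /asboolP|apply/eqP; rewrite piE; apply/asboolP]. Qed.

Definition Vmon_add : Vmon -> Vmon -> Vmon := lift_op2 Vmon idemp_sum.

Lemma pi_Vmon_add : {morph \pi_Vmon : e f / idemp_sum e f >-> Vmon_add e f}.
Proof.
move=> e f; unlock Vmon_add; apply/VmonP.
by apply: mvn_sum; apply/VmonP; rewrite reprK.
Qed.

Lemma Vmon_addA : associative Vmon_add.
Proof.
elim/quotW=> e; elim/quotW=> f; elim/quotW=> g.
by rewrite -!pi_Vmon_add; apply/VmonP/mvn_sumA.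
Qed.
Lemma Vmon_addC : commutative Vmon_add.
Proof.
by elim/quotW=> e; elim/quotW=> f; rewrite -!pi_Vmon_add; apply/VmonP/mvn_sumC.
Qed.
Lemma Vmon_add0 : left_id (\pi_Vmon idemp_zero) Vmon_add.
Proof. by elim/quotW=> e; rewrite -pi_Vmon_add; apply/VmonP/mvn_sum0. Qed.

HB.instance Definition _ :=
  GRing.isNmodule.Build Vmon Vmon_addA Vmon_addC Vmon_add0.

End MurrayVonNeumann.

Section Grothendieck.
Local Open Scope quotient_scope.
Variable M : nmodType.

(* A pair (a, b) stands for the formal difference a - b. *)
Definition grot_rel : rel (M * M) :=
  fun u v => `[< exists k, u.1 + v.2 + k = v.1 + u.2 + k >].

Lemma grot_equiv_rel : equiv_class_of grot_rel.
Proof.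
split=> [u|u v|v u w].
- by apply/asboolP; exists 0.
- by apply/asboolP/asboolP => -[k]; exists k.
- move=> /asboolP[k uv] /asboolP[l vw]; apply/asboolP.
  exists (v.1 + v.2 + k + l).
  rewrite [LHS](AC (2*4) (((1*4)*5)*((3*2)*6))) /= uv vw.
  by rewrite [LHS](AC (3*3) ((4*2)*(((1*5)*3)*6))).
Qed.

Canonical grot_equivRel := EquivRelPack grot_equiv_rel.

Definition grot := {eq_quot grot_rel}.
HB.instance Definition _ := Choice.on grot.
HB.instance Definition _ : EqQuotient _ grot_rel grot := EqQuotient.on grot.

Lemma grotP (u v : M * M) :
  \pi_grot u = \pi_grot v <-> exists k, u.1 + v.2 + k = v.1 + u.2 + k.
Proof.
by split=> [/eqP|h]; [rewrite piE => /asboolP|apply/eqP; rewrite piE; apply/asboolP].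
Qed.

Definition grot_add : grot -> grot -> grot := lift_op2 grot +%R.
Definition grot_opp : grot -> grot := lift_op1 grot (fun u : M * M => (u.2, u.1)).

Lemma pi_grot_add : {morph \pi_grot : u v / u + v >-> grot_add u v}.
Proof.
move=> u v; unlock grot_add; apply/grotP.
have /grotP[k uk] : \pi_grot u = \pi_grot (repr (\pi_grot u)) by rewrite reprK.
have /grotP[l vl] : \pi_grot v = \pi_grot (repr (\pi_grot v)) by rewrite reprK.
exists (k + l); move: (repr _) uk (repr _) vl => u' uk v' vl /=.
rewrite [LHS](AC ((2*2)*2) (((1*3)*5)*((2*4)*6))) /= uk vl.
by rewrite [RHS](AC ((2*2)*2) (((1*3)*5)*((2*4)*6))).
Qed.

Lemma pi_grot_opp : {morph \pi_grot : u / (u.2, u.1) >-> grot_opp u}.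
Proof.
move=> u; unlock grot_opp; apply/grotP.
have /grotP[k uk] : \pi_grot u = \pi_grot (repr (\pi_grot u)) by rewrite reprK.
exists k => /=; move: (repr _) uk => u' uk.
by rewrite [u.2 + _]addrC -uk [u'.2 + _]addrC.
Qed.

Lemma grot_addA : associative grot_add.
Proof.
by elim/quotW=> u; elim/quotW=> v; elim/quotW=> w; rewrite -!pi_grot_add addrA.
Qed.
Lemma grot_addC : commutative grot_add.
Proof. by elim/quotW=> u; elim/quotW=> v; rewrite -!pi_grot_add addrC. Qed.
Lemma grot_add0 : left_id (\pi_grot 0) grot_add.
Proof. by elim/quotW=> u; rewrite -pi_grot_add add0r. Qed.
Lemma grot_addN : left_inverse (\pi_grot 0) grot_opp grot_add.
Proof.
elim/quotW=> u; rewrite -pi_grot_opp -pi_grot_add; apply/grotP; exists 0 => /=.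
by rewrite !addr0 add0r addrC.
Qed.

HB.instance Definition _ :=
  GRing.isZmodule.Build grot grot_addA grot_addC grot_add0 grot_addN.

End Grothendieck.

Definition K0 (A : pzRingType) : zmodType := grot (Vmon A).

(* Main.v *)
Require Import Defs.
From HB Require Import structures.
From mathcomp Require Import all_boot all_order all_algebra.
From mathcomp Require Import finmap complex perm generic_quotient.
From mathcomp Require Import all_classical all_reals all_analysis.
From mathcomp Require Import ring lra zify.
Set Implicit Arguments.
Unset Strict Implicit.
Unset Printing Implicit Defensive.
Import Order.TTheory GRing.Theory Num.Theory.
Import ComplexField.Normc.
Local Open Scope classical_set_scope.
Local Open Scope ring_scope.

(** Let A be the l^p uniform Roe algebra of X. The idea is that the bilateral
    shift on the range of an idempotent of A has vanishing index, and that this index is the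
    class of the idempotent.

    Let E be an idempotent of A. The operator U = 1 - E + E S, where S is the bilateral
    shift, is invertible on l^p(X x Z), and with the projection P onto the nonnegative
    half-line one has U P U^-1 = P - E d, where d is the projection onto the origin
    (unit_conj). Suppose that P - E d is also conjugate to P by an invertible element that
    differs from 1 by an operator small outside of finite windows [-N, N] of Z; this is the
    predicate Ksim. Cutting to a window (cut_sim) gives an idempotent matrix over A that
    is equivalent to its difference with E, hence a class k in V(A) with [E] + k = k
    (idem_absorbed). As n copies of X embed in X with bounded displacement, every class of
    V(A) is represented in A itself (idem_to_one), so K0(A) = 0.

    The predicate Ksim for U P U^-1 (unit_Ksim) comes from a factorization of U. An operator
    close to E has finite propagation, and at that scale asymptotic dimension at most one
    splits X into two halves, each a union of separated and uniformly bounded pieces. After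
    adding a second copy of X, the diagonal matrix (U, 1) is close to a product of two
    invertible elements, each of them block diagonal with respect to a neighbourhood of the
    pieces of one half (assembly). To obtain it, let f be the compression to the first
    half of the operator of finite propagation; then 1 - f + S f is dilated to an invertible
    2 x 2 matrix v0, which conjugates the projection onto the first copy to an idempotent q.
    Up to a small error, q differs from that projection only near both halves. For the
    factors to commute with the projection, q has to be close to a conjugate of it by an
    operator that has blocks for both decompositions. These blocks are matrices of bounded
    size, so q is close to the value at S of a loop of almost idempotent matrices on the unit
    circle that starts at the projection, and such loops are trivial up to a small error
    (loop_trivial): one constant frame is good for the whole loop (frame_exists), and it is
    turned into an invertible Laurent polynomial by Cramer's rule (circle_inverse).

    Finally, an invertible element c with blocks over uniformly bounded pieces does not
    contribute (block_Ksim). Up to a similarity of the permitted kind, c P c^-1 is the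
    projection P far from the origin and an idempotent with finite blocks of bounded size in
    a window. Such an idempotent is equivalent to a coordinate projection, by pivoting in
    each block (block_split). Since X is not amenable, any finite number of copies of X embed
    in one copy with bounded displacement, by a doubling estimate and the marriage theorem
    (spread), so a coordinate projection that contains one copy of X is equivalent to the
    whole window (window_piso). *)

(** * Identities in rings that are not commutative *)

Section NCRing.
Variable R : pzRingType.

(** The tactic ring assumes commutativity. Here both sides of an identity are expanded into
    words with integer coefficients, and the coefficients of the difference have to vanish. *)
Inductive nc_expr := NC0 | NC1 | NCvar of nat | NCadd of nc_expr & nc_expr
  | NCopp of nc_expr | NCmul of nc_expr & nc_expr.

Variable env : nat -> R.

Fixpoint nc_eval (e : nc_expr) : R := match e with
  | NC0 => 0 | NC1 => 1 | NCvar n => env n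
  | NCadd a b => nc_eval a + nc_eval b
  | NCopp a => - nc_eval a
  | NCmul a b => nc_eval a * nc_eval b end.

Definition nc_mon (m : seq nat) : R := foldr (fun n x => env n * x) 1 m.

Definition nc_poly (s : seq (int * seq nat)) : R :=
  foldr (fun c x => nc_mon c.2 *~ c.1 + x) 0 s.

Fixpoint nc_norm (e : nc_expr) : seq (int * seq nat) := match e with
  | NC0 => [::] | NC1 => [:: (1, [::])] | NCvar n => [:: (1, [:: n])]
  | NCadd a b => nc_norm a ++ nc_norm b
  | NCopp a => [seq (- c.1, c.2) | c <- nc_norm a]
  | NCmul a b => let q := nc_norm b in
      flatten [seq [seq (c.1 * d.1, c.2 ++ d.2) | d <- q] | c <- nc_norm a] end.

Lemma nc_mon_cat m n : nc_mon (m ++ n) = nc_mon m * nc_mon n.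
Proof. by elim: m => [|a m IH] /=; rewrite ?mul1r // IH mulrA. Qed.

Lemma nc_poly_cat s t : nc_poly (s ++ t) = nc_poly s + nc_poly t.
Proof. by elim: s => [|a s IH] /=; rewrite ?add0r // IH addrA. Qed.

Lemma nc_normP e : nc_poly (nc_norm e) = nc_eval e.
Proof.
elim: e => //= [|n|a <- b <-|a <-|a <- b <-].
- by rewrite addr0.
- by rewrite addr0 mulr1.
- by rewrite nc_poly_cat.
- by elim: (nc_norm a) => [|c s IH] /=; rewrite ?oppr0 // IH opprD mulrNz.
- elim: (nc_norm a) => [|c s IH] /=; first by rewrite mul0r.
  rewrite nc_poly_cat IH mulrDl; congr (_ + _).
  elim: (nc_norm b) => [|d t IHt] /=; first by rewrite mulr0.
  rewrite IHt mulrDr nc_mon_cat; congr (_ + _).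
  by rewrite mulrzAl mulrzAr [in RHS]mulrzAC mulrzA.
Qed.

Fixpoint nc_add (c : int) (m : seq nat) (s : seq (int * seq nat)) :=
  match s with
  | [::] => [:: (c, m)]
  | d :: t => if d.2 == m then (c + d.1, m) :: t else d :: nc_add c m t end.

Lemma nc_addP c m s : nc_poly (nc_add c m s) = nc_mon m *~ c + nc_poly s.
Proof.
elim: s => //= d t IH; case: eqP => [<-|_] /=; first by rewrite mulrzDr addrA.
by rewrite IH addrCA.
Qed.

Definition nc_collect (s : seq (int * seq nat)) :=
  foldr (fun c t => nc_add c.1 c.2 t) [::] s.

Lemma nc_collectP s : nc_poly (nc_collect s) = nc_poly s.
Proof. by elim: s => //= c s IH; rewrite nc_addP IH. Qed.

Lemma nc_correct e1 e2 :
  all (fun c => c.1 == 0) (nc_collect (nc_norm (NCadd e1 (NCopp e2)))) ->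
  nc_eval e1 = nc_eval e2.
Proof.
move=> h; apply/eqP; rewrite -subr_eq0; apply/eqP.
rewrite -[LHS]/(nc_eval (NCadd e1 (NCopp e2))) -nc_normP -nc_collectP.
by elim: (nc_collect _) h => //= c s IH /andP[/eqP -> /IH ->]; rewrite mulr0z addr0.
Qed.
End NCRing.

Ltac nc_mem x l := match l with
  | nil => constr:(false) | cons x _ => constr:(true) | cons _ ?t => nc_mem x t end.
Ltac nc_atoms t l := match t with
  | @GRing.add _ ?a ?b => let l := nc_atoms a l in nc_atoms b l
  | @GRing.opp _ ?a => nc_atoms a l
  | @GRing.mul _ ?a ?b => let l := nc_atoms a l in nc_atoms b l
  | @GRing.zero _ => l
  | @GRing.one _ => l
  | ?x => let b := nc_mem x l in match b with true => l | false => constr:(cons x l) end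
  end.
Ltac nc_idx x l := match l with
  | cons x _ => constr:(0%N) | cons _ ?t => let n := nc_idx x t in constr:(S n) end.
Ltac nc_reify t l := match t with
  | @GRing.add _ ?a ?b => let a := nc_reify a l in let b := nc_reify b l in constr:(NCadd a b)
  | @GRing.opp _ ?a => let a := nc_reify a l in constr:(NCopp a)
  | @GRing.mul _ ?a ?b => let a := nc_reify a l in let b := nc_reify b l in constr:(NCmul a b)
  | @GRing.zero _ => constr:(NC0)
  | @GRing.one _ => constr:(NC1)
  | ?x => let n := nc_idx x l in constr:(NCvar n)
  end.
Ltac ncring := match goal with |- @eq ?T ?a ?b =>
  let l := nc_atoms a (@nil T) in let l := nc_atoms b l in
  let ea := nc_reify a l in let eb := nc_reify b l in
  apply: (@nc_correct _ (nth (@GRing.zero _) l) ea eb); vm_compute; reflexivity end.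

Section Geometric0.
Context {R : realType}.
Lemma geo_half n : 2^-1 ^+ n = 2^-1 ^+ n.+1 + 2^-1 ^+ n.+1 :> R.
Proof. by rewrite exprS; lra. Qed.

Lemma geo_gt0 n : 0 < 2^-1 ^+ n :> R. Proof. by rewrite exprn_gt0 // invr_gt0. Qed.

Lemma geo_small (C e : R) : 0 < e -> exists n, C * 2^-1 ^+ n < e.
Proof.
move=> e0; have [C0|C0] := leP C 0.
  by exists 0%N; rewrite expr0 mulr1 (le_lt_trans C0).
have [n hn] : exists n, C / e < n%:R.
  by exists (Num.bound (C / e)); rewrite archi_boundP // divr_ge0 // ltW.
exists n; rewrite exprVn ltr_pdivrMr ?exprn_gt0 // mulrC -ltr_pdivrMr //.
by apply: lt_trans hn _; rewrite -natrX ltr_nat ltn_expl.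
Qed.

End Geometric0.

(** * Banach rings *)

(** The norm is a plain function, so that unification never unfolds the
    operator norm in what follows. *)
Record bnorm (R : realType) (B : pzRingType) (nrm : B -> R) : Prop := BNorm {
  nrm_ge0 : forall x, 0 <= nrm x;
  nrm_eq0 : forall x, nrm x <= 0 -> x = 0;
  nrm_0 : nrm 0 = 0;
  nrm_N : forall x, nrm (- x) = nrm x;
  nrmB : forall x y, nrm (x - y) <= nrm x + nrm y;
  nrmM : forall x y, nrm (x * y) <= nrm x * nrm y;
  nrm1 : nrm 1 <= 1;
  nrm_complete : forall (u : nat -> B) (C : R),
    (forall n, nrm (u n.+1 - u n) <= C * 2^-1 ^+ n) ->
    exists l, forall n, nrm (l - u n) <= C * 2 * 2^-1 ^+ n }.

Section BanachRing.
Context {R : realType} {B : pzRingType} (nrm : B -> R) (hn : bnorm nrm).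
Implicit Types (x y z S T U : B).

Ltac opl := intros; lra.
Ltac opn := intros; nra.

Let nrm_ge0' := nrm_ge0 hn.
Let nrm0 := nrm_0 hn.
Let nrmN := nrm_N hn.

Lemma nrmBC x y : nrm (x - y) = nrm (y - x).
Proof. by rewrite -nrmN opprB. Qed.

Lemma nrmD x y : nrm (x + y) <= nrm x + nrm y.
Proof. by rewrite -{1}[y]opprK -[in leRHS](nrmN y); exact: nrmB. Qed.

Lemma nrm_sum (A : Type) (s : seq A) (P : pred A) (f : A -> B) :
  nrm (\sum_(a <- s | P a) f a) <= \sum_(a <- s | P a) nrm (f a).
Proof.
elim/big_rec2: _ => [|a x u _ h]; first by rewrite nrm0.
by apply: le_trans (nrmD _ _) _; rewrite lerD2l.
Qed.

Lemma nrm_dist x y z : nrm (x - z) <= nrm (x - y) + nrm (y - z).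
Proof. by have -> : x - z = (x - y) + (y - z); [ncring|exact: nrmD]. Qed.

Lemma nrm_tri x y : nrm x <= nrm y + nrm (x - y).
Proof. by have {1}-> : x = y + (x - y); [ncring|exact: nrmD]. Qed.

Lemma nrm_small T (K : R) : (forall n, nrm T <= K * 2^-1 ^+ n) -> T = 0.
Proof.
move=> h; apply: (nrm_eq0 hn); apply/ler_addgt0Pr => e e0; rewrite add0r.
by have [n /ltW h'] := geo_small K e0; apply: le_trans (h n) h'.
Qed.

Lemma nrm_small_eps T : (forall e : R, 0 < e -> nrm T <= e) -> T = 0.
Proof.
by move=> h; apply: (nrm_eq0 hn); apply/ler_addgt0Pr => e e0; rewrite add0r; exact: h.
Qed.

(** ** Closed subrings *)

Record csub0 (D : B -> Prop) : Prop := CSub0 {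
  cs0 : D 0;
  csB : forall S T, D S -> D T -> D (S - T);
  csM : forall S T, D S -> D T -> D (S * T);
  cs_cl : forall T, (forall e : R, 0 < e -> exists2 S, D S & nrm (T - S) <= e) -> D T }.

Record csub (D : B -> Prop) : Prop := CSub { cs_csub0 :> csub0 D; cs1 : D 1 }.

Section CSub.
Variables (D : B -> Prop) (hD : csub0 D).
Lemma csN T : D T -> D (- T).
Proof. by move=> hT; rewrite -sub0r; apply: (csB hD) => //; apply: cs0. Qed.
Lemma csD S T : D S -> D T -> D (S + T).
Proof. by move=> hS hT; rewrite -[T]opprK; apply: (csB hD) => //; apply: csN. Qed.
Lemma cs_sum (A : Type) (s : seq A) (P : pred A) (f : A -> B) :
  (forall a, P a -> D (f a)) -> D (\sum_(a <- s | P a) f a).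
Proof. by move=> h; elim/big_rec: _ => [|a x Pa hx]; [apply: cs0|apply: csD => //; apply: h]. Qed.
Lemma cs_lim (T : nat -> B) L (C : R) : (forall n, D (T n)) ->
  (forall n, nrm (L - T n) <= C * 2^-1 ^+ n) -> D L.
Proof.
move=> DT hL; apply: (cs_cl hD) => e e0; have [n /ltW h] := geo_small C e0.
by exists (T n) => //; apply: le_trans (hL n) h.
Qed.
End CSub.

Lemma csub_cap (D D' : B -> Prop) : csub D -> csub D' -> csub (fun T => D T /\ D' T).
Proof.
move=> h h'; split; last by split; apply: cs1.
split=> [|S T [? ?] [? ?]|S T [? ?] [? ?]|T hT]; try by split; [apply: cs0 h|apply: cs0 h'].
- by split; [apply: (csB h)|apply: (csB h')].
- by split; [apply: (csM h)|apply: (csM h')].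
- split; [apply: (cs_cl h)|apply: (cs_cl h')] => e /hT[S [? ?] ?]; by exists S.
Qed.

Lemma csub_comm (F : B) : csub (fun T => T * F = F * T).
Proof.
split; last by rewrite mul1r mulr1.
split=> [|S T hS hT|S T hS hT|T hT]; first by rewrite mul0r mulr0.
- by rewrite mulrBl mulrBr hS hT.
- by rewrite -mulrA hT mulrA hS mulrA.
- apply/eqP; rewrite -subr_eq0; apply/eqP/nrm_small_eps => e e0.
  have F1 : 0 < 2 * (nrm F + 1) by rewrite mulr_gt0 ?ltr_wpDl ?(nrm_ge0 hn).
  have [S hS Se] := hT (e / (2 * (nrm F + 1))) (divr_gt0 e0 F1).
  have -> : T * F - F * T = (T - S) * F - F * (T - S).
    by rewrite mulrBl mulrBr hS; ncring.
  apply: le_trans ((nrmB hn) _ _) _.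
  have h1 := (nrmM hn) (T - S) F; have h2 := (nrmM hn) F (T - S).
  move: Se; rewrite ler_pdivlMr // => Se.
  have h3 := (nrm_ge0 hn) (T - S); move: h1 h2 h3 Se; opl.
Qed.

(** The closure of a filtered subring. *)
Section Filtered.
Variable fil : nat -> B -> Prop.
Hypotheses (fil_mono : forall n m T, (n <= m)%N -> fil n T -> fil m T)
  (filB : forall n S T, fil n S -> fil n T -> fil n (S - T))
  (filM : forall n m S T, fil n S -> fil m T -> fil (n + m) (S * T))
  (fil1 : fil 0 1).

Definition fil_cl T := forall e : R, 0 < e -> exists n S, fil n S /\ nrm (T - S) <= e.

Lemma fil_in n T : fil n T -> fil_cl T.
Proof. by move=> hT e e0; exists n, T; split=> //; rewrite subrr nrm0 ltW. Qed.

Lemma fil_cl_csub : csub fil_cl.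
Proof.
split; last exact: fil_in fil1.
split=> [|S T hS hT|S T hS hT|T hT].
- by apply: (@fil_in 0%N); rewrite -(subrr 1); exact: filB.
- move=> e e0; have e2 : 0 < e / 2 by rewrite divr_gt0.
  have [n [S' [S'n Se]]] := hS _ e2; have [m [T' [T'm Te]]] := hT _ e2.
  exists (n + m)%N, (S' - T'); split.
    by apply: filB; [apply: fil_mono S'n|apply: fil_mono T'm]; rewrite ?leq_addr ?leq_addl.
  have -> : S - T - (S' - T') = (S - S') - (T - T') by ncring.
  by apply: le_trans (nrmB hn _ _) _; rewrite (splitr e); exact: lerD.
- move=> e e0; have e2 : 0 < e / 2 by rewrite divr_gt0.
  have T0 : 0 < nrm T + 1 by rewrite ltr_wpDl.
  have [n [S' [S'n Se]]] := hS _ (divr_gt0 e2 T0).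
  have S'0 : 0 < nrm S' + 1 by rewrite ltr_wpDl.
  have [m [T' [T'm Te]]] := hT _ (divr_gt0 e2 S'0).
  exists (n + m)%N, (S' * T'); split; first exact: filM.
  have -> : S * T - S' * T' = (S - S') * T + S' * (T - T') by ncring.
  apply: le_trans (nrmD _ _) _; rewrite (splitr e); apply: lerD.
    move: Se; rewrite ler_pdivlMr // => Se; apply: le_trans (nrmM hn _ _) _.
    by apply: le_trans Se; rewrite ler_wpM2l // lerDl.
  move: Te; rewrite ler_pdivlMr // mulrC => Te; apply: le_trans (nrmM hn _ _) _.
  by apply: le_trans Te; rewrite ler_wpM2r // lerDl.
- move=> e e0; have e2 : 0 < e / 2 by rewrite divr_gt0.
  have [S hS SE] := hT _ e2; have [n [S' [S'n S'e]]] := hS _ e2.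
  exists n, S'; split=> //; apply: le_trans (nrm_dist _ S _) _.
  by rewrite (splitr e); exact: lerD.
Qed.
End Filtered.

(** The Neumann series, inside a closed subring. *)
Lemma neumann D (x : B) : csub D -> D x -> nrm (1 - x) <= 2^-1 ->
  exists y : B, [/\ D y, x * y = 1, y * x = 1, nrm y <= 3 & nrm (1 - y) <= 3 * nrm (1 - x)].
Proof.
move=> hD Dx; set a : B := 1 - x => ha.
have aD : D a by apply: (csB hD) => //; apply: cs1.
have an n : nrm (a ^+ n) <= 2^-1 ^+ n.
  elim: n => [|n IH]; first by rewrite !expr0 (nrm1 hn).
  rewrite !exprS; apply: le_trans ((nrmM hn) _ _) _.
  by apply: ler_pM; rewrite ?(nrm_ge0 hn).
have aDn n : D (a ^+ n).
  by elim: n => [|n IH]; [rewrite expr0; apply: (cs1 hD)|rewrite exprS; apply: (csM hD)].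
pose y n : B := \sum_(i < n) a ^+ i.
have yS n : y n.+1 - y n = a ^+ n by rewrite /y big_ord_recr /= addrAC subrr add0r.
have [|L hL] := nrm_complete hn (u := y) (C := 1); first by move=> n; rewrite yS mul1r.
have xE : x = 1 - a by rewrite /a; ncring.
have ay n : a * y n = y n.+1 - 1.
  elim: n => [|n IH]; first by rewrite /y big_ord0 big_ord1 mulr0 expr0 subrr.
  have -> : y n.+1 = y n + a ^+ n by rewrite -yS; ncring.
  by rewrite mulrDr IH -exprS -(yS n.+1); ncring.
have ya n : y n * a = y n.+1 - 1.
  elim: n => [|n IH]; first by rewrite /y big_ord0 big_ord1 mul0r expr0 subrr.
  have -> : y n.+1 = y n + a ^+ n by rewrite -yS; ncring.
  by rewrite mulrDl IH -exprSr -(yS n.+1); ncring.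
have xy : x * L = 1.
  apply/eqP; rewrite -subr_eq0; apply/eqP.
  apply: (@nrm_small _ ((nrm x) * 2 + 1)) => n.
  have -> : x * L - 1 = x * (L - y n) - a ^+ n.
    rewrite mulrBr; have -> : x * y n = y n - a * y n by rewrite {1}xE mulrBl mul1r.
    by rewrite ay -yS; ncring.
  apply: le_trans ((nrmB hn) _ _) _; rewrite [leRHS]mulrDl mul1r lerD //.
  apply: le_trans ((nrmM hn) _ _) _; rewrite -mulrA ler_wpM2l ?(nrm_ge0 hn) //.
  by have := hL n; rewrite mul1r.
have yx : L * x = 1.
  apply/eqP; rewrite -subr_eq0; apply/eqP.
  apply: (@nrm_small _ (2 * (nrm x) + 1)) => n.
  have -> : L * x - 1 = (L - y n) * x - a ^+ n.
    rewrite mulrBl; have -> : y n * x = y n - y n * a by rewrite {1}xE mulrBr mulr1.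
    by rewrite ya -yS; ncring.
  apply: le_trans ((nrmB hn) _ _) _; rewrite [leRHS]mulrDl mul1r lerD //.
  apply: le_trans ((nrmM hn) _ _) _; rewrite mulrAC ler_wpM2r ?(nrm_ge0 hn) //.
  by have := hL n; rewrite mul1r.
have L3 : nrm L <= 3.
  have := hL 0%N; rewrite /y big_ord0 subr0 expr0; opl.
exists L; split=> //.
  by apply: (cs_lim hD (C := 1 * 2) (T := y)) => // n; apply: (cs_sum hD) => i _.
have -> : 1 - L = - (L * a) by rewrite /a mulrBr yx mulr1; ncring.
by rewrite nrmN (le_trans ((nrmM hn) _ _)) // ler_wpM2r ?(nrm_ge0 hn).
Qed.

(** Close idempotents are similar. *)
Lemma close_idem D (f g : B) (C : R) : csub D -> D f -> D g -> f * f = f -> g * g = g ->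
    nrm f <= C -> nrm g <= C -> 4 * (C * nrm (f - g)) <= 1 ->
  exists z z' : B, [/\ D z, D z', z * z' = 1 & z' * z = 1] /\
    [/\ z * f = g * z, nrm (z - 1) <= 2 * C * nrm (f - g)
      & nrm (z' - 1) <= 6 * C * nrm (f - g)].
Proof.
move=> hD Df Dg ff gg fC gC small.
pose z : B := g * f + (1 - g) * (1 - f).
have zE : 1 - z = (f - g) * f - g * (f - g).
  by rewrite [in RHS]mulrBl ff [in RHS]mulrBr gg /z; ncring.
have hz : nrm (1 - z) <= 2 * C * nrm (f - g).
  rewrite zE; apply: le_trans ((nrmB hn) _ _) _.
  have := (nrmM hn) (f - g) f; have := (nrmM hn) g (f - g).
  have h3 := (nrm_ge0 hn) (f - g); move: fC gC h3; opn.
have D1 := cs1 hD.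
have Dz : D z by apply: (csD hD); apply: (csM hD) => //; apply: (csB hD).
have [|z' [Dz' zz' z'z _ hz']] := neumann hD Dz.
  by apply: le_trans hz _; move: small; opl.
exists z, z'; split; split=> //; last first.
- by rewrite nrmBC; apply: le_trans hz' _; move: hz; opl.
- by rewrite nrmBC.
have -> : z * f = g * (f * f) + (1 - g) * (f - f * f) by rewrite /z; ncring.
have -> : g * z = g * g * f + (g - g * g) * (1 - f) by rewrite /z; ncring.
by rewrite ff gg !subrr mulr0 mul0r.
Qed.

(** If c is invertible and x is close to c, then c' x is close to 1, and the Neumann series
    inverts it. *)
Lemma near_inv D (c c' x : B) : csub D -> D c -> D c' -> D x -> c * c' = 1 -> c' * c = 1 ->
    nrm c' * nrm (x - c) <= 2^-1 ->
  exists x' : B, [/\ D x', x * x' = 1, x' * x = 1 & nrm (x' - c') <= 3 * nrm c' ^+ 2 * nrm (x - c)].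
Proof.
move=> hD Dc Dc' Dx cc c'c small.
have e1 : 1 - c' * x = c' * (c - x) by rewrite mulrBr c'c.
have h1 : nrm (1 - c' * x) <= nrm c' * nrm (x - c).
  by rewrite e1; apply: le_trans (nrmM hn _ _) _; rewrite nrmBC.
have [||y [Dy y1 y2 _ hy]] := @neumann D (c' * x) hD; first by apply: (csM hD).
  exact: le_trans h1 small.
exists (y * c'); split.
- exact: (csM hD).
- by rewrite -[x]mul1r -cc -!mulrA [x * _]mulrA [c' * _]mulrA [c' * _]mulrA y1 mul1r.
- by rewrite -mulrA.
have -> : y * c' - c' = - ((1 - y) * c') by ncring.
rewrite nrmN; apply: le_trans (nrmM hn _ _) _.
apply: le_trans (ler_wpM2r (nrm_ge0' _) hy) _.
have -> : 3 * nrm c' ^+ 2 * nrm (x - c) = 3 * (nrm c' * nrm (x - c)) * nrm c' by ring.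
by rewrite ler_wpM2r // ler_wpM2l.
Qed.

(** ** Newton iteration for idempotents *)

(** This is 3 f^2 - 2 f^3: the defect h = f^2 - f becomes 4 h^3 - 3 h^2. *)
Definition newton f : B := f - ((f + f) * (f * f - f) - (f * f - f)).

Lemma newton_defect f : let h := f * f - f in let g := newton f in
  g * g - g = (h + h + h + h - 1 - 1 - 1) * (h * h).
Proof. by rewrite /newton /=; ncring. Qed.

Definition newton_it (f : B) n : B := iter n newton f.

Lemma newton_it_in D f : csub0 D -> D f -> forall n, D (newton_it f n).
Proof.
move=> hD Df; elim=> //= n; rewrite -/(newton_it f n); move: (newton_it f n) => g Dg.
have Dh : D (g * g - g) by apply: (csB hD) => //; apply: (csM hD).
apply: (csB hD) => //; apply: (csB hD) => //; apply: (csM hD) => //; exact: (csD hD).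
Qed.

Section NewtonConv.
Variables (f : B) (C r : R).
Let h0 := nrm (f * f - f).
Hypotheses (fC : nrm f <= C) (C1 : 1 <= C) (hr : 4 * h0 <= r) (Cr : (2 * C + 3) * r <= 1).

Let C3 : 0 <= 2 * C + 3. Proof. by move: C1; lra. Qed.

Lemma newton_step_norm (g : B) : nrm g <= C + 1 ->
  nrm (newton g - g) <= (2 * C + 3) * nrm (g * g - g).
Proof.
move=> gC; rewrite /newton.
have -> : g - ((g + g) * (g * g - g) - (g * g - g)) - g =
    (g * g - g) - (g + g) * (g * g - g) by ncring.
set h := g * g - g; apply: le_trans (nrmB hn _ _) _.
have h1 := nrmM hn (g + g) h; have h2 := nrmD g g; have h3 := nrm_ge0' h.
move: gC h1 h2 h3; opn.
Qed.

(** Each step multiplies the defect by at most r, so the steps form a geometric series. *)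
Lemma newton_inv n : nrm (newton_it f n - f) <= 1 - 2^-1 ^+ n /\ nrm (newton_it f n * newton_it f n - newton_it f n) <= h0 * r ^+ n.
Proof.
have r0 : 0 <= r by apply: le_trans hr; rewrite mulr_ge0 ?nrm_ge0'.
have r5 : 5 * r <= 1.
  by apply: le_trans Cr; rewrite ler_wpM2r //; move: C1; lra.
elim: n => [|n [IH1 IH2]]; first by rewrite !expr0 !subrr nrm0 mulr1.
rewrite [newton_it f n.+1]/= -/(newton_it f n); set g := newton_it f n in IH1 IH2 *.
have gC : nrm g <= C + 1.
  have := nrm_tri g f; have : 0 <= 2^-1 ^+ n :> R by rewrite ltW // geo_gt0.
  by move: IH1 fC; set u := 2^-1 ^+ n; move: u => u; opl.
have rn : 0 <= r ^+ n by rewrite exprn_ge0.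
have rn2 : r ^+ n <= 2^-1 ^+ n by rewrite lerXn2r ?nnegrE ?invr_ge0 //; lra.
have h00 : 0 <= h0 by exact: nrm_ge0'.
have rn1 : r ^+ n <= 1 by apply: le_trans rn2 _; rewrite exprn_ile1 ?invr_ge0 // invf_le1 ?ler1n.
split.
  apply: le_trans (nrm_dist _ g _) _; rewrite (geo_half n) in IH1.
  have h1 := newton_step_norm gC.
  have h2 : (2 * C + 3) * nrm (g * g - g) <= 2^-1 ^+ n.+1.
    apply: (@le_trans _ _ ((2 * C + 3) * (h0 * r ^+ n))); first by rewrite ler_wpM2l.
    rewrite exprS mulrA; apply: ler_pM => //; first by rewrite mulr_ge0.
    have : (2 * C + 3) * (4 * h0) <= (2 * C + 3) * r by rewrite ler_wpM2l.
    have -> : (2 * C + 3) * (4 * h0) = 4 * ((2 * C + 3) * h0) by ring.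
    by move: Cr; generalize ((2 * C + 3) * r) ((2 * C + 3) * h0) => u v; lra.
  by move: h1 h2 IH1; set u := 2^-1 ^+ n.+1; move: u => u; opl.
rewrite newton_defect; set h := g * g - g in IH2 *.
have hh : nrm h <= 4^-1.
  apply: le_trans IH2 _; have : h0 * r ^+ n <= h0 * 1 by rewrite ler_wpM2l.
  by move: hr; lra.
have h3 : nrm (h + h + h + h - 1 - 1 - 1) <= 4.
  have := nrmB hn (h + h + h + h - 1 - 1) 1; have := nrmB hn (h + h + h + h - 1) 1.
  have := nrmB hn (h + h + h + h) 1; have := nrmD (h + h + h) h; have := nrmD (h + h) h.
  have := nrmD h h; have := nrm1 hn; move: hh; opl.
apply: le_trans (nrmM hn _ _) _.
apply: (@le_trans _ _ (4 * (nrm h * nrm h))).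
  by apply: ler_pM => //; exact: (nrmM hn).
have nh := nrm_ge0' h.
apply: (@le_trans _ _ (4 * ((h0 * r ^+ n) * (h0 * r ^+ n)))).
  by rewrite ler_wpM2l //; apply: ler_pM.
rewrite exprSr.
have -> : 4 * (h0 * r ^+ n * (h0 * r ^+ n)) = (4 * h0) * ((h0 * r ^+ n) * r ^+ n) by ring.
have -> : h0 * (r ^+ n * r) = r * ((h0 * r ^+ n) * 1) by ring.
by rewrite ler_pM // ?mulr_ge0 // ler_wpM2l // mulr_ge0.
Qed.

(** The iterates are polynomials in f, hence the limit commutes with f. *)
Lemma newton_lim : exists q, [/\ q * q = q, q * f = f * q &
  forall n, nrm (q - newton_it f n) <= 2 * (2 * C + 3) * h0 * r ^+ n].
Proof.
have r0 : 0 <= r by apply: le_trans hr; rewrite mulr_ge0 ?nrm_ge0'.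
have r5 : 5 * r <= 1.
  by apply: le_trans Cr; rewrite ler_wpM2r //; move: C1; lra.
have h00 : 0 <= h0 by exact: nrm_ge0'.
pose K := (2 * C + 3) * h0; have K0 : 0 <= K by rewrite mulr_ge0.
have gC n : nrm (newton_it f n) <= C + 1.
  have [h1 _] := newton_inv n; have := nrm_tri (newton_it f n) f.
  have : 0 <= 2^-1 ^+ n :> R by rewrite ltW // geo_gt0.
  by move: h1 fC; set u := 2^-1 ^+ n; move: u => u; opl.
have st n : nrm (newton_it f n.+1 - newton_it f n) <= K * r ^+ n.
  apply: le_trans (newton_step_norm (gC n)) _; rewrite -mulrA ler_wpM2l //.
  by have [] := newton_inv n.
have rn2 n : r ^+ n <= 2^-1 ^+ n by rewrite lerXn2r ?nnegrE ?invr_ge0 //; lra.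
have [n|q hq] := nrm_complete hn (u := newton_it f) (C := K).
  by apply: le_trans (st n) _; rewrite ler_wpM2l.
have rate n : nrm (q - newton_it f n) <= 2 * (2 * C + 3) * h0 * r ^+ n.
  have tail m : nrm (newton_it f (m + n) - newton_it f n) <= 2 * K * (r ^+ n - r ^+ (m + n)).
    elim: m => [|m IH]; first by rewrite add0n !subrr nrm0 mulr0.
    apply: le_trans (nrm_dist _ (newton_it f (m + n)) _) _.
    rewrite addSn exprS; have := st (m + n)%N.
    have : K * r * r ^+ (m + n) <= K * 5^-1 * r ^+ (m + n).
      by rewrite ler_wpM2r ?exprn_ge0 // ler_wpM2l //; lra.
    have : 0 <= K * r ^+ (m + n) by rewrite mulr_ge0 ?exprn_ge0.
    move: IH; generalize (r ^+ (m + n)) => u; generalize (r ^+ n) => v.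
    have -> : 2 * K * (v - r * u) = 2 * K * v - 2 * (K * r * u) by ring.
    have -> : K * 5^-1 * u = 5^-1 * (K * u) by ring.
    have -> : 2 * K * (v - u) = 2 * K * v - 2 * (K * u) by ring.
    by opl.
  apply/ler_addgt0Pr => e e0; have [m /ltW hm] := geo_small (K * 2) e0.
  apply: le_trans (nrm_dist _ (newton_it f (m + n)) _) _; rewrite addrC; apply: lerD.
    apply: le_trans (tail m) _; rewrite /K mulrA ler_wpM2l ?mulr_ge0 //.
    by rewrite gerBl exprn_ge0.
  apply: le_trans (hq _) _; apply: le_trans hm; rewrite ler_wpM2l ?mulr_ge0 //.
  by rewrite exprD ler_piMr ?exprn_ge0 ?invr_ge0 // exprn_ile1 ?invr_ge0 // invf_le1 ?ler1n.
exists q; split=> //; last first.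
  pose D x := x * f = f * x.
  have hD : csub D := csub_comm f.
  apply: (cs_lim hD (T := newton_it f) (C := K * 2)) => // n.
  by apply: newton_it_in; [exact: hD|].
apply/eqP; rewrite -subr_eq0; apply/eqP.
apply: (@nrm_small _ (K * 2 * (nrm q + 1) + K * 2 * (C + 1) + h0)) => n.
set g := newton_it f n.
have -> : q * q - q = (q - g) * q + g * (q - g) - (q - g) + (g * g - g) by ncring.
have h1 : nrm (g * g - g) <= h0 * 2^-1 ^+ n.
  by have [_ h1] := newton_inv n; apply: le_trans h1 _; rewrite ler_wpM2l.
have h2 := hq n; rewrite -/g in h2.
apply: le_trans (nrmD _ _) _; rewrite [leRHS]mulrDl; apply: lerD => //.
apply: le_trans (nrmB hn _ _) _; apply: le_trans (lerD (nrmD _ _) (lexx _)) _.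
have h3 := nrmM hn (q - g) q; have h4 := nrmM hn g (q - g); have h5 := gC n.
rewrite -/g in h5; have h6 := nrm_ge0' (q - g); have h7 := nrm_ge0' q; have h8 := nrm_ge0' g.
have h9 : nrm (q - g) * nrm q <= K * 2 * 2^-1 ^+ n * nrm q by rewrite ler_wpM2r.
have h10 : nrm g * nrm (q - g) <= (C + 1) * (K * 2 * 2^-1 ^+ n) by rewrite ler_pM.
set u := 2^-1 ^+ n in h2 h9 h10 *.
have -> : (K * 2 * (nrm q + 1) + K * 2 * (C + 1)) * u =
  K * 2 * u * nrm q + (C + 1) * (K * 2 * u) + K * 2 * u by ring.
by apply: lerD => //; apply: lerD; [apply: le_trans h3 h9|apply: le_trans h4 h10].
Qed.
End NewtonConv.

(** If q commutes with f and is close to it, then q is locally Lipschitz in f: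
    f acts on the left of q (1 - q') almost as 1 and f' on its right almost as 0. *)
Lemma idem_lip (f f' q q' : B) (C : R) : q * q = q -> q' * q' = q' ->
    q * f = f * q -> q' * f' = f' * q' -> nrm q <= C -> nrm q' <= C ->
    nrm (q - f) <= 4^-1 -> nrm (q' - f') <= 4^-1 ->
  nrm (q - q') <= 4 * C * (1 + C) * nrm (f - f').
Proof.
move=> qq qq' qf qf' qC qC' df df'.
have C0 : 0 <= C by apply: le_trans qC; exact: nrm_ge0'.
pose Z := q * (1 - q'); pose W := (1 - q) * q'.
have qZ : q * Z = Z by rewrite /Z mulrA qq.
have Zq : Z * q' = 0 by rewrite /Z -mulrA mulrBl qq' mul1r subrr mulr0.
have qW : q * W = 0 by rewrite /W mulrA mulrBr qq mulr1 subrr mul0r.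
have Wq : W * q' = W by rewrite /W -mulrA qq'.
have ZE : Z = q * (f - f') * (1 - q') + (q - f) * Z - Z * (q' - f').
  have e1 : q * f * (1 - q') = f * Z by rewrite qf /Z mulrA.
  have e2 : q * f' * (1 - q') = Z * f' by rewrite /Z -!mulrA mulrBr mulrBl -qf' mulr1 mul1r.
  have -> : q * (f - f') * (1 - q') = f * Z - Z * f' by rewrite mulrBr [LHS]mulrBl e1 e2.
  by rewrite [(q - f) * Z]mulrBl qZ [Z * (q' - f')]mulrBr Zq; ncring.
have WE : W = (q' * 0) - (1 - q) * (f - f') * q' - (q - f) * W + W * (q' - f').
  have e1 : (1 - q) * f * q' = f * W.
    have -> : (1 - q) * f * q' = f * q' - q * f * q' by ncring.
    by rewrite qf /W; ncring.
  have e2 : (1 - q) * f' * q' = W * f' by rewrite /W -!mulrA qf'.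
  have -> : (1 - q) * (f - f') * q' = f * W - W * f' by rewrite mulrBr [LHS]mulrBl e1 e2.
  by rewrite [(q - f) * W]mulrBl qW [W * (q' - f')]mulrBr Wq; ncring.
have d0 := nrm_ge0' (f - f').
have nZ : nrm Z <= 2 * C * (1 + C) * nrm (f - f').
  have h1 : nrm Z <= nrm (q * (f - f') * (1 - q')) + nrm ((q - f) * Z) + nrm (Z * (q' - f')).
    by rewrite {1}ZE; apply: le_trans (nrmB hn _ _) _; rewrite lerD2r; exact: nrmD.
  have h2 := nrmM hn (q - f) Z; have h3 := nrmM hn Z (q' - f').
  have h4 : nrm (q * (f - f') * (1 - q')) <= C * nrm (f - f') * (1 + C).
    apply: le_trans (nrmM hn _ _) _; apply: ler_pM => //.
      by apply: le_trans (nrmM hn _ _) _; rewrite ler_wpM2r.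
    by have := nrmB hn 1 q'; have := nrm1 hn; move: qC'; opl.
  have h5 := nrm_ge0' Z; move: df df' h1 h2 h3 h4 h5.
  have -> : 2 * C * (1 + C) * nrm (f - f') = 2 * (C * nrm (f - f') * (1 + C)) by ring.
  by generalize (C * nrm (f - f') * (1 + C)) => u; opn.
have nW : nrm W <= 2 * C * (1 + C) * nrm (f - f').
  have h1 : nrm W <= nrm ((1 - q) * (f - f') * q') + nrm ((q - f) * W) + nrm (W * (q' - f')).
    rewrite {1}WE mulr0 sub0r; apply: le_trans (nrmD _ _) _; rewrite lerD2r.
    by apply: le_trans (nrmB hn _ _) _; rewrite nrmN.
  have h2 := nrmM hn (q - f) W; have h3 := nrmM hn W (q' - f').
  have h4 : nrm ((1 - q) * (f - f') * q') <= (1 + C) * nrm (f - f') * C.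
    apply: le_trans (nrmM hn _ _) _; apply: ler_pM => //.
    apply: le_trans (nrmM hn _ _) _; rewrite ler_wpM2r //.
    by have := nrmB hn 1 q; have := nrm1 hn; move: qC; opl.
  have h5 := nrm_ge0' W; move: df df' h1 h2 h3 h4 h5.
  have -> : 2 * C * (1 + C) * nrm (f - f') = 2 * ((1 + C) * nrm (f - f') * C) by ring.
  by generalize ((1 + C) * nrm (f - f') * C) => u; opn.
have -> : q - q' = Z - W by rewrite /Z /W; ncring.
apply: le_trans (nrmB hn _ _) _; move: nZ nW.
have -> : 4 * C * (1 + C) * nrm (f - f') = 2 * (2 * C * (1 + C) * nrm (f - f')) by ring.
by generalize (2 * C * (1 + C) * nrm (f - f')) => u; opl.
Qed.

(** ** Approximate equality *)

(** The constants are products and sums, so a polynomial expression inherits the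
    relation from its variables with a constant that does not depend on e. *)
Definition app (e : R) x y (K : R) : Prop :=
  [/\ nrm x <= K, nrm y <= K & nrm (x - y) <= K * e].

Section App.
Variable e : R.
Hypothesis e0 : 0 <= e.

Lemma app_refl x (K : R) : nrm x <= K -> app e x x K.
Proof.
move=> xK; split=> //; rewrite subrr nrm0 mulr_ge0 //.
by apply: le_trans xK; exact: nrm_ge0'.
Qed.

Lemma app_mul x y x' y' (K K' : R) : app e x y K -> app e x' y' K' ->
  app e (x * x') (y * y') (2 * (K * K')).
Proof.
move=> [xK yK xy] [xK' yK' xy'].
have p1 : nrm (x * x') <= K * K' by apply: le_trans (nrmM hn _ _) _; apply: ler_pM.
have p2 : nrm (y * y') <= K * K' by apply: le_trans (nrmM hn _ _) _; apply: ler_pM.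
have KK : 0 <= K * K' by apply: le_trans p1; exact: nrm_ge0'.
split; [by move: p1 KK; opl|by move: p2 KK; opl|].
have -> : x * x' - y * y' = x * (x' - y') + (x - y) * y' by ncring.
apply: le_trans (nrmD _ _) _.
have h1 : nrm (x * (x' - y')) <= K * (K' * e).
  by apply: le_trans (nrmM hn _ _) _; apply: ler_pM.
have h2 : nrm ((x - y) * y') <= (K * e) * K'.
  by apply: le_trans (nrmM hn _ _) _; apply: ler_pM.
have -> : 2 * (K * K') * e = K * (K' * e) + (K * e) * K' by ring.
exact: lerD.
Qed.

Lemma app_add x y x' y' (K K' : R) : app e x y K -> app e x' y' K' ->
  app e (x + x') (y + y') (K + K').
Proof.
move=> [xK yK xy] [xK' yK' xy'].
split; try by apply: le_trans (nrmD _ _) _; apply: lerD.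
have -> : x + x' - (y + y') = (x - y) + (x' - y') by ncring.
by apply: le_trans (nrmD _ _) _; rewrite mulrDl; apply: lerD.
Qed.

Lemma app_opp x y (K : R) : app e x y K -> app e (- x) (- y) K.
Proof. by move=> [? ? ?]; split; rewrite ?nrmN // -opprD nrmN. Qed.

Lemma app_trans x y z (K K' : R) : app e x y K -> app e y z K' -> app e x z (K + K').
Proof.
move=> [xK yK xy] [yK' zK' yz]; have y0 := nrm_ge0' y.
split; [move: xK yK' y0; opl|move: zK' yK y0; opl|].
by apply: le_trans (nrm_dist _ y _) _; rewrite mulrDl; apply: lerD.
Qed.

Lemma app_sym x y (K : R) : app e x y K -> app e y x K.
Proof. by move=> [? ? ?]; split=> //; rewrite nrmBC. Qed.
End App.
End BanachRing.

Arguments normc : simpl never.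
#[local] Opaque opnorm ellp_norm.



(** * Bounded operators on l^p spaces *)

Section Geometric.
Context {R : realType}.

Lemma geo_limit (a : nat -> R) K : (forall n, `|a n.+1 - a n| <= K * 2^-1 ^+ n) ->
  exists l, forall n, `|a n - l| <= K * 2 * 2^-1 ^+ n.
Proof.
move=> h; have K0 : 0 <= K by have := h 0%N; rewrite expr0 mulr1; apply: le_trans.
pose d n := K * 2 * 2^-1 ^+ n.
have dS n : d n = d n.+1 + K * 2^-1 ^+ n.
  rewrite /d [in LHS]geo_half mulrDr; congr (_ + _).
  by rewrite exprS mulrA mulfK ?pnatr_eq0.
have up n : a n - d n <= a n.+1 - d n.+1.
  by have := h n; rewrite (dS n) ler_norml => /andP[? ?]; lra.
have dn n : a n.+1 + d n.+1 <= a n + d n.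
  by have := h n; rewrite (dS n) ler_norml => /andP[? ?]; lra.
have d0 n : 0 <= d n by rewrite /d !mulr_ge0 // ltW // geo_gt0.
have upn m n : a n - d n <= a (m + n)%N - d (m + n)%N.
  by elim: m => // m IH; apply: le_trans IH _; rewrite addSn.
have dnn m n : a (m + n)%N + d (m + n)%N <= a n + d n.
  by elim: m => // m IH; apply: le_trans IH; rewrite addSn.
have ub m n : a m - d m <= a n + d n.
  have := upn n m; have := dnn m n; have := d0 (m + n)%N; rewrite (addnC n m); lra.
pose E := [set a n - d n | n in [set: nat]].
have supE : has_sup E.
  by split; [exists (a 0%N - d 0%N), 0%N|exists (a 0%N + d 0%N) => _ [n _ <-]].
exists (sup E) => n; rewrite -/(d n) ler_norml.
have h1 : a n - d n <= sup E by apply: sup_upper_bound => //; exists n.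
have h2 : sup E <= a n + d n by apply: ge_sup; [case: supE|move=> _ [m _ <-]].
by apply/andP; split; lra.
Qed.

Lemma Re_le_normc (z : R[i]) : `|complex.Re z| <= normc z.
Proof.
by case: z => a b /=; rewrite -sqrtr_sqr ler_sqrt ?addr_ge0 ?sqr_ge0 // lerDl sqr_ge0.
Qed.
Lemma Im_le_normc (z : R[i]) : `|complex.Im z| <= normc z.
Proof.
by case: z => a b /=; rewrite -sqrtr_sqr ler_sqrt ?addr_ge0 ?sqr_ge0 // lerDr sqr_ge0.
Qed.
Lemma normc_le_ReIm (z : R[i]) : normc z <= `|complex.Re z| + `|complex.Im z|.
Proof.
case: z => a b /=; rewrite -[leRHS]ger0_norm ?addr_ge0 // -sqrtr_sqr.
rewrite ler_sqrt ?sqr_ge0 // sqrrD !real_normK ?num_real //.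
by rewrite addrAC lerDl mulrn_wge0 // mulr_ge0.
Qed.

Lemma geo_limitC (a : nat -> R[i]) K : (forall n, normc (a n.+1 - a n) <= K * 2^-1 ^+ n) ->
  exists l, forall n, normc (a n - l) <= K * 4 * 2^-1 ^+ n.
Proof.
move=> h.
have ReB (x y : R[i]) : complex.Re (x - y) = complex.Re x - complex.Re y by case: x y => [? ?] [? ?].
have ImB (x y : R[i]) : complex.Im (x - y) = complex.Im x - complex.Im y by case: x y => [? ?] [? ?].
have [n|l1 h1] := @geo_limit (fun n => complex.Re (a n)) K.
  by rewrite -ReB; apply: le_trans (Re_le_normc _) (h n).
have [n|l2 h2] := @geo_limit (fun n => complex.Im (a n)) K.
  by rewrite -ImB; apply: le_trans (Im_le_normc _) (h n).
exists (Complex l1 l2) => n; apply: le_trans (normc_le_ReIm _) _.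
rewrite ReB ImB /=; have := h1 n; have := h2 n; rewrite -!mulrA; lra.
Qed.
End Geometric.

Lemma normc_zero {R : realType} : normc (0 : R[i]) = 0. Proof. exact: normc0. Qed.
Lemma normc_one {R : realType} : normc (1 : R[i]) = 1. Proof. exact: normc1. Qed.

Lemma sum_const_seq {R : realType} (A : Type) (s : seq A) (c : R) :
  \sum_(x <- s) c = (size s)%:R * c.
Proof.
elim: s => [|a s IH]; first by rewrite big_nil mul0r.
by rewrite big_cons IH /= -[(size s).+1]add1n natrD mulrDl mul1r.
Qed.

Section EllpBasics.
Context {R : realType} {p : R} (p1 : 1 <= p).
Implicit Types I J : choiceType.

Let p0 : 0 < p. Proof. by rewrite (lt_le_trans _ p1). Qed.

Lemma ellp_ext I (u v : ellp I p1) : (u : I -> R[i]) =1 v -> u = v.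
Proof. by move=> h; apply/val_inj/funext. Qed.

Lemma ellpDE I (u v : ellp I p1) i : (u + v) i = u i + v i. Proof. by []. Qed.
Lemma ellpBE I (u v : ellp I p1) i : (u - v) i = u i - v i. Proof. by []. Qed.
Lemma ellpZE I (c : R[i]) (u : ellp I p1) i : (c *: u) i = c * u i. Proof. by []. Qed.
Lemma ellp0E I i : (0 : ellp I p1) i = 0. Proof. by []. Qed.
Lemma ellp_deltaE I (j i : I) : ellp_delta p1 j i = (i == j)%:R. Proof. by []. Qed.

Lemma ellp_norm_le_fin I (u : ellp I p1) (M : R) : 0 <= M ->
  (forall F : {fset I}, \sum_(x <- F) normc (u x) `^ p <= M `^ p) -> ellp_norm u <= M.
Proof. by move=> M0 h; apply/ellp_norm_leP => //; apply/pow_sum_leP. Qed.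

Lemma ellp_fin_le I (u : ellp I p1) (F : {fset I}) :
  \sum_(x <- F) normc (u x) `^ p <= ellp_norm u `^ p.
Proof. by move: F; apply/pow_sum_leP; apply/ellp_norm_leP => //; exact: ellp_norm_ge0. Qed.

(** Composition with a partial injection is a contraction for every exponent: coordinate
    projections, shifts, slices, matrix units and permutations all arise in this way. *)
Record pinj (I J : choiceType) := Pinj {
  pfun :> I -> option J;
  pinjP : forall i i' j, pfun i = Some j -> pfun i' = Some j -> i = i' }.

Definition pull_fun I J (s : pinj I J) (u : J -> R[i]) : I -> R[i] :=
  fun i => if s i is Some j then u j else 0.

Lemma pull_sum I J (s : pinj I J) (u : J -> R[i]) (F : {fset I}) : exists G : {fset J},
  \sum_(x <- F) normc (pull_fun s u x) `^ p = \sum_(x <- G) normc (u x) `^ p.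
Proof.
exists [fset j in pmap s F]%fset.
have un : uniq (pmap s F).
  have := fset_uniq F; elim: (F : seq I) => //= i t IH /andP[it /IH ut].
  case E: (s i) => [j|//] /=; rewrite ut andbT; apply: contra it.
  by rewrite mem_pmap => /mapP[i' i't E']; rewrite (pinjP E (esym E')).
rewrite [RHS](perm_big (pmap s F)) /=; last first.
  by apply: uniq_perm => //; move=> j; rewrite in_fset.
elim: (F : seq I) => [|i t IH] /=; first by rewrite !big_nil.
rewrite big_cons IH /pull_fun; case E: (s i) => [j|] /=; first by rewrite big_cons.
by rewrite normc_zero powR0 ?add0r // gt_eqF.
Qed.

Lemma pull_in I J (s : pinj I J) (u : ellp J p1) : pull_fun s u \in in_ellp p1.
Proof.
apply/in_ellpP; exists (ellp_norm u `^ p); apply/pow_sum_leP => F.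
by have [G ->] := pull_sum s u F; exact: ellp_fin_le.
Qed.

Definition pull_vec I J (s : pinj I J) (u : ellp J p1) : ellp I p1 := Ellp (pull_in s u).

Lemma pull_norm I J (s : pinj I J) (u : ellp J p1) : ellp_norm (pull_vec s u) <= ellp_norm u.
Proof.
apply: ellp_norm_le_fin; first exact: ellp_norm_ge0.
by move=> F; have [G] := pull_sum s u F; rewrite /= => ->; exact: ellp_fin_le.
Qed.

Lemma pull_vec_linear I J (s : pinj I J) : linear (pull_vec s).
Proof.
move=> a u v; apply: ellp_ext => i; rewrite ellpDE ellpZE /= /pull_fun.
by case: (s i) => //; rewrite mulr0 addr0.
Qed.

Lemma ellp_dom_in I (u : ellp I p1) (f : I -> R[i]) :
  (forall i, normc (f i) <= normc (u i)) -> f \in in_ellp p1.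
Proof.
move=> h; apply/in_ellpP; exists (ellp_norm u `^ p); apply/pow_sum_leP => F.
apply: le_trans (ellp_fin_le u F); apply: ler_sum => i _.
by rewrite ge0_ler_powR ?nnegrE ?normc_ge0 ?(ltW p0).
Qed.

Lemma ellp_dom_norm I (u v : ellp I p1) :
  (forall i, normc (v i) <= normc (u i)) -> ellp_norm v <= ellp_norm u.
Proof.
move=> h; apply: ellp_norm_le_fin; first exact: ellp_norm_ge0.
move=> F; apply: le_trans (ellp_fin_le u F); apply: ler_sum => i _.
by rewrite ge0_ler_powR ?nnegrE ?normc_ge0 ?(ltW p0).
Qed.

Lemma ellp_delta_norm I (i : I) : ellp_norm (ellp_delta p1 i) <= 1.
Proof.
apply: ellp_norm_le_fin => // F; rewrite powR1.
have e j : normc (delta_fun i j : R[i]) `^ p = (j == i)%:R.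
  by rewrite /delta_fun; case: eqP => _; rewrite ?normc_one ?powR1 // normc_zero powR0 ?gt_eqF.
rewrite (eq_bigr _ (fun j _ => e j)).
have [iF|iF] := boolP (i \in F).
  rewrite (big_fsetD1 i) //= eqxx big_seq big1 ?addr0 // => x.
  by rewrite !inE => /andP[/negbTE ->].
by rewrite big_seq big1 // => x xF; case: eqP xF iF => // -> ->.
Qed.

Lemma ellp_norm_sum I (A : Type) (s : seq A) (P : pred A) (f : A -> ellp I p1) :
  ellp_norm (\sum_(a <- s | P a) f a) <= \sum_(a <- s | P a) ellp_norm (f a).
Proof.
elim/big_rec2: _ => [|a x u _ h]; first by rewrite ellp_norm0.
by apply: le_trans (ellp_normD_le _ _) _; rewrite lerD2l.
Qed.

Lemma ellp_sumE I (A : Type) (s : seq A) (P : pred A) (f : A -> ellp I p1) (i : I) :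
  (\sum_(a <- s | P a) f a) i = \sum_(a <- s | P a) f a i.
Proof. by elim/big_rec2: _ => // a x u _ <-. Qed.

Lemma ellp_combE I (F : {fset I}) (g : I -> R[i]) (i : I) :
  (\sum_(x <- F) g x *: ellp_delta p1 x) i = if i \in F then g i else 0.
Proof.
rewrite ellp_sumE; under eq_bigr => x _ do rewrite ellpZE ellp_deltaE.
have [iF|iF] := boolP (i \in F).
  rewrite (big_fsetD1 i) //= eqxx mulr1 big_seq big1 => [|y]; first by rewrite addr0.
  by rewrite !inE eq_sym => /andP[/negbTE -> _]; rewrite mulr0.
rewrite big_seq big1 // => y yF.
by case: eqP yF iF => [-> ->|]; rewrite ?mulr0.
Qed.

(** Only the values on finite sets matter for the norm, so pointwise limits of
    a geometrically Cauchy sequence of vectors are norm limits. *)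
Lemma ellp_complete I (u : nat -> ellp I p1) (C : R) :
  (forall n, ellp_norm (u n.+1 - u n) <= C * 2^-1 ^+ n) ->
  exists l : ellp I p1, (forall n, ellp_norm (l - u n) <= C * 2 * 2^-1 ^+ n) /\
    forall i n, normc (u n i - l i) <= C * 4 * 2^-1 ^+ n.
Proof.
move=> h.
have C0 : 0 <= C.
  by have := h 0%N; rewrite expr0 mulr1; apply: le_trans; exact: ellp_norm_ge0.
have cauchy m n : ellp_norm (u (m + n)%N - u n) <= C * 2 * 2^-1 ^+ n.
  suff : ellp_norm (u (m + n)%N - u n) <= C * 2 * (2^-1 ^+ n - 2^-1 ^+ (m + n)).
    move=> h1; apply: le_trans h1 _; rewrite ler_wpM2l ?mulr_ge0 //.
    by rewrite gerBl ltW // geo_gt0.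
  elim: m => [|m IH]; first by rewrite add0n !subrr mulr0 ellp_norm0.
  have -> : u (m.+1 + n)%N - u n = (u (m + n).+1 - u (m + n)%N) + (u (m + n)%N - u n).
    by rewrite addSn addrA subrK.
  apply: le_trans (ellp_normD_le _ _) _; apply: le_trans (lerD (h _) IH) _.
  rewrite addSn (geo_half (m + n)).
  by have : C * 2 * 2^-1 ^+ (m + n).+1 = C * 2^-1 ^+ (m + n);
    [rewrite exprS mulrA mulfK ?pnatr_eq0|rewrite (geo_half (m + n)); lra].
have lim i : exists l, forall n, normc (u n i - l) <= C * 4 * 2^-1 ^+ n.
  apply: geo_limitC => n.
  by apply: le_trans (h n); exact: (normc_le_ellp_norm (u n.+1 - u n) i).
have [f hf] := choice lim.
have fin n (F : {fset I}) :
    \sum_(x <- F) normc (f x - u n x) `^ p <= (C * 2 * 2^-1 ^+ n) `^ p.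
  set M := C * 2 * _; have M0 : 0 <= M by rewrite !mulr_ge0 // ltW // geo_gt0.
  pose w : ellp I p1 := \sum_(x <- F) (f x - u n x) *: ellp_delta p1 x.
  have wE x : x \in F -> w x = f x - u n x by move=> xF; rewrite /w ellp_combE xF.
  have -> : \sum_(x <- F) normc (f x - u n x) `^ p = \sum_(x <- F) normc (w x) `^ p.
    by apply: eq_big_seq => x xF; rewrite wE.
  apply: le_trans (ellp_fin_le w F) _.
  rewrite ge0_ler_powR ?nnegrE ?ellp_norm_ge0 ?(ltW p0) //.
  apply/ler_addgt0Pr => e e0.
  have [m hm] := @geo_small R ((size F)%:R * (C * 4)) e e0.
  pose v : ellp I p1 := \sum_(x <- F) (u (m + n)%N - u n) x *: ellp_delta p1 x.
  have vle : ellp_norm v <= M.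
    apply: le_trans (cauchy m n); apply: ellp_dom_norm => i; rewrite /v.
    by rewrite ellp_combE; case: ifP => // _; rewrite normc_zero normc_ge0.
  have -> : w = v + \sum_(x <- F) (f x - u (m + n)%N x) *: ellp_delta p1 x.
    rewrite /w /v -big_split /=; apply: eq_bigr => x _; rewrite -scalerDl; congr (_ *: _).
    change (f x - u n x = (u (m + n)%N x - u n x) + (f x - u (m + n)%N x)).
    by ncring.
  apply: le_trans (ellp_normD_le _ _) _; apply: lerD => //.
  apply: le_trans (ellp_norm_sum _ _ _) _; apply: le_trans (ltW hm).
  apply: (@le_trans _ _ (\sum_(x <- F) C * 4 * 2^-1 ^+ m)).
    apply: ler_sum => x _; apply: le_trans (ellp_normZ_le _ _) _.
    have h1 : normc (f x - u (m + n)%N x) <= C * 4 * 2^-1 ^+ m.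
      rewrite -normcN opprB; apply: le_trans (hf _ _) _.
      rewrite ler_wpM2l ?mulr_ge0 // addnC exprD ler_piMl ?exprn_ge0 ?invr_ge0 //.
      by rewrite exprn_ile1 ?invr_ge0 // invf_le1 // ler1n.
    rewrite -[leRHS]mulr1; apply: ler_pM => //;
      [exact: normc_ge0|exact: ellp_norm_ge0|exact: ellp_delta_norm].
  by rewrite sum_const_seq !mulrA.
have fin0 : f - u 0%N \in in_ellp p1.
  by apply/in_ellpP; exists ((C * 2 * 2^-1 ^+ 0) `^ p); apply/pow_sum_leP => F; exact: fin.
pose l : ellp I p1 := Ellp fin0 + u 0%N.
have lE i : l i = f i.
  by have -> : l i = f i - u 0%N i + u 0%N i; [|rewrite subrK].
exists l; split=> [n|i n]; last by rewrite lE.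
apply: ellp_norm_le_fin; first by rewrite !mulr_ge0 // ltW // geo_gt0.
move=> F; apply: le_trans (fin n F); apply: ler_sum => i _.
by rewrite -lE.
Qed.
End EllpBasics.

Ltac gen_norms := repeat match goal with
  | |- context [opnorm ?T] => generalize (opnorm T)
  | |- context [ellp_norm ?T] => generalize (ellp_norm T) end; clear; intros.
Ltac opl := gen_norms; lra.
Ltac opn := gen_norms; nra.

Section BopBasics.
Context {R : realType} {p : R} (p1 : 1 <= p) {I : choiceType}.
Local Notation E := (ellp I p1).
Local Notation B := (bop I p1).
Implicit Types (S T U : B) (u v : E) (x y z : I).

Lemma bopDE S T u : (S + T) u = S u + T u. Proof. by []. Qed.
Lemma bopBE S T u : (S - T) u = S u - T u. Proof. by []. Qed.
Lemma bopME S T u : (S * T) u = S (T u). Proof. by []. Qed.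
Lemma bop1E u : (1 : B) u = u. Proof. by []. Qed.
Lemma bop0E u : (0 : B) u = 0. Proof. by []. Qed.

Lemma bop_sumE (A : Type) (s : seq A) (P : pred A) (f : A -> B) u :
  (\sum_(a <- s | P a) f a) u = \sum_(a <- s | P a) f a u.
Proof. by elim/big_rec2: _ => // a x S _ <-. Qed.

Lemma mcoefD S T x y : mcoef (S + T) x y = mcoef S x y + mcoef T x y. Proof. by []. Qed.
Lemma mcoefB S T x y : mcoef (S - T) x y = mcoef S x y - mcoef T x y. Proof. by []. Qed.
Lemma mcoefN S x y : mcoef (- S) x y = - mcoef S x y. Proof. by []. Qed.
Lemma mcoef1 x y : mcoef (1 : B) x y = (x == y)%:R. Proof. by []. Qed.
Lemma mcoef0 x y : mcoef (0 : B) x y = 0. Proof. by []. Qed.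
Lemma mcoef_sum (A : Type) (s : seq A) (P : pred A) (f : A -> B) x y :
  mcoef (\sum_(a <- s | P a) f a) x y = \sum_(a <- s | P a) mcoef (f a) x y.
Proof. by elim/big_rec2: _ => // a z S _ <-. Qed.

Lemma mcoef_ext S T : (forall x y, mcoef S x y = mcoef T x y) -> S = T.
Proof.
move=> h; apply/eqP; rewrite -subr_eq0; apply/eqP; apply: bop_ext => u.
apply: ellp_ext => x; rewrite bop0E ellp0E; apply: bop_coef0 => y _.
by rewrite mcoefB h subrr.
Qed.

Lemma opnorm_bound T (M : R) : 0 <= M -> (forall u, ellp_norm (T u) <= M * ellp_norm u) ->
  opnorm T <= M.
Proof. by move=> M0 h; apply/opnorm_leP. Qed.

Lemma normc_mcoef T x y : normc (mcoef T x y) <= opnorm T.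
Proof.
apply: le_trans (normc_le_ellp_norm _ _) _; apply: le_trans (le_opnorm _ _) _.
by rewrite -[leRHS]mulr1 ler_wpM2l ?opnorm_ge0 // ellp_delta_norm.
Qed.

Lemma opnorm0 : opnorm (0 : B) = 0.
Proof.
apply: le_anti; rewrite opnorm_ge0 andbT; apply: opnorm_bound => // u.
by rewrite ellp_norm0 mul0r.
Qed.

Lemma opnorm1_le : opnorm (1 : B) <= 1.
Proof. by apply: opnorm_bound => // u; rewrite mul1r. Qed.

Lemma opnormN T : opnorm (- T) = opnorm T.
Proof. by rewrite -[- T]sub0r opnormBC subr0. Qed.

Lemma opnormD_le S T : opnorm (S + T) <= opnorm S + opnorm T.
Proof. by rewrite -{1}[T]opprK -[in leRHS](opnormN T); exact: opnormB_le. Qed.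

Lemma opnorm_eq0 T : opnorm T <= 0 -> T = 0.
Proof.
move=> T0; apply: mcoef_ext => x y; rewrite mcoef0; apply: eq0_normc.
by apply: le_anti; rewrite normc_ge0 andbT (le_trans (normc_mcoef _ _ _)).
Qed.

(** Geometric Cauchy sequences suffice for the fixed points needed here. *)
Lemma bop_complete (T : nat -> B) (C : R) :
  (forall n, opnorm (T n.+1 - T n) <= C * 2^-1 ^+ n) ->
  exists L, forall n, opnorm (L - T n) <= C * 2 * 2^-1 ^+ n.
Proof.
move=> h.
have C0 : 0 <= C.
  by have := h 0%N; rewrite expr0 mulr1; apply: le_trans; exact: opnorm_ge0.
have lim u : exists l : E, (forall n, ellp_norm (l - T n u) <= C * ellp_norm u * 2 * 2^-1 ^+ n) /\
    forall i n, normc (T n u i - l i) <= C * ellp_norm u * 4 * 2^-1 ^+ n.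
  apply: (@ellp_complete _ _ _ _ (fun n => T n u)) => n; rewrite -bopBE.
  by apply: le_trans (le_opnorm _ _) _; rewrite mulrAC ler_wpM2r ?ellp_norm_ge0.
have [L hL] := choice lim.
have Llin : linear L.
  move=> a u v; apply: ellp_ext => i; apply/eqP; rewrite -subr_eq0; apply/eqP.
  apply: eq0_normc; apply: le_anti; rewrite normc_ge0 andbT.
  set w := a *: u + v.
  pose K := C * ellp_norm w * 4 + (normc a * (C * ellp_norm u * 4) + C * ellp_norm v * 4).
  have hK n : normc (L w i - (a *: L u + L v) i) <= K * 2^-1 ^+ n.
    have -> : L w i - (a *: L u + L v) i =
        - (T n w i - L w i) + (a * (T n u i - L u i) + (T n v i - L v i)).
      have -> : T n w i = a * T n u i + T n v i by rewrite /w linearP.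
      have -> : (a *: L u + L v) i = a * L u i + L v i by [].
      by ncring.
    apply: le_trans (le_normcD _ _) _; rewrite normcN /K !mulrDl; apply: lerD.
      exact: (hL w).2.
    apply: le_trans (le_normcD _ _) _; rewrite normcM; apply: lerD; last exact: (hL v).2.
    by rewrite -[leRHS]mulrA ler_wpM2l ?normc_ge0 //; exact: (hL u).2.
  apply/ler_addgt0Pr => e e0; rewrite add0r.
  by have [n /ltW hn] := geo_small K e0; apply: le_trans (hK n) hn.
have Lb u n : ellp_norm (L u - T n u) <= C * 2 * 2^-1 ^+ n * ellp_norm u.
  by have := (hL u).1 n; congr (_ <= _); ring.
have LB : L \in (@bounded_linear _ _ _ p1).
  apply/bounded_linearP; split=> //.
  exists (C * 2 + opnorm (T 0%N)); first by rewrite addr_ge0 ?mulr_ge0 ?opnorm_ge0.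
  move=> u; have -> : L u = (L u - T 0%N u) + T 0%N u by rewrite subrK.
  apply: le_trans (ellp_normD_le _ _) _; rewrite mulrDl; apply: lerD; last exact: le_opnorm.
  by have := Lb u 0%N; rewrite expr0 mulr1.
exists (Bop LB) => n; apply: opnorm_bound; first by rewrite !mulr_ge0 // ltW // geo_gt0.
by move=> u; rewrite bopBE; exact: Lb.
Qed.


Lemma bop_bnorm : bnorm (@opnorm R I p p1).
Proof.
split; [exact: opnorm_ge0|exact: opnorm_eq0|exact: opnorm0|exact: opnormN|
  exact: opnormB_le|exact: opnormM_le|exact: opnorm1_le|exact: bop_complete].
Qed.

(** ** Operators with prescribed support *)

Section Support.
Variable ctl : nat -> I -> I -> Prop.
Hypotheses (ctl_refl : forall n x, ctl n x x)
  (ctl_mono : forall n m x y, (n <= m)%N -> ctl n x y -> ctl m x y)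
  (ctl_trans : forall n m x y z, ctl n x y -> ctl m y z -> ctl (n + m) x z).

Definition supp n T := forall x y, mcoef T x y != 0 -> ctl n x y.

Definition supp_cl := fil_cl (@opnorm R I p p1) supp.

Lemma suppB n S T : supp n S -> supp n T -> supp n (S - T).
Proof.
move=> hS hT x y; rewrite mcoefB; have [S0|S0 _] := eqVneq (mcoef S x y) 0; last exact: hS.
by rewrite S0 sub0r oppr_eq0; exact: hT.
Qed.

(** Propagation adds up: a nonzero entry of a product needs an intermediate point. *)
Lemma suppM n m S T : supp n S -> supp m T -> supp (n + m) (S * T).
Proof.
move=> hS hT x z; apply: contra_neqP => nxz.
have -> : mcoef (S * T) x z = S (T (ellp_delta p1 z)) x by [].
apply: bop_coef0 => y yz; have [//|xy] := eqVneq (mcoef S x y) 0.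
by case: nxz; apply: ctl_trans (hS _ _ xy) (hT _ _ yz).
Qed.

Lemma supp1 n : supp n 1.
Proof. by move=> x y; rewrite mcoef1; have [->|] := eqVneq x y; rewrite ?eqxx. Qed.

Lemma supp_mono n m T : (n <= m)%N -> supp n T -> supp m T.
Proof. by move=> nm hT x y /hT; exact: ctl_mono. Qed.

Lemma supp_in n T : supp n T -> supp_cl T.
Proof. by move=> hT; apply: (fil_in bop_bnorm hT). Qed.

Lemma supp_cl_csub : csub (@opnorm R I p p1) supp_cl.
Proof.
exact: (fil_cl_csub bop_bnorm supp_mono suppB suppM (supp1 0)).
Qed.
End Support.
End BopBasics.

Section Pull.
Context {R : realType} {p : R} (p1 : 1 <= p).
Implicit Types I J : choiceType.

Lemma pull_bounded I (s : pinj I I) : (pull_vec (p1 := p1) s) \in (@bounded_linear _ _ _ p1).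
Proof.
apply/bounded_linearP; split; first exact: pull_vec_linear.
by exists 1 => // u; rewrite mul1r; exact: pull_norm.
Qed.

Definition pull I (s : pinj I I) : bop I p1 := Bop (pull_bounded s).

Lemma pullE I (s : pinj I I) (u : ellp I p1) i :
  pull s u i = if s i is Some j then u j else 0.
Proof. by []. Qed.

Lemma opnorm_pull I (s : pinj I I) : opnorm (pull s) <= 1.
Proof. by apply: opnorm_bound => // u; rewrite mul1r; exact: pull_norm. Qed.

Lemma mcoef_pull I (s : pinj I I) i j : mcoef (pull s) i j = (s i == Some j)%:R.
Proof.
rewrite /mcoef pullE; case: (s i) => [k|//]; rewrite ellp_deltaE.
by rewrite (inj_eq Some_inj).
Qed.

(** Multiplication by a bounded function. *)
Record wfun I := WFun { wf :> I -> R[i]; wfP : exists C : R, forall i, normc (wf i) <= C }.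

Lemma wmul_in I (g : wfun I) (u : ellp I p1) : (fun i => g i * u i) \in in_ellp p1.
Proof.
have [C hC] := wfP g; pose v := ((C%:C)%C : R[i]) *: u.
apply: (@ellp_dom_in _ _ p1 _ v) => i; rewrite ellpZE !normcM ler_wpM2r ?normc_ge0 //.
apply: le_trans (hC i) _; rewrite /normc /= expr0n /= addr0 sqrtr_sqr; exact: ler_norm.
Qed.

Definition wmul_vec I (g : wfun I) (u : ellp I p1) : ellp I p1 := Ellp (wmul_in g u).

Lemma wmul_norm I (g : wfun I) (C : R) u : 0 <= C -> (forall i, normc (g i) <= C) ->
  ellp_norm (wmul_vec g u) <= C * ellp_norm u.
Proof.
move=> C0 hC; have nC : normc ((C%:C)%C : R[i]) = C.
  by rewrite /normc /= expr0n /= addr0 sqrtr_sqr ger0_norm.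
apply: le_trans (_ : _ <= ellp_norm (((C%:C)%C : R[i]) *: u)) _; last first.
  by rewrite -[in leRHS]nC; exact: ellp_normZ_le.
apply: ellp_dom_norm => i; rewrite ellpZE !normcM nC ler_wpM2r ?normc_ge0 //.
Qed.

Lemma wmul_bounded I (g : wfun I) : wmul_vec g \in (@bounded_linear _ _ _ p1).
Proof.
have [C hC] := wfP g; apply/bounded_linearP; split.
  move=> a u v; apply: ellp_ext => i.
  change (g i * (a * u i + v i) = a * (g i * u i) + g i * v i).
  by rewrite mulrDr mulrCA.
have C0 : 0 <= Num.max 0 C by rewrite le_max lexx.
exists (Num.max 0 C) => // u; apply: wmul_norm => // i.
by rewrite le_max hC orbT.
Qed.

Definition wmul I (g : wfun I) : bop I p1 := Bop (wmul_bounded g).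

Lemma wmulE I (g : wfun I) (u : ellp I p1) i : wmul g u i = g i * u i.
Proof. by []. Qed.

Lemma opnorm_wmul I (g : wfun I) (C : R) : 0 <= C -> (forall i, normc (g i) <= C) ->
  opnorm (wmul g) <= C.
Proof. by move=> C0 hC; apply: opnorm_bound => // u; exact: wmul_norm. Qed.

(** The coordinate projection onto a subset. *)
Lemma chi_pinj I (A : pred I) i i' j :
  (if A i then Some i else None) = Some j -> (if A i' then Some i' else None) = Some j -> i = i'.
Proof. by case: (A i) => // -[->]; case: (A i') => // -[->]. Qed.

Definition chi I (A : pred I) : bop I p1 := pull (Pinj (@chi_pinj I A)).

Lemma chiE I (A : pred I) (u : ellp I p1) i : chi A u i = if A i then u i else 0.
Proof. by rewrite pullE /=; case: (A i). Qed.

Lemma mcoef_chi I (A : pred I) i j : mcoef (chi A) i j = (A i && (i == j))%:R.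
Proof. by rewrite mcoef_pull /=; case: (A i). Qed.

Lemma chi_mul I (A A' : pred I) : chi A * chi A' = chi (fun i => A i && A' i).
Proof.
apply: bop_ext => u; apply: ellp_ext => i; rewrite bopME !chiE.
by case: (A i); case: (A' i).
Qed.

Lemma chi_idem I (A : pred I) : chi A * chi A = chi A.
Proof. by rewrite chi_mul; congr chi; apply/funext => i; rewrite andbb. Qed.

Lemma chiC I (A : pred I) : chi (fun i => ~~ A i) = 1 - chi A.
Proof.
apply: bop_ext => u; apply: ellp_ext => i.
rewrite bopBE ellpBE bop1E !chiE; case: (A i); rewrite ?subrr ?subr0 //.
Qed.

End Pull.

(** * Amplifications *)

Section Amplification.
Context {R : realType} {p : R} (p1 : 1 <= p) {X K : choiceType}.
Local Notation I := (X * K)%type.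
Local Notation E := (ellp X p1).
Local Notation EI := (ellp I p1).
Implicit Types (T : bop X p1) (S : bop I p1).

Let p0 : 0 < p. Proof. by rewrite (lt_le_trans _ p1). Qed.

Lemma slice_pinj (k : K) (x x' : X) (i : I) : Some (x, k) = Some i -> Some (x', k) = Some i -> x = x'.
Proof. by move=> [<-] [<-]. Qed.
Lemma embed_pinj (k : K) (i i' : I) (x : X) :
  (if i.2 == k then Some i.1 else None) = Some x ->
  (if i'.2 == k then Some i'.1 else None) = Some x -> i = i'.
Proof. by case: i i' => [y l] [y' l'] /=; do 2 case: eqP => // -> [->]. Qed.

Definition slice (k : K) : EI -> E := pull_vec (Pinj (@slice_pinj k)).
Definition embed (k : K) : E -> EI := pull_vec (Pinj (@embed_pinj k)).

Lemma sliceE k (u : EI) x : slice k u x = u (x, k). Proof. by []. Qed.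
Lemma embedE k (v : E) i : embed k v i = if i.2 == k then v i.1 else 0.
Proof. by rewrite /= /pull_fun /=; case: eqP. Qed.

Lemma ellp_fin_approx (I' : choiceType) (u : ellp I' p1) (e : R) : 0 < e -> exists F : {fset I'},
  ellp_norm u `^ p <= \sum_(x <- F) normc (u x) `^ p + e.
Proof.
move=> e0; apply: contrapT => /forallNP h.
have : (pow_sum p u <= (ellp_norm u `^ p - e)%:E)%E.
  apply/pow_sum_leP => F; rewrite lerBrDr leNgt; apply/negP => h'.
  by apply: (h F); exact: ltW.
by rewrite pow_sumE lee_fin leNgt ltrBlDr ltrDl e0.
Qed.

Lemma slice_sum (u : EI) (F : {fset K}) :
  \sum_(k <- F) ellp_norm (slice k u) `^ p <= ellp_norm u `^ p.
Proof.
apply/ler_addgt0Pr => e e0.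
have e1 : 0 < e / (size F).+1%:R by rewrite divr_gt0.
have [G hG] := choice (fun k => ellp_fin_approx (slice k u) e1).
apply: (@le_trans _ _ (\sum_(k <- F) (\sum_(x <- G k) normc (u (x, k)) `^ p + e / (size F).+1%:R))).
  by apply: ler_sum => k _; exact: hG.
rewrite big_split /= sum_const_seq; apply: lerD; last first.
  rewrite mulrCA ger_pMr // ler_pdivrMr // mul1r ler_nat; exact: leqnSn.
pose s := [seq (x, k) | k <- F, x <- G k].
have us : uniq s.
  apply: allpairs_uniq_dep; [exact: fset_uniq|by move=> k _; exact: fset_uniq|].
  by move=> [k x] [k' x'] _ _ /= [-> ->].
have -> : \sum_(k <- F) \sum_(x <- G k) normc (u (x, k)) `^ p =
    \sum_(i <- [fset i in s]%fset) normc (u i) `^ p.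
  rewrite [RHS](perm_big s) /=; last by apply: uniq_perm; [exact: fset_uniq|exact: us|move=> i; rewrite in_fset].
  by rewrite /s big_allpairs_dep.
exact: ellp_fin_le.
Qed.

(** T tensored with the identity of l^p(K). *)
Definition lift_fun T (u : EI) : I -> R[i] := fun i => T (slice i.2 u) i.1.

(** The slices of the image are the images of the slices, and the p-th powers of their norms
    add up. *)
Lemma lift_sum T (u : EI) (F : {fset I}) :
  \sum_(i <- F) normc (lift_fun T u i) `^ p <= (opnorm T * ellp_norm u) `^ p.
Proof.
pose KF := [fset i.2 | i in F]%fset; pose XF := [fset i.1 | i in F]%fset.
apply: (@le_trans _ _ (\sum_(k <- KF) \sum_(x <- XF) normc (T (slice k u) x) `^ p)).
  have -> : \sum_(k <- KF) \sum_(x <- XF) normc (T (slice k u) x) `^ p =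
      \sum_(i <- [seq (x, k) | k <- KF, x <- XF]) normc (lift_fun T u i) `^ p.
    by rewrite big_allpairs_dep.
  pose s := [seq (x, k) | k <- KF, x <- XF].
  have us : uniq s.
    apply: allpairs_uniq_dep; [exact: fset_uniq|by move=> k _; exact: fset_uniq|].
    by move=> [k x] [k' x'] _ _ /= [-> ->].
  have sub : {subset F <= s}.
    move=> [x k] iF; apply/allpairsPdep; exists k, x; split=> //.
      by apply/imfsetP; exists (x, k).
    by apply/imfsetP; exists (x, k).
  rewrite [leRHS](bigID (mem F)) /= -[leLHS]addr0; apply: lerD; last first.
    by apply: sumr_ge0 => i _; exact: powR_ge0.
  rewrite -[leRHS]big_filter le_eqVlt; apply/orP; left; apply/eqP; apply: perm_big.
  apply: uniq_perm; [exact: fset_uniq|exact: filter_uniq|move=> i; rewrite mem_filter /=].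
  by have [/sub ->|] := boolP (i \in F).
apply: (@le_trans _ _ (\sum_(k <- KF) (opnorm T * ellp_norm (slice k u)) `^ p)).
  apply: ler_sum => k _; apply: le_trans (ellp_fin_le _ _) _.
  by rewrite ge0_ler_powR ?nnegrE ?mulr_ge0 ?opnorm_ge0 ?ellp_norm_ge0 ?(ltW p0) ?le_opnorm.
under eq_bigr => k _ do rewrite powRM ?opnorm_ge0 ?ellp_norm_ge0 //.
rewrite -mulr_sumr powRM ?opnorm_ge0 ?ellp_norm_ge0 //.
by rewrite ler_wpM2l ?powR_ge0 //; exact: slice_sum.
Qed.

Lemma lift_in T (u : EI) : lift_fun T u \in in_ellp p1.
Proof.
by apply/in_ellpP; exists ((opnorm T * ellp_norm u) `^ p); apply/pow_sum_leP; exact: lift_sum.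
Qed.

Definition lift_vec T (u : EI) : EI := Ellp (lift_in T u).

Lemma lift_norm T u : ellp_norm (lift_vec T u) <= opnorm T * ellp_norm u.
Proof.
apply: ellp_norm_le_fin; first by rewrite mulr_ge0 ?opnorm_ge0 ?ellp_norm_ge0.
exact: lift_sum.
Qed.

Lemma slice_linear k : linear (slice k). Proof. exact: pull_vec_linear. Qed.
Lemma embed_linear k : linear (embed k). Proof. exact: pull_vec_linear. Qed.

Lemma lift_bounded T : lift_vec T \in (@bounded_linear _ _ _ p1).
Proof.
apply/bounded_linearP; split; last by exists (opnorm T); [exact: opnorm_ge0|exact: lift_norm].
move=> a u v; apply: ellp_ext => i.
change (T (slice i.2 (a *: u + v)) i.1 = a * T (slice i.2 u) i.1 + T (slice i.2 v) i.1).
by rewrite slice_linear linearP.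
Qed.

Definition lift T : bop I p1 := Bop (lift_bounded T).

Lemma liftE T (u : EI) i : lift T u i = T (slice i.2 u) i.1. Proof. by []. Qed.

Lemma opnorm_lift T : opnorm (lift T) <= opnorm T.
Proof. by apply: opnorm_bound; [exact: opnorm_ge0|exact: lift_norm]. Qed.

Lemma slice_lift T u k : slice k (lift T u) = T (slice k u).
Proof. by apply: ellp_ext => x. Qed.

Lemma liftM T T' : lift (T * T') = lift T * lift T'.
Proof.
apply: bop_ext => u; apply: ellp_ext => i.
by rewrite bopME !liftE slice_lift.
Qed.
Lemma lift1 : lift 1 = 1.
Proof. by apply: bop_ext => u; apply: ellp_ext => -[x k]. Qed.
Lemma liftB T T' : lift (T - T') = lift T - lift T'.
Proof. by apply: bop_ext => u; apply: ellp_ext => i. Qed.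
Lemma liftN T : lift (- T) = - lift T.
Proof. by apply: bop_ext => u; apply: ellp_ext => i. Qed.
Lemma liftD T T' : lift (T + T') = lift T + lift T'.
Proof. by apply: bop_ext => u; apply: ellp_ext => i. Qed.

Lemma slice_delta k i : slice k (ellp_delta p1 i) = if k == i.2 then ellp_delta p1 i.1 else 0.
Proof.
apply: ellp_ext => x; rewrite sliceE ellp_deltaE; case: i => y l /=.
by rewrite xpair_eqE; case: (k == l); rewrite ?andbT ?andbF ?ellp_deltaE.
Qed.

Lemma mcoef_lift T i j : mcoef (lift T) i j = if i.2 == j.2 then mcoef T i.1 j.1 else 0.
Proof.
rewrite {1}/mcoef liftE slice_delta; case: eqP => // _.
by rewrite linear0.
Qed.

(** Operators acting on the second coordinate only. *)
Lemma pullK_pinj (s : pinj K K) (i i' j : I) :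
  omap (pair i.1) (s i.2) = Some j -> omap (pair i'.1) (s i'.2) = Some j -> i = i'.
Proof.
case: i i' j => [x k] [x' k'] [y l] /=.
case E: (s k) => [m|//] /= [<- ml]; case E': (s k') => [m'|//] /= [-> ml'].
by move: E E'; rewrite ml ml' => E E'; rewrite (pinjP E E').
Qed.

Definition pullK (s : pinj K K) : bop I p1 := pull p1 (Pinj (@pullK_pinj s)).

Lemma pullKE (s : pinj K K) (u : EI) i :
  pullK s u i = if s i.2 is Some l then u (i.1, l) else 0.
Proof. by rewrite pullE /=; case: (s i.2). Qed.

Lemma slice_pullK (s : pinj K K) (u : EI) k :
  slice k (pullK s u) = if s k is Some l then slice l u else 0.
Proof. by apply: ellp_ext => x; rewrite sliceE pullKE /=; case: (s k). Qed.

Lemma lift_pullK T (s : pinj K K) : lift T * pullK s = pullK s * lift T.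
Proof.
apply: bop_ext => u; apply: ellp_ext => i.
rewrite !bopME liftE slice_pullK pullKE; case: (s i.2) => [l|]; first by rewrite liftE.
by rewrite linear0.
Qed.

Lemma opnorm_pullK s : opnorm (pullK s) <= 1. Proof. exact: opnorm_pull. Qed.

Lemma mcoef_pullK s i j : mcoef (pullK s) i j = ((i.1 == j.1) && (s i.2 == Some j.2))%:R.
Proof.
rewrite mcoef_pull /=; case: i j => [x k] [y l] /=; case: (s k) => [m|] /=; last by rewrite andbF.
by rewrite !(inj_eq Some_inj) xpair_eqE.
Qed.

(** ** Entries *)

Lemma ent_bounded k l S : (fun v : E => slice k (S (embed l v))) \in (@bounded_linear _ _ _ p1).
Proof.
apply/bounded_linearP; split.
  by move=> a u v; rewrite embed_linear linearP slice_linear.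
exists (opnorm S); first exact: opnorm_ge0.
move=> u; apply: le_trans (pull_norm _ _) _; apply: le_trans (le_opnorm _ _) _.
by rewrite ler_wpM2l ?opnorm_ge0 //; exact: pull_norm.
Qed.

Definition ent k l S : bop X p1 := Bop (ent_bounded k l S).

Lemma entE k l S v x : ent k l S v x = S (embed l v) (x, k). Proof. by []. Qed.

Lemma opnorm_ent k l S : opnorm (ent k l S) <= opnorm S.
Proof.
apply: opnorm_bound => [|u]; first exact: opnorm_ge0.
apply: le_trans (pull_norm _ _) _; apply: le_trans (le_opnorm _ _) _.
by rewrite ler_wpM2l ?opnorm_ge0 //; exact: pull_norm.
Qed.

Lemma entB k l S S' : ent k l (S - S') = ent k l S - ent k l S'.
Proof. by apply: bop_ext => v; apply: ellp_ext => x. Qed.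

Lemma embed_delta l y : embed l (ellp_delta p1 y) = ellp_delta p1 (y, l).
Proof.
apply: ellp_ext => -[x k]; rewrite embedE !ellp_deltaE xpair_eqE.
by case: (k == l); rewrite ?andbT ?andbF.
Qed.

Lemma mcoef_ent k l S x y : mcoef (ent k l S) x y = mcoef S (x, k) (y, l).
Proof. by rewrite /mcoef entE embed_delta. Qed.

Lemma ent_sum k l (A : Type) (s : seq A) (P : pred A) (f : A -> bop I p1) :
  ent k l (\sum_(a <- s | P a) f a) = \sum_(a <- s | P a) ent k l (f a).
Proof.
elim/big_rec2: _ => [|a x S _ <-]; first by apply: bop_ext => v; apply: ellp_ext => x.
by apply: bop_ext => v; apply: ellp_ext => y.
Qed.

End Amplification.

(** * The algebra of the factorization *)

Section LRing.
Context {B : pzRingType} (tz : int -> B).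

(** The same normal form with coefficients in the integral powers of a central unit. *)
Inductive lr_expr := LR0 | LR1 | LRt of int | LRvar of nat | LRadd of lr_expr & lr_expr
  | LRopp of lr_expr | LRmul of lr_expr & lr_expr.

Variable env : nat -> B.

Fixpoint lr_eval (e : lr_expr) : B := match e with
  | LR0 => 0 | LR1 => 1 | LRt m => tz m | LRvar n => env n
  | LRadd a b => lr_eval a + lr_eval b
  | LRopp a => - lr_eval a
  | LRmul a b => lr_eval a * lr_eval b end.

Definition lr_mon (m : int * seq nat) : B := tz m.1 * nc_mon env m.2.

Definition lr_poly (s : seq (int * (int * seq nat))) : B :=
  foldr (fun c x => lr_mon c.2 *~ c.1 + x) 0 s.

Fixpoint lr_norm (e : lr_expr) : seq (int * (int * seq nat)) := match e with
  | LR0 => [::] | LR1 => [:: (1, (0, [::]))] | LRt m => [:: (1, (m, [::]))]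
  | LRvar n => [:: (1, (0, [:: n]))]
  | LRadd a b => lr_norm a ++ lr_norm b
  | LRopp a => [seq (- c.1, c.2) | c <- lr_norm a]
  | LRmul a b => let q := lr_norm b in
      flatten [seq [seq (c.1 * d.1, (c.2.1 + d.2.1, c.2.2 ++ d.2.2)) | d <- q] | c <- lr_norm a] end.

Hypotheses (tz0 : tz 0 = 1) (tzD : forall m n, tz (m + n) = tz m * tz n)
  (tzc : forall m n, tz m * env n = env n * tz m).

Lemma lr_mon_cat m n : lr_mon (m.1 + n.1, m.2 ++ n.2) = lr_mon m * lr_mon n.
Proof.
rewrite /lr_mon /= nc_mon_cat tzD.
have c : tz n.1 * nc_mon env m.2 = nc_mon env m.2 * tz n.1.
  elim: m.2 => [|a s IH] /=; first by rewrite mul1r mulr1.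
  by rewrite mulrA tzc -mulrA IH mulrA.
by rewrite -!mulrA [tz n.1 * (_ * _)]mulrA c !mulrA.
Qed.

Lemma lr_poly_cat s t : lr_poly (s ++ t) = lr_poly s + lr_poly t.
Proof. by elim: s => [|a s IH] /=; rewrite ?add0r // IH addrA. Qed.

Lemma lr_normP e : lr_poly (lr_norm e) = lr_eval e.
Proof.
elim: e => //= [|m|n|a <- b <-|a <-|a <- b <-].
- by rewrite /lr_mon /= tz0 mulr1 addr0.
- by rewrite /lr_mon /= mulr1 addr0.
- by rewrite /lr_mon /= tz0 mul1r addr0 mulr1.
- by rewrite lr_poly_cat.
- by elim: (lr_norm a) => [|c s IH] /=; rewrite ?oppr0 // IH opprD mulrNz.
- elim: (lr_norm a) => [|c s IH] /=; first by rewrite mul0r.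
  rewrite lr_poly_cat IH mulrDl; congr (_ + _).
  elim: (lr_norm b) => [|d t IHt] /=; first by rewrite mulr0.
  rewrite IHt mulrDr lr_mon_cat; congr (_ + _).
  by rewrite mulrzAl mulrzAr [in RHS]mulrzAC mulrzA.
Qed.

Fixpoint lr_add (c : int) (m : int * seq nat) (s : seq (int * (int * seq nat))) :=
  match s with
  | [::] => [:: (c, m)]
  | d :: t => if d.2 == m then (c + d.1, m) :: t else d :: lr_add c m t end.

Lemma lr_addP c m s : lr_poly (lr_add c m s) = lr_mon m *~ c + lr_poly s.
Proof.
elim: s => //= d t IH; case: eqP => [<-|_] /=; first by rewrite mulrzDr addrA.
by rewrite IH addrCA.
Qed.

Definition lr_collect (s : seq (int * (int * seq nat))) :=
  foldr (fun c t => lr_add c.1 c.2 t) [::] s.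

Lemma lr_collectP s : lr_poly (lr_collect s) = lr_poly s.
Proof. by elim: s => //= c s IH; rewrite lr_addP IH. Qed.

Lemma lr_correct e1 e2 :
  all (fun c => c.1 == 0) (lr_collect (lr_norm (LRadd e1 (LRopp e2)))) ->
  lr_eval e1 = lr_eval e2.
Proof.
move=> h; apply/eqP; rewrite -subr_eq0; apply/eqP.
rewrite -[LHS]/(lr_eval (LRadd e1 (LRopp e2))) -lr_normP -lr_collectP.
by elim: (lr_collect _) h => //= c s IH /andP[/eqP -> /IH ->]; rewrite mulr0z addr0.
Qed.
End LRing.

(** tz m stands for the m-th power of a unit commuting with the coefficients. *)
Record laurent_unit (B : pzRingType) (tz : int -> B) : Prop := LaurentUnit {
  tz_0 : tz 0 = 1; tz_D : forall m n, tz (m + n) = tz m * tz n }.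

Definition tcomm (B : pzRingType) (tz : int -> B) (x : B) := forall m, tz m * x = x * tz m.

Lemma tcommM (B : pzRingType) (tz : int -> B) x y : tcomm tz x -> tcomm tz y -> tcomm tz (x * y).
Proof. by move=> hx hy m; rewrite mulrA hx -mulrA hy mulrA. Qed.
Lemma tcommB (B : pzRingType) (tz : int -> B) x y : tcomm tz x -> tcomm tz y -> tcomm tz (x - y).
Proof. by move=> hx hy m; rewrite mulrBr mulrBl hx hy. Qed.

Lemma lr_correct_list (B : pzRingType) (tz : int -> B) (l : seq B) e1 e2 :
  laurent_unit tz -> foldr (fun x P => tcomm tz x /\ P) True l ->
  all (fun c => c.1 == 0) (lr_collect (lr_norm (LRadd e1 (LRopp e2)))) ->
  lr_eval tz (nth 0 l) e1 = lr_eval tz (nth 0 l) e2.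
Proof.
move=> [h0 hD] hl; apply: lr_correct => // m n.
elim: l hl n => [|x l IH] /= => [_ n|[hx /IH hl] [|n]] //=; first by rewrite nth_nil mulr0 mul0r.
Qed.

Ltac lr_atoms tz t l := match t with
  | @GRing.add _ ?a ?b => let l := lr_atoms tz a l in lr_atoms tz b l
  | @GRing.opp _ ?a => lr_atoms tz a l
  | @GRing.mul _ ?a ?b => let l := lr_atoms tz a l in lr_atoms tz b l
  | @GRing.zero _ => l
  | @GRing.one _ => l
  | tz _ => l
  | ?x => let b := nc_mem x l in match b with true => l | false => constr:(cons x l) end
  end.
Ltac lr_reify tz t l := match t with
  | @GRing.add _ ?a ?b => let a := lr_reify tz a l in let b := lr_reify tz b l in constr:(LRadd a b)
  | @GRing.opp _ ?a => let a := lr_reify tz a l in constr:(LRopp a)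
  | @GRing.mul _ ?a ?b => let a := lr_reify tz a l in let b := lr_reify tz b l in constr:(LRmul a b)
  | @GRing.zero _ => constr:(LR0)
  | @GRing.one _ => constr:(LR1)
  | tz ?m => constr:(LRt m)
  | ?x => let n := nc_idx x l in constr:(LRvar n)
  end.
Ltac lring tz htz := match goal with |- @eq ?T ?a ?b =>
  let l := lr_atoms tz a (@nil T) in let l := lr_atoms tz b l in
  let ea := lr_reify tz a l in let eb := lr_reify tz b l in
  apply: (@lr_correct_list _ tz l ea eb htz);
  [rewrite /=; repeat split; assumption|vm_compute; reflexivity] end.

(** ** Two by two matrices *)
Section MatrixUnits.
Context {R : realType} {B : pzRingType} (nrm : B -> R) (hn : bnorm nrm).
Variable eu : bool -> bool -> B.
Hypotheses (euM : forall b c b' c', eu b c * eu b' c' = if c == b' then eu b c' else 0)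
  (eu1 : eu true true + eu false false = 1) (eu_nrm : forall b c, nrm (eu b c) <= 1).

Definition ucomm (x : B) := forall b c, x * eu b c = eu b c * x.

Definition m2 a b c d : B :=
  a * eu true true + b * eu true false + c * eu false true + d * eu false false.

Lemma m2M a b c d a' b' c' d' : ucomm a' -> ucomm b' -> ucomm c' -> ucomm d' ->
  m2 a b c d * m2 a' b' c' d' =
  m2 (a * a' + b * c') (a * b' + b * d') (c * a' + d * c') (c * b' + d * d').
Proof.
move=> ha hb hc hd.
have st (x y : B) s r s' r' : ucomm y -> x * eu s r * (y * eu s' r') = x * y * (eu s r * eu s' r').
  by move=> hy; rewrite -!mulrA [eu s r * (y * _)]mulrA -hy !mulrA.
by rewrite /m2 !mulrDl !mulrDr !st // !euM /= !mulr0; ncring.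
Qed.

Lemma m2_Pi : m2 1 0 0 0 = eu true true. Proof. by rewrite /m2; ncring. Qed.
Lemma m2_1 : m2 1 0 0 1 = 1. Proof. by rewrite /m2 -[RHS]eu1; ncring. Qed.

Lemma ucomm0 : ucomm 0. Proof. by move=> b c; rewrite mul0r mulr0. Qed.
Lemma ucomm1 : ucomm 1. Proof. by move=> b c; rewrite mul1r mulr1. Qed.
Lemma ucommB x y : ucomm x -> ucomm y -> ucomm (x - y).
Proof. by move=> hx hy b c; rewrite mulrBl mulrBr hx hy. Qed.
Lemma ucommD x y : ucomm x -> ucomm y -> ucomm (x + y).
Proof. by move=> hx hy b c; rewrite mulrDl mulrDr hx hy. Qed.
Lemma ucommN x : ucomm x -> ucomm (- x).
Proof. by move=> hx b c; rewrite mulNr mulrN hx. Qed.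
Lemma ucommM x y : ucomm x -> ucomm y -> ucomm (x * y).
Proof. by move=> hx hy b c; rewrite -mulrA hy mulrA hx mulrA. Qed.

Lemma app_m2 e a b c d a' b' c' d' (K1 K2 K3 K4 : R) : 0 <= e ->
  app nrm e a a' K1 -> app nrm e b b' K2 -> app nrm e c c' K3 -> app nrm e d d' K4 ->
  app nrm e (m2 a b c d) (m2 a' b' c' d')
    (2 * (K1 * 1) + 2 * (K2 * 1) + 2 * (K3 * 1) + 2 * (K4 * 1)).
Proof.
move=> e0 h1 h2 h3 h4.
have u b1 b2 : app nrm e (eu b1 b2) (eu b1 b2) 1 by apply: app_refl.
rewrite /m2; have mu x x' K b1 b2 : app nrm e x x' K ->
    app nrm e (x * eu b1 b2) (x' * eu b1 b2) (2 * (K * 1)) by move=> h; apply: app_mul.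
by apply: (app_add hn _ (mu _ _ _ _ _ h4)); apply: (app_add hn _ (mu _ _ _ _ _ h3));
  apply: (app_add hn); exact: mu.
Qed.
End MatrixUnits.

(** ** The two factors *)
Section EStage.
Context {R : realType}.

(** The data: E is the idempotent, a its approximation of finite propagation and
    h the characteristic function of one half of the space. *)
Record edata (B : pzRingType) (nrm : B -> R) (eu : bool -> bool -> B) (tz : int -> B)
    (E a h : B) (C e : R) : Prop := EData {
  ed_n : bnorm nrm;
  ed_uM : forall b c b' c', eu b c * eu b' c' = if c == b' then eu b c' else 0;
  ed_u1 : eu true true + eu false false = 1;
  ed_un : forall b c, nrm (eu b c) <= 1;
  ed_t : laurent_unit tz;
  ed_tn : forall m, nrm (tz m) <= 1;
  ed_tu : forall m, ucomm eu (tz m);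
  ed_tE : tcomm tz E; ed_ta : tcomm tz a; ed_th : tcomm tz h;
  ed_uE : ucomm eu E; ed_ua : ucomm eu a; ed_uh : ucomm eu h;
  ed_E : E * E = E; ed_h : h * h = h; ed_hn : nrm h <= 1;
  ed_e0 : 0 <= e; ed_app : app nrm e a E C }.

Section Formulas.
Context {B : pzRingType} (eu : bool -> bool -> B) (tz : int -> B) (E a h : B).
Local Notation t := (tz 1).
Local Notation t' := (tz (-1)).
(** If a and h are commuting idempotents, then k vanishes, al and be are mutually inverse and
    v0 is diagonal with entries al and be. In general al be = 1 - nu k, and the matrix v0 is
    invertible by the standard dilation of a pair of almost inverse elements. The matrices
    qJ, w and w' are approximations, for a close to the idempotent E, of q = v0 Pi v0',
    du v0' and v0 du'. Every term of qJ - Pi has a factor kJ, every term of w - 1 and w' - 1 a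
    factor kJ or g, and both of these pass through 1 - h: that is what localizes them. *)
Definition es_f := h * a * h.
Definition es_k := es_f - es_f * es_f.
Definition es_kJ := h * a * (1 - h) * a * h.
Definition es_g := (1 - h) * a + h * a * (1 - h).
Definition es_nu := 1 + 1 - t - t'.
Definition es_al := 1 - es_f + t * es_f.
Definition es_be := 1 - es_f + t' * es_f.
Definition es_u := 1 - E + t * E.
Definition es_u' := 1 - E + t' * E.
Definition es_ua := 1 - a + t * a.
Definition es_ba := 1 - a + t' * a.
Definition es_v0 := m2 eu ((1 + es_nu * es_k) * es_al) (- (es_nu * es_k)) (es_nu * es_k) es_be.
Definition es_v0' := m2 eu es_be (es_nu * es_k) (- (es_nu * es_k)) ((1 + es_nu * es_k) * es_al).
Definition es_q := es_v0 * eu true true * es_v0'.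
Definition es_qJ := m2 eu (1 - es_nu * es_kJ * (es_nu * es_kJ))
  ((1 + es_nu * es_kJ) * es_al * (es_nu * es_kJ)) (es_nu * es_kJ * es_be)
  (es_nu * es_kJ * (es_nu * es_kJ)).
Definition es_du := m2 eu es_u 0 0 es_u'.
Definition es_du' := m2 eu es_u' 0 0 es_u.
Definition es_w := m2 eu (1 - es_nu * es_kJ + (t - 1) * (es_g * es_be)) (es_ua * (es_nu * es_kJ))
  (- (es_ba * (es_nu * es_kJ)))
  (1 - es_nu * es_kJ + (t' - 1) * (es_g * es_al) + es_ba * (es_nu * es_kJ) * es_al).
Definition es_w' := m2 eu
  (1 - es_nu * es_kJ + (t' - 1) * (es_al * es_g) + es_nu * es_kJ * es_al * es_ba)
  (- (es_nu * es_kJ * es_ua)) (es_nu * es_kJ * es_ba)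
  (1 - es_nu * es_kJ + (t - 1) * (es_be * es_g)).
End Formulas.

Section Identities.
Context {B : pzRingType} {nrm : B -> R} {eu : bool -> bool -> B} {tz : int -> B}
  {E a h : B} {C e : R} (hd : edata nrm eu tz E a h C e).
Local Notation t := (tz 1).
Local Notation t' := (tz (-1)).
Local Notation f := (es_f a h).
Local Notation k := (es_k a h).
Local Notation kJ := (es_kJ a h).
Local Notation g := (es_g a h).
Local Notation nu := (es_nu tz).
Local Notation al := (es_al tz a h).
Local Notation be := (es_be tz a h).
Local Notation u := (es_u tz E).
Local Notation u' := (es_u' tz E).
Local Notation ua := (es_ua tz a).
Local Notation ba := (es_ba tz a).

Let ht := ed_t hd. Let tE := ed_tE hd. Let ta := ed_ta hd. Let th := ed_th hd.
Let tf : tcomm tz f.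
Proof. exact: tcommM (tcommM th ta) th. Qed.
Let ub : ucomm eu 0 := @ucomm0 _ eu. Let ub1 : ucomm eu 1 := @ucomm1 _ eu.
Let tu m := ed_tu hd m.

(** The part of k inside of the first half is small because a is close to an idempotent;
    the remainder kJ passes through the other half. *)
Lemma es_k_eq : k = h * (a - a * a) * h + kJ.
Proof.
rewrite /es_k /es_f /es_kJ.
have -> : h * a * h * (h * a * h) = h * a * (h * h) * a * h by ncring.
by rewrite (ed_h hd); ncring.
Qed.

Lemma es_albe : al * be = 1 - nu * k.
Proof. by rewrite /es_al /es_be /es_nu /es_k; have := tf; generalize (es_f a h) => F tF; lring tz ht. Qed.
Lemma es_beal : be * al = 1 - nu * k.
Proof. by rewrite /es_al /es_be /es_nu /es_k; have := tf; generalize (es_f a h) => F tF; lring tz ht. Qed.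

Ltac uc := rewrite /es_u /es_u' /es_ua /es_ba /es_al /es_be /es_nu /es_k /es_kJ /es_g /es_f;
  repeat first [exact: (ed_uE hd)|exact: (ed_ua hd)|exact: (ed_uh hd)|exact: tu
    |exact: ub|exact: ub1|apply: ucommB|apply: ucommD|apply: ucommN|apply: ucommM].

Lemma es_v0K : es_v0 eu tz a h * es_v0' eu tz a h = 1.
Proof.
rewrite /es_v0 /es_v0' (m2M (ed_uM hd)); try uc.
rewrite -[RHS](m2_1 (ed_u1 hd)); rewrite /es_al /es_be /es_nu /es_k.
by have := tf; generalize (es_f a h) => F tF; congr (m2 eu); lring tz ht.
Qed.

Lemma es_v0'K : es_v0' eu tz a h * es_v0 eu tz a h = 1.
Proof.
rewrite /es_v0 /es_v0' (m2M (ed_uM hd)); try uc.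
rewrite -[RHS](m2_1 (ed_u1 hd)); rewrite /es_al /es_be /es_nu /es_k.
by have := tf; generalize (es_f a h) => F tF; congr (m2 eu); lring tz ht.
Qed.

Lemma es_q_idem : es_q eu tz a h * es_q eu tz a h = es_q eu tz a h.
Proof.
rewrite /es_q -!mulrA [es_v0' _ _ _ _ * (es_v0 _ _ _ _ * _)]mulrA es_v0'K mul1r.
by rewrite [eu true true * (eu true true * _)]mulrA (ed_uM hd).
Qed.

Lemma es_q_eq : es_q eu tz a h = m2 eu (1 - nu * k * (nu * k)) ((1 + nu * k) * al * (nu * k))
  (nu * k * be) (nu * k * (nu * k)).
Proof.
rewrite /es_q -(m2_Pi eu) /es_v0 /es_v0' (m2M (ed_uM hd)); try uc.
rewrite (m2M (ed_uM hd)); try uc.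
rewrite /es_al /es_be /es_nu /es_k.
by have := tf; generalize (es_f a h) => F tF; congr (m2 eu); lring tz ht.
Qed.

Lemma es_uu : u * u' = 1.
Proof.
have -> : u * u' = 1 - nu * (E - E * E) by rewrite /es_u /es_u' /es_nu; lring tz ht.
by rewrite (ed_E hd) subrr mulr0 subr0.
Qed.
Lemma es_u'u : u' * u = 1.
Proof.
have -> : u' * u = 1 - nu * (E - E * E) by rewrite /es_u /es_u' /es_nu; lring tz ht.
by rewrite (ed_E hd) subrr mulr0 subr0.
Qed.

Lemma es_duK : es_du eu tz E * es_du' eu tz E = 1.
Proof.
rewrite /es_du /es_du' (m2M (ed_uM hd)); try uc.
by rewrite es_uu es_u'u !(mul0r, mulr0, addr0, add0r) m2_1 // (ed_u1 hd).
Qed.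
Lemma es_du'K : es_du' eu tz E * es_du eu tz E = 1.
Proof.
rewrite /es_du /es_du' (m2M (ed_uM hd)); try uc.
by rewrite es_uu es_u'u !(mul0r, mulr0, addr0, add0r) m2_1 // (ed_u1 hd).
Qed.

Lemma es_du_Pi : es_du eu tz E * eu true true = eu true true * es_du eu tz E.
Proof.
rewrite -(m2_Pi eu) /es_du !(m2M (ed_uM hd)); try uc.
by congr (m2 eu); ncring.
Qed.
Lemma es_du'_Pi : es_du' eu tz E * eu true true = eu true true * es_du' eu tz E.
Proof.
rewrite -(m2_Pi eu) /es_du' !(m2M (ed_uM hd)); try uc.
by congr (m2 eu); ncring.
Qed.

Lemma es_v1_eq : es_du eu tz E * es_v0' eu tz a h =
  m2 eu (u * be) (u * (nu * k)) (- (u' * (nu * k))) (u' * ((1 + nu * k) * al)).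
Proof.
rewrite /es_du /es_v0' (m2M (ed_uM hd)); try uc.
by congr (m2 eu); ncring.
Qed.
Lemma es_v1'_eq : es_v0 eu tz a h * es_du' eu tz E =
  m2 eu ((1 + nu * k) * al * u') (- (nu * k * u)) (nu * k * u') (be * u).
Proof.
rewrite /es_du' /es_v0 (m2M (ed_uM hd)); try uc.
by congr (m2 eu); ncring.
Qed.

Let tg : tcomm tz g.
Proof. rewrite (_ : g = a - f); [exact: tcommB|rewrite /es_g /es_f; ncring]. Qed.

Lemma es_uabe : ua * be = 1 - nu * k + (t - 1) * (g * be).
Proof.
rewrite -es_albe; have -> : ua = al + (t - 1) * g.
  by rewrite /es_ua /es_al /es_g /es_f; ncring.
by ncring.
Qed.
Lemma es_baal : ba * al = 1 - nu * k + (t' - 1) * (g * al).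
Proof.
rewrite -es_beal; have -> : ba = be + (t' - 1) * g.
  by rewrite /es_ba /es_be /es_g /es_f; ncring.
by ncring.
Qed.
Lemma es_alba : al * ba = 1 - nu * k + (t' - 1) * (al * g).
Proof.
rewrite -es_albe; have -> : ba = be + (t' - 1) * g.
  by rewrite /es_ba /es_be /es_g /es_f; ncring.
rewrite mulrDr; congr (_ + _); rewrite /es_al.
by have := tg; have := tf; generalize (es_f a h) (es_g a h) => F G tF tG; lring tz ht.
Qed.
Lemma es_beua : be * ua = 1 - nu * k + (t - 1) * (be * g).
Proof.
rewrite -es_beal; have -> : ua = al + (t - 1) * g.
  by rewrite /es_ua /es_al /es_g /es_f; ncring.
rewrite mulrDr; congr (_ + _); rewrite /es_be.
by have := tg; have := tf; generalize (es_f a h) (es_g a h) => F G tF tG; lring tz ht.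
Qed.

Let hn := ed_n hd. Let e0 := ed_e0 hd.

Lemma es_app1 : app nrm e 1 1 1. Proof. by apply: (app_refl hn e0); exact: (nrm1 hn). Qed.
Lemma es_apph : app nrm e h h 1. Proof. by apply: (app_refl hn e0); exact: (ed_hn hd). Qed.
Lemma es_appt m : app nrm e (tz m) (tz m) 1.
Proof. by apply: (app_refl hn e0); exact: (ed_tn hd). Qed.
Lemma es_appa : app nrm e a a C.
Proof. by apply: (app_refl hn e0); case: (ed_app hd). Qed.
Lemma es_appE : app nrm e E a C. Proof. exact: (app_sym hn (ed_app hd)). Qed.

Lemma es_app_f : app nrm e f f (2 * (2 * (1 * C) * 1)).
Proof.
rewrite /es_f; apply: (app_mul hn); last exact: es_apph.
by apply: (app_mul hn); [exact: es_apph|exact: es_appa].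
Qed.

Lemma es_app_1h : app nrm e (1 - h) (1 - h) (1 + 1).
Proof. by apply: (app_add hn); [exact: es_app1|apply: (app_opp hn); exact: es_apph]. Qed.

Lemma es_app_g : app nrm e g g (2 * ((1 + 1) * C) + 2 * (2 * (1 * C) * (1 + 1))).
Proof.
rewrite /es_g; apply: (app_add hn); apply: (app_mul hn); try exact: es_app_1h.
  exact: es_appa.
by apply: (app_mul hn); [exact: es_apph|exact: es_appa].
Qed.

Lemma es_app_k : app nrm e k kJ
  (2 * (2 * (1 * (C + 2 * (C * C))) * 1) + 2 * (2 * (2 * (2 * (1 * C) * (1 + 1)) * C) * 1)).
Proof.
rewrite es_k_eq -[X in app nrm e _ X _]add0r; apply: (app_add hn); last first.
  rewrite /es_kJ; apply: (app_mul hn); last exact: es_apph.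
  apply: (app_mul hn); last exact: es_appa.
  apply: (app_mul hn); last exact: es_app_1h.
  by apply: (app_mul hn); [exact: es_apph|exact: es_appa].
have -> : 0 = h * (E - E * E) * h by rewrite (ed_E hd) subrr mulr0 mul0r.
apply: (app_mul hn); last exact: es_apph.
apply: (app_mul hn); first exact: es_apph.
apply: (app_add hn); first exact: (ed_app hd).
by apply: (app_opp hn); apply: (app_mul hn); exact: (ed_app hd).
Qed.
Lemma es_app_diagl : app nrm e k k
  (2 * (2 * (1 * (C + 2 * (C * C))) * 1) + 2 * (2 * (2 * (2 * (1 * C) * (1 + 1)) * C) * 1)).
Proof. by apply: (app_refl hn e0); case: es_app_k. Qed.
Lemma es_app_diagr : app nrm e kJ kJ
  (2 * (2 * (1 * (C + 2 * (C * C))) * 1) + 2 * (2 * (2 * (2 * (1 * C) * (1 + 1)) * C) * 1)).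
Proof. by apply: (app_refl hn e0); case: es_app_k. Qed.
End Identities.

Ltac appt hn e0 := repeat first [eassumption | apply: (app_add hn)
  | apply: (app_opp hn) | apply: (app_mul hn)].

Lemma app_nrm (B : pzRingType) (nrm : B -> R) e x y (K : R) : app nrm e x y K -> nrm x <= K.
Proof. by case. Qed.

(** The constants depend on C only, so that the accuracy e can be chosen afterwards. *)
Lemma es_bounds (C : R) : exists K1 K2 K3 K4 K5 : R,
  forall (B : pzRingType) (nrm : B -> R) (eu : bool -> bool -> B) (tz : int -> B)
    (E a h : B) (e : R), edata nrm eu tz E a h C e ->
  [/\ app nrm e (es_q eu tz a h) (es_qJ eu tz a h) K1,
      app nrm e (es_du eu tz E * es_v0' eu tz a h) (es_w eu tz a h) K2,
      app nrm e (es_v0 eu tz a h * es_du' eu tz E) (es_w' eu tz a h) K3,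
      nrm (es_v0 eu tz a h) <= K4 & nrm (es_v0' eu tz a h) <= K5].
Proof.
do 5 eexists; move=> B nrm eu tz E a h e hd.
have hn := ed_n hd; have e0 := ed_e0 hd; have un := ed_un hd.
have H1 := es_app1 hd; have Ht := es_appt hd 1; have Ht' := es_appt hd (-1).
have HE := es_appE hd; have Ha := es_appa hd.
have hf := es_app_f hd; have hg := es_app_g hd; have hk := es_app_k hd.
have hJ := es_app_diagr hd; have hkk := es_app_diagl hd.
split.
- rewrite (es_q_eq hd) /es_qJ /es_al /es_be /es_nu.
  move: hf hk; generalize (es_f a h) (es_k a h) (es_kJ a h) => F Kk KJ hf hk.
  by apply: (app_m2 hn un e0); appt hn e0.
- rewrite (es_v1_eq hd) /es_w; apply: (app_m2 hn un e0).
  + apply: (app_trans hn (y := es_ua tz a * es_be tz a h)); last rewrite (es_uabe hd).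
      rewrite /es_u /es_ua /es_be.
      by move: hf; generalize (es_f a h) => F hf; appt hn e0.
    rewrite /es_be /es_nu.
    move: hf hk hg; generalize (es_f a h) (es_k a h) (es_kJ a h) (es_g a h) => F Kk KJ G hf hk hg.
    by appt hn e0.
  + rewrite /es_u /es_ua /es_nu; move: hk; generalize (es_k a h) (es_kJ a h) => Kk KJ hk.
    by appt hn e0.
  + rewrite /es_u' /es_ba /es_nu; move: hk; generalize (es_k a h) (es_kJ a h) => Kk KJ hk.
    by appt hn e0.
  + apply: (app_trans hn (y := es_ba tz a * ((1 + es_nu tz * es_kJ a h) * es_al tz a h))).
      rewrite /es_u' /es_ba /es_nu /es_al.
      by move: hf hk; generalize (es_f a h) (es_k a h) (es_kJ a h) => F Kk KJ hf hk; appt hn e0.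
    have -> : es_ba tz a * ((1 + es_nu tz * es_kJ a h) * es_al tz a h) =
        es_ba tz a * es_al tz a h + es_ba tz a * (es_nu tz * es_kJ a h) * es_al tz a h by ncring.
    rewrite (es_baal hd) /es_ba /es_nu /es_al.
    move: hf hk hg hJ; generalize (es_f a h) (es_k a h) (es_kJ a h) (es_g a h) => F Kk KJ G hf hk hg hJ.
    by appt hn e0.
- rewrite (es_v1'_eq hd) /es_w'; apply: (app_m2 hn un e0).
  + apply: (app_trans hn (y := (1 + es_nu tz * es_kJ a h) * es_al tz a h * es_ba tz a)).
      rewrite /es_u' /es_ba /es_nu /es_al.
      by move: hf hk; generalize (es_f a h) (es_k a h) (es_kJ a h) => F Kk KJ hf hk; appt hn e0.
    have -> : (1 + es_nu tz * es_kJ a h) * es_al tz a h * es_ba tz a =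
        es_al tz a h * es_ba tz a + es_nu tz * es_kJ a h * es_al tz a h * es_ba tz a by ncring.
    rewrite (es_alba hd) /es_ba /es_nu /es_al.
    move: hf hk hg hJ; generalize (es_f a h) (es_k a h) (es_kJ a h) (es_g a h) => F Kk KJ G hf hk hg hJ.
    by appt hn e0.
  + rewrite /es_u /es_ua /es_nu; move: hk; generalize (es_k a h) (es_kJ a h) => Kk KJ hk.
    by appt hn e0.
  + rewrite /es_u' /es_ba /es_nu; move: hk; generalize (es_k a h) (es_kJ a h) => Kk KJ hk.
    by appt hn e0.
  + apply: (app_trans hn (y := es_be tz a h * es_ua tz a)); last rewrite (es_beua hd).
      rewrite /es_u /es_ua /es_be.
      by move: hf; generalize (es_f a h) => F hf; appt hn e0.
    rewrite /es_be /es_nu.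
    move: hf hk hg; generalize (es_f a h) (es_k a h) (es_kJ a h) (es_g a h) => F Kk KJ G hf hk hg.
    by appt hn e0.
- apply: (app_nrm (e := e) (y := es_v0 eu tz a h)).
  rewrite /es_v0 /es_al /es_be /es_nu.
  move: hf hkk; generalize (es_f a h) (es_k a h) => F Kk hf hkk.
  by apply: (app_m2 hn un e0); appt hn e0.
- apply: (app_nrm (e := e) (y := es_v0' eu tz a h)).
  rewrite /es_v0' /es_al /es_be /es_nu.
  move: hf hkk; generalize (es_f a h) (es_k a h) => F Kk hf hkk.
  by apply: (app_m2 hn un e0); appt hn e0.
Qed.
End EStage.

(** * Assembling the factorization *)

Section Assembly.
Context {R : realType}.

Record asm_data (B : pzRingType) (nrm : B -> R) (D0 D1 : B -> Prop)
  (Pi v0 v0' du du' w w' q' qJ Y Y' : B) (M e : R) : Prop := AsmData {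
  as_n : bnorm nrm; as_D0 : csub nrm D0; as_D1 : csub nrm D1;
  as_Pi : [/\ D0 Pi, D1 Pi, Pi * Pi = Pi & nrm Pi <= 1];
  as_v0 : [/\ D0 v0, D0 v0', v0 * v0' = 1 & v0' * v0 = 1];
  as_v0n : nrm v0 <= M /\ nrm v0' <= M;
  as_du : [/\ du * du' = 1, du' * du = 1, du * Pi = Pi * du & du' * Pi = Pi * du'];
  as_w : [/\ D1 w, D1 w', app nrm e (du * v0') w M & app nrm e (v0 * du') w' M];
  as_Y : [/\ D0 Y, D0 Y', D1 Y & D1 Y'];
  as_YK : [/\ Y * Y' = 1, Y' * Y = 1 & q' = Y * Pi * Y'];
  as_q : app nrm e (v0 * Pi * v0') qJ M;
  as_qJ : nrm (q' - qJ) <= e; as_e0 : 0 <= e }.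

(** If v0 conjugates Pi to q and v1 = du v0' conjugates q to Pi, and q is close to an
    idempotent q' conjugate to Pi within D0 and D1, then du is up to a small error a
    product of elements of D1 and D0 that commute with Pi. *)
Lemma assembly (M : R) : 1 <= M -> exists2 K : R, 1 <= K &
  forall (B : pzRingType) (nrm : B -> R) (D0 D1 : B -> Prop)
    (Pi v0 v0' du du' w w' q' qJ Y Y' : B) (e : R),
    asm_data nrm D0 D1 Pi v0 v0' du du' w w' q' qJ Y Y' M e -> K * e <= 1 ->
  exists u0 u0' u1 u1' : B,
  [/\ [/\ D0 u0, D0 u0', u0 * u0' = 1 & u0' * u0 = 1],
      [/\ D1 u1, D1 u1', u1 * u1' = 1 & u1' * u1 = 1] &
      nrm (u1 * u0 - (du * Pi + (1 - Pi))) <= K * e].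
Proof.
move=> M1; have M0 : 0 <= M by move: M1; lra.
pose A1 := 2 * (M * M); pose A2 := 7 * (M * (M * M)).
pose A3 := 2 * (2 * (A2 * 1) * M); pose A4 := A3 + 2 * M; pose T := 4 * (A4 * A4) + 4 * (A4 * M) + 2.
pose L := 2 * (2 * (2 * (2 * (M * T) * T) * M) * 1).
pose K := L + 8 * (A4 * A4) + 8 * (A4 * M) + 2 * A1 + 1.
have A10 : 0 <= A1 by rewrite /A1 !mulr_ge0.
have A20 : 0 <= A2 by rewrite /A2 !mulr_ge0.
have A30 : 0 <= A3 by rewrite /A3 !mulr_ge0.
have A40 : 0 <= A4 by rewrite /A4 addr_ge0 ?mulr_ge0.
have AA0 : 0 <= A4 * A4 by rewrite mulr_ge0.
have AM0 : 0 <= A4 * M by rewrite mulr_ge0.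
have T0 : 0 <= T by rewrite /T; move: AA0 AM0; lra.
have L0 : 0 <= L by rewrite /L !mulr_ge0.
exists K; first by rewrite /K; move: L0 AA0 AM0 A10; lra.
move=> B nrm D0 D1 Pi v0 v0' du du' w w' q' qJ Y Y' e hd Ke.
have hn := as_n hd; have hD0 := as_D0 hd; have hD1 := as_D1 hd.
have [D0P D1P PP Pn] := as_Pi hd; have [D0v D0v' vv' v'v] := as_v0 hd.
have [vn v'n] := as_v0n hd; have [dd' d'd dP d'P] := as_du hd.
have [D1w D1w' aw aw'] := as_w hd; have [D0Y D0Y' D1Y D1Y'] := as_Y hd.
have [YY' Y'Y q'E] := as_YK hd; have aq := as_q hd; have q'J := as_qJ hd; have e0 := as_e0 hd.
have n0 := nrm_ge0 hn.
pose v1 := du * v0'; pose v1' := v0 * du'.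
have v1K : v1 * v1' = 1 by rewrite /v1 /v1' -mulrA [v0' * _]mulrA v'v mul1r.
have v1'K : v1' * v1 = 1 by rewrite /v1 /v1' -mulrA [du' * _]mulrA d'd mul1r.
pose q := v0 * Pi * v0'.
have qE : v1' * Pi * v1 = q.
  by rewrite /v1' /v1 /q -!mulrA [du' * (Pi * _)]mulrA d'P -!mulrA [du' * (du * _)]mulrA d'd mul1r.
(* the small quantities *)
have h1 : 0 <= A1 * e by rewrite mulr_ge0.
have h2 : 0 <= A4 * A4 * e by rewrite mulr_ge0.
have h3 : 0 <= A4 * M * e by rewrite mulr_ge0.
have h4 : 0 <= L * e by rewrite mulr_ge0.
have hKe : K * e = L * e + 8 * (A4 * A4 * e) + 8 * (A4 * M * e) + 2 * (A1 * e) + e.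
  by rewrite /K; generalize L A4 A1 => l a4 a1; ring.
have [s1 s2 s3 s4] : [/\ A1 * e <= 2^-1, 8 * (A4 * A4 * e) <= 1, 8 * (A4 * M * e) <= 1 & e <= 1].
  move: Ke h1 h2 h3 h4 e0; rewrite hKe; generalize (L * e) (A4 * A4 * e) (A4 * M * e) (A1 * e).
  by move=> *; split; lra.
(* w is invertible in D1 *)
have ww : nrm (1 - w * w') <= A1 * e.
  by rewrite -v1K; case: (app_mul hn aw aw').
have ww2 : nrm (1 - w' * w) <= A1 * e.
  by rewrite -v1'K; case: (app_mul hn aw' aw).
have [|y [Dy wy _ yn yn1]] := neumann hn hD1 (csM hD1 D1w D1w'); first exact: le_trans ww s1.
have [|y2 [Dy2 _ y2w _ _]] := neumann hn hD1 (csM hD1 D1w' D1w); first exact: le_trans ww2 s1.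
pose wi := w' * y; have wwi : w * wi = 1 by rewrite /wi mulrA.
have wiw : wi * w = 1.
  have -> : wi = y2 * w' by rewrite -[RHS]mulr1 -wwi mulrA -[y2 * w' * w]mulrA y2w mul1r.
  by rewrite -mulrA.
have D1wi : D1 wi by apply: (csM hD1).
have [_ wn awn] := aw; have [v1'n w'n aw'n] := aw'.
have awi : app nrm e v1' wi A2.
  have M3 : M <= M * (M * M) by apply: ler_peMr => //; apply: mulr_ege1.
  split.
  - by apply: le_trans v1'n _; rewrite /A2; move: M3 M0; lra.
  - apply: le_trans (nrmM hn _ _) _; apply: (@le_trans _ _ (M * 3)); first exact: ler_pM.
    by rewrite /A2; move: M3 M0; lra.
  - have -> : v1' - wi = (v1' - w') + w' * (1 - y) by rewrite /wi; ncring.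
    apply: le_trans (nrmD hn _ _) _.
    have h : nrm (w' * (1 - y)) <= M * (3 * (A1 * e)).
      apply: le_trans (nrmM hn _ _) _; apply: ler_pM => //.
      by apply: le_trans yn1 _; apply: ler_wpM2l.
    have h22 : nrm (v1' - w') <= M * (M * M) * e.
      by apply: le_trans aw'n _; apply: ler_wpM2r.
    by apply: le_trans (lerD h22 h) _; rewrite /A2 /A1 le_eqVlt; apply/orP; left; apply/eqP; ring.
clearbody wi.
pose q1 := wi * Pi * w.
have aP : app nrm e Pi Pi 1 by apply: (app_refl hn).
have aq1 : app nrm e q q1 A3 by rewrite -qE; apply: (app_mul hn (app_mul hn awi aP) aw).
have [qn q1n qq1] := aq1.
have qJq : nrm (q - q') <= 2 * M * e.
  apply: le_trans (nrm_dist hn _ qJ _) _; case: aq => _ _ h.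
  rewrite [X in _ + X]nrmBC //; apply: le_trans (lerD h q'J) _.
  by have := ler_wpM2r e0 M1; lra.
have q'n : nrm q' <= A4.
  apply: le_trans (nrm_tri hn q' q) _; rewrite /A4; apply: lerD => //.
  rewrite nrmBC //; apply: le_trans qJq _.
  by rewrite -[X in _ <= X]mulr1; apply: ler_wpM2l => //; rewrite mulr_ge0.
have A34 : A3 <= A4 by rewrite /A4; move: M0; lra.
have qid : q * q = q by rewrite /q -!mulrA [v0' * (v0 * _)]mulrA v'v mul1r [Pi * (Pi * _)]mulrA PP.
have q1id : q1 * q1 = q1 by rewrite /q1 -!mulrA [w * (wi * _)]mulrA wwi mul1r [Pi * (Pi * _)]mulrA PP.
have q'id : q' * q' = q' by rewrite q'E -!mulrA [Y' * (Y * _)]mulrA Y'Y mul1r [Pi * (Pi * _)]mulrA PP.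
have D0q : D0 q by do 2 apply: (csM hD0) => //.
have D1q : D1 q1 by do 2 apply: (csM hD1) => //.
have D0q' : D0 q' by rewrite q'E; do 2 apply: (csM hD0) => //.
have D1q' : D1 q' by rewrite q'E; do 2 apply: (csM hD1) => //.
have d2 : nrm (q' - q1) <= 2 * A4 * e.
  apply: le_trans (nrm_dist hn _ q _) _; rewrite [X in X + _]nrmBC //.
  by apply: le_trans (lerD qJq qq1) _; rewrite /A4; have := mulr_ge0 A30 e0; have := mulr_ge0 M0 e0; lra.
have [|z [z' [[Dz Dz' zz' z'z] [zq zn _]]]] := close_idem hn hD0 D0q D0q' qid q'id (le_trans qn A34) q'n.
  have h : A4 * nrm (q - q') <= A4 * (2 * M * e) by apply: ler_wpM2l.
  by apply: le_trans (ler_wpM2l _ h) _ => //; move: s3; generalize A4; intros; lra.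
have [|z1 [z1' [[Dz1 Dz1' zz1' z'z1] [zq1 zn1 _]]]] :=
    close_idem hn hD1 D1q' D1q q'id q1id q'n (le_trans q1n A34).
  have h : A4 * nrm (q' - q1) <= A4 * (2 * A4 * e) by apply: ler_wpM2l.
  by apply: le_trans (ler_wpM2l _ h) _ => //; move: s2; lra.
have hz : nrm (z - 1) <= 4 * (A4 * M * e).
  have h : A4 * nrm (q - q') <= A4 * (2 * M * e) by apply: ler_wpM2l.
  by apply: le_trans zn _; move: h; generalize A4; intros; lra.
have hz1 : nrm (z1 - 1) <= 4 * (A4 * A4 * e).
  have h : A4 * nrm (q' - q1) <= A4 * (2 * A4 * e) by apply: ler_wpM2l.
  by apply: le_trans zn1 _; move: h; generalize A4; intros; lra.
have T2 : 2 <= T by rewrite /T; move: AA0 AM0; lra.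
have TE : T * e = 4 * (A4 * A4 * e) + 4 * (A4 * M * e) + 2 * e.
  by rewrite /T; generalize A4 => a4; ring.
have cl x : nrm (x - 1) <= T * e -> nrm (x - 1) <= 1 -> app nrm e x 1 T.
  move=> xe x1; have i1 := nrm1 hn; split=> //; last by move: i1 T2; lra.
  by apply: le_trans (nrm_tri hn x 1) _; move: i1 x1 T2; lra.
have az : app nrm e z 1 T.
  by apply: cl; [rewrite TE|]; apply: le_trans hz _; move: s3 h2 e0; generalize (A4 * A4 * e) (A4 * M * e); intros; lra.
have az1 : app nrm e z1 1 T.
  by apply: cl; [rewrite TE|]; apply: le_trans hz1 _; move: s2 h3 e0; generalize (A4 * A4 * e) (A4 * M * e); intros; lra.
have av0 : app nrm e v0 v0 M by apply: (app_refl hn).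
pose c0 := Y' * z * v0; pose c0' := v0' * z' * Y.
pose c1 := w * z1 * Y; pose c1' := Y' * z1' * wi.
have c0P : c0 * Pi = Pi * c0.
  have -> : c0 * Pi = Y' * (z * q) * v0 by rewrite /c0 /q -!mulrA v'v mulr1.
  by rewrite zq q'E /c0 -!mulrA [Y' * (Y * _)]mulrA Y'Y mul1r.
have c1P : c1 * Pi = Pi * c1.
  have -> : c1 * Pi = w * (z1 * q') * Y by rewrite /c1 q'E -!mulrA Y'Y mulr1.
  by rewrite zq1 /q1 /c1 -!mulrA [w * (wi * _)]mulrA wwi mul1r.
have c0K : c0 * c0' = 1.
  rewrite /c0 /c0' -!mulrA [v0 * (v0' * _)]mulrA vv' mul1r [z * (z' * _)]mulrA zz' mul1r.
  exact: Y'Y.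
have c0'K : c0' * c0 = 1.
  rewrite /c0 /c0' -!mulrA [Y * (Y' * _)]mulrA YY' mul1r [z' * (z * _)]mulrA z'z mul1r.
  exact: v'v.
have c1K : c1 * c1' = 1.
  rewrite /c1 /c1' -!mulrA [Y * (Y' * _)]mulrA YY' mul1r [z1 * (z1' * _)]mulrA zz1' mul1r.
  exact: wwi.
have c1'K : c1' * c1 = 1.
  rewrite /c1 /c1' -!mulrA [wi * (w * _)]mulrA wiw mul1r [z1' * (z1 * _)]mulrA z'z1 mul1r.
  exact: Y'Y.
have acc : app nrm e (c1 * c0) du (2 * (2 * (2 * (M * T) * T) * M)).
  have -> : c1 * c0 = w * z1 * z * v0.
    by rewrite /c1 /c0 -!mulrA [Y * (Y' * _)]mulrA YY' mul1r.
  have -> : du = du * v0' * 1 * 1 * v0 by rewrite !mulr1 -mulrA v'v mulr1.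
  by do 3 apply: (app_mul hn) => //; exact: (app_sym hn aw).
have cutM (c d : B) : d * Pi = Pi * d ->
    (c * Pi + (1 - Pi)) * (d * Pi + (1 - Pi)) = c * d * Pi + (1 - Pi).
  move=> dP0.
  have -> : (c * Pi + (1 - Pi)) * (d * Pi + (1 - Pi)) =
    c * (Pi * d) * Pi + c * (Pi - Pi * Pi) + (d * Pi - (Pi * d) * Pi) + (1 - Pi) - (Pi - Pi * Pi).
    by ncring.
  by rewrite -dP0 -!mulrA PP !subrr mulr0; ncring.
have cP (c c' : B) : c * Pi = Pi * c -> c * c' = 1 -> c' * c = 1 -> c' * Pi = Pi * c'.
  move=> h cc' c'c; rewrite -[LHS]mulr1 -cc' -!mulrA [Pi * (c * _)]mulrA -h.
  by rewrite -!mulrA [c' * (c * _)]mulrA c'c mul1r.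
have P1 : 1 * Pi + (1 - Pi) = 1 by ncring.
exists (c0 * Pi + (1 - Pi)), (c0' * Pi + (1 - Pi)), (c1 * Pi + (1 - Pi)), (c1' * Pi + (1 - Pi)).
have D01 := cs1 hD0; have D11 := cs1 hD1.
have D0c (x : B) : D0 x -> D0 (x * Pi + (1 - Pi)).
  by move=> hx; apply: (csD hD0); [apply: (csM hD0)|apply: (csB hD0)].
have D1c (x : B) : D1 x -> D1 (x * Pi + (1 - Pi)).
  by move=> hx; apply: (csD hD1); [apply: (csM hD1)|apply: (csB hD1)].
split; [split|split|].
- by apply: D0c; do 2 apply: (csM hD0) => //.
- by apply: D0c; do 2 apply: (csM hD0) => //.
- by rewrite cutM ?c0K //; exact: cP c0P _ _.
- by rewrite cutM ?c0'K.
- by apply: D1c; do 2 apply: (csM hD1) => //.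
- by apply: D1c; do 2 apply: (csM hD1) => //.
- by rewrite cutM ?c1K //; exact: cP c1P _ _.
- by rewrite cutM ?c1'K.
rewrite cutM //.
have -> : c1 * c0 * Pi + (1 - Pi) - (du * Pi + (1 - Pi)) = (c1 * c0) * Pi - du * Pi by ncring.
case: (app_mul hn acc aP) => _ _ /le_trans; apply; apply: ler_wpM2r => //.
by rewrite -/L /K; move: AA0 AM0 A10; lra.
Qed.
End Assembly.

(** * A frame that is good for a whole loop *)

Section Frame.
Context {R : realType}.
Local Notation C := R[i].

(** An affine function that is large somewhere in the disc of radius S is small near at
    most one point of a grid, so that a grid with more points than functions has a point
    where all functions are large. *)
Lemma grid_avoid (N M : nat) (S c : R) (a b : 'I_M -> C) : (0 < N)%N -> (M < N * N)%N ->
    1 <= S -> 0 < c ->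
    (forall j, exists2 s, normc s <= S & c <= normc (a j + b j * s)) ->
  exists2 s : C, normc s <= 2 & forall j, c / (8 * S * N%:R) <= normc (a j + b j * s).
Proof.
move=> N0 MN S1 c0 h; set d := c / _.
have N0' : 0 < N%:R :> R by rewrite ltr0n.
pose g (u : 'I_N * 'I_N) : C := Complex (u.1%:R / N%:R) (u.2%:R / N%:R).
have g2 u : normc (g u) <= 2.
  apply: le_trans (normc_le_ReIm _) _; rewrite /= !ger0_norm ?divr_ge0 ?ler0n //.
  have q1 (k : 'I_N) : k%:R / N%:R <= 1 :> R by rewrite ler_pdivrMr // mul1r ler_nat ltnW.
  by have := lerD (q1 u.1) (q1 u.2); lra.
apply: contrapT => /forall2NP hn.
have bad u : exists j, normc (a j + b j * g u) < d.
  case: (hn (g u)) => [//|]; move/existsNP => [j /negP]; rewrite -ltNge => hj; by exists j.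
have {bad}[f hf] : exists f : 'I_N * 'I_N -> 'I_M, forall u, normc (a (f u) + b (f u) * g u) < d.
  exists (fun u => projT1 (cid (bad u))) => u; exact: projT2 (cid (bad u)).
suff fi : injective f.
  by have := leq_card f fi; rewrite card_prod !card_ord leqNgt MN.
move=> u v uv; apply: contrapT => neq.
have hu := hf u; have hv := hf v; rewrite -uv in hv.
have [s sS cs] := h (f u).
set A := a (f u) in hu hv cs; set Bb := b (f u) in hu hv cs.
have gd : N%:R^-1 <= normc (g u - g v).
  have ord_d (k l : 'I_N) : k <> l -> N%:R^-1 <= `|k%:R / N%:R - l%:R / N%:R| :> R.
    move=> kl; rewrite -mulrBl normrM [X in _ * X]ger0_norm ?invr_ge0 ?ler0n //.
    rewrite ler_peMl ?invr_ge0 ?ler0n //.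
    have {}kl : (k != l :> nat) by apply/eqP => /val_inj.
    case/orP: (leq_total k l) => kl'.
      rewrite distrC -natrB // ger0_norm ?ler0n // ler1n subn_gt0 ltn_neqAle kl; exact: kl'.
    by rewrite -natrB // ger0_norm ?ler0n // ler1n subn_gt0 ltn_neqAle eq_sym kl; exact: kl'.
  have [e1|n1] := eqVneq u.1 v.1; last first.
    by apply: le_trans (Re_le_normc _); apply: ord_d => e; rewrite e eqxx in n1.
  have [e2|n2] := eqVneq u.2 v.2; last first.
    by apply: le_trans (Im_le_normc _); apply: ord_d => e; rewrite e eqxx in n2.
  by case: neq; rewrite [u]surjective_pairing [v]surjective_pairing e1 e2.
have hB : normc Bb <= 2 * d * N%:R.
  have : normc (Bb * (g u - g v)) <= 2 * d.
    have -> : Bb * (g u - g v) = (A + Bb * g u) - (A + Bb * g v) by ring.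
    apply: le_trans (le_normcD _ _) _; rewrite normcN; move: hu hv; lra.
  rewrite normcM => hB; rewrite -ler_pdivrMr //; apply: le_trans hB.
  by apply: ler_wpM2l => //; exact: normc_ge0.
have hA : normc A <= d + 2 * (2 * d * N%:R).
  have -> : A = (A + Bb * g u) - Bb * g u by ring.
  apply: le_trans (le_normcD _ _) _; rewrite normcN normcM; apply: lerD; first exact: ltW.
  rewrite mulrC; apply: ler_pM => //; exact: normc_ge0.
have dN : 8 * S * (d * N%:R) = c by rewrite /d; field; rewrite !gt_eqF //; move: S1; lra.
have : normc (A + Bb * s) <= d + 2 * (2 * d * N%:R) + 2 * d * N%:R * S.
  apply: le_trans (le_normcD _ _) _; apply: lerD => //; rewrite normcM.
  by apply: ler_pM => //; exact: normc_ge0.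
have d0 : 0 < d by rewrite /d divr_gt0 // !mulr_gt0 //; move: S1; lra.
have N1 : 1 <= N%:R :> R by rewrite ler1n.
have dN1 : d <= d * N%:R by rewrite ler_peMr // ltW.
have dS : d * N%:R <= S * (d * N%:R) by rewrite ler_peMl // mulr_ge0 ?ltW.
have w0 : 0 < d * N%:R by rewrite mulr_gt0.
by move: dN dS dN1 cs w0; lra.
Qed.

(** At the points of a fine grid of [0, 1] the condition on s concerns finitely many affine
    functions, so grid_avoid gives one s for all of them, and the Lipschitz condition extends
    the bound to the whole interval. The mesh is of order 1 / N^2 while the bound from
    grid_avoid is of order 1 / N, which is why N can be chosen. *)
Lemma frame_step (c L S : R) : 0 < c -> 0 <= L -> 2 <= S -> exists2 dl : R, 0 < dl &
  forall (W : Type) (PW : W -> Prop) (D : R -> C -> W -> C),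
    (forall x, 0 <= x <= 1 -> exists s w, [/\ normc s <= S, PW w & c <= normc (D x s w)]) ->
    (forall x w, exists a b, forall s, D x s w = a + b * s) ->
    (forall x y s w, 0 <= x <= 1 -> 0 <= y <= 1 -> normc s <= S -> PW w ->
      normc (D x s w - D y s w) <= L * `|x - y|) ->
  exists2 s, normc s <= S & forall x, 0 <= x <= 1 -> exists2 w, PW w & dl <= normc (D x s w).
Proof.
move=> c0 L0 S2.
pose Q := 16 * S * L / c + 2.
have Q0 : 0 <= Q by rewrite /Q addr_ge0 // divr_ge0 ?(ltW c0) // !mulr_ge0 //; move: S2; lra.
pose q := Num.bound Q; have hq : Q < q%:R by rewrite archi_boundP.
have q2 : (2 < q)%N by rewrite -(ltr_nat R); apply: le_lt_trans hq; rewrite /Q lerDr divr_ge0 ?(ltW c0) // !mulr_ge0 //; move: S2; lra.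
pose N := q.+1; pose M := (q * N)%N.
have N0 : 0 < N%:R :> R by rewrite ltr0n.
have M0 : 0 < M%:R :> R by rewrite ltr0n muln_gt0; lia.
pose d := c / (8 * S * N%:R).
have S0 : 0 < S by move: S2; lra.
have d0 : 0 < d by rewrite /d divr_gt0 // !mulr_gt0.
exists (d / 2); first by rewrite divr_gt0.
move=> W PW D hD aff lip.
pose pt (j : 'I_M.+1) : R := j%:R / M%:R.
have pt01 j : 0 <= pt j <= 1.
  rewrite /pt divr_ge0 ?ler0n //= ler_pdivrMr // mul1r ler_nat -ltnS; exact: ltn_ord.
have [w hw] : exists w : 'I_M.+1 -> W, forall j, PW (w j) /\
    exists2 s, normc s <= S & c <= normc (D (pt j) s (w j)).
  have ex j : exists w, PW w /\ exists2 s, normc s <= S & c <= normc (D (pt j) s w).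
    by have [s [w [h1 h2 h3]]] := hD _ (pt01 j); exists w; split=> //; exists s.
  by exists (fun j => projT1 (cid (ex j))) => j; exact: projT2 (cid (ex j)).
have [ab hab] : exists ab : 'I_M.+1 -> C * C, forall j s, D (pt j) s (w j) = (ab j).1 + (ab j).2 * s.
  have ex j : exists ab : C * C, forall s, D (pt j) s (w j) = ab.1 + ab.2 * s.
    by have [a [b h]] := aff (pt j) (w j); exists (a, b).
  by exists (fun j => projT1 (cid (ex j))) => j; exact: projT2 (cid (ex j)).
have [||||s s2 hs] := @grid_avoid N M.+1 S c (fun j => (ab j).1) (fun j => (ab j).2) _ _ _ c0.
- by [].
- by rewrite /M /N; nia.
- by move: S2; lra.
- by move=> j; have [_ [s sS hs]] := hw j; exists s => //; rewrite -hab.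
exists s; first exact: le_trans s2 S2.
move=> x /andP[x0 x1].
have xM : 0 <= x * M%:R by rewrite mulr_ge0 // ltW.
pose k := Num.trunc (x * M%:R).
have /andP[k1 k2] : k%:R <= x * M%:R < k.+1%:R by exact: truncn_itv.
have kM : (k < M.+1)%N.
  by rewrite ltnS -(ler_nat R); apply: le_trans k1 _; rewrite ler_piMl // ltW.
pose j := Ordinal kM; have [Pj _] := hw j.
exists (w j) => //.
have := hs j; rewrite -hab -/d => hd.
have ptx : `|x - pt j| <= M%:R^-1.
  have e : x = x * M%:R / M%:R by rewrite mulfK // gt_eqF.
  rewrite {1}e /pt /= -mulrBl normrM [X in _ * X]ger0_norm ?invr_ge0 ?(ltW M0) //.
  rewrite ler_piMl ?invr_ge0 ?(ltW M0) // ger0_norm ?subr_ge0 //.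
  by move: k2; rewrite -[k.+1]addn1 natrD; lra.
have l1 : normc (D (pt j) s (w j) - D x s (w j)) <= L * M%:R^-1.
  apply: le_trans (lip _ _ _ _ _ _ _ _) _ => //; [by rewrite x0|exact: le_trans s2 S2|].
  by rewrite distrC; apply: ler_wpM2l.
have LM : L * M%:R^-1 <= d / 2.
  rewrite ler_pdivrMr // /d.
  have -> : c / (8 * S * N%:R) / 2 * M%:R = c * q%:R / (16 * S).
    by rewrite /M natrM; field; rewrite !gt_eqF.
  rewrite ler_pdivlMr ?mulr_gt0 // mulrC -ler_pdivrMl // [_ * (_ * L)]mulrC.
  by apply: le_trans (ltW hq); rewrite /Q; lra.
have -> : D x s (w j) = D (pt j) s (w j) - (D (pt j) s (w j) - D x s (w j)) by ring.
have tri : normc (D (pt j) s (w j)) <= normc (D (pt j) s (w j) - (D (pt j) s (w j) - D x s (w j)))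
    + normc (D (pt j) s (w j) - D x s (w j)).
  by rewrite -[X in normc X <= _](subrK (D (pt j) s (w j) - D x s (w j))); exact: le_normcD.
move: tri l1 LM hd; lra.
Qed.

(** The entries are fixed one after the other, by frame_step. *)
Lemma frame_seq (K : nat) (c L S : R) : 0 < c -> 0 <= L -> 2 <= S -> exists2 dl : R, 0 < dl &
  forall D : R -> seq C -> C,
    (forall x u w, (size u + size w).+1 = K -> exists a b, forall s, D x (u ++ s :: w) = a + b * s) ->
    (forall x y w, 0 <= x <= 1 -> 0 <= y <= 1 -> size w = K -> (forall s, s \in w -> normc s <= S) ->
      normc (D x w - D y w) <= L * `|x - y|) ->
    (forall x, 0 <= x <= 1 -> exists w, [/\ size w = K, (forall s, s \in w -> normc s <= S) &
      c <= normc (D x w)]) ->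
  exists w, [/\ size w = K, (forall s, s \in w -> normc s <= S) &
    forall x, 0 <= x <= 1 -> dl <= normc (D x w)].
Proof.
move=> c0 L0 S2; elim: K c c0 => [|K IH] c c0.
  exists c => // D _ _ h; exists [::]; split=> // x /h[w [/size0nil -> _]] //.
have [d1 d10 h1] := frame_step c0 L0 S2.
have [d2 d20 h2] := IH d1 d10; exists d2 => // D aff lip hD.
have [||| s sS hs] := h1 (seq C) (fun w => size w = K /\ forall s, s \in w -> normc s <= S)
   (fun x s w => if size w == K then D x (s :: w) else 0).
- move=> x /hD[[|s w] [//= [sw] hS cD]]; exists s, w; split.
  + by apply: hS; rewrite inE eqxx.
  + by split=> // t tw; apply: hS; rewrite inE tw orbT.
  + by rewrite sw eqxx.
- move=> x w; case: eqP => [sw|_]; last by exists 0, 0 => s; rewrite mul0r addr0.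
  by have [|a [b h]] := aff x [::] w; [rewrite add0n sw|exists a, b].
- move=> x y s w x01 y01 sS [sw hw]; rewrite sw eqxx; apply: lip => //=; first by rewrite sw.
  by move=> t; rewrite inE => /orP[/eqP -> //|/hw].
have [|||w [sw hw hw2]] := h2 (fun x w => D x (s :: w)).
- by move=> x u w suw; apply: (aff x (s :: u) w); rewrite /= addSn suw.
- move=> x y w x01 y01 sw hw; apply: lip => //=; first by rewrite sw.
  by move=> t; rewrite inE => /orP[/eqP -> //|/hw].
- by move=> x /hs[w [sw hw]]; rewrite sw eqxx => h; exists w.
exists (s :: w); split=> //=; first by rewrite sw.
by move=> t; rewrite inE => /orP[/eqP -> //|/hw].
Qed.
End Frame.

(** * Determinants and frames *)

Section DetBounds.
Context {R : realType}.
Local Notation C := R[i].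

Lemma normc_prod (I : Type) (s : seq I) (f : I -> C) :
  normc (\prod_(i <- s) f i) = \prod_(i <- s) normc (f i).
Proof. by elim/big_rec2: _ => [|i x y _ <-]; rewrite ?normc_one ?normcM. Qed.

Lemma normc_sum_le (I : Type) (s : seq I) (P : pred I) (f : I -> C) :
  normc (\sum_(i <- s | P i) f i) <= \sum_(i <- s | P i) normc (f i).
Proof.
elim/big_rec2: _ => [|i x y _ h]; first by rewrite normc_zero.
by apply: le_trans (le_normcD _ _) _; rewrite lerD2l.
Qed.

Lemma normc_sum_const (I : finType) (f : I -> C) (M : R) :
  (forall i, normc (f i) <= M) -> normc (\sum_i f i) <= #|I|%:R * M.
Proof.
move=> h; apply: le_trans (normc_sum_le _ _ _) _.
by apply: le_trans (ler_sum _ (fun i _ => h i)) _; rewrite sumr_const mulr_natl.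
Qed.

Lemma normc_sign (b : bool) : normc ((-1) ^+ b : C) = 1.
Proof. by case: b; rewrite ?expr0 ?expr1 ?normcN normc_one. Qed.

Lemma normc_prod_le n (f : 'I_n -> C) (M : R) : (forall i, normc (f i) <= M) ->
  normc (\prod_i f i) <= M ^+ n.
Proof.
move=> h; rewrite normc_prod -[n in M ^+ n]card_ord -prodr_const.
by apply: ler_prod => i _; rewrite normc_ge0 h.
Qed.

Lemma prod_lip n (f g : 'I_n -> C) (M e : R) : 1 <= M -> (forall i, normc (f i) <= M) ->
    (forall i, normc (g i) <= M) -> (forall i, normc (f i - g i) <= e) ->
  normc (\prod_i f i - \prod_i g i) <= n%:R * M ^+ n * e.
Proof.
move=> M1; elim: n f g => [|n IH] f g hf hg hfg.
  by rewrite !big_ord0 subrr normc_zero !mul0r.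
have M0 : 0 <= M by move: M1; lra.
rewrite !big_ord_recl; set F := \prod_(i < n) f _; set G := \prod_(i < n) g _.
have e0 : 0 <= e by apply: le_trans (hfg ord0); exact: normc_ge0.
have -> : f ord0 * F - g ord0 * G = f ord0 * (F - G) + (f ord0 - g ord0) * G by ring.
apply: le_trans (le_normcD _ _) _; rewrite !normcM.
have h1 : normc (f ord0) * normc (F - G) <= M * (n%:R * M ^+ n * e).
  apply: ler_pM; rewrite ?normc_ge0 //; exact: IH.
have h2 : normc (f ord0 - g ord0) * normc G <= e * M ^+ n.
  apply: ler_pM; rewrite ?normc_ge0 //; exact: normc_prod_le.
have h3 : e * M ^+ n <= M ^+ n.+1 * e.
  by rewrite mulrC ler_wpM2r // exprS ler_peMl // exprn_ge0.
apply: le_trans (lerD h1 (le_trans h2 h3)) _.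
by rewrite -addn1 natrD addn1 exprS le_eqVlt; apply/orP; left; apply/eqP; ring.
Qed.

Lemma det_le n (A : 'M[C]_n) (M : R) : (forall i j, normc (A i j) <= M) ->
  normc (\det A) <= (n`!)%:R * M ^+ n.
Proof.
move=> h; rewrite /determinant.
have -> : (n`!)%:R = #|{perm 'I_n}|%:R :> R by rewrite card_Sn.
apply: (@normc_sum_const _ (fun s => _)) => s; rewrite normcM normc_sign mul1r.
exact: normc_prod_le.
Qed.

Lemma det_lip n (A B : 'M[C]_n) (M e : R) : 1 <= M -> (forall i j, normc (A i j) <= M) ->
    (forall i j, normc (B i j) <= M) -> (forall i j, normc (A i j - B i j) <= e) ->
  normc (\det A - \det B) <= (n`!)%:R * (n%:R * M ^+ n) * e.
Proof.
move=> M1 hA hB hAB; rewrite /determinant -sumrB.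
have -> : (n`!)%:R = #|{perm 'I_n}|%:R :> R by rewrite card_Sn.
rewrite -mulrA; apply: (@normc_sum_const _ (fun s => _)) => s.
by rewrite -mulrBr normcM normc_sign mul1r; exact: prod_lip.
Qed.

Lemma adj_le n (A : 'M[C]_n) (M : R) i j : 1 <= M -> (forall i j, normc (A i j) <= M) ->
  normc ((\adj A) i j) <= (n`!)%:R * M ^+ n.
Proof.
case: n A i j => [A []//|n] A i j M1 h; rewrite mxE /cofactor -signr_odd normcM normc_sign mul1r.
apply: le_trans (det_le (M := M) _) _; first by move=> k l; rewrite !mxE.
have M0 : 0 <= M by move: M1; lra.
apply: ler_pM; rewrite ?ler0n ?exprn_ge0 //.
  by rewrite ler_nat factS leq_pmull.
by rewrite exprS ler_peMl // exprn_ge0.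
Qed.
End DetBounds.

Section FrameMatrix.
Context {R : realType}.
Local Notation C := R[i].

(** Q B Pi + (1 - Q) B (1 - Pi) for the coordinate projection Pi: if Q is an idempotent
    and this matrix is invertible, then it conjugates Pi to Q. *)
Definition frame_mx n (Q : 'M[C]_n) (pi : pred 'I_n) (B : 'M[C]_n) : 'M[C]_n :=
  \matrix_(i, j) \sum_k (if pi j then Q i k else (i == k)%:R - Q i k) * B k j.

(** The matrices that are the identity outside of a set of coordinates. *)
Definition padded n (va : pred 'I_n) (B : 'M[C]_n) :=
  forall k j, ~~ (va k && va j) -> B k j = (k == j)%:R.

Definition seq_mx n (va : pred 'I_n) (w : seq C) : 'M[C]_n :=
  \matrix_(k, j) if va k && va j then nth 0 w (k * n + j) else (k == j)%:R.

Lemma seq_mx_padded n va w : padded va (@seq_mx n va w).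
Proof. by move=> k j /negbTE h; rewrite mxE h. Qed.

Lemma frame_mx_le n (Q : 'M[C]_n) pi (B : 'M[C]_n) (M : R) : 1 <= M -> (forall i j, normc (Q i j) <= M) ->
  (forall i j, normc (B i j) <= M) -> forall i j, normc (frame_mx Q pi B i j) <= n%:R * ((1 + M) * M).
Proof.
move=> M1 hQ hB i j; rewrite mxE -[n in n%:R]card_ord; apply: normc_sum_const => k.
rewrite normcM; apply: ler_pM; rewrite ?normc_ge0 //; case: ifP => _.
  by apply: le_trans (hQ _ _) _; lra.
apply: le_trans (le_normcD _ _) _; rewrite normcN; apply: lerD => //.
by case: (i == k); rewrite ?normc_one ?normc_zero.
Qed.

Lemma frame_mx_lip n (Q Q' : 'M[C]_n) pi (B : 'M[C]_n) (M e : R) : 0 <= e -> (forall i j, normc (B i j) <= M) ->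
    (forall i j, normc (Q i j - Q' i j) <= e) ->
  forall i j, normc (frame_mx Q pi B i j - frame_mx Q' pi B i j) <= n%:R * (e * M).
Proof.
move=> e0 hB hQ i j; rewrite !mxE -sumrB -[n in n%:R]card_ord; apply: normc_sum_const => k.
rewrite -mulrBl normcM; apply: ler_pM; rewrite ?normc_ge0 //; case: ifP => _ //.
have -> : (i == k)%:R - Q i k - ((i == k)%:R - Q' i k) = - (Q i k - Q' i k) by ring.
by rewrite normcN.
Qed.

(** Expansion of the determinant along a column. *)
Lemma det_affine n (V : C -> 'M[C]_n) (j0 : 'I_n) (al be : 'I_n -> C) :
  (forall s i, V s i j0 = al i + be i * s) -> (forall s i j, j != j0 -> V s i j = V 0 i j) ->
  exists a b, forall s, \det (V s) = a + b * s.
Proof.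
move=> h0 h1; exists (\sum_i al i * cofactor (V 0) i j0), (\sum_i be i * cofactor (V 0) i j0) => s.
rewrite (expand_det_col _ j0) mulr_suml -big_split; apply: eq_bigr => i _ /=.
have -> : cofactor (V s) i j0 = cofactor (V 0) i j0.
  by congr (_ * \det _); apply/matrixP => k l; rewrite !mxE h1 // eq_sym neq_lift.
by rewrite h0 mulrDl mulrAC.
Qed.

Lemma frame_mx_affine n (Q : 'M[C]_n) pi va (u w : seq C) : (size u + size w).+1 = (n * n)%N ->
  exists a b, forall s, \det (frame_mx Q pi (seq_mx va (u ++ s :: w))) = a + b * s.
Proof.
case: n Q pi va => [//|n] Q pi va sz; set p := size u.
have pn : (p < n.+1 * n.+1)%N by rewrite -sz ltnS leq_addr.
have k0n : (p %/ n.+1 < n.+1)%N by rewrite ltn_divLR.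
pose k0 : 'I_n.+1 := Ordinal k0n; pose j0 : 'I_n.+1 := Ordinal (ltn_pmod p (ltn0Sn n)).
have pos (k j : 'I_n.+1) : (k * n.+1 + j)%N = p -> k = k0 /\ j = j0.
  move=> e; split; apply: val_inj => /=; rewrite -e.
    by rewrite divnMDl // divn_small ?addn0.
  by rewrite modnMDl modn_small.
have pos0 : (k0 * n.+1 + j0)%N = p by rewrite /= -divn_eq.
have nthE s s' k j : ((k, j) != (k0, j0)) ->
    seq_mx va (u ++ s :: w) k j = seq_mx va (u ++ s' :: w) k j.
  move=> kj; rewrite !mxE; case: ifP => // _.
  have ne : (k * n.+1 + j)%N <> p by move=> /pos[ek ej]; rewrite ek ej eqxx in kj.
  rewrite !nth_cat -/p; case: ltnP => // le.
  by case: (_ - _)%N (subnKC le) => [|q] //; rewrite addn0 => /esym.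
pose cq i k := (if pi j0 then Q i k else (i == k)%:R - Q i k).
pose al i := \sum_(k | k != k0) cq i k * seq_mx va (u ++ 0 :: w) k j0 +
  (if va k0 && va j0 then 0 else cq i k0 * (k0 == j0)%:R).
pose be i := if va k0 && va j0 then cq i k0 else 0.
apply: (@det_affine _ (fun s => frame_mx Q pi (seq_mx va (u ++ s :: w))) j0 al be).
- move=> s i; rewrite mxE (bigD1 k0) //= -/(cq _ _) addrC /al -addrA; congr (_ + _).
    apply: eq_bigr => k kk; rewrite -/(cq _ _) (nthE s 0) // xpair_eqE negb_and kk //.
  rewrite /be mxE pos0 nth_cat ltnn subnn /=; case: ifP => _; first by rewrite add0r.
  by rewrite mul0r addr0.
- move=> s i j jj; rewrite !mxE; apply: eq_bigr => k _; congr (_ * _).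
  by apply: nthE; rewrite xpair_eqE negb_and jj orbT.
Qed.

(** The determinant of the frame matrix is affine in each entry of B, so frame_seq applies
    to the list of the entries. The bound dl depends on n, c, L and S only. *)
Lemma frame_exists (n : nat) (c L S : R) : 0 < c -> 0 <= L -> 2 <= S -> exists2 dl : R, 0 < dl &
  forall (Q : R -> 'M[C]_n) (pi va : pred 'I_n),
    (forall x i j, 0 <= x <= 1 -> normc (Q x i j) <= S) ->
    (forall x y i j, 0 <= x <= 1 -> 0 <= y <= 1 -> normc (Q x i j - Q y i j) <= L * `|x - y|) ->
    (forall x, 0 <= x <= 1 -> exists B, [/\ padded va B, (forall i j, normc (B i j) <= S) &
      c <= normc (\det (frame_mx (Q x) pi B))]) ->
  exists B, [/\ padded va B, (forall i j, normc (B i j) <= S) &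
    forall x, 0 <= x <= 1 -> dl <= normc (\det (frame_mx (Q x) pi B))].
Proof.
move=> c0 L0 S2; have S1 : 1 <= S by move: S2; lra.
have S0 : 0 <= S by move: S2; lra.
pose M := n%:R * ((1 + S) * S) + 1.
have M1 : 1 <= M by rewrite /M lerDr !mulr_ge0 ?ler0n //; move: S0; lra.
pose L' := (n`!)%:R * (n%:R * M ^+ n) * (n%:R * (L * S)).
have L'0 : 0 <= L' by rewrite /L' !mulr_ge0 ?ler0n ?exprn_ge0 //; move: M1; lra.
have [dl dl0 h] := frame_seq (n * n) c0 L'0 S2; exists dl => // Q pi va hQ lQ hB.
have seqS w : (forall s, s \in w -> normc s <= S) -> forall i j, normc (@seq_mx n va w i j) <= S.
  move=> hw i j; rewrite mxE; case: ifP => _; last first.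
    by case: (i == j); rewrite ?normc_one ?normc_zero //.
  have [lt|ge] := ltnP (i * n + j) (size w); first by apply: hw; exact: mem_nth.
  by rewrite nth_default // normc_zero.
have [|||w [sw hw dw]] := h (fun x w => \det (frame_mx (Q x) pi (seq_mx va w))).
- by move=> x u w; exact: frame_mx_affine.
- move=> x y w x01 y01 sw hw.
  have e0 : 0 <= L * `|x - y| by rewrite mulr_ge0.
  have -> : L' * `|x - y| = (n`!)%:R * (n%:R * M ^+ n) * (n%:R * (L * `|x - y| * S)) by rewrite /L'; ring.
  apply: det_lip => // i j.
  + by apply: le_trans (frame_mx_le pi S1 (fun k l => hQ _ k l x01) (seqS w hw) i j) _; rewrite /M lerDl.
  + by apply: le_trans (frame_mx_le pi S1 (fun k l => hQ _ k l y01) (seqS w hw) i j) _; rewrite /M lerDl.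
  + by apply: frame_mx_lip => // [k l|k l]; [exact: seqS|exact: lQ].
- move=> x /hB[B [pB BS cB]].
  have [w sw hw] : exists2 w, size w = (n * n)%N &
      (forall s, s \in w -> normc s <= S) /\ forall k j : 'I_n, nth 0 w (k * n + j) = B k j.
    case: n B BS {pB cB h Q pi va hQ lQ hB seqS M M1 L' L'0 dl0} => [|n] B BS.
      by exists [::] => //; split=> // -[].
    exists (mkseq (fun p => B (inord (p %/ n.+1)) (inord (p %% n.+1))) (n.+1 * n.+1)).
      by rewrite size_mkseq.
    split=> [s /mapP[q _ ->] //|k j].
    rewrite nth_mkseq; last by have := ltn_ord k; have := ltn_ord j; nia.
    by rewrite divnMDl // divn_small // addn0 modnMDl modn_small // !inord_val.
  exists w; split=> //; first by case: hw.
  suff -> : seq_mx va w = B by [].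
  by apply/matrixP => k j; rewrite mxE; case: ifP => [_|/negbT /pB //]; case: hw.
exists (seq_mx va w); split=> //; [exact: seq_mx_padded|exact: seqS].
Qed.
End FrameMatrix.

Import numFieldNormedType.Exports.

(** * Polynomials on the unit circle *)

Section Circle.
Context {R : realType}.
Local Notation C := R[i].

Definition zc (x : R) : C := Complex (cos (pi *+ 2 * x)) (sin (pi *+ 2 * x)).

Lemma zc0 : zc 0 = 1. Proof. by rewrite /zc mulr0 cos0 sin0. Qed.
Lemma zc1 : zc 1 = 1. Proof. by rewrite /zc mulr1 cos2pi sin2pi. Qed.
Lemma zcD x y : zc (x + y) = zc x * zc y.
Proof.
rewrite /zc mulrDr cosD sinD; apply/eqP; rewrite eq_complex /=.
by rewrite eqxx /= addrC eqxx.
Qed.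
Lemma normc_zc x : normc (zc x) = 1.
Proof. by rewrite /zc /normc cos2Dsin2 sqrtr1. Qed.
Lemma zc_neq0 x : zc x != 0.
Proof. by apply/eqP => h; have := normc_zc x; rewrite h normc_zero => /eqP; rewrite eq_sym oner_eq0. Qed.
Lemma zcV x : (zc x)^-1 = zc (- x).
Proof. by apply: (mulfI (zc_neq0 x)); rewrite divff ?zc_neq0 // -zcD subrr zc0. Qed.
Lemma zc_conj x : ((zc x)^*)%C = (zc x)^-1.
Proof. by rewrite zcV /zc mulrN cosN sinN. Qed.
Lemma zcX x n : zc x ^+ n = zc (x * n%:R).
Proof.
elim: n => [|n IH]; first by rewrite mulr0 zc0.
by rewrite exprS IH -zcD -addn1 natrD mulrDr mulr1 addrC.
Qed.

Lemma zc_neq1 x : 0 < x < 1 -> zc x != 1.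
Proof.
move=> /andP[x0 x1]; apply/eqP => -[h _].
have := h; have -> : pi *+ 2 * x = (pi * x) *+ 2 by rewrite mulrnAl.
rewrite cos_mulr2n cos2sin2 => h2.
have s0 : 0 < sin (pi * x).
  by apply: sin_gt0_pi; rewrite mulr_gt0 ?pi_gt0 //= gtr_pMr ?pi_gt0.
have : 0 < sin (pi * x) ^+ 2 by rewrite exprn_gt0.
move: h2; rewrite mulrnBl; lra.
Qed.

Lemma zc_lip x y : normc (zc x - zc y) <= 4 * pi * `|x - y|.
Proof.
wlog: x y / x <= y => [h|xy].
  by case/orP: (le_total x y) => xy; [exact: h|rewrite distrC -normcN opprB; exact: h].
have p0 : 0 <= pi *+ 2 :> R by rewrite mulrn_wge0 // pi_ge0.
have pxy : pi *+ 2 * x <= pi *+ 2 * y by exact: ler_wpM2l.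
have e : pi *+ 2 * y - pi *+ 2 * x = 2 * pi * `|x - y|.
  by rewrite distrC ger0_norm ?subr_ge0 //; ring.
have hc : `|cos (pi *+ 2 * x) - cos (pi *+ 2 * y)| <= 2 * pi * `|x - y|.
  have [|c _ hc] := @MVT_segment R cos (fun t => - sin t) _ _ pxy.
    by apply/continuous_subspaceT => ?; exact: continuous_cos.
  rewrite distrC hc e normrM normrN [X in _ * X]ger0_norm ?ler_piMl ?sin_max //.
    by rewrite !mulr_ge0 ?pi_ge0.
  by rewrite !mulr_ge0 ?pi_ge0.
have hs : `|sin (pi *+ 2 * x) - sin (pi *+ 2 * y)| <= 2 * pi * `|x - y|.
  have [|c _ hc'] := @MVT_segment R sin cos _ _ pxy.
    by apply/continuous_subspaceT => ?; exact: continuous_sin.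
  rewrite distrC hc' e normrM [X in _ * X]ger0_norm ?ler_piMl ?cos_max //.
    by rewrite !mulr_ge0 ?pi_ge0.
  by rewrite !mulr_ge0 ?pi_ge0.
apply: le_trans (normc_le_ReIm _) _; rewrite /=; move: hc hs; lra.
Qed.

(** Orthogonality of the characters of the group of N-th roots of unity. *)
Lemma sum_zc (N : nat) (j l : nat) : (j < N)%N -> (l < N)%N -> j != l ->
  \sum_(k < N) zc (k%:R / N%:R) ^+ j * zc (- (k%:R / N%:R)) ^+ l = 0.
Proof.
move=> jN lN jl; have N0 : N%:R != 0 :> R by rewrite pnatr_eq0; case: N jN {lN}.
pose w := zc ((j%:R - l%:R) / N%:R).
have -> : \sum_(k < N) zc (k%:R / N%:R) ^+ j * zc (- (k%:R / N%:R)) ^+ l = \sum_(k < N) w ^+ k.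
  apply: eq_bigr => k _; rewrite /w !zcX -zcD; congr zc.
  by rewrite mulNr -!mulrBr; field.
have wN : w ^+ N = 1.
  rewrite /w zcX divfK // zcD -zcV -[j%:R]mul1r -[l%:R]mul1r -!zcX zc1 !expr1n.
  by rewrite invr1 mulr1.
have w1 : w != 1.
  have pos (a b : nat) : (a < N)%N -> (b < a)%N -> zc ((a%:R - b%:R) / N%:R) != 1.
    move=> aN ba; apply: zc_neq1.
    have N0' : 0 < N%:R :> R by rewrite ltr0n (leq_ltn_trans _ aN).
    rewrite divr_gt0 ?subr_gt0 ?ltr_nat //= ltr_pdivrMr // mul1r.
    by rewrite -natrB ?(ltnW ba) // ltr_nat (leq_ltn_trans _ aN) // leq_subr.
  have [jl'|lj|jl'] := ltngtP j l; [|exact: pos|by rewrite jl' eqxx in jl].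
  have := pos _ _ lN jl'; apply: contraNneq => h.
  by rewrite -[X in zc X]opprK -zcV -mulNr opprB -/w h invr1.
by apply: (mulfI (_ : w - 1 != 0)); rewrite ?subr_eq0 // mulr0 -subrX1 wN subrr.
Qed.

(** The coefficients of a polynomial are averages of its values. *)
Lemma coef_bound (q : {poly C}) (M : R) l :
  (forall x, 0 <= x <= 1 -> normc q.[zc x] <= M) -> normc q`_l <= M.
Proof.
move=> h; set N := size q.
have M0 : 0 <= M by apply: le_trans (h 0 _); rewrite ?lexx ?ler01 // normc_ge0.
have [lN|lN] := ltnP l N; last by rewrite nth_default // normc_zero.
have N0 : (0 < N)%N by exact: leq_ltn_trans lN.
have N0' : 0 < N%:R :> R by rewrite ltr0n.
have key : N%:R * q`_l = \sum_(k < N) q.[zc (k%:R / N%:R)] * zc (- (k%:R / N%:R)) ^+ l.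
  have -> : \sum_(k < N) q.[zc (k%:R / N%:R)] * zc (- (k%:R / N%:R)) ^+ l =
     \sum_(j < N) q`_j * \sum_(k < N) zc (k%:R / N%:R) ^+ j * zc (- (k%:R / N%:R)) ^+ l.
    under [RHS]eq_bigr do rewrite mulr_sumr; rewrite exchange_big; apply: eq_bigr => k _.
    by rewrite horner_coef mulr_suml; apply: eq_bigr => j _; rewrite mulrA.
  rewrite (bigD1 (Ordinal lN)) //= [X in _ + X]big1 ?addr0; last first.
    by move=> j jl; rewrite sum_zc ?mulr0.
  have -> : \sum_(k < N) zc (k%:R / N%:R) ^+ l * zc (- (k%:R / N%:R)) ^+ l = N%:R :> C.
    rewrite (eq_bigr (fun=> 1)) ?sumr_const ?card_ord // => k _.
    by rewrite -exprMn -zcD subrr zc0 expr1n.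
  exact: mulrC.
have nN : normc (N%:R : C) = N%:R.
  have -> : N%:R = ((N%:R : R)%:C)%C :> C by rewrite rmorph_nat.
  by rewrite /normc /= expr0n addr0 sqrtr_sqr ger0_norm // ler0n.
rewrite -(ler_pM2l N0') -nN -normcM key nN -[X in X%:R * M]card_ord.
apply: normc_sum_const => k; rewrite normcM zcX normc_zc mulr1; apply: h.
rewrite divr_ge0 ?ler0n //= ler_pdivrMr // mul1r ler_nat ltnW //.
Qed.

(** The conjugate of a polynomial on the circle, up to a power of the variable. *)
Definition pstar (D : nat) (q : {poly C}) : {poly C} := \poly_(i < D.+1) ((q`_(D - i))^*)%C.

Lemma pstarE D (q : {poly C}) x : (size q <= D.+1)%N -> (pstar D q).[zc x] = zc x ^+ D * ((q.[zc x])^*)%C.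
Proof.
move=> sq; rewrite /pstar horner_poly (horner_coef_wide _ sq) rmorph_sum mulr_sumr /=.
rewrite (reindex_inj rev_ord_inj) /=; apply: eq_bigr => i _.
have cX : ((zc x ^+ i)^*)%C = (zc x)^-1 ^+ i by rewrite zcX zc_conj exprVn zcX.
have -> : ((q`_i * zc x ^+ i)^*)%C = ((q`_i)^*)%C * ((zc x ^+ i)^*)%C by exact: rmorphM.
rewrite cX subSS subKn ?leq_ord // mulrCA; congr (_ * _).
have iD : (i <= D)%N by exact: leq_ord.
have -> : zc x ^+ D = zc x ^+ (D - i) * zc x ^+ i by rewrite -exprD subnK.
by rewrite -mulrA exprVn divff ?mulr1 // expf_neq0 // zc_neq0.
Qed.

Lemma size_pstar D (q : {poly C}) : (size (pstar D q) <= D.+1)%N. Proof. exact: size_poly. Qed.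

Definition mxev n (P : 'M[{poly C}]_n) (z : C) : 'M[C]_n := map_mx (horner_eval z) P.

Lemma mxevM n (P Q : 'M[{poly C}]_n) z : mxev (P *m Q) z = mxev P z *m mxev Q z.
Proof. exact: map_mxM. Qed.

Lemma size_mul_le (q r : {poly C}) a b : (size q <= a.+1)%N -> (size r <= b.+1)%N ->
  (size (q * r)%R <= (a + b).+1)%N.
Proof.
move=> hq hr; apply: leq_trans (size_polyMleq _ _) _.
by rewrite -subn1 leq_subLR; apply: leq_trans (leq_add hq hr) _; lia.
Qed.

Lemma size_prod_ord n (f : 'I_n -> {poly C}) s : (forall i, (size (f i) <= s.+1)%N) ->
  (size (\prod_i f i)%R <= (n * s).+1)%N.
Proof.
elim: n f => [|n IH] f h; first by rewrite big_ord0 size_poly1.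
by rewrite big_ord_recl mulSn; apply: size_mul_le (h _) (IH _ (fun i => h _)).
Qed.

Lemma size_det n (P : 'M[{poly C}]_n) s : (forall i j, (size (P i j) <= s.+1)%N) ->
  (size (\det P)%R <= (n * s).+1)%N.
Proof.
move=> h; apply: leq_trans (size_sum _ _ _) _; apply/bigmax_leqP => t _.
rewrite -signr_odd mulr_sign; case: ifP => _; rewrite ?size_polyN; apply: size_prod_ord => i; exact: h.
Qed.

Lemma size_adj n (P : 'M[{poly C}]_n) s i j : (forall i j, (size (P i j) <= s.+1)%N) ->
  (size (((\adj P) i j)%R) <= (n * s).+1)%N.
Proof.
case: n P i j => [P []//|n] P i j h; rewrite mxE /cofactor -signr_odd mulr_sign.
have hs : (size (\det (row' j (col' i P)))%R <= (n.+1 * s).+1)%N.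
  apply: leq_trans (size_det (s := s) _) _; first by move=> k l; rewrite !mxE.
  by rewrite ltnS leq_mul2r leqnSn orbT.
by case: ifP => _; rewrite ?size_polyN.
Qed.

Lemma size_expn (q : {poly C}) s n : (size q <= s.+1)%N -> (size (q ^+ n)%R <= (n * s).+1)%N.
Proof.
move=> h; rewrite -[n in q ^+ n]card_ord -prodr_const; exact: (size_prod_ord (f := fun=> q)).
Qed.

(** The inverse of a matrix of polynomials whose determinant is bounded below on the
    circle, up to a small remainder: by Cramer's rule, the inverse of d = det being
    expanded into the geometric series of 1 - |d|^2 / c. *)
Lemma circle_inverse n (M dl : R) : 1 <= M -> 0 < dl -> exists C1 rho : R,
  [/\ 0 <= C1, 0 <= rho, rho < 1 &
  forall s k (P : 'M[{poly C}]_n), (forall i j, (size (P i j) <= s.+1)%N) ->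
    (forall x i j, 0 <= x <= 1 -> normc (mxev P (zc x) i j) <= M) ->
    (forall x, 0 <= x <= 1 -> dl <= normc (\det (mxev P (zc x)))) ->
  exists (Z : 'M[{poly C}]_n) (X1 : {poly C}),
  [/\ P *m Z = ('X^(n * s * k.+1) - X1)%:M, Z *m P = ('X^(n * s * k.+1) - X1)%:M,
      (forall i j, (size (Z i j) <= (2 * (n * s) * k.+1).+1)%N) /\
        (size X1 <= (2 * (n * s) * k.+1).+1)%N,
      forall x i j, 0 <= x <= 1 -> normc (mxev Z (zc x) i j) <= C1 &
      forall x, 0 <= x <= 1 -> normc X1.[zc x] <= rho ^+ k.+1]].
Proof.
move=> M1 dl0; pose c0 := (n`!)%:R * M ^+ n.
have M0 : 0 <= M by move: M1; lra.
have c00 : 0 <= c0 by rewrite mulr_ge0 ?ler0n ?exprn_ge0.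
pose c := c0 ^+ 2 + dl ^+ 2; have dl2 : 0 < dl ^+ 2 by rewrite exprn_gt0.
have cpos : 0 < c by rewrite ltr_wpDl ?exprn_ge0.
pose rho := 1 - dl ^+ 2 / c.
have rho1 : dl ^+ 2 / c <= 1 by rewrite ler_pdivrMr // mul1r lerDr exprn_ge0.
have rho0 : 0 < dl ^+ 2 / c by rewrite divr_gt0.
have cge0 : 0 <= rho by rewrite /rho; lra.
have rlt : rho < 1 by rewrite /rho; lra.
exists (c^-1 * c0 * (c / dl ^+ 2) * c0), rho; split=> //.
  have i1 : 0 <= c^-1 by rewrite invr_ge0 ltW.
  have i2 : 0 <= c / dl ^+ 2 by rewrite divr_ge0 // ltW.
  exact: (mulr_ge0 (mulr_ge0 (mulr_ge0 i1 c00) i2) c00).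
move=> s k P sP PM Pd; set D := (n * s)%N; pose d := \det P.
have sd : (size d <= D.+1)%N by exact: size_det.
pose ds := pstar D d; have sds : (size ds <= D.+1)%N by exact: size_pstar.
pose cC : C := ((c^-1)%:C)%C.
pose x1 : {poly C} := 'X^D - cC *: (d * ds).
have ncC : normc cC = c^-1.
  by rewrite /cC /normc /= expr0n addr0 sqrtr_sqr ger0_norm // invr_ge0 ltW.
have sx1 : (size x1 <= (2 * D).+1)%N.
  apply: leq_trans (size_polyD _ _) _; rewrite geq_max size_polyXn size_polyN.
  apply/andP; split; first by lia.
  apply: leq_trans (size_scale_leq _ _) _; rewrite mul2n -addnn; exact: size_mul_le.
pose G : {poly C} := \sum_(i < k.+1) ('X^D) ^+ (k - i) * x1 ^+ i.
have sG : (size G <= (2 * D * k).+1)%N.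
  apply: leq_trans (size_sum _ _ _) _; apply/bigmax_leqP => i _.
  have sX : (size ('X^D ^+ (k - i) : {poly C})%R <= (D * (k - i)).+1)%N by rewrite -exprM size_polyXn.
  apply: leq_trans (size_mul_le sX (size_expn i sx1)) _.
  by have := ltn_ord i; rewrite ltnS; nia.
pose Z : 'M[{poly C}]_n := (cC *: (ds * G)) *: \adj P.
have key : cC *: (ds * G) * d = 'X^(D * k.+1) - x1 ^+ k.+1.
  rewrite exprM subrXX; have -> : 'X^D - x1 = cC *: (d * ds) by rewrite /x1 opprB addrC subrK.
  by rewrite -!scalerAl; congr (_ *: _); rewrite mulrAC [ds * d]mulrC.
have hdet x : \det (mxev P (zc x)) = d.[zc x] by rewrite det_map_mx.
have dM x : 0 <= x <= 1 -> normc d.[zc x] <= c0.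
  by move=> x01; rewrite -hdet; apply: det_le => i j; exact: PM.
have hds x : normc ds.[zc x] = normc d.[zc x].
  rewrite pstarE // normcM zcX normc_zc mul1r.
  by case: (d.[zc x]) => a b; rewrite /normc /= sqrrN.
have hx1 x : 0 <= x <= 1 -> normc x1.[zc x] <= rho.
  move=> x01; rewrite /x1 hornerD hornerN hornerZ hornerXn hornerM pstarE //.
  set w := d.[zc x].
  have -> : zc x ^+ D - cC * (w * (zc x ^+ D * (w^*)%C)) = zc x ^+ D * (1 - cC * (w * (w^*)%C)) by ring.
  rewrite normcM zcX normc_zc mul1r.
  have -> : w * (w^*)%C = ((normc w ^+ 2)%:C)%C.
    case: w => a b; rewrite /normc sqr_sqrtr ?addr_ge0 ?sqr_ge0 //.
    by apply/eqP; rewrite eq_complex /= mulrN opprK -!expr2 eqxx mulrN mulrC addNr eqxx.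
  have -> : 1 - cC * ((normc w ^+ 2)%:C)%C = ((1 - c^-1 * normc w ^+ 2)%:C)%C.
    rewrite /cC; generalize (normc w ^+ 2) (c^-1) => u v.
    by apply/eqP; rewrite eq_complex /=; apply/andP; split; apply/eqP; ring.
  have w2 : dl ^+ 2 <= normc w ^+ 2.
    by rewrite ler_pXn2r ?nnegrE ?normc_ge0 ?(ltW dl0) // /w -hdet Pd.
  have w3 : normc w ^+ 2 <= c0 ^+ 2 by rewrite ler_pXn2r ?nnegrE ?normc_ge0 ?dM.
  rewrite /normc /= expr0n addr0 sqrtr_sqr ger0_norm.
    by rewrite /rho lerD2l lerN2 mulrC ler_wpM2l // invr_ge0 ltW.
  by rewrite subr_ge0 mulrC ler_pdivrMr // mul1r; apply: le_trans w3 _; rewrite lerDl ltW.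
exists Z, (x1 ^+ k.+1); split.
- rewrite -scalemxAr mul_mx_adj -key; apply/matrixP => i j; rewrite !mxE -mulrnAr.
  by case: (i == j) => //=; rewrite ?mulr1n ?mulr0n ?mulr0.
- rewrite -scalemxAl mul_adj_mx -key; apply/matrixP => i j; rewrite !mxE -mulrnAr.
  by case: (i == j) => //=; rewrite ?mulr1n ?mulr0n ?mulr0.
- split; last by apply: leq_trans (size_expn _ sx1) _; rewrite mulnC.
  move=> i j; rewrite mxE.
  have s1 : (size (cC *: (ds * G))%R <= (D + 2 * D * k).+1)%N.
    by apply: leq_trans (size_scale_leq _ _) _; exact: size_mul_le.
  apply: leq_trans (size_mul_le s1 (size_adj i j sP)) _; rewrite -/D ltnS; clear; nia.
- move=> x i j x01; rewrite !mxE /horner_eval hornerM hornerZ hornerM !normcM ncC hds.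
  have hG : normc G.[zc x] <= c / dl ^+ 2.
    rewrite horner_sum; apply: le_trans (normc_sum_le _ _ _) _.
    apply: (@le_trans _ _ (\sum_(i < k.+1) rho ^+ i)).
      apply: ler_sum => l _; rewrite hornerM !horner_exp hornerX !normcM.
      rewrite -exprM zcX normc_zc mul1r.
      have nX (z : C) m : normc (z ^+ m) = normc z ^+ m.
        by elim: m => [|m IH]; rewrite ?expr0 ?normc_one // !exprS normcM IH.
      by rewrite nX lerXn2r ?nnegrE ?normc_ge0 ?hx1.
    have e : (\sum_(i < k.+1) rho ^+ i) * (1 - rho) = 1 - rho ^+ k.+1.
      by rewrite mulrC -[LHS]opprK -mulNr opprB -subrX1 opprB.
    have r1 : 1 - rho = dl ^+ 2 / c by rewrite /rho; lra.
    rewrite -[c / _]invf_div -[_^-1]mul1r ler_pdivlMr // -r1 e.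
    by have := exprn_ge0 k.+1 cge0; lra.
  have hA : normc ((\adj P) i j).[zc x] <= c0.
    have -> : ((\adj P) i j).[zc x] = (\adj (mxev P (zc x))) i j.
      by rewrite /mxev -map_mx_adj [RHS]mxE.
    by apply: adj_le => // a b; exact: PM.
  rewrite mxE in hA.
  apply: ler_pM; rewrite ?mulr_ge0 ?normc_ge0 ?invr_ge0 ?(ltW cpos) //.
  rewrite -mulrA; apply: ler_wpM2l; rewrite ?invr_ge0 ?(ltW cpos) //.
  by apply: ler_pM; rewrite ?normc_ge0 ?dM.
- move=> x x01; rewrite horner_exp.
  have nX (z : C) m : normc (z ^+ m) = normc z ^+ m.
    by elim: m => [|m IH]; rewrite ?expr0 ?normc_one // !exprS normcM IH.
  by rewrite nX lerXn2r ?nnegrE ?normc_ge0 ?hx1.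
Qed.
End Circle.

(** * Block operators and families of matrices *)

Section Blocks.
Context {R : realType} {p : R} (p1 : 1 <= p) {I : choiceType}.
Local Notation C := R[i].
Local Notation B := (bop I p1).

(** The classes of an equivalence relation, with an enumeration of each. *)
Record classes (n : nat) (cls : I -> seq I) : Prop := Classes {
  cl_uniq : forall i, uniq (cls i);
  cl_self : forall i, i \in cls i;
  cl_eq : forall i j, j \in cls i -> cls j = cls i;
  cl_size : forall i, (size (cls i) <= n)%N }.

Variables (n : nat) (cls : I -> seq I) (hc : classes n cls).

Lemma la_subproof i : (index i (cls i) < n)%N.
Proof. by apply: leq_trans (cl_size hc i); rewrite index_mem (cl_self hc). Qed.
(** The label of a point in its class. *)
Definition la i : 'I_n := Ordinal (la_subproof i).
Definition pt i (a : 'I_n) : option I := onth (cls i) a.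
Definition va i : pred 'I_n := fun a => (a < size (cls i))%N.

Lemma pt_eq i j : j \in cls i -> pt j = pt i. Proof. by move=> h; rewrite /pt (cl_eq hc h). Qed.
Lemma va_eq i j : j \in cls i -> va j = va i. Proof. by move=> h; rewrite /va (cl_eq hc h). Qed.

Lemma onth_in (s : seq I) x0 k : (k < size s)%N -> onth s k = Some (nth x0 s k).
Proof. by move=> h; rewrite onthE (nth_map x0). Qed.

Lemma ptP i a j : (pt i a == Some j) = (j \in cls i) && (la j == a).
Proof.
rewrite /pt; apply/eqP/andP => [h|[jc /eqP <-]].
  have jc : j \in cls i by apply/onthP; exists a.
  split=> //; apply/eqP/val_inj => /=; rewrite (cl_eq hc jc).
  have as_ : (a < size (cls i))%N by rewrite -onthTE h.
  by rewrite -(@onth_nth _ j _ _ _ h) index_uniq // (cl_uniq hc).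
by rewrite /= (cl_eq hc jc) (onth_in j) ?index_mem // nth_index.
Qed.

Lemma pt_la i j : j \in cls i -> pt i (la j) = Some j.
Proof. by move=> h; apply/eqP; rewrite ptP h eqxx. Qed.

Lemma va_pt i a : va i a = (pt i a != None).
Proof. by rewrite /va /pt -onthTE; case: onth. Qed.

Lemma va_la i j : j \in cls i -> va i (la j).
Proof. by move=> h; rewrite va_pt pt_la. Qed.

Lemma pt_inj i i' a b j : (if la i == a then pt i b else None) = Some j ->
  (if la i' == a then pt i' b else None) = Some j -> i = i'.
Proof.
case: eqP => // ia /eqP; rewrite ptP => /andP[ij _]; case: eqP => // ia' /eqP; rewrite ptP => /andP[ij' _].
have e : cls i = cls i' by rewrite -(cl_eq hc ij) -(cl_eq hc ij').
have ii' : i' \in cls i by rewrite e (cl_self hc).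
by have := pt_la ii'; rewrite ia' -ia (pt_la (cl_self hc i)) => -[].
Qed.

(** Multiplication by a function, the zero operator if the function is unbounded. *)
Definition wm (g : I -> C) : B :=
  match pselect (exists c : R, forall i, normc (g i) <= c) with
  | left h => wmul p1 (WFun h) | right _ => 0 end.

Lemma wmE (g : I -> C) (c : R) u i : (forall i, normc (g i) <= c) -> wm g u i = g i * u i.
Proof. by move=> h; rewrite /wm; case: pselect => [h'|[]]; [rewrite wmulE|exists c]. Qed.

Lemma opnorm_wm (g : I -> C) (c : R) : 0 <= c -> (forall i, normc (g i) <= c) -> opnorm (wm g) <= c.
Proof.
by move=> c0 h; rewrite /wm; case: pselect => [h'|[]]; [exact: opnorm_wmul|exists c].
Qed.

Definition fbound (M : I -> 'M[C]_n) (c : R) := forall i a b, normc (M i a b) <= c.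

(** The operator whose restriction to the class of i is the matrix M i. *)
Definition blk (M : I -> 'M[C]_n) : B :=
  \sum_a \sum_b wm (fun i => M i a b) * pull p1 (Pinj (fun i i' => @pt_inj i i' a b)).

Definition oapp_vec (u : ellp I p1) (x : option I) : C := if x is Some j then u j else 0.

Lemma blkE M c u i : fbound M c -> blk M u i = \sum_b M i (la i) b * oapp_vec u (pt i b).
Proof.
move=> hM; rewrite /blk bop_sumE ellp_sumE (bigD1 (la i)) //= [X in _ + X]big1 ?addr0.
  rewrite bop_sumE ellp_sumE; apply: eq_bigr => b _.
  by rewrite bopME (wmE (c := c)) // pullE /= eqxx.
move=> a ai; rewrite bop_sumE ellp_sumE big1 // => b _.
rewrite bopME (wmE (c := c)) // pullE /= eq_sym (negbTE ai) mulr0 //.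
Qed.

Lemma opnorm_blk M c : 0 <= c -> fbound M c -> opnorm (blk M) <= n%:R * (n%:R * c).
Proof.
have hn := bop_bnorm p1 (I := I).
move=> c0 hM; have sumb (f : 'I_n -> B) e : (forall a, opnorm (f a) <= e) -> opnorm (\sum_a f a) <= n%:R * e.
  move=> h; apply: le_trans (nrm_sum hn _ _ _) _.
  by apply: le_trans (ler_sum _ (fun a _ => h a)) _; rewrite sumr_const card_ord mulr_natl.
apply: (sumb) => a; apply: (sumb) => b.
apply: le_trans (opnormM_le _ _) _; rewrite -[c]mulr1; apply: ler_pM; rewrite ?opnorm_ge0 //.
  exact: opnorm_wm.
exact: opnorm_pull.
Qed.

Lemma mcoef_blkM M c (T : B) i j : fbound M c ->
  mcoef (blk M * T) i j = \sum_b M i (la i) b * (if pt i b is Some k then mcoef T k j else 0).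
Proof. by move=> hM; rewrite /mcoef bopME (blkE _ _ hM). Qed.

Lemma mcoef_blk M c i j : fbound M c ->
  mcoef (blk M) i j = if j \in cls i then M i (la i) (la j) else 0.
Proof.
move=> hM; have := mcoef_blkM 1 i j hM; rewrite mulr1 => ->.
case: ifP => ij; last first.
  rewrite big1 // => b _; case E: (pt i b) => [k|]; rewrite ?mulr0 // mcoef1.
  case: eqP => [kj|]; rewrite ?mulr0 //; move/eqP: E; rewrite kj ptP ij //.
rewrite (bigD1 (la j)) //= pt_la // mcoef1 eqxx mulr1 big1 ?addr0 // => b bj.
case E: (pt i b) => [k|]; rewrite ?mulr0 // mcoef1.
case: eqP => [kj|]; rewrite ?mulr0 //; move/eqP: E; rewrite kj ptP ij /= eq_sym (negbTE bj) //.
Qed.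

Definition esupp (T : B) := forall i j, mcoef T i j != 0 -> j \in cls i.

Lemma esupp_blk M c : fbound M c -> esupp (blk M).
Proof. by move=> hM i j; rewrite (mcoef_blk _ _ hM); case: ifP => //; rewrite eqxx. Qed.

Definition mat (T : B) (i : I) : 'M[C]_n :=
  \matrix_(a, b) if pt i a is Some x then (if pt i b is Some y then mcoef T x y else 0) else 0.

Lemma mat_eq T i j : j \in cls i -> mat T j = mat T i.
Proof. by move=> h; apply/matrixP => a b; rewrite !mxE (pt_eq h). Qed.

Lemma mat_bound T : fbound (mat T) (opnorm T).
Proof.
move=> i a b; rewrite mxE; case: pt => [x|]; last by rewrite normc_zero opnorm_ge0.
by case: pt => [y|]; [exact: normc_mcoef|rewrite normc_zero opnorm_ge0].
Qed.

Lemma matB S T i : mat (S - T) i = mat S i - mat T i.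
Proof.
apply/matrixP => a b; rewrite !mxE; case: pt => [x|]; last by rewrite subr0.
by case: pt => [y|]; [exact: mcoefB|rewrite subr0].
Qed.
Lemma matD S T i : mat (S + T) i = mat S i + mat T i.
Proof.
apply/matrixP => a b; rewrite !mxE; case: pt => [x|]; last by rewrite addr0.
by case: pt => [y|]; [exact: mcoefD|rewrite addr0].
Qed.

Lemma mat_la T i j : j \in cls i -> mat T i (la i) (la j) = mcoef T i j.
Proof. by move=> ij; rewrite mxE (pt_la (cl_self hc i)) (pt_la ij). Qed.

Lemma blk_mat T : esupp T -> blk (mat T) = T.
Proof.
move=> hT; apply: mcoef_ext => i j; rewrite (mcoef_blk _ _ (mat_bound T)).
by case: ifP => [ij|ij]; [rewrite mat_la|apply/esym/eqP; apply: contraFT ij; exact: hT].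
Qed.

Definition vam i : 'M[C]_n := \matrix_(a, b) (va i a && (a == b))%:R.

Definition masked i (A : 'M[C]_n) := forall a b, ~~ (va i a && va i b) -> A a b = 0.

Lemma mat_masked T i : masked i (mat T i).
Proof.
move=> a b; rewrite !va_pt mxE; case: pt => [x|] //; case: pt => //.
Qed.

Lemma mat1 i : mat 1 i = vam i.
Proof.
apply/matrixP => a b; rewrite !mxE va_pt; case Ea: (pt i a) => [x|] //=.
move/eqP: Ea; rewrite ptP => /andP[xc /eqP xa].
case Eb: (pt i b) => [y|].
  move/eqP: Eb; rewrite ptP => /andP[yc /eqP yb]; rewrite mcoef1 -xa -yb.
  suff -> : (la x == la y) = (x == y) by [].
  by apply/idP/idP => [/eqP e|/eqP -> //]; have := pt_la xc; rewrite e pt_la // => -[->].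
case: eqP => // ab; have := pt_la xc; by rewrite xa ab Eb.
Qed.

Lemma matM S T i : esupp S -> mat (S * T) i = mat S i *m mat T i.
Proof.
move=> hS; apply/matrixP => a d; rewrite !mxE.
case Ea: (pt i a) => [x|]; last by rewrite big1 // => b _; rewrite mxE Ea mul0r.
move/eqP: (Ea); rewrite ptP => /andP[xc /eqP xa].
case Ed: (pt i d) => [z|]; last first.
  by rewrite big1 // => b _; rewrite [X in _ * X]mxE Ed; case: (pt i b); rewrite mulr0.
rewrite -{1}(blk_mat hS) (mcoef_blkM _ _ _ (mat_bound S)); apply: eq_bigr => b _.
rewrite (mat_eq S xc) xa (pt_eq xc) [X in _ = _ * X]mxE Ed.
by case: (pt i b).
Qed.

Lemma masked_mul i (A : 'M[C]_n) : masked i A -> A *m vam i = A.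
Proof.
move=> hA; apply/matrixP => a b; rewrite mxE (bigD1 b) //= mxE eqxx andbT big1 ?addr0.
  by case vb: (va i b); rewrite ?mulr1 // mulr0 hA // vb andbF.
by move=> d db; rewrite mxE (negbTE db) andbF mulr0.
Qed.

Lemma mat_blk M c i : fbound M c -> (forall j, j \in cls i -> M j = M i) -> masked i (M i) ->
  mat (blk M) i = M i.
Proof.
move=> hM inv msk; apply/matrixP => a b; rewrite mxE.
have := msk a b; rewrite !va_pt; case Ea: (pt i a) => [x|] /= h; last by rewrite h.
case Eb: (pt i b) h => [y|] /= h; last by rewrite h.
move/eqP: (Ea); rewrite ptP => /andP[xc /eqP xa].
move/eqP: (Eb); rewrite ptP => /andP[yc /eqP yb].
by rewrite (mcoef_blk _ _ hM) (cl_eq hc xc) yc inv // xa yb.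
Qed.

Lemma esupp_closed : csub (@opnorm R I p p1) esupp.
Proof.
split; first split.
- by move=> i j; rewrite mcoef0 eqxx.
- move=> S T hS hT i j; rewrite mcoefB; have [->|h _] := eqVneq (mcoef S i j) 0; last exact: hS.
  by rewrite sub0r oppr_eq0; exact: hT.
- move=> S T hS hT i j; apply: contraNT => ij.
  rewrite -(blk_mat hS) (mcoef_blkM _ _ _ (mat_bound S)) big1 // => b _.
  case E: (pt i b) => [k|]; rewrite ?mulr0 //.
  move/eqP: E; rewrite ptP => /andP[kc _].
  have [->|h] := eqVneq (mcoef T k j) 0; first by rewrite mulr0.
  by move: ij; rewrite -(cl_eq hc kc) (hT _ _ h).
- move=> T h i j; apply: contraNT => ij; apply/eqP/eq0_normc; apply: le_anti; rewrite normc_ge0 andbT.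
  apply/ler_addgt0Pr => e e0; rewrite add0r; have [S hS hST] := h e e0.
  have -> : mcoef T i j = mcoef (T - S) i j.
    by rewrite mcoefB; have [->|/hS] := eqVneq (mcoef S i j) 0; [rewrite subr0|rewrite (negbTE ij)].
  exact: le_trans (normc_mcoef _ _ _) hST.
- by move=> i j; rewrite mcoef1; case: (i =P j) => [<- _|_]; [exact: (cl_self hc)|rewrite eqxx].
Qed.
End Blocks.

(** * Laurent polynomials with coefficients in the block operators *)

Section Laurent.
Context {R : realType} {p : R} (p1 : 1 <= p) {I : choiceType}.
Local Notation C := R[i].
Local Notation B := (bop I p1).
Local Notation B2 := (bop (I * int)%type p1).
Variables (n : nat) (cls : I -> seq I) (hc : classes n cls).

Lemma shift_pinj (m : int) (k k' j : int) : Some (k - m) = Some j -> Some (k' - m) = Some j -> k = k'.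
Proof. by move=> [<-] [] /addIr. Qed.

Definition sh (m : int) : B2 := pullK p1 (Pinj (@shift_pinj m)).

Lemma shE m u i k : sh m u (i, k) = u (i, k - m). Proof. by rewrite pullKE. Qed.

Lemma sh0 : sh 0 = 1.
Proof. by apply: bop_ext => u; apply: ellp_ext => -[i k]; rewrite shE subr0. Qed.

Lemma shD m l : sh (m + l) = sh m * sh l.
Proof.
by apply: bop_ext => u; apply: ellp_ext => -[i k]; rewrite bopME !shE opprD addrA.
Qed.

Lemma sh_unit : laurent_unit sh. Proof. by split; [exact: sh0|exact: shD]. Qed.
Lemma opnorm_sh m : opnorm (sh m) <= 1. Proof. exact: opnorm_pull. Qed.
Lemma lift_sh T m : lift T * sh m = sh m * lift T. Proof. exact: lift_pullK. Qed.
Lemma shC m l : sh m * sh l = sh l * sh m. Proof. by rewrite -!shD addrC. Qed.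

Local Notation PM := (I -> 'M[{poly C}]_n).
Implicit Types P Q : PM.

(** A family P of matrices of polynomials, one for each class, is read as a polynomial in
    the shift; the predicates say that P has bounded coefficients, bounded degree, depends
    only on the class, and is supported on the labels of the class. *)
Definition cf P (l : nat) : I -> 'M[C]_n := fun i => \matrix_(a, b) (P i a b)`_l.
Definition pbound P (c : R) := forall i a b l, normc (P i a b)`_l <= c.
Definition psize P s := forall i a b, (size (P i a b) <= s.+1)%N.
Definition pinv P := forall i j, j \in cls i -> P j = P i.
Definition pmask P := forall i a b, ~~ (va cls i a && va cls i b) -> P i a b = 0.

Definition Op s P : B2 := \sum_(l < s.+1) lift (blk p1 hc (cf P l)) * sh (l : nat)%:Z.

Lemma cf_bound P c l : pbound P c -> fbound (cf P l) c.
Proof. by move=> h i a b; rewrite mxE. Qed.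

Lemma opnorm_Op s P c : 0 <= c -> pbound P c -> opnorm (Op s P) <= s.+1%:R * (n%:R * (n%:R * c)).
Proof.
move=> c0 hP; apply: le_trans (nrm_sum (bop_bnorm p1) _ _ _) _.
apply: le_trans (ler_sum _ (_ : forall l : 'I_s.+1, true -> _ <= n%:R * (n%:R * c))) _.
  move=> l _; apply: le_trans (opnormM_le _ _) _; rewrite -[X in _ <= X]mulr1.
  apply: ler_pM; [exact: opnorm_ge0|exact: opnorm_ge0| |exact: opnorm_sh].
  by apply: le_trans (opnorm_lift _) _; apply: opnorm_blk => //; exact: cf_bound.
by rewrite sumr_const card_ord [X in _ <= X]mulr_natl.
Qed.

Definition pc (q : {poly C}) (z : int) : C := if z is Posz d then q`_d else 0.

Lemma pc0 z : pc 0 z = 0. Proof. by case: z => //= d; rewrite coef0. Qed.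
Lemma pcD q r z : pc (q + r) z = pc q z + pc r z.
Proof. by case: z => [d|d] /=; rewrite ?coefD ?addr0. Qed.
Lemma pc_sum (A : Type) (s : seq A) (f : A -> {poly C}) z : pc (\sum_(a <- s) f a) z = \sum_(a <- s) pc (f a) z.
Proof. by elim/big_rec2: _ => [|a x y _ <-]; rewrite ?pc0 ?pcD. Qed.

Lemma pcM (q r : {poly C}) s z : (size q <= s.+1)%N -> pc (q * r) z = \sum_(l < s.+1) q`_l * pc r (z - (l : nat)%:Z).
Proof.
move=> sq; case: z => [d|d] /=; last first.
  by rewrite big1 // => l _; rewrite (_ : Negz d - _ = Negz (d + l)) ?mulr0 //; lia.
rewrite coefM; pose F (l : nat) := q`_l * pc r (d%:Z - l%:Z).
have FE l : (l <= d)%N -> q`_l * r`_(d - l) = F l.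
  by move=> ld; rewrite /F (_ : d%:Z - l%:Z = (d - l)%N%:Z) //; lia.
have F0 l : (d < l)%N -> F l = 0.
  by move=> ld; rewrite /F (_ : d%:Z - l%:Z = Negz (l - d).-1) ?mulr0 //; lia.
have F1 l : (s < l)%N -> F l = 0 by move=> sl; rewrite /F nth_default ?mul0r //; apply: leq_trans sl.
transitivity (\sum_(l < d.+1) F l); first by apply: eq_bigr => l _; apply: FE; rewrite -ltnS.
rewrite -!(big_mkord xpredT F).
have ext a b : (a <= b)%N -> (forall l, (a <= l)%N -> F l = 0) -> \sum_(0 <= l < a) F l = \sum_(0 <= l < b) F l.
  move=> ab z; rewrite [RHS](big_cat_nat (n := a)) //= [X in _ + X]big1_seq ?addr0 // => l.
  by rewrite mem_index_iota => /andP[_ /andP[/z ->]].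
case/orP: (leq_total d.+1 s.+1) => h; first exact: (ext _ _ h F0).
by apply/esym; exact: (ext _ _ h F1).
Qed.

Lemma mcoef_OpM s P c (T : B2) i k y : pbound P c -> mcoef (Op s P * T) (i, k) y =
  \sum_(l < s.+1) \sum_b (P i (la hc i) b)`_l *
    (if pt cls i b is Some j then mcoef T (j, k - (l : nat)%:Z) y else 0).
Proof.
move=> hP; rewrite {1}/mcoef bopME /Op bop_sumE ellp_sumE; apply: eq_bigr => l _.
rewrite bopME liftE /sh slice_pullK (blkE _ _ _ (cf_bound l hP)).
by apply: eq_bigr => b _; rewrite mxE; case: (pt cls i b).
Qed.

Lemma mcoef_Op s P c i k j m : pbound P c -> psize P s -> mcoef (Op s P) (i, k) (j, m) =
  if j \in cls i then pc (P i (la hc i) (la hc j)) (k - m) else 0.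
Proof.
move=> hP sP; rewrite -[Op s P]mulr1 (mcoef_OpM _ _ _ _ _ hP) exchange_big /=.
have E b : \sum_(l < s.+1) (P i (la hc i) b)`_l *
    (if pt cls i b is Some j0 then mcoef 1 (j0, k - (l : nat)%:Z) (j, m) else 0) =
    if pt cls i b == Some j then pc (P i (la hc i) b) (k - m) else 0.
  case: (pt cls i b) => [x|]; last by rewrite big1 // => l _; rewrite mulr0.
  have -> : (Some x == Some j) = (x == j) by [].
  case: (x =P j) => [<-|xj]; last first.
    rewrite big1 // => l _; rewrite mcoef1 xpair_eqE; case: (x =P j) => //= _; exact: mulr0.
  rewrite -[P i (la hc i) b in RHS]mulr1 (pcM _ _ (sP _ _ _)); apply: eq_bigr => l _.
  rewrite mcoef1 xpair_eqE eqxx /=; congr (_ * _).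
  rewrite /pc; case e: (k - m - l%:Z) => [d|d]; last by case: eqP => // h; lia.
  rewrite coef1; suff -> : (k - (l : nat)%:Z == m) = (d == 0)%N by [].
  by apply/eqP/eqP => h; lia.
under eq_bigr do rewrite E ptP //.
case: ifP => ij; last by rewrite big1 // => b _; rewrite ij.
rewrite (bigD1 (la hc j)) //= eqxx big1 ?addr0 // => b bj.
by rewrite eq_sym (negbTE bj).
Qed.

Lemma pboundD P Q c c' : pbound P c -> pbound Q c' -> pbound (fun i => P i + Q i) (c + c').
Proof.
by move=> hP hQ i a b l; rewrite mxE coefD; apply: le_trans (le_normcD _ _) _; apply: lerD.
Qed.

Lemma pboundM P Q s c c' : 0 <= c -> 0 <= c' -> psize P s -> pbound P c -> pbound Q c' ->
  pbound (fun i => P i *m Q i) (n%:R * (s.+1%:R * (c * c'))).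
Proof.
move=> c0 c'0 sP hP hQ i a b l; rewrite mxE coef_sum -[n in n%:R]card_ord.
apply: (@normc_sum_const _ _ (fun j => (P i a j * Q i j b)`_l)) => j.
rewrite -[_`_l]/(pc _ l%:Z) (pcM _ _ (sP _ _ _)) -[s.+1 in X in _ <= X]card_ord.
apply: (@normc_sum_const _ _ (fun t : 'I_s.+1 => (P i a j)`_t * pc (Q i j b) (l%:Z - t%:Z))) => t.
rewrite normcM; apply: ler_pM; rewrite ?normc_ge0 //.
by case: (_ - _) => [d|d] /=; rewrite ?normc_zero.
Qed.

Lemma psizeM P Q s s' : psize P s -> psize Q s' -> psize (fun i => P i *m Q i) (s + s').
Proof.
move=> hP hQ i a b; rewrite mxE; apply: leq_trans (size_sum _ _ _) _.
by apply/bigmax_leqP => j _; exact: size_mul_le.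
Qed.

Lemma psizeD P Q s : psize P s -> psize Q s -> psize (fun i => P i + Q i) s.
Proof.
by move=> hP hQ i a b; rewrite mxE; apply: leq_trans (size_polyD _ _) _; rewrite geq_max hP hQ.
Qed.

Lemma OpD s P Q c c' : pbound P c -> pbound Q c' -> psize P s -> psize Q s ->
  Op s (fun i => P i + Q i) = Op s P + Op s Q.
Proof.
move=> hP hQ sP sQ; apply: mcoef_ext => -[i k] [j m]; rewrite mcoefD.
rewrite (mcoef_Op _ _ _ _ (pboundD hP hQ) (psizeD sP sQ)) (mcoef_Op _ _ _ _ hP sP) (mcoef_Op _ _ _ _ hQ sQ).
by case: ifP; rewrite ?addr0 // mxE pcD.
Qed.

(** Evaluation at the shift is multiplicative, since the shift commutes with the blocks. *)
Lemma OpM s s' P Q c c' : 0 <= c -> 0 <= c' -> pbound P c -> pbound Q c' -> psize P s -> psize Q s' ->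
  pinv Q -> pmask Q -> Op s P * Op s' Q = Op (s + s') (fun i => P i *m Q i).
Proof.
move=> c0 c'0 hP hQ sP sQ iQ mQ; apply: mcoef_ext => -[i k] [j m].
rewrite (mcoef_OpM _ _ _ _ _ hP) (mcoef_Op _ _ _ _ (pboundM c0 c'0 sP hP hQ) (psizeM sP sQ)).
rewrite exchange_big /= mxE.
have E b : \sum_(l < s.+1) (P i (la hc i) b)`_l *
    (if pt cls i b is Some j0 then mcoef (Op s' Q) (j0, k - (l : nat)%:Z) (j, m) else 0) =
    if j \in cls i then pc (P i (la hc i) b * Q i b (la hc j)) (k - m) else 0.
  case Eb: (pt cls i b) => [x|]; last first.
    rewrite big1 => [|l _]; last by rewrite mulr0.
    case: ifP => // _; rewrite mQ ?mulr0 ?pc0 // va_pt //; by rewrite Eb.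
  move/eqP: Eb; rewrite (ptP hc) => /andP[xc /eqP xb].
  case: ifP => ij; last first.
    rewrite big1 // => l _; rewrite (mcoef_Op _ _ _ _ hQ sQ) (cl_eq hc xc) ij mulr0 //.
  rewrite (pcM _ _ (sP _ _ _)); apply: eq_bigr => l _.
  rewrite (mcoef_Op _ _ _ _ hQ sQ) (cl_eq hc xc) ij (iQ _ _ xc) xb.
  by congr (_ * pc _ _); lia.
under eq_bigr do rewrite E.
by case: ifP => ij; [rewrite pc_sum|rewrite big1].
Qed.

Lemma Op_widen s s' P c : (s <= s')%N -> pbound P c -> psize P s -> Op s' P = Op s P.
Proof.
move=> ss hP sP; have sP' : psize P s' by move=> i a b; apply: leq_trans (sP i a b) _.
by apply: mcoef_ext => -[i k] [j m]; rewrite (mcoef_Op _ _ _ _ hP sP) (mcoef_Op _ _ _ _ hP sP').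
Qed.

Definition vamp i : 'M[{poly C}]_n := \matrix_(a, b) (va cls i a && (a == b))%:R.

Lemma psizeX m : psize (fun i => 'X^m *: vamp i) m.
Proof.
move=> i a b; rewrite !mxE; case: (_ && _); rewrite ?mulr0 ?size_poly0 // mulr1 size_polyXn //.
Qed.
Lemma pboundX m : pbound (fun i => 'X^m *: vamp i) 1.
Proof.
move=> i a b l; rewrite !mxE; case: (_ && _); rewrite ?mulr0 ?coef0 ?normc_zero // mulr1 coefXn.
by case: eqP; rewrite ?normc_one ?normc_zero.
Qed.
Lemma vamp_mask i (A : 'M[{poly C}]_n) : (forall a b, ~~ (va cls i a && va cls i b) -> A a b = 0) ->
  A *m vamp i = A /\ vamp i *m A = A.
Proof.
move=> hA; split; apply/matrixP => a b; rewrite mxE.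
  rewrite (bigD1 b) //= mxE eqxx andbT big1 ?addr0.
    by case vb: (va cls i b); rewrite ?mulr1 // mulr0 hA // vb andbF.
  by move=> d db; rewrite mxE (negbTE db) andbF mulr0.
rewrite (bigD1 a) //= mxE eqxx andbT big1 ?addr0.
  by case vb: (va cls i a); rewrite ?mul1r // mul0r hA // vb.
by move=> d db; rewrite mxE eq_sym (negbTE db) andbF mul0r.
Qed.

Lemma OpX m : Op m (fun i => 'X^m *: vamp i) = sh m%:Z.
Proof.
apply: mcoef_ext => -[i k] [j l]; rewrite (mcoef_Op _ _ _ _ (pboundX m) (psizeX m)).
rewrite /sh mcoef_pullK /= !mxE.
case: ifP => ij; last by case: eqP => // e; rewrite e (cl_self hc) in ij.
rewrite (va_la hc (cl_self hc i)) /=.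
have -> : (la hc i == la hc j) = (i == j).
  apply/idP/idP => [/eqP e|/eqP -> //]; have := pt_la hc ij; rewrite -e (pt_la hc (cl_self hc i)).
  by move=> -[->].
case: (i =P j) => _ /=; last by rewrite mulr0 pc0.
rewrite mulr1 /pc; have -> : (Some (k - m%:Z) == Some l) = (k - m%:Z == l) by [].
case e: (k - l) => [d|d]; last by case: eqP => // h; lia.
by rewrite coefXn; congr (_%:R); congr nat_of_bool; apply/eqP/eqP => h; lia.
Qed.
End Laurent.

Section Scalars.
Context {R : realType} {p : R} (p1 : 1 <= p).
Local Notation C := R[i].

Lemma scal_bound (I : choiceType) (z : C) : exists c : R, forall i : I, normc z <= c.
Proof. by exists (normc z). Qed.

Definition scal (I : choiceType) (z : C) : bop I p1 := wmul p1 (WFun (scal_bound I z)).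

Lemma scalE (I : choiceType) (z : C) u i : scal I z u i = z * u i.
Proof. by rewrite /scal wmulE. Qed.

Lemma opnorm_scal (I : choiceType) (z : C) : opnorm (scal I z) <= normc z.
Proof. by apply: opnorm_wmul => //; exact: normc_ge0. Qed.

Lemma scalB (I : choiceType) (z w : C) : scal I (z - w) = scal I z - scal I w.
Proof. by apply: bop_ext => u; apply: ellp_ext => i; rewrite bopBE ellpBE !scalE mulrBl. Qed.
Lemma scalM (I : choiceType) (z w : C) : scal I (z * w) = scal I z * scal I w.
Proof. by apply: bop_ext => u; apply: ellp_ext => i; rewrite bopME !scalE mulrA. Qed.
Lemma scal1 (I : choiceType) : scal I 1 = 1.
Proof. by apply: bop_ext => u; apply: ellp_ext => i; rewrite scalE mul1r. Qed.
Lemma scalZ (I : choiceType) (z : C) u : scal I z u = z *: u.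
Proof. by apply: ellp_ext => i; rewrite scalE ellpZE. Qed.
Lemma scalC (I : choiceType) (z : C) (T : bop I p1) : scal I z * T = T * scal I z.
Proof. by apply: bop_ext => u; rewrite !bopME !scalZ linearZ. Qed.
Lemma mcoef_scal (I : choiceType) (z : C) (T : bop I p1) i j : mcoef (scal I z * T) i j = z * mcoef T i j.
Proof. by rewrite /mcoef bopME scalE. Qed.
End Scalars.

Section Representation.
Context {R : realType} {p : R} (p1 : 1 <= p) {I : choiceType}.
Local Notation C := R[i].
Local Notation B := (bop I p1).
Local Notation B2 := (bop (I * int)%type p1).
Variables (n : nat) (cls : I -> seq I) (hc : classes n cls).
Local Notation sh := (@sh R p p1 I).
Local Notation scal := (scal p1 I).
Local Notation mat := (@mat R p p1 I n cls).
Local Notation Op := (Op p1 hc).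
Local Notation vamp := (@vamp R I n cls).
Local Notation vam := (@vam R I n cls).

(** G is the symbol of S, a Laurent polynomial of degree at most d in the shift. *)
Definition Rep (d : nat) (S : B2) (G : R -> B) : Prop := (forall x, esupp cls (G x)) /\
  exists (P : I -> 'M[{poly C}]_n) (c : R),
  [/\ 0 <= c, pbound P c, pinv cls P, pmask cls P & psize P (2 * d)] /\
  (S = Op (2 * d) P * sh (- d%:Z) /\
   forall x i, zc x ^+ d *: mat (G x) i = mxev (P i) (zc x)).

Let hE := esupp_closed p1 hc.

Lemma mxev_vamp i (z : C) : mxev (vamp i) z = vam i.
Proof.
by apply/matrixP => a b; rewrite !mxE /horner_eval; case: (_ && _); rewrite ?hornerC ?horner0.
Qed.

Lemma mat_scal z T i : mat (scal z * T) i = z *: mat T i.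
Proof.
apply/matrixP => a b; rewrite !mxE; case: pt => [x|]; last by rewrite mulr0.
by case: pt => [y|]; rewrite ?mulr0 // mcoef_scal.
Qed.

Lemma esupp_scal z : esupp cls (scal z).
Proof.
move=> i j; rewrite -[scal z]mulr1 mcoef_scal mcoef1; case: (i =P j) => [<- _|_].
  exact: (cl_self hc).
by rewrite mulr0 eqxx.
Qed.

Lemma pmaskX m : pmask cls (fun i => 'X^m *: vamp i).
Proof.
move=> i a b h; rewrite !mxE; case: (a =P b) => [e|_]; last by rewrite andbF mulr0.
by move: h; rewrite e andbb => /negbTE ->; rewrite mulr0.
Qed.
Lemma pinvX m : pinv cls (fun i => 'X^m *: vamp i).
Proof. by move=> i j h; congr (_ *: _); apply/matrixP => a b; rewrite !mxE (va_eq hc h). Qed.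

Lemma Rep_const T : esupp cls T -> Rep 0 (lift T) (fun=> T).
Proof.
move=> hT; split=> //.
exists (fun i => map_mx polyC (mat T i)), (opnorm T); split; [split|split].
- exact: opnorm_ge0.
- move=> i a b l; rewrite mxE coefC; case: eqP => _; first exact: mat_bound.
  by rewrite normc_zero opnorm_ge0.
- by move=> i j h; rewrite (mat_eq hc _ h).
- by move=> i a b h; rewrite mxE mat_masked.
- by move=> i a b; rewrite mxE; exact: size_polyC_leq1.
- rewrite oppr0 sh0 mulr1 /Op big_ord_recl big_ord0 addr0 sh0 mulr1; congr lift.
  rewrite -[LHS](blk_mat hc hT); congr (blk p1 hc _); apply/funext => i.
  by apply/matrixP => a b; rewrite !mxE coefC.
- move=> x i; rewrite expr0 scale1r; apply/matrixP => a b.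
  by rewrite !mxE /horner_eval hornerC.
Qed.

Lemma Rep_t : Rep 1 (sh 1) (fun x => scal (zc x)).
Proof.
split; first by move=> x; exact: esupp_scal.
exists (fun i => 'X^2 *: vamp i), 1; split; [split|split] => //.
- exact: pboundX.
- exact: pinvX.
- exact: pmaskX.
- exact: psizeX.
- by rewrite OpX -shD.
- move=> x i; rewrite expr1 -[scal _]mulr1 mat_scal (mat1 p1 hc) scalerA.
  rewrite -[X in _ = X](_ : zc x ^+ 2 *: mxev (vamp i) (zc x) = _); last first.
    by apply/matrixP => a b; rewrite !mxE /horner_eval hornerM hornerXn.
  by rewrite mxev_vamp expr2.
Qed.

Lemma Rep_t' : Rep 1 (sh (-1)) (fun x => scal (zc (- x))).
Proof.
split; first by move=> x; exact: esupp_scal.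
exists (fun i => 'X^0 *: vamp i), 1; split; [split|split] => //.
- exact: pboundX.
- exact: pinvX.
- exact: pmaskX.
- by move=> i a b; apply: leq_trans (psizeX _ _ _ _ _) _.
- by rewrite (Op_widen p1 hc (s := 0) (c := 1)) ?OpX ?sh0 ?mul1r //; [exact: pboundX|exact: psizeX].
- move=> x i; rewrite expr1 -[scal _]mulr1 mat_scal (mat1 p1 hc) scalerA -zcV divff ?zc_neq0 //.
  by rewrite expr0 !scale1r mxev_vamp.
Qed.

Lemma Rep_mono d d' S G : (d <= d')%N -> Rep d S G -> Rep d' S G.
Proof.
move=> dd [hG [P [c [[c0 hP iP mP sP] [-> ev]]]]]; split=> //.
pose X i : 'M[{poly C}]_n := 'X^(d' - d) *: vamp i.
pose Q i := X i *m P i.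
have l01 : 0 <= 1 :> R by [].
have hX := pboundX cls (d' - d) : pbound X 1.
have sX := @psizeX R I n cls (d' - d) : psize X (d' - d).
exists Q, (n%:R * ((d' - d).+1%:R * (1 * c))); split; [split|split].
- by rewrite !mulr_ge0 ?ler0n.
- rewrite /Q; by apply: pboundM => //.
- by move=> i j h; rewrite /Q /X (pinvX _ h) (iP _ _ h).
- move=> i a b h; rewrite /Q /X -scalemxAl (vamp_mask (mP i)).2 mxE mP ?mulr0 //.
- by move=> i a b; apply: leq_trans (psizeM sX sP _ _ _) _; lia.
- have -> : Op (2 * d') Q = Op (d' - d + 2 * d) Q.
    apply: (Op_widen p1 hc _ (pboundM p1 l01 c0 sX hX hP) (psizeM sX sP)); lia.
  rewrite -(OpM p1 hc l01 c0 hX hP sX sP iP mP) OpX.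
  rewrite [sh _ * Op _ _](_ : _ = Op (2 * d) P * sh (d' - d)%N%:Z); last first.
    rewrite /Op mulr_suml mulr_sumr; apply: eq_bigr => l _.
    by rewrite mulrA -lift_sh -!mulrA shC.
  by rewrite -mulrA -shD; congr (_ * sh _); lia.
- move=> x i; rewrite /Q /X -scalemxAl (vamp_mask (mP i)).2.
  have -> : mxev ('X^(d' - d) *: P i) (zc x) = zc x ^+ (d' - d) *: mxev (P i) (zc x).
    by apply/matrixP => a b; rewrite !mxE /horner_eval hornerM hornerXn.
  by rewrite -ev scalerA -exprD subnK.
Qed.

Lemma RepD d S S' G G' : Rep d S G -> Rep d S' G' -> Rep d (S + S') (fun x => G x + G' x).
Proof.
move=> [hG [P [c [[c0 hP iP mP sP] [-> ev]]]]] [hG' [P' [c' [[c0' hP' iP' mP' sP'] [-> ev']]]]].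
split; first by move=> x; apply: (csD hE); [exact: hG|exact: hG'].
exists (fun i => P i + P' i), (c + c'); split; [split|split].
- exact: addr_ge0.
- exact: pboundD.
- by move=> i j h; rewrite (iP _ _ h) (iP' _ _ h).
- by move=> i a b h; rewrite mxE (mP _ _ _ h) (mP' _ _ _ h) addr0.
- exact: psizeD.
- by rewrite (OpD p1 hc hP hP' sP sP') mulrDl.
- by move=> x i; rewrite matD scalerDr ev ev' /mxev map_mxD.
Qed.

Lemma Op_sh s P m : Op s P * sh m = sh m * Op s P.
Proof.
rewrite /Op mulr_suml mulr_sumr; apply: eq_bigr => l _.
by rewrite [RHS]mulrA -lift_sh -!mulrA shC.
Qed.

Lemma RepM d d' S S' G G' : Rep d S G -> Rep d' S' G' -> Rep (d + d') (S * S') (fun x => G x * G' x).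
Proof.
move=> [hG [P [c [[c0 hP iP mP sP] [-> ev]]]]] [hG' [P' [c' [[c0' hP' iP' mP' sP'] [-> ev']]]]].
split; first by move=> x; apply: (csM hE); [exact: hG|exact: hG'].
exists (fun i => P i *m P' i), (n%:R * ((2 * d).+1%:R * (c * c'))); split; [split|split].
- by rewrite !mulr_ge0 ?ler0n.
- exact: (pboundM p1 c0 c0' sP hP hP').
- by move=> i j h; rewrite (iP _ _ h) (iP' _ _ h).
- move=> i a b h; rewrite mxE big1 // => k _.
  by move: h; rewrite negb_and => /orP[h|h]; [rewrite (mP i a k) ?mul0r // (negbTE h)|rewrite (mP' i k b) ?mulr0 // (negbTE h) andbF].
- by rewrite mulnDr; exact: psizeM.
- rewrite mulnDr -(OpM p1 hc c0 c0' hP hP' sP sP' iP' mP').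
  rewrite -!mulrA; congr (_ * _); rewrite mulrA -Op_sh -!mulrA -shD; congr (_ * sh _).
  by rewrite PoszD opprD.
- move=> x i; rewrite matM // exprD mxevM -ev -ev' -scalemxAl -scalemxAr scalerA //.
Qed.

Lemma RepN d S G : Rep d S G -> Rep d (- S) (fun x => - G x).
Proof.
move=> h; have := RepM (Rep_const (csN hE (cs1 hE))) h.
rewrite liftN lift1 mulN1r; rewrite (_ : (fun x => -1 * G x) = (fun x => - G x)) //.
by apply/funext => x; rewrite mulN1r.
Qed.

Lemma RepB d S S' G G' : Rep d S G -> Rep d S' G' -> Rep d (S - S') (fun x => G x - G' x).
Proof. by move=> h /RepN; exact: RepD. Qed.

Lemma Rep1 : Rep 0 1 (fun=> 1).
Proof. by have := Rep_const (cs1 hE); rewrite lift1. Qed.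

Lemma Rep_newton d S G : Rep d S G -> Rep (3 * d) (newton S) (fun x => newton (G x)).
Proof.
move=> h; have h2 : Rep (d + d) (S * S - S) (fun x => G x * G x - G x).
  by apply: RepB; [exact: RepM|apply: Rep_mono h; lia].
rewrite /newton; apply: RepB; first by apply: Rep_mono h; lia.
apply: RepB; last by apply: Rep_mono h2; lia.
by have := RepM (RepD h h) h2; apply: Rep_mono; lia.
Qed.

Lemma Rep_newton_it d S G k : Rep d S G -> Rep (3 ^ k * d) (newton_it S k) (fun x => newton_it (G x) k).
Proof.
move=> h; elim: k => [|k IH]; first by rewrite expn0 mul1n.
by rewrite expnS -mulnA; exact: Rep_newton IH.
Qed.
End Representation.

(** * Transport of idempotents and frames *)

Section Transport.
Context {R : realType} {B : pzRingType} (nrm : B -> R) (hn : bnorm nrm).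

(** Along a Lipschitz path of idempotents, all of them are conjugate to the first one,
    with a bound that depends on the Lipschitz constant only. *)
Lemma transport (C L : R) : 0 <= C -> 0 <= L -> exists2 T : R, 1 <= T &
  forall (D : B -> Prop) (Q : R -> B), csub nrm D ->
    (forall x, 0 <= x <= 1 -> [/\ D (Q x), Q x * Q x = Q x & nrm (Q x) <= C]) ->
    (forall x y, 0 <= x <= 1 -> 0 <= y <= 1 -> nrm (Q x - Q y) <= L * `|x - y|) ->
  forall x, 0 <= x <= 1 -> exists S S' : B, [/\ D S, D S', S * S' = 1, S' * S = 1 & S * Q 0 = Q x * S]
    /\ nrm S <= T /\ nrm S' <= T.
Proof.
move=> C0 L0; pose N := (Num.bound (4 * C * L)).+1.
have N0 : 0 < N%:R :> R by rewrite ltr0n.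
have hN : 4 * C * L <= N%:R.
  apply: ltW; apply: lt_le_trans (archi_boundP _) _; first by rewrite !mulr_ge0.
  by rewrite ler_nat leqnSn.
exists (3 ^+ N); first by rewrite exprn_ege1 // ler1n.
move=> D Q hD hQ lQ.
have step x y : 0 <= x <= 1 -> 0 <= y <= 1 -> `|x - y| <= N%:R^-1 -> exists z z' : B,
    [/\ D z, D z', z * z' = 1, z' * z = 1 & z * Q x = Q y * z] /\ nrm z <= 3 /\ nrm z' <= 3.
  move=> x01 y01 xy; have [Dx ix nx] := hQ x x01; have [Dy iy ny] := hQ y y01.
  have sm : 4 * (C * nrm (Q x - Q y)) <= 1.
    have h1 : nrm (Q x - Q y) <= L * N%:R^-1.
      by apply: le_trans (lQ _ _ x01 y01) _; apply: ler_wpM2l.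
    have h2 : C * nrm (Q x - Q y) <= C * (L * N%:R^-1) by apply: ler_wpM2l.
    apply: (@le_trans _ _ (4 * C * L * N%:R^-1)); first by move: h2; lra.
    by rewrite ler_pdivrMr // mul1r.
  have [z [z' [[Dz Dz' zz' z'z] [zq zn zn']]]] := close_idem hn hD Dx Dy ix iy nx ny sm.
  exists z, z'; split=> //.
  have n1 := nrm1 hn; have t1 := nrm_tri hn z 1; have t2 := nrm_tri hn z' 1.
  by split; move: sm zn zn' n1 t1 t2; lra.
have main k : (k <= N)%N -> forall x, 0 <= x <= k%:R / N%:R -> exists S S' : B,
    [/\ D S, D S', S * S' = 1, S' * S = 1 & S * Q 0 = Q x * S] /\ nrm S <= 3 ^+ k /\ nrm S' <= 3 ^+ k.
  elim: k => [|k IH] kN x /andP[x0 xk].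
    have -> : x = 0 by apply: le_anti; rewrite x0 andbT; move: xk; rewrite mul0r.
    exists 1, 1; rewrite !mulr1 !mul1r; split; last by rewrite expr0; split; exact: nrm1.
    by split=> //; exact: (cs1 hD).
  have [xk'|xk'] := leP x (k%:R / N%:R).
    have [|S [S' [h [n1 n2]]]] := IH (ltnW kN) x; first by rewrite x0.
    exists S, S'; split=> //; split; [apply: le_trans n1 _|apply: le_trans n2 _];
      by rewrite exprS ler_peMl ?exprn_ge0 // ler1n.
  have kN1 : k%:R / N%:R <= 1 :> R by rewrite ler_pdivrMr // mul1r ler_nat ltnW.
  have k0 : 0 <= k%:R / N%:R :> R by rewrite divr_ge0 ?ler0n.
  have kN2 : k.+1%:R / N%:R <= 1 :> R by rewrite ler_pdivrMr // mul1r ler_nat.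
  have [|S [S' [[DS DS' SS' S'S SQ] [n1 n2]]]] := IH (ltnW kN) (k%:R / N%:R); first by rewrite k0 /=.
  have [|||z [z' [[Dz Dz' zz' z'z zq] [zn zn']]]] := step (k%:R / N%:R) x.
  - by rewrite k0.
  - by rewrite x0 (le_trans xk).
  - rewrite distrC ger0_norm ?subr_ge0 ?(ltW xk') //.
    by rewrite lerBlDr; apply: le_trans xk _; rewrite -addn1 natrD mulrDl mul1r addrC.
  exists (z * S), (S' * z'); split; [split|split].
  - exact: (csM hD).
  - exact: (csM hD).
  - by rewrite -mulrA [S * (S' * _)]mulrA SS' mul1r.
  - by rewrite -mulrA [z' * (z * _)]mulrA z'z mul1r.
  - by rewrite -mulrA SQ mulrA zq mulrA.
  - apply: le_trans (nrmM hn _ _) _; rewrite exprS; apply: ler_pM => //; exact: (nrm_ge0 hn).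
  - apply: le_trans (nrmM hn _ _) _; rewrite exprSr; apply: ler_pM => //; exact: (nrm_ge0 hn).
by move=> x x01; apply: (main N) => //; rewrite divff // gt_eqF.
Qed.

(** If q is an idempotent and this element is invertible, it conjugates P to q. *)
Definition frm (q b P : B) : B := q * b * P + (1 - q) * b * (1 - P).

Lemma frm_dist (f q b P : B) : nrm P <= 1 ->
  nrm (frm f b P - frm q b P) <= 3 * (nrm (f - q) * nrm b).
Proof.
move=> P1; have -> : frm f b P - frm q b P = (f - q) * b * P - (f - q) * b * (1 - P).
  by rewrite /frm; ncring.
apply: le_trans (nrmB hn _ _) _.
have n0 := nrm_ge0 hn; have h0 := nrmM hn (f - q) b.
have n1P : nrm (1 - P) <= 2.
  by apply: le_trans (nrmB hn _ _) _; have := nrm1 hn; move: P1; lra.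
have h1 : nrm ((f - q) * b * P) <= nrm (f - q) * nrm b * 1.
  by apply: le_trans (nrmM hn _ _) _; apply: ler_pM.
have h2 : nrm ((f - q) * b * (1 - P)) <= nrm (f - q) * nrm b * 2.
  by apply: le_trans (nrmM hn _ _) _; apply: ler_pM.
by move: h1 h2; lra.
Qed.

Lemma frm_norm (f b P : B) (c : R) : nrm P <= 1 -> nrm f <= c -> nrm (frm f b P) <= (3 * c + 2) * nrm b.
Proof.
move=> P1 fc; have -> : frm f b P = (frm f b P - frm 0 b P) + b * (1 - P).
  by rewrite /frm; ncring.
apply: le_trans (nrmD hn _ _) _; have := frm_dist f 0 b P1; rewrite subr0 => h.
have n0 := nrm_ge0 hn.
have n1P : nrm (1 - P) <= 2.
  by apply: le_trans (nrmB hn _ _) _; have := nrm1 hn; move: P1; lra.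
have h1 : nrm (b * (1 - P)) <= nrm b * 2 by apply: le_trans (nrmM hn _ _) _; apply: ler_pM.
have h2 : nrm f * nrm b <= c * nrm b by apply: ler_wpM2r.
by move: h h1 h2; lra.
Qed.

Lemma frm_conj (f b P : B) : P * P = P -> nrm P <= 1 ->
  nrm (frm f b P * P - f * frm f b P) <= 3 * (nrm (f * f - f) * nrm b).
Proof.
move=> PP P1; have -> : frm f b P * P - f * frm f b P = - (frm (f * f) b P - frm f b P) +
    (f * b * (P * P - P) + (1 - f) * b * (P - P * P)) by rewrite /frm; ncring.
by rewrite PP !subrr !mulr0 !addr0 (nrm_N hn); exact: frm_dist.
Qed.
End Transport.

Lemma pad_frame_ring (B : pzRingType) (q b P v : B) : q * v = q -> v * b = b -> b * v = b -> v * P = P ->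
  q * (b + (1 - v)) * P + (1 - q) * (b + (1 - v)) * (1 - P) =
  q * b * P + (v - q) * b * (v - P) + (1 - v).
Proof.
move=> qv vb bv vP.
have -> : q * (b + (1 - v)) * P = q * b * P + q * (P - v * P) by ncring.
have -> : (1 - q) * (b + (1 - v)) * (1 - P) =
  b - q * b - b * P + q * b * P + (1 - v) - (P - v * P) + (q - q * v) * P - (q - q * v) + q * (v * P - v * P) by ncring.
have -> : (v - q) * b * (v - P) = (v * b) * v - (v * b) * P - q * (b * v) + q * b * P by ncring.
by rewrite vP vb bv qv !subrr; ncring.
Qed.

Lemma pad_mul_ring (B : pzRingType) (x y v : B) : x * v = x -> v * y = y -> v * v = v ->
  (x + (1 - v)) * (y + (1 - v)) = x * y + (1 - v).
Proof.
move=> xv vy vv; have -> : (x + (1 - v)) * (y + (1 - v)) =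
  x * y + (x - x * v) + (y - v * y) + (1 - v) - (v - v * v) by ncring.
by rewrite xv vy vv !subrr; ncring.
Qed.

Section PaddedFrames.
Context {R : realType} {p : R} (p1 : 1 <= p) {I : choiceType}.
Local Notation C := R[i].
Local Notation B := (bop I p1).
Variables (n : nat) (cls : I -> seq I) (hc : classes n cls) (A : pred I).
Local Notation mat := (@mat R p p1 I n cls).
Local Notation vam := (@vam R I n cls).
Local Notation Pi := (chi p1 A).

(** Classes with fewer than n points are completed by the identity matrix, so that all
    determinants are of size n. *)
Definition pad i (M : 'M[C]_n) : 'M[C]_n := M + (1%:M - vam i).

Definition pit i : pred 'I_n := fun a => if pt cls i a is Some x then A x else false.

Lemma vamK i : vam i *m vam i = vam i.
Proof.
apply: masked_mul => a b h; rewrite mxE; case: (a =P b) => [e|_]; last by rewrite andbF.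
by move: h; rewrite e andbb => /negbTE ->.
Qed.

Lemma masked_mull i (M : 'M[C]_n) : masked cls i M -> vam i *m M = M.
Proof.
move=> hM; apply/matrixP => a b; rewrite mxE (bigD1 a) //= mxE eqxx andbT big1 ?addr0.
  by case vb: (va cls i a); rewrite ?mul1r // mul0r hM // vb.
by move=> d db; rewrite mxE eq_sym (negbTE db) andbF mul0r.
Qed.

Lemma mat_chi i : mat Pi i = \matrix_(a, b) (pit i a && (a == b))%:R.
Proof.
apply/matrixP => a b; rewrite !mxE /pit; case Ea: (pt cls i a) => [x|] //=.
move/eqP: Ea; rewrite (ptP hc) => /andP[xc /eqP xa].
case Eb: (pt cls i b) => [y|]; last first.
  by case: (a =P b) => [e|]; rewrite ?andbF //; move: Eb; rewrite -e -xa (pt_la hc xc).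
move/eqP: Eb; rewrite (ptP hc) => /andP[yc /eqP yb]; rewrite mcoef_chi -xa -yb.
suff -> : (la hc x == la hc y) = (x == y) by [].
by apply/idP/idP => [/eqP e|/eqP -> //]; have := pt_la hc xc; rewrite e (pt_la hc yc) => -[->].
Qed.

Lemma esupp_chi : esupp cls Pi.
Proof.
move=> i j; rewrite mcoef_chi; case: (i =P j) => [<- _|_]; first exact: (cl_self hc).
by rewrite andbF eqxx.
Qed.

Lemma frame_mxE (Q M : 'M[C]_n) (pi : pred 'I_n) (D : 'M[C]_n) :
    D = \matrix_(a, b) (pi a && (a == b))%:R ->
  frame_mx Q pi M = Q *m M *m D + (1%:M - Q) *m M *m (1%:M - D).
Proof.
move=> ->; apply/matrixP => a b; rewrite !mxE.
have dg (N : 'M[C]_n) (g : 'I_n -> C) (E : 'M[C]_n) : (forall c d, E c d = if c == d then g d else 0) ->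
    \sum_j N a j * E j b = N a b * g b.
  move=> hE; rewrite (bigD1 b) //= hE eqxx big1 ?addr0 // => j jb.
  by rewrite hE (negbTE jb) mulr0.
rewrite (dg _ (fun d => (pi d)%:R)); last first.
  by move=> c d; rewrite !mxE; case: (c =P d) => [->|_]; rewrite ?andbT ?andbF.
rewrite (dg _ (fun d => (~~ pi d)%:R)); last first.
  move=> c d; rewrite !mxE; case: (c =P d) => [->|_]; rewrite ?andbT ?andbF ?subrr ?subr0 //.
  by case: (pi d); rewrite ?subrr ?subr0.
rewrite !mxE; case: (pi b); rewrite ?mulr1 ?mulr0 ?addr0 ?add0r //.
by apply: eq_bigr => k _; rewrite !mxE.
Qed.

(** The frame of a class is the matrix of a block operator. *)
Lemma frame_pad (q b : B) i : esupp cls q -> esupp cls b ->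
  frame_mx (mat q i) (pit i) (pad i (mat b i)) = pad i (mat (frm q b Pi) i).
Proof.
have hE := esupp_closed p1 hc; have E1 := cs1 hE; have EP := esupp_chi.
move=> hq hb; rewrite (frame_mxE _ _ (mat_chi i)) /frm.
rewrite !matD !(matM hc) //; try by do ?[apply: (csM hE)|apply: (csB hE)].
rewrite !matB (mat1 p1 hc).
set q' := mat q i; set b' := mat b i; set P := mat Pi i; set v := vam i.
have vq : v *m q' = q' by apply: masked_mull; exact: mat_masked.
have qv : q' *m v = q' by apply: masked_mul; exact: mat_masked.
have vb : v *m b' = b' by apply: masked_mull; exact: mat_masked.
have bv : b' *m v = b' by apply: masked_mul; exact: mat_masked.
have vP : v *m P = P by apply: masked_mull; exact: mat_masked.
have Pv : P *m v = P by apply: masked_mul; exact: mat_masked.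
have vv : v *m v = v by exact: vamK.
exact: (pad_frame_ring qv vb bv vP).
Qed.

Lemma pad_mul i (M N : 'M[C]_n) : masked cls i M -> masked cls i N -> pad i M *m pad i N = pad i (M *m N).
Proof.
move=> hM hN; have Mv := masked_mul hM; have vN := masked_mull hN; have vv := vamK i.
exact: (pad_mul_ring Mv vN vv).
Qed.

Lemma pad_padded i (M : 'M[C]_n) : masked cls i M -> padded (va cls i) (pad i M).
Proof.
move=> hM k j kj; rewrite /pad mxE hM // add0r !mxE.
case: (k =P j) => [e|_]; last by rewrite andbF subrr.
by move: kj; rewrite e andbb => /negbTE ->; rewrite subr0.
Qed.

Lemma padded_pad i (M : 'M[C]_n) : padded (va cls i) M ->
  exists2 N, masked cls i N & M = pad i N.
Proof.
move=> hM; exists (M - (1%:M - vam i)); last by rewrite /pad subrK.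
move=> a b h; rewrite !mxE hM //; case: (a =P b) => [e|_]; last by rewrite andbF !subr0.
by move: h; rewrite e andbb => /negbTE ->; rewrite subr0 subrr.
Qed.

Lemma pad_bound i (M : 'M[C]_n) (c : R) : masked cls i M -> 1 <= c -> (forall a b, normc (M a b) <= c) ->
  forall a b, normc (pad i M a b) <= c.
Proof.
move=> hM c1 Mc a b; case E: (va cls i a && va cls i b); last first.
  rewrite (pad_padded hM (negbT E)); case: (a == b); rewrite ?normc_one ?normc_zero //.
  by move: c1; lra.
have -> : pad i M a b = M a b; last exact: Mc.
move/andP: E => [Ea _]; rewrite /pad !mxE Ea /=.
by case: (a == b); rewrite subrr addr0.
Qed.
End PaddedFrames.

(** * Loops of block idempotents are trivial *)

Section LoopFrame.
Context {R : realType} {p : R} (p1 : 1 <= p) {I : choiceType}.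
Local Notation C := R[i].
Local Notation B := (bop I p1).
Variables (n : nat) (cls : I -> seq I) (hc : classes n cls) (A : pred I).
Local Notation mat := (@mat R p p1 I n cls).
Local Notation Pi := (chi p1 A).
Let hE := esupp_closed p1 hc.
Let hn := bop_bnorm p1 (I := I).

(** One block operator serves as a frame for the whole loop. Transport along the loop gives
    a frame at each point, with a uniform bound on its determinant; frame_exists then gives
    a common one in each class, with bounds that do not depend on the class. *)
Lemma frame_op (Cq L : R) (Q : R -> B) : 1 <= Cq -> 0 <= L ->
    (forall x, 0 <= x <= 1 -> [/\ esupp cls (Q x), Q x * Q x = Q x & opnorm (Q x) <= Cq]) ->
    (forall x y, 0 <= x <= 1 -> 0 <= y <= 1 -> opnorm (Q x - Q y) <= L * `|x - y|) ->
    Q 0 = Pi ->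
  exists (b : B) (dl : R), [/\ 0 < dl, esupp cls b &
    forall x i, 0 <= x <= 1 -> dl <= normc (\det (pad cls i (mat (frm (Q x) b Pi) i)))].
Proof.
move=> C1 L0 hQ lQ Q0; have C0 : 0 <= Cq by move: C1; lra.
have [T T1 hT] := transport hn C0 L0.
pose S0 := Cq + T + 2; have S2 : 2 <= S0 by rewrite /S0; move: C0 T1; lra.
have S1 : 1 <= S0 by move: S2; lra.
have CS : Cq <= S0 by rewrite /S0; move: T1; lra.
have TS : T <= S0 by rewrite /S0; move: C0; lra.
pose d0 := (n`!)%:R * S0 ^+ n.
have d00 : 0 < d0 by rewrite mulr_gt0 ?ltr0n ?fact_gt0 // exprn_gt0 //; move: S1; lra.
have c0 : 0 < d0^-1 by rewrite invr_gt0.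
have [dl dl0 fr] := @frame_exists R n d0^-1 L S0 c0 L0 S2.
have ex i : exists M : 'M[C]_n, [/\ padded (va cls i) M, (forall k j, normc (M k j) <= S0) &
    forall x, 0 <= x <= 1 -> dl <= normc (\det (frame_mx (mat (Q x) i) (pit cls A i) M))].
  apply: fr.
  - move=> x k j x01; have [_ _ hx] := hQ x x01.
    by apply: le_trans (mat_bound _ _ _ _ _) _; apply: le_trans hx CS.
  - move=> x y k j x01 y01.
    have -> : mat (Q x) i k j - mat (Q y) i k j = mat (Q x - Q y) i k j by rewrite matB !mxE.
    by apply: le_trans (mat_bound _ _ _ _ _) _; exact: lQ.
  - move=> x x01; have [Ex Qx nx] := hQ x x01.
    have [S [S' [[ES ES' SS' S'S SQ] [nS nS']]]] := hT (esupp cls) Q hE hQ lQ x x01.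
    have mS : masked cls i (mat S i) by exact: mat_masked.
    have mS' : masked cls i (mat S' i) by exact: mat_masked.
    have bS a b : normc (pad cls i (mat S i) a b) <= S0.
      by apply: pad_bound => // k l; apply: le_trans (mat_bound _ _ _ _ _) _; apply: le_trans nS TS.
    have bS' a b : normc (pad cls i (mat S' i) a b) <= S0.
      by apply: pad_bound => // k l; apply: le_trans (mat_bound _ _ _ _ _) _; apply: le_trans nS' TS.
    exists (pad cls i (mat S i)); split=> //; first exact: pad_padded.
    rewrite (frame_pad hc A i Ex ES).
    have -> : frm (Q x) S Pi = S.
      rewrite Q0 in SQ; rewrite /frm.
      have -> : Q x * S * Pi + (1 - Q x) * S * (1 - Pi) =
         S + (Q x * S * Pi - S * Pi) + (Q x * S * Pi - Q x * S) by ncring.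
      by rewrite -SQ -mulrA chi_idem !subrr !addr0.
    have dd : \det (pad cls i (mat S i)) * \det (pad cls i (mat S' i)) = 1.
      rewrite -det_mulmx pad_mul // -(matM hc) // SS' (mat1 p1 hc) /pad addrC subrK; exact: det1.
    have dS' : normc (\det (pad cls i (mat S' i))) <= d0 by exact: det_le.
    rewrite -[d0^-1]mul1r ler_pdivrMr //.
    rewrite -(normc_one (R := R)) -dd normcM; apply: ler_wpM2l => //; exact: normc_ge0.
pose good (Qm : R -> 'M[C]_n) (pi vi : pred 'I_n) := [set M : 'M[C]_n |
  [/\ padded vi M, (forall k j, normc (M k j) <= S0) &
    forall x, 0 <= x <= 1 -> dl <= normc (\det (frame_mx (Qm x) pi M))]].
pose Bf i := xget 0 (good (fun x => mat (Q x) i) (pit cls A i) (va cls i)).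
have hB i : good (fun x => mat (Q x) i) (pit cls A i) (va cls i) (Bf i).
  by have [M hM] := ex i; exact: (@xgetPex _ 0 (good _ _ _)) (ex_intro _ M hM).
have iB i j : j \in cls i -> Bf j = Bf i.
  move=> h; have e1 : (fun x => mat (Q x) j) = (fun x => mat (Q x) i).
    by apply/funext => x; rewrite (mat_eq hc _ h).
  have e2 : pit cls A j = pit cls A i :> pred 'I_n.
    by apply/funext => a; rewrite /pit (pt_eq hc h).
  by rewrite /Bf e1 e2 (va_eq hc h).
pose N i := Bf i - (1%:M - vam n cls i).
have mN i : masked cls i (N i) /\ Bf i = pad cls i (N i).
  split; last by rewrite /pad subrK.
  have [pB _ _] := hB i; have [N' mN' e] := padded_pad pB.
  by rewrite /N e /pad addrK.
have bN : fbound N (S0 + 2).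
  move=> i a b; rewrite /N mxE; apply: le_trans (le_normcD _ _) _; have [_ h _] := hB i.
  apply: lerD => //; rewrite mxE normcN mxE; apply: le_trans (le_normcD _ _) _.
  have b1 (x : bool) : normc (x%:R : C) <= 1 by case: x; rewrite ?normc_one ?normc_zero.
  by rewrite [X in _ + normc X]mxE normcN !mxE; have := b1 (a == b); have := b1 (va cls i a && (a == b)); lra.
have iN i j : j \in cls i -> N j = N i.
  move=> h; rewrite /N (iB _ _ h); have -> // : vam n cls j = vam n cls i :> 'M[C]_n.
  by apply/matrixP => a b; rewrite !mxE (va_eq hc h).
have EN : esupp cls (blk p1 hc N) by apply: esupp_blk bN.
exists (blk p1 hc N), dl; split=> // x i x01; have [Ex _ _] := hQ x x01.
rewrite -(frame_pad hc A i Ex EN) (mat_blk _ _ bN) //; last exact: (mN i).1.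
  by rewrite -(mN i).2; have [_ _] := hB i; apply.
by move=> j h; exact: iN.
Qed.
End LoopFrame.

Lemma pow_le {R : realType} (x y : R) k : 0 <= x -> x <= y -> x ^+ k <= y ^+ k.
Proof. by move=> x0 xy; apply: lerXn2r; rewrite ?nnegrE //; exact: le_trans xy. Qed.

Lemma sum3_le {R : realType} (a b c w : R) : 0 <= a -> 0 <= b -> 0 <= c -> 0 <= w ->
  (a + b + c) * w <= 1 -> [/\ a * w <= 1, b * w <= 1 & c * w <= 1].
Proof.
move=> a0 b0 c0 w0 h; have := mulr_ge0 a0 w0; have := mulr_ge0 b0 w0; have := mulr_ge0 c0 w0.
by split; lra.
Qed.

Lemma half_le {R : realType} (a b : R[i]) (e dl : R) : normc (a - b) <= e -> e <= dl / 2 ->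
  dl <= normc a -> dl / 2 <= normc b.
Proof.
move=> h1 h2 h3; have : normc a <= normc b + normc (a - b).
  by rewrite -[X in normc X <= _](subrK b) addrC; exact: le_normcD.
by lra.
Qed.

Lemma pad_det_lip {R : realType} {p : R} (p1 : 1 <= p) {I : choiceType} (n : nat)
    (cls : I -> seq I) (hc : classes n cls) i (S T : bop I p1) (M e : R) :
    1 <= M -> opnorm S <= M -> opnorm T <= M -> opnorm (S - T) <= e ->
  normc (\det (pad cls i (@mat R p p1 I n cls S i)) - \det (pad cls i (@mat R p p1 I n cls T i))) <=
    (n`!)%:R * (n%:R * M ^+ n) * e.
Proof.
move=> M1 SM TM ST; apply: det_lip => //.
- move=> a b; apply: pad_bound => //; first exact: mat_masked.
  by move=> u v; apply: le_trans (mat_bound _ _ _ _ _) SM.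
- move=> a b; apply: pad_bound => //; first exact: mat_masked.
  by move=> u v; apply: le_trans (mat_bound _ _ _ _ _) TM.
move=> a b; have := @mat_bound R p p1 I n cls (S - T) i a b; rewrite matB.
move: (@mat R p p1 I n cls S i) (@mat R p p1 I n cls T i) => m1 m2.
rewrite mxE [X in normc (_ + X)]mxE /pad [X in _ -> normc (X - _) <= _]mxE [X in _ -> normc (_ - X) <= _]mxE => h.
have -> : m1 a b + (1%:M - vam n cls i) a b - (m2 a b + (1%:M - vam n cls i) a b) = m1 a b - m2 a b.
  by ring.
exact: le_trans h ST.
Qed.

(** After k Newton steps the degree is multiplied by 3^k, and the remainder of the inverse
    is made small by a number of terms that is linear in k. *)
Lemma size_growth (n d a k : nat) :
  ((2 * (n * (2 * (3 ^ k * d))) * (a * k.+1)).+1 <= (8 * (n * n * d * a)).+1 * 6 ^ k)%N.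
Proof.
have e6 : (6 ^ k = 2 ^ k * 3 ^ k)%N by rewrite -expnMn.
have h : (k.+1 * 3 ^ k <= 6 ^ k)%N by rewrite e6 leq_mul2r ltn_expl // orbT.
have p6 : (0 < 6 ^ k)%N by rewrite expn_gt0.
have nn : (n <= n * n)%N by case: n => // n; rewrite leq_pmulr.
have -> : (2 * (n * (2 * (3 ^ k * d))) * (a * k.+1) = 4 * (n * d * a) * (k.+1 * 3 ^ k))%N by lia.
have nda : (n * d * a <= n * n * d * a)%N by rewrite -!(mulnA _ d); exact: leq_mul.
set t := (8 * _)%N; have -> : (t.+1 * 6 ^ k = t * 6 ^ k + 6 ^ k)%N by rewrite mulSn addnC.
rewrite -[X in (X <= _)%N]addn1; apply: leq_add => //.
apply: leq_trans (leq_mul (leq_mul (leqnn 4) nda) h) _.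
by rewrite leq_mul2r /t leq_mul2r !orbT.
Qed.

Lemma pow_small {R : realType} (rho e : R) : 0 <= rho -> rho < 1 -> 0 < e -> exists a, rho ^+ a <= e.
Proof.
move=> r0 r1 e0; have [->|rn] := eqVneq rho 0; first by exists 1%N; rewrite expr1 ltW.
have rp : 0 < rho by rewrite lt_def rn.
pose t := rho^-1 - 1; have t0 : 0 < t by rewrite /t subr_gt0 invf_gt1.
have bern a : 1 + a%:R * t <= rho^-1 ^+ a.
  elim: a => [|a IH]; first by rewrite mul0r addr0 expr0.
  rewrite exprS; have rt : rho^-1 = 1 + t by rewrite /t; ring.
  have a0 : 0 <= a%:R * t by rewrite mulr_ge0 ?ler0n ?ltW.
  have : (1 + t) * (1 + a%:R * t) <= (1 + t) * rho^-1 ^+ a.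
    by apply: ler_wpM2l => //; move: t0; lra.
  rewrite -rt; apply: le_trans; rewrite rt -addn1 natrD.
  have : 0 <= t * (a%:R * t) by rewrite mulr_ge0 // ltW.
  lra.
pose a := Num.bound (e^-1 / t); exists a.
have ha : e^-1 / t < a%:R by rewrite archi_boundP // divr_ge0 ?invr_ge0 ?ltW.
rewrite -[rho ^+ a]invrK -exprVn -[e]invrK lef_pV2 ?posrE ?invr_gt0 ?exprn_gt0 ?invr_gt0 //.
apply: le_trans (bern a); move: ha; rewrite ltr_pdivrMr // => ha; move: ha; lra.
Qed.

Ltac olra := repeat match goal with |- context [@opnorm ?r ?x ?p ?q ?t] =>
  let u := fresh "u" in generalize (@opnorm r x p q t) => u end; clear; intros; lra.

Section Loops.
Context {R : realType} {p : R} (p1 : 1 <= p) {I : choiceType}.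
Local Notation C := R[i].
Local Notation B := (bop I p1).
Local Notation B2 := (bop (I * int)%type p1).
Variables (n : nat) (cls : I -> seq I) (hc : classes n cls) (A : pred I).
Local Notation mat := (@mat R p p1 I n cls).
Local Notation Pi := (chi p1 A).
Local Notation Op := (Op p1 hc).
Local Notation sh := (@sh R p p1 I).
Local Notation vamp := (@vamp R I n cls).
Let hE := esupp_closed p1 hc.
Let hn := bop_bnorm p1 (I := I).
Let hn2 := bop_bnorm p1 (I := (I * int)%type).

Variable D : B2 -> Prop.
Hypotheses (hD : csub (@opnorm R _ p p1) D) (hDl : forall T : B, esupp cls T -> D (lift T))
  (hDs : forall m, D (sh m)).

Lemma D_Op s (P : I -> 'M[{poly C}]_n) c : pbound P c -> D (Op s P).
Proof.
move=> hP; apply: (cs_sum hD) => l _; apply: (csM hD) => //; apply: hDl.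
by apply: esupp_blk; exact: cf_bound hP.
Qed.

(** Operators with an invertible symbol are invertible up to a small remainder. *)
Lemma rep_inverse (d : nat) (S : B2) (G : R -> B) (M dl C1 rho : R) (k : nat) :
    1 <= M -> 0 <= C1 -> 0 <= rho -> Rep hc d S G ->
    (forall x, 0 <= x <= 1 -> opnorm (G x) <= M) ->
    (forall x i, 0 <= x <= 1 -> dl <= normc (\det (pad cls i (mat (G x) i)))) ->
    (forall s k (P : 'M[{poly C}]_n), (forall i j, (size (P i j) <= s.+1)%N) ->
      (forall x i j, 0 <= x <= 1 -> normc (mxev P (zc x) i j) <= M) ->
      (forall x, 0 <= x <= 1 -> dl <= normc (\det (mxev P (zc x)))) ->
      exists (Z : 'M[{poly C}]_n) (X1 : {poly C}),
      [/\ P *m Z = ('X^(n * s * k.+1) - X1)%:M, Z *m P = ('X^(n * s * k.+1) - X1)%:M,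
        (forall i j, (size (Z i j) <= (2 * (n * s) * k.+1).+1)%N) /\
          (size X1 <= (2 * (n * s) * k.+1).+1)%N,
        forall x i j, 0 <= x <= 1 -> normc (mxev Z (zc x) i j) <= C1 &
        forall x, 0 <= x <= 1 -> normc X1.[zc x] <= rho ^+ k.+1]) ->
  let sz := (2 * (n * (2 * d)) * k.+1)%N in
  exists Z e e' : B2, [/\ D Z, S * Z = 1 - e, Z * S = 1 - e',
    opnorm Z <= sz.+1%:R * (n%:R * (n%:R * C1)) &
    opnorm e <= sz.+1%:R * (n%:R * (n%:R * rho ^+ k.+1)) /\
    opnorm e' <= sz.+1%:R * (n%:R * (n%:R * rho ^+ k.+1))].
Proof.
move=> M1 C10 rho0 [EG [P [c [[c0 hP iP mP sP] [SE ev]]]]] GM dG inv sz.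
pose v := vamp.
have vP i : P i *m v i = P i /\ v i *m P i = P i := vamp_mask (mP i).
have vv i : v i *m v i = v i.
  have := @pmaskX R I n cls 0 i; rewrite expr0 scale1r => h; exact: (vamp_mask h).1.
pose Pt i := P i + 'X^d *: (1%:M - v i).
have evPt x i : mxev (Pt i) (zc x) = zc x ^+ d *: pad cls i (mat (G x) i).
  apply/matrixP => a b; have := congr1 (fun M : 'M[C]_n => M a b) (ev x i).
  rewrite [LHS]mxE [RHS]mxE /horner_eval => eab.
  rewrite [LHS]mxE [RHS]mxE /pad [X in _ = _ * X]mxE mulrDr eab /horner_eval /Pt.
  rewrite [X in X.[_] = _]mxE hornerD; congr (_ + _).
  rewrite !mxE hornerM hornerXn; congr (_ * _).
  by case: (a == b); case: (va cls i a); rewrite /= ?hornerE.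
have nz x m : normc (zc x ^+ m) = 1 by rewrite zcX normc_zc.
have nG x i : 0 <= x <= 1 -> forall a b, normc (mxev (Pt i) (zc x) a b) <= M.
  move=> x01 a b; rewrite evPt mxE normcM nz mul1r; apply: pad_bound => //.
    exact: mat_masked.
  by move=> k' l'; apply: le_trans (mat_bound _ _ _ _ _) _; exact: GM.
have dP x i : 0 <= x <= 1 -> dl <= normc (\det (mxev (Pt i) (zc x))).
  move=> x01; rewrite evPt detZ normcM -exprM nz mul1r; exact: dG.
have sPt i a b : (size (Pt i a b) <= (2 * d).+1)%N.
  rewrite /Pt mxE; apply: leq_trans (size_polyD _ _) _; rewrite geq_max sP /=.
  rewrite !mxE; case: (a == b); case: (va cls i a); rewrite /= ?subrr ?subr0 ?mulr0 ?mulr1 ?size_poly0 //.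
    by rewrite size_polyXn; lia.
pose good (P0 : 'M[{poly C}]_n) := [set ZX : 'M[{poly C}]_n * {poly C} |
  [/\ P0 *m ZX.1 = ('X^(n * (2 * d) * k.+1) - ZX.2)%:M, ZX.1 *m P0 = ('X^(n * (2 * d) * k.+1) - ZX.2)%:M,
     (forall i j, (size (ZX.1 i j) <= sz.+1)%N) /\ (size ZX.2 <= sz.+1)%N,
     forall x i j, 0 <= x <= 1 -> normc (mxev ZX.1 (zc x) i j) <= C1 &
     forall x, 0 <= x <= 1 -> normc ZX.2.[zc x] <= rho ^+ k.+1]].
pose F P0 := xget (0, 0) (good P0).
have hF i : good (Pt i) (F (Pt i)).
  have [Z [X1 h]] := inv (2 * d)%N k (Pt i) (sPt i) (fun x a b x01 => nG x i x01 a b) (fun x => dP x i).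
  exact: (@xgetPex _ (0, 0) (good _)) (ex_intro _ (Z, X1) h).
have iv i j : j \in cls i -> v j = v i.
  by move=> h; apply/matrixP => a b; rewrite !mxE (va_eq hc h).
have iPt i j : j \in cls i -> Pt j = Pt i by move=> h; rewrite /Pt (iP _ _ h) (iv _ _ h).
pose Z i := v i *m (F (Pt i)).1 *m v i; pose X1 i := (F (Pt i)).2 *: v i.
pose N := (n * (2 * d) * k.+1)%N.
have PtP i : Pt i *m v i = P i /\ v i *m Pt i = P i.
  have [h1 h2] := vP i; rewrite /Pt mulmxDl mulmxDr h1 h2 -scalemxAl -scalemxAr.
  by rewrite mulmxBl mulmxBr mul1mx mulmx1 vv subrr scaler0 addr0.
have PZ i : P i *m Z i = 'X^N *: v i + - X1 i.
  have [h1 _ _ _ _] := hF i; have [Pv vPt] := PtP i.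
  rewrite /Z !mulmxA (vP i).1 -{1}vPt -!mulmxA [Pt i *m (_ *m _)]mulmxA h1.
  rewrite mul_scalar_mx -scalemxAr vv scalerBl //.
have ZP i : Z i *m P i = 'X^N *: v i + - X1 i.
  have [_ h1 _ _ _] := hF i; have [Pv vPt] := PtP i.
  rewrite /Z -!mulmxA (vP i).2 -{1}Pv [(F (Pt i)).1 *m _]mulmxA h1.
  by rewrite mul_scalar_mx -scalemxAr vv scalerBl.
have Zv i a b : Z i a b = if va cls i a && va cls i b then (F (Pt i)).1 a b else 0.
  rewrite /Z mxE (bigD1 b) //= big1 ?addr0; last first.
    by move=> l lb; rewrite [X in _ * X]mxE (negbTE lb) andbF mulr0.
  rewrite [X in _ * X]mxE eqxx andbT mxE (bigD1 a) //= big1 ?addr0; last first.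
    by move=> l la; rewrite [X in X * _]mxE eq_sym (negbTE la) andbF mul0r.
  rewrite [X in X * _ * _]mxE eqxx andbT.
  by case: (va cls i a); case: (va cls i b); rewrite ?mul1r ?mulr1 ?mul0r ?mulr0.
have bZ : pbound Z C1.
  move=> i a b l; rewrite Zv; case: ifP => _; last by rewrite coef0 normc_zero.
  have [_ _ _ h _] := hF i; apply: coef_bound => x x01.
  by have := h x a b x01; rewrite mxE.
have bX : pbound X1 (rho ^+ k.+1).
  move=> i a b l; have [_ _ _ _ h] := hF i; rewrite /X1 !mxE.
  case: (_ && _); rewrite ?mulr1 ?mulr0 ?coef0 ?normc_zero ?exprn_ge0 //.
  exact: coef_bound.
have sZ : psize Z sz.
  by move=> i a b; rewrite Zv; case: ifP => _; [have [_ _ [h _] _ _] := hF i; exact: h|rewrite size_poly0].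
have sX : psize X1 sz.
  move=> i a b; have [_ _ [_ h] _ _] := hF i; rewrite /X1 !mxE.
  by case: (_ && _); rewrite ?mulr1 ?mulr0 ?size_poly0.
have iZ : pinv cls Z by move=> i j h; rewrite /Z (iPt _ _ h) (iv _ _ h).
have mZ : pmask cls Z by move=> i a b h; rewrite Zv (negbTE h).
have bNX : pbound (fun i => - X1 i) (rho ^+ k.+1) by move=> i a b l; rewrite mxE coefN normcN.
have sNX : psize (fun i => - X1 i) sz by move=> i a b; rewrite mxE size_polyN.
have rk0 : 0 <= rho ^+ k.+1 by rewrite exprn_ge0.
pose e := Op sz (fun i => - X1 i).
have ne : opnorm e <= sz.+1%:R * (n%:R * (n%:R * rho ^+ k.+1)) by apply: opnorm_Op.
have Nsz : (N <= 2 * d + sz)%N by rewrite /N /sz; lia.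
have bNv : pbound (fun i => 'X^N *: v i) 1 by exact: pboundX.
have sNv := @psizeX R I n cls N.
have total (W : I -> 'M[{poly C}]_n) : (forall i, W i = 'X^N *: v i + - X1 i) ->
    Op (2 * d + sz) W = sh N%:Z + e.
  move=> hW; have -> : W = fun i => 'X^N *: v i + - X1 i by apply/funext.
  rewrite (OpD p1 hc bNv bNX); last 2 first.
  - by move=> i a b; apply: leq_trans (sNv i a b) _.
  - by move=> i a b; apply: leq_trans (sNX i a b) _; lia.
  rewrite (Op_widen p1 hc Nsz bNv sNv) OpX; congr (_ + _).
  by apply: (Op_widen p1 hc _ bNX sNX); lia.
have PZop : Op (2 * d) P * Op sz Z = sh N%:Z + e.
  by rewrite (OpM p1 hc c0 C10 hP bZ sP sZ iZ mZ); exact: total.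
have ZPop : Op sz Z * Op (2 * d) P = sh N%:Z + e.
  by rewrite (OpM p1 hc C10 c0 bZ hP sZ sP iP mP) addnC; exact: total.
have ee m : opnorm (- (e * sh m)) <= sz.+1%:R * (n%:R * (n%:R * rho ^+ k.+1)).
  rewrite opnormN; apply: le_trans (opnormM_le _ _) _; rewrite -[X in _ <= X]mulr1.
  by apply: ler_pM; [exact: opnorm_ge0|exact: opnorm_ge0|exact: ne|exact: opnorm_sh].
exists (Op sz Z * sh (d%:Z - N%:Z)), (- (e * sh (- N%:Z))), (- (e * sh (- N%:Z))); split.
- by apply: (csM hD); [exact: D_Op bZ|exact: hDs].
- rewrite SE -!mulrA [sh _ * (Op _ _ * _)]mulrA -Op_sh -!mulrA -shD mulrA PZop mulrDl -shD opprK.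
  have -> : - d%:Z + (d%:Z - N%:Z) = - N%:Z by lia.
  by rewrite subrr sh0.
- rewrite SE -!mulrA [sh _ * (Op _ _ * _)]mulrA -Op_sh -!mulrA -shD mulrA ZPop mulrDl -shD opprK.
  have -> : d%:Z - N%:Z + - d%:Z = - N%:Z by lia.
  by rewrite subrr sh0.
- apply: le_trans (opnormM_le _ _) _; rewrite -[X in _ <= X]mulr1.
  by apply: ler_pM; [exact: opnorm_ge0|exact: opnorm_ge0|exact: opnorm_Op|exact: opnorm_sh].
- by split; exact: ee.
Qed.
End Loops.

(** A Laurent polynomial with block coefficients that is almost an idempotent, and whose
    symbol starts at a coordinate projection, is close to a conjugate of this projection.
    The conjugating element is the frame of a Newton iterate of S. The number k of steps is
    chosen last: the defect of the iterate and the remainder of the inverse of the frame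
    decay like 12^-k, while the number of terms of that inverse grows like 6^k. *)
Lemma loop_trivial {R : realType} {p : R} (p1 : 1 <= p) {I : choiceType} (n : nat)
    (cls : I -> seq I) (hc : classes n cls) (A : pred I) (D : bop (I * int)%type p1 -> Prop)
    (Cq L h : R) (d : nat) (S : bop (I * int)%type p1) (G : R -> bop I p1) :
    csub (@opnorm R _ p p1) D -> (forall T : bop I p1, esupp cls T -> D (lift T)) ->
    (forall m, D (sh p1 m)) ->
    1 <= Cq -> 0 <= L -> 0 < h -> 48 * (2 * Cq + 3) * h <= 1 -> Rep hc d S G ->
    opnorm S <= Cq -> opnorm (S * S - S) <= h ->
    (forall x, 0 <= x <= 1 -> opnorm (G x) <= Cq /\ opnorm (G x * G x - G x) <= h) ->
    (forall x y, 0 <= x <= 1 -> 0 <= y <= 1 -> opnorm (G x - G y) <= L * `|x - y|) ->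
    G 0 = chi p1 A ->
  exists Y Y' : bop (I * int)%type p1, [/\ D Y, D Y', Y * Y' = 1, Y' * Y = 1 &
    opnorm (Y * lift (chi p1 A) * Y' - S) <= (4 * (2 * Cq + 3) + 1) * h].
Proof.
move=> hD hDl hDs; pose B := bop I p1; pose B2 := bop (I * int)%type p1; 
have hE := esupp_closed p1 hc; have hn := bop_bnorm p1 (I := I); have hn2 := bop_bnorm p1 (I := (I * int)%type).
move=> C1 L0 h0 hs hR SC Sh hG lG G0.
pose c3 := 2 * Cq + 3; have hs' : 48 * c3 * h <= 1 by [].
have c35 : 5 <= c3 by rewrite /c3; move: C1; olra.
have c30 : 0 < c3 by move: c35; olra.
pose r := (12 * c3)^-1.
have r0 : 0 <= r by rewrite invr_ge0 mulr_ge0 // ltW.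
have r12 : r <= 12^-1 by rewrite /r lef_pV2 ?posrE ?mulr_gt0 //; move: c35; olra.
have hr : 4 * h <= r.
  rewrite /r -[X in _ <= X]mul1r ler_pdivlMr ?mulr_gt0 //; move: hs'; olra.
have cr : c3 * r <= 1.
  rewrite /r mulrC ler_pdivrMl ?mulr_gt0 // mulr1; move: c30; olra.
have c3h : 2 * c3 * h <= 4^-1 by move: hs'; olra.
have rk0 k : 0 <= r ^+ k by rewrite exprn_ge0.
have rk1 k : r ^+ k <= 1 by rewrite exprn_ile1 //; move: r12; olra.
have rk2 k : r ^+ k <= 12^-1 ^+ k by exact: pow_le.
have rhalf k : r ^+ k <= 2^-1 ^+ k.
  by apply: pow_le => //; apply: le_trans r12 _; olra.
have cp0 : 0 <= 2 * c3 * h by rewrite !mulr_ge0 // ltW.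
(* the exact idempotents *)
have exQ x : 0 <= x <= 1 -> exists q, [/\ esupp cls q, q * q = q, q * G x = G x * q &
    forall k, opnorm (q - newton_it (G x) k) <= 2 * c3 * h * r ^+ k].
  move=> x01; have [gC gh] := hG x x01.
  have g4 : 4 * opnorm (G x * G x - G x) <= r by apply: le_trans hr; rewrite ler_wpM2l.
  have [q [qq qG qk]] := newton_lim hn gC C1 g4 cr.
  have qk' k : opnorm (q - newton_it (G x) k) <= 2 * c3 * h * r ^+ k.
    apply: le_trans (qk k) _; apply: ler_wpM2r => //; apply: ler_wpM2l => //.
    by rewrite mulr_ge0 // ltW.
  exists q; split=> //; apply: (cs_lim hE (T := newton_it (G x)) (C := 2 * c3 * h)).
    by apply: newton_it_in; [exact: hE|case: hR => h1 _; exact: h1].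
  by move=> k; apply: le_trans (qk' k) _; apply: ler_wpM2l.
have [Q hQ] : exists Q : R -> B, forall x, 0 <= x <= 1 -> [/\ esupp cls (Q x), Q x * Q x = Q x,
    Q x * G x = G x * Q x & forall k, opnorm (Q x - newton_it (G x) k) <= 2 * c3 * h * r ^+ k].
  pose W x := [set q : B | [/\ esupp cls q, q * q = q, q * G x = G x * q &
    forall k, opnorm (q - newton_it (G x) k) <= 2 * c3 * h * r ^+ k]].
  exists (fun x => xget 0 (W x)) => x /exQ[q hq].
  exact: (@xgetPex _ 0 (W x)) (ex_intro _ q hq).
have near x : 0 <= x <= 1 -> opnorm (Q x - G x) <= 4^-1.
  by move=> /hQ[_ _ _ /(_ 0%N)]; rewrite expr0 mulr1 => h1; apply: le_trans h1 c3h.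
have C2 : 1 <= Cq + 1 by move: C1; olra.
have QC x : 0 <= x <= 1 -> opnorm (Q x) <= Cq + 1.
  move=> x01; apply: le_trans (nrm_tri hn _ (G x)) _; have [gC _] := hG x x01.
  by apply: lerD => //; apply: le_trans (near x x01) _; olra.
pose LQ := 4 * (Cq + 1) * (1 + (Cq + 1)) * L.
have LQ0' : 0 <= 4 * (Cq + 1) * (1 + (Cq + 1)) by move: C1; clear => C1; rewrite !mulr_ge0 //; lra.
have LQ0 : 0 <= LQ by rewrite /LQ mulr_ge0.
have lQ x y : 0 <= x <= 1 -> 0 <= y <= 1 -> opnorm (Q x - Q y) <= LQ * `|x - y|.
  move=> x01 y01; have [_ q1 q2 _] := hQ x x01; have [_ q3 q4 _] := hQ y y01.
  apply: le_trans (idem_lip hn q1 q3 q2 q4 (QC x x01) (QC y y01) (near x x01) (near y y01)) _.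
  have -> : LQ * `|x - y| = 4 * (Cq + 1) * (1 + (Cq + 1)) * (L * `|x - y|) by rewrite /LQ mulrA.
  by apply: ler_wpM2l => //; exact: lG.
have l01 : 0 <= (0 : R) <= 1 by rewrite lexx ler01.
have EPi : esupp cls (chi p1 A) by exact: (esupp_chi hc).
have PiK : (chi p1 A) * (chi p1 A) = (chi p1 A) by exact: chi_idem.
have nPi : opnorm (chi p1 A) <= 1 by exact: opnorm_pull.
have Q0 : Q 0 = (chi p1 A).
  have [_ q1 q2 _] := hQ 0 l01; have nr := near 0 l01; rewrite G0 in q2 nr.
  have z4 : opnorm ((chi p1 A) - (chi p1 A)) <= 4^-1 by rewrite subrr opnorm0 invr_ge0.
  have nP : opnorm (chi p1 A) <= Cq + 1 by apply: le_trans nPi C2.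
  have := idem_lip hn q1 PiK q2 erefl (QC 0 l01) nP nr z4.
  rewrite subrr opnorm0 mulr0 => /(nrm_eq0 hn) /eqP; rewrite subr_eq0 => /eqP //.
(* one frame b for the whole loop, with determinants bounded below by dl *)
have [|b [dl [dl0 Eb db]]] := frame_op hc C2 LQ0 _ lQ Q0.
  by move=> x x01; have [? ? _ _] := hQ x x01; split=> //; exact: QC.
pose bb := opnorm b; have bb0 : 0 <= bb by exact: opnorm_ge0.
pose M := (3 * (Cq + 2) + 2) * bb + 1.
have M1 : 1 <= M by rewrite /M lerDr mulr_ge0 //; move: C1; olra.
have dl2 : 0 < dl / 2 by rewrite divr_gt0.
have [K1 [rho [K10 rho0 rho1 inv]]] := circle_inverse n M1 dl2.
have p12 : 0 < 12^-1 :> R by rewrite invr_gt0 ltr0n.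
have [a0 ha0] := pow_small rho0 rho1 p12.
have {ha0}[a a1 ha] : exists2 a : nat, (0 < a)%N & rho ^+ a <= 12^-1.
  exists a0.+1 => //; apply: le_trans ha0; rewrite exprS.
  by apply: ler_piMl; [exact: exprn_ge0|exact: ltW].
pose E : R := (8 * (n * n * d * a)).+1%:R.
pose W1 := (n`!)%:R * (n%:R * M ^+ n) * (3 * (2 * c3 * h * bb)) * (2 / dl).
pose W2 := 2 * (E * (n%:R * n%:R)).
pose W3 := 9 * (E * (n%:R * (n%:R * K1))) * bb.
have M0 : 0 <= M by apply: le_trans M1.
have E0 : 0 <= E by rewrite ler0n.
have W10 : 0 <= W1.
  by rewrite /W1; apply: mulr_ge0; [move: M0 c30 h0 bb0; generalize M c3 bb; clear => m c b *; rewrite !mulr_ge0 ?ler0n ?exprn_ge0 // ltW|rewrite divr_ge0 // ltW].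
have W20 : 0 <= W2 by rewrite /W2 !mulr_ge0 ?ler0n.
have W30 : 0 <= W3 by rewrite /W3 !mulr_ge0 ?ler0n.
(* W1: the frame of the k-th iterate is still invertible; W2: the remainder of its inverse is
   small; W3: the frame intertwines Pi and the iterate up to h, even after the division. *)
have [k /ltW hk] := geo_small (W1 + W2 + W3) (ltr01 : 0 < 1 :> R).
have g0 : 0 <= 2^-1 ^+ k :> R by rewrite exprn_ge0 ?invr_ge0.
have [s1 s2 s3] : [/\ W1 * 2^-1 ^+ k <= 1, W2 * 2^-1 ^+ k <= 1 & W3 * 2^-1 ^+ k <= 1].
  exact: sum3_le.
pose f := newton_it S k; pose g x := newton_it (G x) k.
pose Y : B2 := frm f (lift b) (lift (chi p1 A)).
have RY : Rep hc (3 ^ k * d) Y (fun x => frm (g x) b (chi p1 A)).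
  have Rf := Rep_newton_it k hR.
  have Rb := Rep_const hc Eb; have RP := Rep_const hc EPi.
  have R1 := Rep1 p1 hc.
  have R1f : Rep hc (3 ^ k * d) (1 - f) (fun x => 1 - g x).
    by apply: RepB Rf; apply: Rep_mono R1.
  have := RepD (RepM (RepM Rf Rb) RP) (RepM (RepM R1f Rb) (RepB R1 RP)).
  by rewrite !addn0.
have gQ x : 0 <= x <= 1 -> opnorm (g x - Q x) <= 2 * c3 * h * r ^+ k.
  by move=> x01; rewrite (nrmBC hn); have [_ _ _ hk'] := hQ x x01; exact: hk'.
have gC x : 0 <= x <= 1 -> opnorm (g x) <= Cq + 2.
  move=> x01; apply: le_trans (nrm_tri hn _ (Q x)) _.
  have w1 : 2 * c3 * h * r ^+ k <= 4^-1 * 1 by apply: ler_pM.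
  by apply: le_trans (lerD (QC x x01) (le_trans (gQ x x01) w1)) _; olra.
have QC' x : 0 <= x <= 1 -> opnorm (Q x) <= Cq + 2.
  by move=> x01; apply: le_trans (QC x x01) _; olra.
have frM z : opnorm z <= Cq + 2 -> opnorm (frm z b (chi p1 A)) <= M.
  by move=> hz; apply: le_trans (frm_norm hn b nPi hz) _; rewrite /M -/bb lerDl.
have YM x : 0 <= x <= 1 -> opnorm (frm (g x) b (chi p1 A)) <= M.
  by move=> x01; apply: frM; exact: gC.
have Yd x i : 0 <= x <= 1 -> dl / 2 <= normc (\det (pad cls i ((@mat R p p1 I n cls) (frm (g x) b (chi p1 A)) i))).
  move=> x01; have := db x i x01.
  have qM := frM _ (QC' x x01).
  have dist : opnorm (frm (Q x) b (chi p1 A) - frm (g x) b (chi p1 A)) <= 3 * (2 * c3 * h * r ^+ k * bb).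
    rewrite (nrmBC hn); apply: le_trans (frm_dist hn _ _ _ nPi) _; apply: ler_wpM2l => //.
    by apply: ler_wpM2r => //; exact: gQ.
  have dd := pad_det_lip hc i M1 qM (YM x x01) dist.
  have sm : (n`!)%:R * (n%:R * M ^+ n) * (3 * (2 * c3 * h * r ^+ k * bb)) <= dl / 2.
    have e1 : (n`!)%:R * (n%:R * M ^+ n) * (3 * (2 * c3 * h * r ^+ k * bb)) = W1 * r ^+ k * (dl / 2).
      rewrite /W1; generalize c3 (r ^+ k) bb ((n`!)%:R * (n%:R * M ^+ n)) => u1 u2 u3 u4.
      by move: dl0; clear => dl0; field; exact: lt0r_neq0.
    rewrite e1; apply: ler_piMl; first exact: (ltW dl2).
    by apply: le_trans s1; apply: ler_wpM2l.
  exact: half_le dd sm.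
have ak : (0 < a * k.+1)%N by rewrite muln_gt0 a1.
pose k' := (a * k.+1).-1; have k'E : k'.+1 = (a * k.+1)%N by rewrite /k' prednK.
have [Z [e [e' [DZ YZ ZY nZ [ne ne']]]]] := rep_inverse hD hDl hDs k' M1 K10 rho0 RY YM Yd inv.
move: nZ ne ne'; set sz := (2 * _ * _)%N => nZ ne ne'.
have szE : sz.+1%:R <= E * 6 ^+ k.
  have : (sz.+1 <= (8 * (n * n * d * a)).+1 * 6 ^ k)%N.
    by rewrite /sz k'E; exact: size_growth.
  by rewrite -(ler_nat R) natrM natrX.
have e6 : 6 ^+ k * 12^-1 ^+ k = 2^-1 ^+ k :> R.
  by rewrite -exprMn; congr (_ ^+ k); olra.
have rhok : rho ^+ k'.+1 <= 12^-1 ^+ k.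
  rewrite k'E exprM; apply: (@le_trans _ _ (12^-1 ^+ k.+1)).
    by apply: pow_le => //; exact: exprn_ge0.
  by rewrite exprS ler_piMl ?exprn_ge0 ?invr_ge0 //; olra.
have t12 : 0 <= 12^-1 ^+ k :> R by rewrite exprn_ge0 ?invr_ge0.
have small : sz.+1%:R * (n%:R * (n%:R * rho ^+ k'.+1)) <= 2^-1.
  have : sz.+1%:R * (n%:R * (n%:R * rho ^+ k'.+1)) <= (E * 6 ^+ k) * (n%:R * (n%:R * 12^-1 ^+ k)).
    apply: ler_pM; rewrite ?mulr_ge0 ?ler0n ?exprn_ge0 //.
    by apply: ler_wpM2l; rewrite ?ler0n //; apply: ler_wpM2l; rewrite ?ler0n.
  have -> : E * 6 ^+ k * (n%:R * (n%:R * 12^-1 ^+ k)) = E * (n%:R * n%:R) * (6 ^+ k * 12^-1 ^+ k) by ring.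
  rewrite e6; move: s2; rewrite /W2; generalize (E * (n%:R * n%:R)) (2^-1 ^+ k : R) => u w; generalize (sz.+1%:R * (n%:R * (n%:R * rho ^+ k'.+1))); clear; intros; nra.
have DY : D Y.
  have Df : D f.
    apply: newton_it_in; first exact: hD.
    have [_ [P [c [[_ hP _ _ _] [-> _]]]]] := hR.
    by apply: (csM hD); [apply: D_Op; [exact: hD|exact: hDl|exact: hDs|exact: hP]|exact: hDs].
  have Db := hDl _ Eb; have DP := hDl _ EPi; have D1 := cs1 hD.
  by apply: (csD hD); apply: (csM hD) => //; try apply: (csM hD) => //; apply: (csB hD).
have n1YZ : opnorm (1 - Y * Z) <= 2^-1.
  by rewrite YZ opprB addrC subrK; exact: le_trans ne small.
have n1ZY : opnorm (1 - Z * Y) <= 2^-1.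
  by rewrite ZY opprB addrC subrK; exact: le_trans ne' small.
have [y [Dy yK _ y3 _]] := neumann hn2 hD (csM hD DY DZ) n1YZ.
have [y2 [_ _ y2K _ _]] := neumann hn2 hD (csM hD DZ DY) n1ZY.
pose Y' := Z * y; have YY' : Y * Y' = 1 by rewrite /Y' mulrA.
have Y'Y : Y' * Y = 1.
  have -> : Y' = y2 * Z by rewrite -[RHS]mulr1 -YY' mulrA -[y2 * Z * Y]mulrA y2K mul1r.
  by rewrite -mulrA.
have nY' : opnorm Y' <= 3 * (E * 6 ^+ k * (n%:R * (n%:R * K1))).
  apply: le_trans (opnormM_le _ _) _; rewrite mulrC; apply: ler_pM => //; try exact: opnorm_ge0.
  by apply: le_trans nZ _; apply: ler_wpM2r => //; rewrite !mulr_ge0 ?ler0n.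
exists Y, Y'; split=> //; first by apply: (csM hD).
clearbody Y'.
have S4 : 4 * opnorm (S * S - S) <= r by apply: le_trans hr; rewrite ler_wpM2l.
have [q [_ _ qk]] := newton_lim hn2 SC C1 S4 cr.
have qk' j : opnorm (q - newton_it S j) <= 2 * c3 * h.
  apply: le_trans (qk j) _; rewrite -[X in _ <= X]mulr1; apply: ler_pM => //.
    by rewrite !mulr_ge0 ?opnorm_ge0 // ltW.
  by apply: ler_wpM2l => //; rewrite mulr_ge0 // ltW.
have fS : opnorm (f - S) <= 4 * c3 * h.
  apply: le_trans (nrm_dist hn2 _ q _) _; rewrite [X in X + _](nrmBC hn2 f q).
  by apply: le_trans (lerD (qk' k) (qk' 0%N)) _; olra.
have [_ fdef] := newton_inv hn2 SC C1 S4 cr k.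
have lP1 : opnorm (lift (chi p1 A) : B2) <= 1 by apply: le_trans (opnorm_lift _) nPi.
have lPP : lift (chi p1 A) * lift (chi p1 A) = lift (chi p1 A) :> B2 by rewrite -liftM PiK.
have cj := frm_conj hn2 f (lift b) lPP lP1; rewrite -/Y in cj.
have nb : opnorm (lift b : B2) <= bb by exact: opnorm_lift.
have -> : Y * lift (chi p1 A) * Y' - S = (Y * lift (chi p1 A) - f * Y) * Y' + (f - S) + (f * (Y * Y') - f) by ncring.
rewrite YY' mulr1 subrr addr0; apply: le_trans (opnormD_le _ _) _.
suff hh : opnorm ((Y * lift (chi p1 A) - f * Y) * Y') <= h.
  by apply: le_trans (lerD hh fS) _; clear; rewrite /c3; lra.
apply: le_trans (opnormM_le _ _) _.
apply: (@le_trans _ _ ((3 * (h * r ^+ k * bb)) * (3 * (E * 6 ^+ k * (n%:R * (n%:R * K1)))))).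
  apply: ler_pM => //; try exact: opnorm_ge0.
  apply: le_trans cj _; apply: ler_wpM2l => //; apply: ler_pM => //; try exact: opnorm_ge0.
  by apply: le_trans fdef _; apply: ler_wpM2r.
have -> : 3 * (h * r ^+ k * bb) * (3 * (E * 6 ^+ k * (n%:R * (n%:R * K1)))) = h * (W3 * (6 ^+ k * r ^+ k)).
  by rewrite /W3; ring.
rewrite -[X in _ <= X]mulr1; apply: ler_wpM2l; first exact: ltW.
apply: le_trans s3; apply: ler_wpM2l => //; rewrite -e6; exact: ler_wpM2l.
Qed.

(** * Marriage and bounded injections *)

Section Rado.
Context {I J : choiceType}.
Implicit Types (N M : I -> {fset J}) (A : {fset I}).
Local Open Scope fset_scope.

Definition nbh N A : {fset J} := \bigcup_(i <- A) N i.

Lemma nbhP N A j : reflect (exists2 i, i \in A & j \in N i) (j \in nbh N A).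
Proof.
apply: (iffP (bigfcupP _ _ _ _)) => [h|h]; case: h => i.
  by rewrite andbT => iA jN; exists i.
by move=> iA jN; exists i => //; rewrite andbT.
Qed.

Definition hall N := forall A, (#|` A| <= #|` nbh N A|)%N.

(** Rado's argument: in a minimal family that satisfies Hall's condition every set is a
    singleton, because the two subfamilies that fail after the removal of one or the
    other of two points would contradict submodularity. *)
Lemma rado N : hall N -> (forall M, hall M -> (forall i, M i `<=` N i) -> M = N) ->
  forall i, exists j, N i = [fset j].
Proof.
move=> hN minN i.
have ne : (0 < #|` N i|)%N.
  have := hN [fset i]; rewrite cardfs1; suff -> : nbh N [fset i] = N i by [].
  by rewrite /nbh big_seq_fset1.
have [j jN] : exists j, j \in N i by move: ne; rewrite cardfs_gt0 => /fset0Pn.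
exists j; apply/eqP; rewrite eqEfsubset fsub1set jN andbT; apply/fsubsetP => j' j'N.
rewrite inE; apply: contraT => jj'.
have bad (x : J) : x \in N i -> exists A, i \notin A /\ (#|` nbh N A `|` (N i `\ x)| <= #|` A|)%N.
  move=> xN; pose M := fun i' => if i' == i then N i `\ x else N i'.
  have MN : M <> N.
    by move=> e; have := congr1 (fun f => x \in f i) e; rewrite /M eqxx !inE eqxx xN.
  have : ~ hall M.
    move=> hM; apply: MN; apply: minN => // i'; rewrite /M; case: eqP => [->|_] //.
    exact: fsubD1set.
  move=> /existsNP[A /negP]; rewrite -ltnNge => hA; exists (A `\ i); rewrite !inE eqxx; split=> //.
  have iA : i \in A.
    apply: contraTT hA => iA; rewrite -leqNgt; apply: leq_trans (hN A) _.
    rewrite (_ : nbh M A = nbh N A) //; apply: eq_big_seq => i' i'A; rewrite /M.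
    by case: eqP => // e; rewrite -e i'A in iA.
  rewrite -ltnS; have -> : (#|` A `\ i|.+1 = #|` A|)%N by rewrite [RHS](cardfsD1 i) iA.
  apply: leq_ltn_trans hA; apply: fsubset_leq_card; apply/fsubsetP => y; rewrite !inE => /orP[].
    move/nbhP => [k]; rewrite !inE => /andP[ki kA] yN; apply/nbhP; exists k => //.
    by rewrite /M (negbTE ki).
  by move=> yN; apply/nbhP; exists i => //; rewrite /M eqxx !inE.
have [A1 [iA1 h1]] := bad j jN; have [A2 [iA2 h2]] := bad j' j'N.
set U1 := nbh N A1 `|` _ in h1; set U2 := nbh N A2 `|` _ in h2.
have c1 : (#|` A1 `|` A2|.+1 <= #|` U1 `|` U2|)%N.
  have -> : (#|` A1 `|` A2|.+1 = #|` i |` (A1 `|` A2)|)%N.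
    by rewrite cardfsU1 !inE negb_or iA1 iA2.
  apply: leq_trans (hN _) _; apply: fsubset_leq_card; apply/fsubsetP => y /nbhP[k].
  rewrite !inE => /orP[/eqP -> yN|/orP[kA|kA] yN].
  - have [->|yj] := eqVneq y j; last by rewrite yN !orbT.
    by rewrite eq_sym jj' jN /= !orbT.
  - by rewrite (_ : y \in nbh N A1) //; apply/nbhP; exists k.
  - by rewrite (_ : y \in nbh N A2) ?orbT //; apply/nbhP; exists k.
have c2 : (#|` A1 `&` A2| <= #|` U1 `&` U2|)%N.
  apply: leq_trans (hN _) _; apply: fsubset_leq_card; apply/fsubsetP => y /nbhP[k].
  rewrite !inE => /andP[k1 k2] yN; apply/andP; split; apply/orP; left; apply/nbhP; by exists k.
have e1 := cardfsUI A1 A2; have e2 := cardfsUI U1 U2.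
by move: h1 h2 c1 c2 e1 e2; clear; lia.
Qed.

(** Hall's marriage theorem for infinite families of finite sets. *)
Lemma marriage N : hall N -> exists2 f : I -> J, injective f & forall i, f i \in N i.
Proof.
move=> hN; pose T := {M : I -> {fset J} | hall M /\ forall i, M i `<=` N i}.
pose Rl (M M' : T) := `[< forall i, sval M' i `<=` sval M i >].
have [M maxM] : exists M : T, forall M' : T, Rl M M' -> M' = M.
  apply: Zorn.
  - by move=> M; apply/asboolP.
  - by move=> M1 M2 M3 /asboolP h1 /asboolP h2; apply/asboolP => i; exact: fsubset_trans (h2 i) (h1 i).
  - move=> [M1 p1] [M2 p2] /asboolP /= h1 /asboolP /= h2; apply: eq_exist.
    by apply/funext => i; apply/eqP; rewrite eqEfsubset h1 h2.
  move=> Ch tot; have [[M0 CM0]|none] := pselect (exists M0 : T, Ch M0); last first.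
    by exists (exist _ N (conj hN (fun i => fsubset_refl _))) => s Cs; case: none; exists s.
  have ex i : exists M : T, Ch M /\ forall M' : T, Ch M' -> (#|` sval M i| <= #|` sval M' i|)%N.
    pose Pm m := `[< exists M : T, Ch M /\ #|` sval M i| = m >].
    have exm : exists m, Pm m by exists (#|` sval M0 i|); apply/asboolP; exists M0.
    case: (ex_minnP exm) => m /asboolP[M [CM mE]] mmin.
    by exists M; split=> // M' CM'; rewrite mE; apply: mmin; apply/asboolP; exists M'.
  have [c hc] : exists c : I -> T, forall i, Ch (c i) /\ forall M' : T, Ch M' -> (#|` sval (c i) i| <= #|` sval M' i|)%N.
    by exists (fun i => projT1 (cid (ex i))) => i; exact: projT2 (cid (ex i)).
  pose L i := sval (c i) i.
  have LM (M' : T) i : Ch M' -> L i `<=` sval M' i.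
    move=> CM'; have [Cc cmin] := hc i; have := tot _ _ Cc CM'.
    case=> /asboolP /(_ i) h; last exact: h.
    by have := cmin _ CM'; rewrite -/(L i) => le; rewrite /L -(eqP (_ : sval M' i == sval (c i) i)) // eqEfcard h le.
  have fin A : exists M' : T, Ch M' /\ forall i, i \in A -> L i = sval M' i.
    elim/finSet_rect: A => A IH; have [->|[a aA]] := fset_0Vmem A; first by exists M0.
    have [M' [CM' h]] := IH _ (fproperD1 aA).
    have [Cc cmin] := hc a.
    have := tot _ _ Cc CM'; case=> /asboolP h'.
      exists M'; split=> // i iA; have [e|ia] := eqVneq i a; last by apply: h; rewrite !inE ia.
      by apply/eqP; rewrite eqEfsubset LM // e h'.
    exists (c a); split=> // i iA; have [-> //|ia] := eqVneq i a.
    apply/eqP; rewrite eqEfsubset LM //= (h i); [exact: h'|by rewrite !inE ia].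
  have hL : hall L.
    move=> A; have [M' [CM' h]] := fin A.
    rewrite (_ : nbh L A = nbh (sval M') A); first by case: (svalP M') => h1 _; exact: h1.
    by apply: eq_big_seq => i iA; exact: h.
  have LN i : L i `<=` N i by apply: fsubset_trans (LM M0 i CM0) _; case: (svalP M0).
  exists (exist _ L (conj hL LN)) => M' CM'; apply/asboolP => i /=; exact: LM.
have [hM MN] := svalP M.
have sing : forall i, exists j, sval M i = [fset j].
  apply: (rado hM) => M' hM' M'M.
  have M'N i : M' i `<=` N i by exact: fsubset_trans (M'M i) (MN i).
  have RM : Rl M (exist _ M' (conj hM' M'N)) by apply/asboolP.
  by rewrite -(maxM _ RM).
have [f hf] : exists f : I -> J, forall i, sval M i = [fset f i].
  by exists (fun i => projT1 (cid (sing i))) => i; exact: projT2 (cid (sing i)).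
exists f; last by move=> i; have /fsubsetP := MN i; apply; rewrite hf inE.
move=> i i' ff; apply: contrapT => /eqP ne.
have := hM [fset i; i']; rewrite cardfs2 ne.
rewrite (_ : nbh (sval M) [fset i; i'] = [fset f i]) ?cardfs1 //.
apply/fsetP => y; apply/nbhP/idP => [[k]|yf].
  by rewrite !inE => /orP[/eqP ->|/eqP ->]; rewrite hf !inE // -ff.
by exists i; rewrite ?hf // !inE eqxx.
Qed.
End Rado.

Section Growth.
Context {R : realType} (X : metricType R) (bgX : bounded_geometry X).
Implicit Types (x y : X) (A F : {fset X}).
Local Open Scope fset_scope.
Local Open Scope ring_scope.

Lemma ball_finite x (r : R) : finite_set (closed_mball x r).
Proof.
have r1 : 0 < `|r| + 1 by rewrite ltr_wpDl.
have [N _ h] := bgX r1; have {}h := h x.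
apply: (@sub_finite_set _ _ (closed_mball x (`|r| + 1))).
  by move=> y /= h'; apply: le_trans h' _; apply: le_trans (ler_norm r) _; rewrite lerDl.
by apply: card_le_finite h _; exact: finite_II.
Qed.

Definition ball x (r : R) : {fset X} := fset_set (closed_mball x r).

Lemma ballE x r y : (y \in ball x r) = (mdist x y <= r).
Proof.
rewrite /ball in_fset_set; last exact: ball_finite.
by apply/idP/idP; rewrite inE.
Qed.

Lemma ball_card r : exists N : nat, (0 < N)%N /\ forall x, (#|` ball x r| <= N)%N.
Proof.
have r1 : 0 < `|r| + 1 by rewrite ltr_wpDl.
have [N N0 h] := bgX r1; exists N; split=> // x.
apply: (@leq_trans (#|` ball x (`|r| + 1)|)).
  apply: fsubset_leq_card; apply/fsubsetP => y; rewrite !ballE => h'.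
  by apply: le_trans h' _; apply: le_trans (ler_norm r) _; rewrite lerDl.
exact: geq_card_fset_set.
Qed.

Definition thick A (r : R) : {fset X} := \bigcup_(a <- A) ball a r.

Lemma thickP A r y : reflect (exists2 a, a \in A & mdist a y <= r) (y \in thick A r).
Proof.
apply: (iffP (bigfcupP _ _ _ _)) => [h|h]; case: h => a.
  by rewrite andbT ballE => aA ay; exists a.
by move=> aA ay; exists a; rewrite ?andbT ?ballE.
Qed.

Lemma thick_sub A r : 0 <= r -> A `<=` thick A r.
Proof. by move=> r0; apply/fsubsetP => a aA; apply/thickP; exists a; rewrite ?mdistxx. Qed.

Lemma thick_thick A r s : thick (thick A r) s `<=` thick A (r + s).
Proof.
apply/fsubsetP => y /thickP[z /thickP[a aA az] zy]; apply/thickP; exists a => //.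
by apply: le_trans (metric_triangle a z y) _; exact: lerD.
Qed.

Hypothesis naX : ~ amenable X.

Lemma pdist_near x (S : set X) (r : R) : (pdist x S <= r%:E)%E -> exists2 y, S y & mdist x y <= r + 1.
Proof.
move=> h; have : (pdist x S < (r + 1)%:E)%E by apply: le_lt_trans h _; rewrite lte_fin ltrDl.
by move=> /ereal_inf_lt[_ [y Sy <-]]; rewrite lte_fin => /ltW; exists y.
Qed.

(** Folner sets fail to exist at some scale, where the boundary of a finite set injects,
    up to the size of balls, in the points near the set and outside of it. *)
Lemma growth1 : exists (s d : R), [/\ 0 <= s, 0 < d & forall A, (1 + d) * #|` A|%:R <= #|` thick A s|%:R].
Proof.
have : exists r e, [/\ 0 < r, 0 < e & forall S : set X, ~ folner_set r e S].
  apply: contrapT => h; apply: naX => r e r0 e0; apply: contrapT => h'.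
  by apply: h; exists r, e; split=> // S hS; apply: h'; exists S.
move=> [r [e [r0 e0 nof]]]; have [N [N0 hN]] := ball_card (r + 1).
have N0' : 0 < N%:R :> R by rewrite ltr0n.
exists (2 * (r + 1)), (e / N%:R); split; first by lra.
  by rewrite divr_gt0.
move=> A; have [->|[a0 a0A]] := fset_0Vmem A; first by rewrite cardfs0 mulr0 ler0n.
set s := 2 * _; have s0 : 0 <= s by rewrite /s; lra.
pose W := thick A s `\` A.
have bdW : (Rboundary r [set` A] `<=` [set` thick W (r + 1)%R])%classic.
  move=> x [/pdist_near[a aA xa] /pdist_near[y yA xy]]; apply/thickP; exists y; last by rewrite metric_sym.
  rewrite !inE; apply/andP; split; first by apply/negP => /= h; exact: yA.
  apply/thickP; exists a => //; apply: le_trans (metric_triangle a x y) _.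
  by rewrite (metric_sym a x) /s; move: xa xy; clear; lra.
have finb : finite_set (Rboundary r [set` A]) by apply: sub_finite_set bdW _; exact: finite_fset.
have cb : (#|` fset_set (Rboundary r [set` A])| <= N * #|` W|)%N.
  apply: (@leq_trans (#|` thick W (r + 1)|)).
    apply: fsubset_leq_card; apply/fsubsetP => x; rewrite in_fset_set // inE => /bdW.
    by [].
  rewrite /thick; clear -hN; elim/finSet_rect: W => W IH; have [->|[w wW]] := fset_0Vmem W.
    by rewrite big_seq_fset0 cardfs0.
  rewrite (big_fsetD1 w) //=; apply: leq_trans (leq_card_fsetU _ _) _.
  rewrite [X in (_ <= _ * X)%N](cardfsD1 w) wW mulnDr muln1; apply: leq_add; first exact: hN.
  by apply: IH; exact: fproperD1.
have big : e * #|` A|%:R <= #|` fset_set (Rboundary r [set` A])|%:R.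
  rewrite leNgt; apply/negP => lt; apply: (nof [set` A]); split.
  - exact: finite_fset.
  - by exists a0.
  have cA : counting [set` A] = (#|` A|%:R)%:E :> \bar R.
    by rewrite /counting asboolT ?set_fsetK //; exact: finite_fset.
  have cB : counting (Rboundary r [set` A]) = (#|` fset_set (Rboundary r [set` A])|%:R)%:E :> \bar R.
    by rewrite /counting asboolT.
  have A0 : 0 < #|` A|%:R :> R by rewrite ltr0n cardfs_gt0; apply/fset0Pn; exists a0.
  rewrite cA cB inver gt_eqF // -EFinM lee_fin ler_pdivrMr //; exact: ltW.
have WA : (#|` A| + #|` W| <= #|` thick A s|)%N.
  by rewrite -(cardfsID A (thick A s)) (fsetIidPr (thick_sub A s0)).
have : e * #|` A|%:R <= N%:R * #|` W|%:R by apply: le_trans big _; rewrite -natrM ler_nat.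
rewrite -ler_pdivrMl // mulrA => h.
have : #|` A|%:R + #|` W|%:R <= #|` thick A s|%:R :> R by rewrite -natrD ler_nat.
by apply: le_trans; rewrite mulrDl mul1r lerD2l mulrC [e / _]mulrC mulrC.
Qed.

(** Iteration of the expansion in growth1. *)
Lemma growth2 : exists2 s : R, 0 <= s & forall A, (2 * #|` A| <= #|` thick A s|)%N.
Proof.
have [s [d [s0 d0 h]]] := growth1.
have it k : forall A, (1 + k%:R * d) * #|` A|%:R <= #|` thick A (k%:R * s)|%:R.
  elim: k => [|k IH] A.
    by rewrite !mul0r addr0 mul1r ler_nat; apply: fsubset_leq_card; exact: thick_sub.
  have h1 := IH (thick A s); have h2 := h A.
  have h3 : #|` thick (thick A s) (k%:R * s)|%:R <= #|` thick A (k.+1%:R * s)|%:R :> R.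
    rewrite ler_nat; apply: fsubset_leq_card; rewrite -addn1 natrD mulrDl mul1r addrC.
    exact: thick_thick.
  apply: le_trans (le_trans h1 h3).
  have k0 : 0 <= k%:R * d by rewrite mulr_ge0 ?ler0n ?ltW.
  apply: (@le_trans _ _ ((1 + k%:R * d) * ((1 + d) * #|` A|%:R))); last by apply: ler_wpM2l => //; lra.
  rewrite mulrA; apply: ler_wpM2r; first exact: ler0n.
  by rewrite -addn1 natrD; have := mulr_ge0 k0 (ltW d0); lra.
pose k := Num.bound d^-1; have hk : d^-1 < k%:R by rewrite archi_boundP // invr_ge0 ltW.
exists (k%:R * s) => [|A]; first by rewrite mulr_ge0 ?ler0n.
rewrite -(ler_nat R); apply: le_trans (it k A); rewrite natrM; apply: ler_wpM2r; first exact: ler0n.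
have : 1 <= k%:R * d by rewrite -ler_pdivrMr // mul1r ltW.
by lra.
Qed.

(** The marriage theorem, for the balls of radius s with every point taken twice. *)
Lemma double : exists2 s : R, 0 <= s & exists f : X * bool -> X,
  injective f /\ forall x b, mdist x (f (x, b)) <= s.
Proof.
have [s s0 hs] := growth2; exists s => //.
pose N (i : X * bool) := ball i.1 s.
have hN : hall N.
  move=> A; pose A1 := [fset i.1 | i in A].
  have le1 : (#|` A| <= 2 * #|` A1|)%N.
    have sub : A `<=` [fset i | i in [seq (x, b) | x <- A1, b <- [:: true; false]]].
      apply/fsubsetP => -[x b] xA; rewrite !inE; apply/allpairsP; exists (x, b); split=> //=.
        by apply/imfsetP; exists (x, b).
      by rewrite !inE; clear; case: b.
    apply: leq_trans (fsubset_leq_card sub) _; rewrite card_fseq; apply: leq_trans (size_undup _) _.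
    by rewrite size_allpairs mulnC.
  apply: leq_trans le1 _; apply: leq_trans (hs A1) _; apply: fsubset_leq_card; apply/fsubsetP => y.
  move=> /thickP[x /imfsetP[i /= iA ->] xy]; apply/nbhP; exists i => //; by rewrite ballE.
have [f fi hf] := marriage hN; exists f; split=> // x b.
by have := hf (x, b); rewrite ballE.
Qed.

(** Iteration of the map of double. *)
Lemma spread (m : nat) : exists2 s : R, 0 <= s & exists f : X -> nat -> X,
  (forall x k, mdist x (f x k) <= s) /\
  forall x y k l, (k < m)%N -> (l < m)%N -> f x k = f y l -> x = y /\ k = l.
Proof.
have [s s0 [f [fi hf]]] := double.
suff [t t0 [g [hg gi]]] : exists2 t : R, 0 <= t & exists g : X -> nat -> X,
    (forall x k, mdist x (g x k) <= t) /\
    forall x y k l, (k < 2 ^ m)%N -> (l < 2 ^ m)%N -> g x k = g y l -> x = y /\ k = l.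
  exists t => //; exists g; split=> // x y k l km lm; apply: gi.
    exact: leq_trans km (ltnW (ltn_expl m (ltnSn 1))).
  exact: leq_trans lm (ltnW (ltn_expl m (ltnSn 1))).
elim: m => [|m [t t0 [g [hg gi]]]].
  exists 0 => //; exists (fun x _ => x); split=> [x k|x y [|k] [|l]] //; first by rewrite mdistxx.
exists (t + s); first exact: addr_ge0.
exists (fun x k => f (g x k./2, odd k)); split=> [x k|x y k l].
  by apply: le_trans (metric_triangle x (g x k./2) _) _; apply: lerD.
rewrite !expnS !mul2n => km lm /fi[e1 e2].
have half (j : nat) : (j < (2 ^ m).*2)%N -> (j./2 < 2 ^ m)%N by move=> h; rewrite ltn_half_double.
have [-> h] := gi _ _ _ _ (half _ km) (half _ lm) e1.
by split=> //; rewrite -[k]odd_double_half -[l]odd_double_half e2 h.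
Qed.
End Growth.

(** * Relative compact perturbations *)

Lemma half_small {R : realType} (a b C d : R) : 2 * ((1 + 2 * C) * d) <= 1 ->
  a <= C * d -> b <= (1 + C) * d -> a + b <= 2^-1.
Proof. by move=> h1 h2 h3; lra. Qed.

Section Compact.
Context {R : realType} {B : pzRingType} (nrm : B -> R) (hn : bnorm nrm).
Variables (D : B -> Prop) (P : B) (F : nat -> B).
Hypotheses (hD : csub nrm D) (DP : D P) (DF : forall N, D (F N)).
Hypotheses (PP : P * P = P) (FF : forall N M, (N <= M)%N -> F N * F M = F N /\ F M * F N = F N)
  (FP : forall N, F N * P = P * F N) (Fn : forall N, nrm (1 - F N) <= 1).
(** Elements of D have almost finite width with respect to the window F. *)
Hypotheses (band : forall T N (e : R), D T -> 0 < e -> exists M0, forall M, (M0 <= M)%N ->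
    nrm ((1 - F M) * T * F N) <= e /\ nrm (F N * T * (1 - F M)) <= e)
  (edge : forall T (e : R), D T -> 0 < e -> exists M0, forall M, (M0 <= M)%N ->
    nrm ((1 - F M) * (T * P - P * T)) <= e /\ nrm ((T * P - P * T) * (1 - F M)) <= e).

(** The elements of D that are small outside of large windows; Kc is an ideal of D by band,
    and P is central in D modulo Kc by edge. *)
Definition Kc (T : B) := D T /\ forall e : R, 0 < e -> exists M0, forall M, (M0 <= M)%N ->
  nrm ((1 - F M) * T) <= e /\ nrm (T * (1 - F M)) <= e.

Lemma Kc_edge T : D T -> Kc (T * P - P * T).
Proof. by move=> DT; split; [apply: (csB hD); apply: (csM hD)|move=> e e0; exact: edge]. Qed.

Lemma KcB S T : Kc S -> Kc T -> Kc (S - T).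
Proof.
move=> [DS hS] [DT hT]; split=> [|e e0]; first exact: (csB hD).
have e2 : 0 < e / 2 by rewrite divr_gt0.
have [M1 h1] := hS _ e2; have [M2 h2] := hT _ e2.
exists (maxn M1 M2) => M; rewrite geq_max => /andP[l1 l2].
have [a1 b1] := h1 _ l1; have [a2 b2] := h2 _ l2.
rewrite mulrBr mulrBl (splitr e); split; apply: le_trans (nrmB hn _ _) _; exact: lerD.
Qed.

Lemma Kc0 : Kc 0.
Proof.
split=> [|e e0]; first exact: (cs0 hD).
by exists 0 => M _; rewrite mulr0 mul0r (nrm_0 hn) ltW.
Qed.

Lemma KcN T : Kc T -> Kc (- T).
Proof. by move=> h; rewrite -sub0r; apply: KcB => //; exact: Kc0. Qed.

Lemma KcD S T : Kc S -> Kc T -> Kc (S + T).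
Proof. by move=> hS hT; rewrite -[T]opprK; apply: KcB => //; exact: KcN. Qed.

Lemma KcMl S T : D S -> Kc T -> Kc (S * T).
Proof.
move=> DS [DT hT]; split=> [|e e0]; first exact: (csM hD).
have nS := nrm_ge0 hn S; have nT := nrm_ge0 hn T.
have S1 : 0 < nrm S + 1 by rewrite ltr_wpDl.
have T1 : 0 < nrm T + 1 by rewrite ltr_wpDl.
have e1 : 0 < e / 2 / (nrm S + 1) by rewrite !divr_gt0.
have e2 : 0 < e / 2 / (nrm T + 1) by rewrite !divr_gt0.
have [N h1] := hT _ e1; have [N1 _] := h1 _ (leqnn N).
have [M0 h2] := band N DS e2.
exists (maxn N M0) => M; rewrite geq_max => /andP[l1 l2]; split.
  have -> : (1 - F M) * (S * T) = (1 - F M) * S * ((1 - F N) * T) + (1 - F M) * S * F N * T by ncring.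
  apply: le_trans (nrmD hn _ _) _; rewrite (splitr e); apply: lerD.
    apply: le_trans (nrmM hn _ _) _; apply: le_trans (_ : (nrm S + 1) * (e / 2 / (nrm S + 1)) <= _); last first.
      by rewrite mulrC divfK // gt_eqF.
    apply: ler_pM; [exact: nrm_ge0 hn _|exact: nrm_ge0 hn _| |exact: N1].
    apply: le_trans (nrmM hn _ _) _; apply: le_trans (ler_wpM2r nS (Fn M)) _; by rewrite mul1r lerDl.
  have [h _] := h2 _ l2; apply: le_trans (nrmM hn _ _) _.
  apply: le_trans (_ : (e / 2 / (nrm T + 1)) * (nrm T + 1) <= _); last by rewrite divfK // gt_eqF.
  by apply: ler_pM; [exact: nrm_ge0 hn _|exact: nT|exact: h|rewrite lerDl].
have [_ h] := h1 _ l1; rewrite -mulrA; apply: le_trans (nrmM hn _ _) _.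
apply: le_trans (_ : (nrm S + 1) * (e / 2 / (nrm S + 1)) <= _); last first.
  by rewrite mulrC divfK ?gt_eqF // ler_pdivrMr // mulr_natr mulr2n lerDl ltW.
by apply: ler_pM; [exact: nS|exact: nrm_ge0 hn _|rewrite lerDl|exact: h].
Qed.

Lemma KcMr S T : D S -> Kc T -> Kc (T * S).
Proof.
move=> DS [DT hT]; split=> [|e e0]; first exact: (csM hD).
have nS := nrm_ge0 hn S; have nT := nrm_ge0 hn T.
have S1 : 0 < nrm S + 1 by rewrite ltr_wpDl.
have T1 : 0 < nrm T + 1 by rewrite ltr_wpDl.
have e1 : 0 < e / 2 / (nrm S + 1) by rewrite !divr_gt0.
have e2 : 0 < e / 2 / (nrm T + 1) by rewrite !divr_gt0.
have [N h1] := hT _ e1; have [_ N1] := h1 _ (leqnn N).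
have [M0 h2] := band N DS e2.
exists (maxn N M0) => M; rewrite geq_max => /andP[l1 l2]; split.
  have [h _] := h1 _ l1; rewrite mulrA; apply: le_trans (nrmM hn _ _) _.
  apply: le_trans (_ : (e / 2 / (nrm S + 1)) * (nrm S + 1) <= _); last first.
    by rewrite divfK ?gt_eqF // ler_pdivrMr // mulr_natr mulr2n lerDl ltW.
  by apply: ler_pM; [exact: nrm_ge0 hn _|exact: nS|exact: h|rewrite lerDl].
have -> : T * S * (1 - F M) = T * (1 - F N) * (S * (1 - F M)) + T * (F N * S * (1 - F M)) by ncring.
apply: le_trans (nrmD hn _ _) _; rewrite (splitr e); apply: lerD.
  apply: le_trans (nrmM hn _ _) _; apply: le_trans (_ : (e / 2 / (nrm S + 1)) * (nrm S + 1) <= _); last first.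
    by rewrite divfK // gt_eqF.
  apply: ler_pM; [exact: nrm_ge0 hn _|exact: nrm_ge0 hn _|exact: N1|].
  apply: le_trans (nrmM hn _ _) _; apply: le_trans (ler_wpM2l nS (Fn M)) _; by rewrite mulr1 lerDl.
have [_ h] := h2 _ l2; apply: le_trans (nrmM hn _ _) _.
apply: le_trans (_ : (nrm T + 1) * (e / 2 / (nrm T + 1)) <= _); last by rewrite mulrC divfK // gt_eqF.
by apply: ler_pM; [exact: nT|exact: nrm_ge0 hn _|rewrite lerDl|exact: h].
Qed.

Lemma Kc_corner N T : D T -> T = F N * T * F N -> Kc T.
Proof.
move=> DT hT; split=> // e e0; exists N => M NM; have [h1 h2] := FF NM.
have -> : (1 - F M) * T = (F N - F M * F N) * T * F N by rewrite {1}hT; ncring.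
have -> : T * (1 - F M) = F N * T * (F N - F N * F M) by rewrite {1}hT; ncring.
by rewrite h1 h2 subrr mulr0 !mul0r (nrm_0 hn) ltW.
Qed.

(** Inverse pairs. *)
Definition inv2 (c c' : B) := [/\ D c, D c', c * c' = 1 & c' * c = 1].

(** Similarity to P by an invertible element of 1 + Kc. *)
Definition Ksim (g : B) := exists k k', [/\ inv2 k k', Kc (k - 1) & g = k * P * k'].

Lemma inv2M c c' d d' : inv2 c c' -> inv2 d d' -> inv2 (c * d) (d' * c').
Proof.
move=> [Dc Dc' h1 h2] [Dd Dd' h3 h4]; split; try exact: (csM hD).
  by rewrite mulrA -(mulrA c) h3 mulr1.
by rewrite mulrA -(mulrA d') h2 mulr1.
Qed.

Lemma inv2_sym c c' : inv2 c c' -> inv2 c' c. Proof. by case. Qed.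

Lemma Kc1M k l : D l -> Kc (k - 1) -> Kc (l - 1) -> Kc (k * l - 1).
Proof.
move=> Dl hk hl; have -> : k * l - 1 = (k - 1) * l + (l - 1) by ncring.
by apply: KcD => //; apply: KcMr.
Qed.

Lemma Kc1V k k' : inv2 k k' -> Kc (k - 1) -> Kc (k' - 1).
Proof.
move=> [_ Dk' h1 h2] hk; have -> : k' - 1 = - (k' * (k - 1)) by rewrite mulrBr h2 mulr1 opprB.
by apply: KcN; apply: KcMl.
Qed.

Lemma Kc_conj c c' k : inv2 c c' -> Kc (k - 1) -> Kc (c * k * c' - 1).
Proof.
move=> [Dc Dc' h1 h2] hk; have -> : c * k * c' - 1 = c * (k - 1) * c' by rewrite mulrBr mulr1 mulrBl h1.
by apply: KcMr => //; apply: KcMl.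
Qed.

Lemma Ksim_K g k k' : inv2 k k' -> Kc (k - 1) -> Ksim g -> Ksim (k * g * k').
Proof.
move=> ik hk [l [l' [il hl ->]]]; exists (k * l), (l' * k'); split; first exact: inv2M.
  by case: il => Dl _ _ _; exact: Kc1M.
by rewrite !mulrA.
Qed.

(** If d P d' = k P k', then the product is the conjugate of c P c' by c k c', which is in 1 + Kc
    as Kc is an ideal. *)
Lemma Ksim_mul c c' d d' : inv2 c c' -> inv2 d d' -> Ksim (c * P * c') -> Ksim (d * P * d') ->
  Ksim (c * d * P * (d' * c')).
Proof.
move=> ic id hc [k [k' [ik hk e]]]; have [Dc Dc' h1 h2] := ic; have [Dk Dk' h3 h4] := ik.
have -> : c * d * P * (d' * c') = (c * k * c') * (c * P * c') * (c * k' * c').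
  have -> : c * d * P * (d' * c') = c * (d * P * d') * c' by rewrite !mulrA.
  rewrite e; have -> : c * k * c' * (c * P * c') * (c * k' * c') = c * k * (c' * c) * P * (c' * c) * k' * c' by rewrite !mulrA.
  by rewrite h2 !mulr1 !mulrA.
apply: Ksim_K => //; last exact: Kc_conj.
have := inv2M (inv2M ic ik) (inv2_sym ic).
by rewrite !mulrA.
Qed.

Lemma Kc_sim c c' : inv2 c c' -> Kc (c * P * c' - P).
Proof.
move=> [Dc Dc' h1 h2]; have -> : c * P * c' - P = (c * P - P * c) * c' by rewrite mulrBl -(mulrA P) h1 mulr1.
by apply: KcMr => //; exact: Kc_edge.
Qed.

(** Nearby idempotents that differ by an element of Kc are conjugate by 1 + Kc. *)
Lemma near_conj (D' : B -> Prop) f g (C : R) : csub nrm D' -> (forall T, D' T -> D T) ->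
    D' f -> D' g -> f * f = f -> g * g = g -> nrm g <= C ->
    2 * ((1 + 2 * C) * nrm (f - g)) <= 1 -> Kc (f - g) ->
  exists z z', [/\ inv2 z z', D' z, D' z', Kc (z - 1) & z * f = g * z].
Proof.
move=> hD' DD' Df Dg ff gg gC small Kd.
pose z := g * f + (1 - g) * (1 - f).
have zE : z - 1 = g * (f - g) - (1 - g) * (f - g).
  have -> : z - 1 = g * (f - g) - (1 - g) * (f - g) + (g * g - g) *+ 2 by rewrite /z mulr2n; ncring.
  by rewrite gg subrr mul0rn addr0.
have D1 := cs1 hD'.
have Dz : D' z.
  apply: (csD hD'); apply: (csM hD') => //; exact: (csB hD').
have n1 : nrm (1 - z) <= 2^-1.
  rewrite (nrmBC hn) zE; apply: le_trans (nrmB hn _ _) _.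
  have a1 : nrm (g * (f - g)) <= C * nrm (f - g).
    by apply: le_trans (nrmM hn _ _) _; apply: ler_wpM2r gC; exact: nrm_ge0 hn _.
  have a2 : nrm ((1 - g) * (f - g)) <= (1 + C) * nrm (f - g).
    apply: le_trans (nrmM hn _ _) _; apply: ler_wpM2r; first exact: nrm_ge0 hn _.
    by apply: le_trans (nrmB hn _ _) _; apply: lerD => //; exact: nrm1 hn.
  exact: half_small small a1 a2.
have [z' [Dz' h1 h2 _ _]] := neumann hn hD' Dz n1.
exists z, z'; split=> //; first by split=> //; exact: DD'.
  rewrite zE; apply: KcB; apply: KcMl => //; first exact: DD'.
  by apply: (csB hD); [exact: cs1 hD|exact: DD'].
have -> : z * f = g * (f * f) + (1 - g) * (f - f * f) by rewrite /z; ncring.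
have -> : g * z = g * g * f + (g - g * g) * (1 - f) by rewrite /z; ncring.
by rewrite ff gg !subrr mulr0 mul0r.
Qed.

(** The two conjugates of P differ by an element of Kc, so near_conj applies. *)
Lemma Ksim_near c c' U U' (C : R) : inv2 c c' -> inv2 U U' -> Ksim (c * P * c') ->
    nrm (c * P * c') <= C -> 2 * ((1 + 2 * C) * nrm (U * P * U' - c * P * c')) <= 1 ->
  Ksim (U * P * U').
Proof.
move=> ic iU hs gC small; have [Dc Dc' h1 h2] := ic; have [DU DU' h3 h4] := iU.
have idem V V' : V' * V = 1 -> V * P * V' * (V * P * V') = V * P * V'.
  move=> e; have -> : V * P * V' * (V * P * V') = V * P * (V' * V) * P * V' by rewrite !mulrA.
  by rewrite e mulr1 -(mulrA V) PP.
have Kd : Kc (U * P * U' - c * P * c').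
  have -> : U * P * U' - c * P * c' = (U * P * U' - P) - (c * P * c' - P) by ncring.
  by apply: KcB; exact: Kc_sim.
have [z [z' [iz _ _ hz e]]] := near_conj hD (fun T h => h)
  (csM hD (csM hD DU DP) DU') (csM hD (csM hD Dc DP) Dc') (idem _ _ h4) (idem _ _ h2) gC small Kd.
have -> : U * P * U' = z' * (c * P * c') * z.
  by case: iz => _ _ _ z2; rewrite -(mulrA z' (c * P * c')) -e mulrA z2 mul1r.
apply: Ksim_K => //; first exact: inv2_sym.
exact: Kc1V hz.
Qed.

End Compact.

(** * Splitting idempotents of block operators *)

Section IdemSplit.
Context {R : realType} {n : nat}.
Local Notation C := R[i].
Implicit Types (G x y : 'M[C]_n) (S : pred 'I_n).

Definition dg S : 'M[C]_n := \matrix_(a, b) (S a && (a == b))%:R.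

Record split_data G (S : pred 'I_n) x y (M : R) : Prop := SplitData {
  sp_xy : x *m y = G; sp_yx : y *m x = dg S;
  sp_Gx : G *m x = x; sp_xS : x *m dg S = x; sp_yG : y *m G = y; sp_Sy : dg S *m y = y;
  sp_x : forall a b, normc (x a b) <= M; sp_y : forall a b, normc (y a b) <= M;
  sp_S : forall a, S a -> row a G != 0 }.

Lemma dg_delta S i : ~~ S i -> dg S *m delta_mx i (0 : 'I_1) = 0 :> 'cV[C]_n.
Proof.
move=> Si; apply/matrixP => a b; rewrite [LHS]mxE [RHS]mxE big1 // => c _; rewrite !mxE.
have [->|ac] := eqVneq a c; last by rewrite andbF mul0r.
by have [->|ci] := eqVneq c i; [rewrite (negbTE Si) mul0r|rewrite mulr0].
Qed.

Lemma delta_dg S i : ~~ S i -> delta_mx (0 : 'I_1) i *m dg S = 0 :> 'rV[C]_n.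
Proof.
move=> Si; apply/matrixP => a b; rewrite [LHS]mxE [RHS]mxE big1 // => c _; rewrite !mxE.
have [->|ci] := eqVneq c i; last by rewrite andbF mul0r.
by rewrite (negbTE Si) mulr0.
Qed.

(** The entry of largest modulus serves as a pivot: the rank one idempotent given by its
    column and its normalized row is a direct summand, and what remains has fewer nonzero
    rows. *)
Lemma idem_split G (M : R) : 0 <= M -> G *m G = G -> (forall a b, normc (G a b) <= M) ->
  exists S x y, split_data G S x y (2 ^+ n * M + n%:R).
Proof.
move=> M0 GG GM; pose nz (H : 'M[C]_n) := #|[pred a | row a H != 0]|.
suff main m : forall H (N : R), 0 <= N -> (nz H <= m)%N -> H *m H = H -> (forall a b, normc (H a b) <= N) ->
    exists S x y, split_data H S x y (2 ^+ m * N + m%:R).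
  apply: (main n G M M0 _ GG GM).
  by apply: leq_trans (max_card _) _; rewrite card_ord.
elim: m => [|m IH] H N N0 nzH HH HN.
  have H0 : H = 0.
    apply/row_matrixP => a; rewrite row0; apply/eqP; apply: contraLR nzH => ha.
    by rewrite -ltnNge; apply/card_gt0P; exists a.
  exists xpred0, 0, 0; have d0 : dg xpred0 = 0 by apply/matrixP => a b; rewrite !mxE.
  split; rewrite ?H0 ?d0 ?mulmx0 //; move=> a b; rewrite ?mxE ?expr0 ?mul1r ?addr0 //.
    by rewrite -[normc _]/(normc (0 : C)) normc_zero.
  by rewrite -[normc _]/(normc (0 : C)) normc_zero.
have [H0|Hn0] := eqVneq H 0.
  have [|S [x [y h]]] := IH H N N0 _ HH HN.
    by rewrite /nz H0 (eq_card0 (A := [pred a | row a (0 : 'M[C]_n) != 0])) // => a; rewrite !inE row0 eqxx.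
  exists S, x, y; case: h => h1 h2 h3 h4 h5 h6 h7 h8 h9.
  have le : 2 ^+ m * N + m%:R <= 2 ^+ m.+1 * N + m.+1%:R.
    apply: lerD; last by rewrite ler_nat.
    by apply: ler_wpM2r => //; rewrite exprS ler_peMl ?exprn_ge0 // ler1n.
  by split=> // a b; exact: le_trans le.
have [[i j] hij] : exists ij : 'I_n * 'I_n, forall a b, normc (H a b) <= normc (H ij.1 ij.2).
  have [i0 _] : exists i : 'I_n, True.
    by case: (posnP n) => [n0|n0]; [case/eqP: Hn0; apply/matrixP => a; exfalso; case: a => a; rewrite n0|exists (Ordinal n0)].
  have [ij _ h] := @arg_maxP _ R _ (i0, i0) xpredT (fun ij : 'I_n * 'I_n => normc (H ij.1 ij.2)) erefl.
  by exists ij => a b; exact: (h (a, b)).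
rewrite /= in hij.
have p0 : H i j != 0.
  apply: contra_neq Hn0 => e; apply/matrixP => a b; rewrite mxE; apply: eq0_normc.
  by apply: le_anti; rewrite normc_ge0 andbT -(@normc_zero R) -[X in normc X <= _]/(H a b) -e hij.
pose c : 'cV[C]_n := col j H; pose r : 'rV[C]_n := (H i j)^-1 *: row i H.
have rc : r *m c = 1%:M.
  apply/matrixP => a b; rewrite !ord1 -scalemxAl mxE.
  have -> : (row i H *m c) 0 0 = H i j.
    have -> : row i H *m c = (row i (H *m H)) *m delta_mx j 0.
      by rewrite row_mul -mulmxA -colE.
    by rewrite HH -colE !mxE.
  by rewrite !mxE mulVf.
have Hc : H *m c = c by rewrite /c colE mulmxA HH.
have rH : r *m H = r by rewrite /r -scalemxAl -row_mul HH.
pose H' := H - c *m r.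
have cr : c *m r *m (c *m r) = c *m r by rewrite mulmxA -(mulmxA c) rc mulmx1.
have Hcr : H *m (c *m r) = c *m r by rewrite mulmxA Hc.
have crH : c *m r *m H = c *m r by rewrite -mulmxA rH.
have H'H' : H' *m H' = H'.
  by rewrite /H' mulmxBl !mulmxBr HH Hcr crH cr subrr subr0.
have HH' : H *m H' = H' by rewrite /H' mulmxBr HH Hcr.
have H'H : H' *m H = H' by rewrite /H' mulmxBl HH crH.
have H'c : H' *m c = 0 by rewrite /H' mulmxBl Hc -mulmxA rc mulmx1 subrr.
have rH' : r *m H' = 0 by rewrite /H' mulmxBr rH mulmxA rc mul1mx subrr.
have crE a b : (c *m r) a b = H a j * ((H i j)^-1 * H i b).
  by rewrite mxE big_ord1 !mxE.
have rn b : normc (r 0 b) <= 1.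
  rewrite !mxE normcM normcV mulrC ler_pdivrMr ?mul1r ?hij //.
  by rewrite lt_neqAle normc_ge0 andbT eq_sym; apply: contra_neq p0 => /eq0_normc ->.
have rowi : row i H' = 0.
  apply/rowP => b; rewrite !mxE big_ord1 !mxE mulrA divff ?mul1r ?subrr //.
have row0 a : row a H = 0 -> row a H' = 0.
  move=> e; rewrite /H' linearB /= e row_mul.
  have -> : row a c = 0.
    by apply/rowP => b; rewrite ord1 !mxE; have := congr1 (fun v : 'rV_n => v 0 j) e; rewrite !mxE.
  by rewrite mul0mx subrr.
have H'N a b : normc (H' a b) <= 2 * N.
  have -> : H' a b = H a b - (c *m r) a b by rewrite !mxE.
  apply: le_trans (le_normcD _ _) _; rewrite normcN crE normcM mulr2n mulrDl mul1r; apply: lerD => //.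
  rewrite -[N]mulr1; apply: ler_pM; rewrite ?normc_ge0 //.
  by have := rn b; rewrite !mxE.
have nzH' : (nz H' <= m)%N.
  rewrite -ltnS; apply: leq_trans nzH; apply: proper_card; apply/properP; split.
    by apply/fintype.subsetP => a; rewrite !inE; apply: contra_neq; exact: row0.
  exists i; rewrite !inE ?rowi ?eqxx //.
  apply: contra_neq p0 => e; have := congr1 (fun v : 'rV_n => v 0 j) e; by rewrite !mxE.
have [|S [x [y h]]] := IH H' (2 * N) _ nzH' H'H' H'N; first by rewrite mulr_ge0.
have [h1 h2 h3 h4 h5 h6 h7 h8 h9] := h.
have Si : ~~ S i by apply/negP => /h9; rewrite rowi eqxx.
pose ei : 'cV[C]_n := delta_mx i 0; pose ei' : 'rV[C]_n := delta_mx 0 i.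
pose S1 a := S a || (a == i).
have dS : dg S1 = dg S + ei *m ei'.
  apply/matrixP => a b; rewrite [LHS]mxE [RHS]mxE [X in _ = X + _]mxE [X in _ = _ + X]mxE big_ord1 !mxE /S1.
  have [->|ai] := eqVneq a i; last by rewrite orbF mul0r addr0.
  rewrite (negbTE Si) /= add0r [X in _ = X * _](_ : _ = 1) // mul1r.
  by congr (_%:R); rewrite /= eq_sym.
have xe : x *m ei = 0 by rewrite -h4 -mulmxA dg_delta // mulmx0.
have ey : ei' *m y = 0 by rewrite -h6 mulmxA delta_dg // mul0mx.
have yc : y *m c = 0 by rewrite -h5 -mulmxA H'c mulmx0.
have rx : r *m x = 0 by rewrite -h3 mulmxA rH' mul0mx.
have eS : ei' *m dg S = 0 by exact: delta_dg.
have Se : dg S *m ei = 0 by exact: dg_delta.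
have ee : ei' *m ei = 1%:M.
  by apply/matrixP => a b; rewrite !ord1 mul_delta_mx !mxE !eqxx.
have HN' : H' + c *m r = H by rewrite /H' subrK.
have Hx : H *m x = x by rewrite -h3 mulmxA HH'.
have yH : y *m H = y by rewrite -h5 -mulmxA H'H.
exists S1, (x + c *m ei'), (y + ei *m r); split.
- rewrite mulmxDl !mulmxDr h1 -(mulmxA c) ey mulmx0 add0r mulmxA xe mul0mx addr0.
  by rewrite -(mulmxA c) (mulmxA ei') ee mul1mx.
- rewrite mulmxDl !mulmxDr h2 (mulmxA y) yc mul0mx addr0 -(mulmxA ei r x) rx mulmx0 add0r.
  by rewrite -(mulmxA ei) (mulmxA r) rc mul1mx dS.
- by rewrite mulmxDr Hx mulmxA Hc.
- rewrite dS mulmxDl !mulmxDr h4 mulmxA xe mul0mx addr0 -(mulmxA c ei') eS mulmx0 add0r.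
  by rewrite -(mulmxA c) (mulmxA ei') ee mul1mx.
- by rewrite mulmxDl yH -mulmxA rH.
- rewrite dS mulmxDl !mulmxDr h6 mulmxA Se mul0mx addr0 -mulmxA ey mulmx0 add0r.
  by rewrite -(mulmxA ei) (mulmxA ei') ee mul1mx.
- move=> a b; rewrite [X in normc X]mxE; apply: le_trans (le_normcD _ _) _.
  rewrite [X in _ + normc X]mxE big_ord1 !mxE.
  have xb := h7 a b; have xn := normc_ge0 (x a b).
  have [->|bi] := eqVneq b i; last first.
    rewrite mulr0 normc_zero addr0; apply: le_trans xb _; rewrite exprSr mulrA lerD2l.
    by rewrite ler_nat.
  have -> : x a i = 0.
    have := congr1 (fun v : 'cV_n => v a 0) xe; by rewrite /ei -colE !mxE.
  rewrite normc_zero add0r mulr1; apply: le_trans (HN _ _) _.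
  rewrite -[X in X <= _]addr0; apply: lerD; last exact: ler0n.
  by rewrite ler_peMl // exprn_ege1 // ler1n.
- move=> a b; rewrite [X in normc X]mxE; apply: le_trans (le_normcD _ _) _.
  have -> : m.+1%:R = m%:R + 1 :> R by rewrite -addn1 natrD.
  rewrite addrA; apply: lerD.
    by apply: le_trans (h8 a b) _; rewrite exprSr mulrA.
  rewrite mxE big_ord1 [X in normc (X * _)]mxE eqxx andbT.
  have [_|ai] := eqVneq a i; first by rewrite mul1r.
  by rewrite mul0r normc_zero.
move=> a; rewrite /S1 => /orP[/h9|/eqP ->]; first by apply: contra_neq; exact: row0.
apply: contra_neq p0 => e; have := congr1 (fun v : 'rV_n => v 0 j) e; by rewrite !mxE.
Qed.
End IdemSplit.

Section BlockSplit.
Context {R : realType} {p : R} (p1 : 1 <= p) {I : choiceType}.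
Local Notation C := R[i].
Local Notation B := (bop I p1).
Variables (n : nat) (cls : I -> seq I) (hc : classes n cls).
Local Notation mat := (@mat R p p1 I n cls).

Lemma mcoef_chil (A : pred I) (T : B) i j : mcoef (chi p1 A * T) i j = if A i then mcoef T i j else 0.
Proof. exact: chiE. Qed.

Lemma mcoef_chir (A : pred I) (T : B) i j : mcoef (T * chi p1 A) i j = if A j then mcoef T i j else 0.
Proof.
rewrite -[LHS]/(T (chi p1 A (ellp_delta p1 j)) i).
have -> : chi p1 A (ellp_delta p1 j) = if A j then ellp_delta p1 j else 0.
  apply: ellp_ext => k; rewrite chiE; have [->|kj] := eqVneq k j; first by case: (A j).
  by rewrite ellp_deltaE (negbTE kj); case: (A j); case: (A k); rewrite ?ellp_deltaE ?(negbTE kj) ?ellp0E.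
case: (A j) => //; by rewrite linear0 ellp0E.
Qed.

Lemma mat_chi_dg (A : pred I) i (S : pred 'I_n) : (forall a, S a -> va cls i a) ->
  (forall j, j \in cls i -> A j = S (la hc j)) -> mat (chi p1 A) i = dg S.
Proof.
move=> Sv AS; apply/matrixP => a b; rewrite [LHS]mxE [RHS]mxE.
case xE : (pt cls i a) => [x|]; last first.
  by case Sa : (S a) => //; have := Sv _ Sa; rewrite va_pt xE.
have [xc lx] : x \in cls i /\ la hc x = a.
  by have := ptP hc i a x; rewrite xE eqxx => /esym/andP[? /eqP].
case yE : (pt cls i b) => [y|]; last first.
  have [e|ab] := eqVneq a b; last by rewrite andbF.
  by rewrite e yE in xE.
have ly : la hc y = b by apply/eqP; have := ptP hc i b y; rewrite yE eqxx => /esym/andP[].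
rewrite mcoef_chi AS // lx; congr (_%:R); congr ((_ && _) : nat).
apply/eqP/eqP => [e|e]; first by rewrite -lx -ly e.
by have := yE; rewrite -e xE => -[].
Qed.

(** An idempotent with blocks is, within the operators with blocks, equivalent to a
    coordinate projection. *)
Lemma block_split (T : B) : esupp cls T -> T * T = T -> exists (A : pred I) (x y : B),
  [/\ esupp cls x, esupp cls y, x * y = T & y * x = chi p1 A] /\
  [/\ T * x = x, x * chi p1 A = x, y * T = y, chi p1 A * y = y &
      forall i, A i -> exists j, mcoef T i j != 0].
Proof.
move=> eT TT; pose K := 2 ^+ n * opnorm T + n%:R.
have [spl hspl] : exists spl : 'M[C]_n -> pred 'I_n * 'M[C]_n * 'M[C]_n,
    forall i, split_data (mat T i) (spl (mat T i)).1.1 (spl (mat T i)).1.2 (spl (mat T i)).2 K.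
  have ex G : exists s : pred 'I_n * 'M[C]_n * 'M[C]_n, (exists i, G = mat T i) -> split_data G s.1.1 s.1.2 s.2 K.
    have [[i ->]|no] := pselect (exists i, G = mat T i); last by exists (xpred0, 0, 0).
    have [S [x [y h]]] := @idem_split R n (mat T i) (opnorm T) (opnorm_ge0 _)
      (etrans (esym (matM hc T i eT)) (congr1 (mat ^~ i) TT)) (fun a b => @mat_bound R p p1 I n cls T i a b).
    by exists (S, x, y).
  by exists (fun G => projT1 (cid (ex G))) => i; apply: (projT2 (cid (ex (mat T i)))); exists i.
pose S i := (spl (mat T i)).1.1; pose x i := (spl (mat T i)).1.2; pose y i := (spl (mat T i)).2.
have inv i j : j \in cls i -> mat T j = mat T i by move=> ji; exact: (mat_eq hc).
have bx : fbound x K by move=> i a b; exact: sp_x (hspl i) a b.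
have by' : fbound y K by move=> i a b; exact: sp_y (hspl i) a b.
have Sva i a : S i a -> va cls i a.
  move=> /(sp_S (hspl i)); apply: contraR => va'; apply/eqP/rowP => b; rewrite !mxE.
  by move: va'; rewrite va_pt negbK => /eqP ->.
have mx i : masked cls i (x i).
  move=> a b; rewrite negb_and => /orP[h|h].
    rewrite /x -(sp_Gx (hspl i)) mxE big1 // => c _; rewrite mat_masked ?mul0r //.
    by rewrite (negbTE h).
  rewrite /x -(sp_xS (hspl i)) mxE big1 // => c _; rewrite [X in _ * X]mxE.
  have [cb|cb] := eqVneq c b; last by rewrite andbF mulr0.
  case e : ((spl (mat T i)).1.1 c); last by rewrite mulr0.
  by have := Sva i c e; rewrite cb (negbTE h).
have my i : masked cls i (y i).
  move=> a b; rewrite negb_and => /orP[h|h].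
    rewrite /y -(sp_Sy (hspl i)) mxE big1 // => c _; rewrite [X in X * _]mxE.
    case e : ((spl (mat T i)).1.1 a); last by rewrite mul0r.
    by have := Sva i a e; rewrite (negbTE h).
  rewrite /y -(sp_yG (hspl i)) mxE big1 // => c _; rewrite (mat_masked T) ?mulr0 //.
  by rewrite (negbTE h) andbF.
pose X := blk p1 hc x; pose Y := blk p1 hc y; pose A i := S i (la hc i).
have mX i : mat X i = x i by apply: (mat_blk p1 hc bx) => // j ji; rewrite /x (inv i j).
have mY i : mat Y i = y i by apply: (mat_blk p1 hc by') => // j ji; rewrite /y (inv i j).
have mA i : mat (chi p1 A) i = dg (S i).
  by apply: mat_chi_dg => [a|j ji]; [exact: Sva|rewrite /A /S (inv i j)].
have eX : esupp cls X by exact: esupp_blk bx.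
have eY : esupp cls Y by exact: esupp_blk by'.
have eA : esupp cls (chi p1 A).
  move=> i j; rewrite mcoef_chi; have [->|_] := eqVneq i j; last by rewrite andbF eqxx.
  by move=> _; exact: cl_self hc j.
have hE := esupp_closed p1 hc; have eM (U V : B) : esupp cls U -> esupp cls V -> esupp cls (U * V).
  by move=> hU hV; apply: (csM (cs_csub0 hE)).
have ext (U V : B) : esupp cls U -> esupp cls V -> (forall i, mat U i = mat V i) -> U = V.
  move=> hU hV h; rewrite -(blk_mat hc hU) -(blk_mat hc hV); congr (blk p1 hc _).
  by apply/funext.
exists A, X, Y; split; split=> //.
- by apply: ext => // [|i]; [exact: eM|rewrite (matM hc) // mX mY; exact: sp_xy (hspl i)].
- by apply: ext => // [|i]; [exact: eM|rewrite (matM hc) // mX mY mA; exact: sp_yx (hspl i)].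
- by apply: ext => // [|i]; [exact: eM|rewrite (matM hc) // mX; exact: sp_Gx (hspl i)].
- by apply: ext => // [|i]; [exact: eM|rewrite (matM hc) // mX mA; exact: sp_xS (hspl i)].
- by apply: ext => // [|i]; [exact: eM|rewrite (matM hc) // mY; exact: sp_yG (hspl i)].
- by apply: ext => // [|i]; [exact: eM|rewrite (matM hc) // mY mA; exact: sp_Sy (hspl i)].
move=> i /(sp_S (hspl i)) h; apply: contrapT => /forallNP no; case/eqP: h; apply/rowP => b.
rewrite !mxE (pt_la hc (cl_self hc i)); case: (pt cls i b) => // j.
by apply/eqP; apply: contrapT => /negP; exact: no.
Qed.
End BlockSplit.

(** * Partial isomorphisms of coordinate projections *)

(** A choice of an enumeration for each class. *)
Lemma rel_classes (I : choiceType) (Rl : I -> I -> Prop) (n : nat) :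
    (forall i, Rl i i) -> (forall i j, Rl i j -> Rl j i) ->
    (forall i j k, Rl i j -> Rl j k -> Rl i k) ->
    (forall i, exists2 s : seq I, (size s <= n)%N & forall j, Rl i j -> j \in s) ->
  exists2 cls : I -> seq I, classes n cls & forall i j, (j \in cls i) <-> Rl i j.
Proof.
move=> Rr Rs Rt fin; pose S i : set I := [set j | Rl i j].
have finS i : finite_set (S i).
  have [s _ h] := fin i; apply: sub_finite_set (finite_fset [fset x in s]%fset) => j /h js.
  by rewrite /= inE.
pose cls i : seq I := fset_set (S i).
have clsE i j : (j \in cls i) <-> Rl i j.
  by rewrite /cls in_fset_set // inE.
exists cls => //; split.
- by move=> i; exact: fset_uniq.
- by move=> i; apply/clsE.
- move=> i j /clsE ij; rewrite /cls; congr (fset_set _ : seq I); apply/funext => k; apply/propext.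
  by split=> h; [exact: Rt ij h|exact: Rt (Rs _ _ ij) h].
move=> i; have [s ss h] := fin i; apply: leq_trans ss; apply: uniq_leq_size; first exact: fset_uniq.
by move=> j /clsE; exact: h.
Qed.

(** Hilbert's hotel: the points outside of A move along the orbits of phi. *)
Lemma hotel (I : choiceType) (W A : pred I) (phi : I -> I) :
    (forall i, A i -> W i) -> (forall i, W i -> A (phi i)) ->
    (forall i j, W i -> W j -> phi i = phi j -> i = j) ->
  exists h : I -> I, [/\ forall i, W i -> A (h i), forall i j, W i -> W j -> h i = h j -> i = j,
    forall a, A a -> exists2 i, W i & h i = a & forall i, h i = i \/ h i = phi i].
Proof.
move=> AW WA inj; pose C i := exists k w, [/\ W w, ~~ A w & i = iter k phi w].
pose h i := if `[< C i >] then phi i else i.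
have nC i : W i -> ~ C i -> A i by move=> Wi; apply: contra_notT => nA; exists 0, i.
have CS i : C i -> C (phi i) by move=> [k [w [Ww Aw ->]]]; exists k.+1, w.
exists h; split.
- by move=> i Wi; rewrite /h; case: asboolP => // c; [exact: WA|exact: nC].
- move=> i j Wi Wj; rewrite /h; case: asboolP => ci; case: asboolP => cj; [exact: inj| | |by []].
    by move=> e; case: cj; rewrite -e; exact: CS.
  by move=> e; case: ci; rewrite e; exact: CS.
- move=> a Aa; have [[k [w [Ww Aw e]]]|c] := pselect (C a); last first.
    by exists a; [exact: AW|rewrite /h; case: asboolP].
  case: k e => [e|k e]; first by move: Aa; rewrite e /= (negbTE Aw).
  exists (iter k phi w); last by rewrite /h asboolT //; exists k, w.
  by elim: {e} k => [|k IH] //=; exact/AW/WA.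
by move=> i; rewrite /h; case: asboolP; [right|left].
Qed.

Section PIso.
Context {B : pzRingType} (D : B -> Prop).

(** An equivalence of the idempotents P and Q in the sense of Murray and von Neumann. *)
Record piso (P Q a b : B) : Prop := PIso {
  pi_a : D a; pi_b : D b; pi_ab : a * b = P; pi_ba : b * a = Q;
  pi_Pa : P * a = a; pi_aQ : a * Q = a; pi_Qb : Q * b = b; pi_bP : b * P = b }.

Lemma piso_sym P Q a b : piso P Q a b -> piso Q P b a.
Proof. by case=> h1 h2 h3 h4 h5 h6 h7 h8; split. Qed.

Lemma piso_refl P : D P -> P * P = P -> piso P P P P. Proof. by []. Qed.

Hypotheses (DM : forall x y, D x -> D y -> D (x * y)) (DD : forall x y, D x -> D y -> D (x + y)).

Lemma piso_trans P Q S a b c d : piso P Q a b -> piso Q S c d -> piso P S (a * c) (d * b).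
Proof.
case=> h1 h2 h3 h4 h5 h6 h7 h8; case=> k1 k2 k3 k4 k5 k6 k7 k8; split; try exact: DM.
- by rewrite mulrA -(mulrA a) k3 h6.
- by rewrite mulrA -(mulrA d) h4 k8.
- by rewrite mulrA h5.
- by rewrite -mulrA k6.
- by rewrite mulrA k7.
- by rewrite -mulrA h8.
Qed.

Lemma piso_sum P P' Q Q' a b a' b' : P * P' = 0 -> P' * P = 0 -> Q * Q' = 0 -> Q' * Q = 0 ->
  piso P Q a b -> piso P' Q' a' b' -> piso (P + P') (Q + Q') (a + a') (b + b').
Proof.
move=> o1 o2 o3 o4; case=> h1 h2 h3 h4 h5 h6 h7 h8; case=> k1 k2 k3 k4 k5 k6 k7 k8.
have z (x y u v : B) : x * u = x -> u * v = 0 -> v * y = y -> x * y = 0.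
  by move=> <- e <-; rewrite mulrA -(mulrA x) e mulr0 mul0r.
have zl (u v w : B) : u * v = 0 -> v * w = w -> u * w = 0.
  by move=> e <-; rewrite mulrA e mul0r.
have zr (u v w : B) : u * v = u -> v * w = 0 -> u * w = 0.
  by move=> <- e; rewrite -mulrA e mulr0.
split; try exact: DD.
- by rewrite mulrDl !mulrDr h3 k3 (z a b' Q Q') // (z a' b Q' Q) // addr0 add0r.
- by rewrite mulrDl !mulrDr h4 k4 (z b a' P P') // (z b' a P' P) // addr0 add0r.
- by rewrite mulrDl !mulrDr h5 k5 (zl _ _ _ o1 k5) (zl _ _ _ o2 h5) addr0 add0r.
- by rewrite mulrDl !mulrDr h6 k6 (zr _ _ _ h6 o3) (zr _ _ _ k6 o4) addr0 add0r.
- by rewrite mulrDl !mulrDr h7 k7 (zl _ _ _ o3 k7) (zl _ _ _ o4 h7) addr0 add0r.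
- by rewrite mulrDl !mulrDr h8 k8 (zr _ _ _ h8 o1) (zr _ _ _ k8 o2) addr0 add0r.
Qed.

(** Partial isomorphisms on both sides of a splitting of F glue to a similarity. *)
Lemma glue P F q q' a b a' b' : D (1 - F) -> F * F = F -> P * P = P -> F * P = P * F -> q + q' = F ->
    q * q' = 0 -> q' * q = 0 -> piso q (F * P) a b -> piso q' (F * (1 - P)) a' b' ->
  exists k k', [/\ D k, D k', k * k' = 1 & k' * k = 1] /\
    (k * P * k' = q + (1 - F) * P /\ k - 1 = F * (k - 1) * F).
Proof.
move=> DF FF PP FP qF o1 o2 h h'.
have e1 : F * P * (F * (1 - P)) = 0.
  have -> : F * P * (F * (1 - P)) = F * (P * F) * (1 - P) by ncring.
  rewrite -FP mulrA FF; have -> : F * P * (1 - P) = F * (P - P * P) by ncring.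
  by rewrite PP subrr mulr0.
have e2 : F * (1 - P) * (F * P) = 0.
  have -> : F * (1 - P) * (F * P) = F * F * P - F * (P * F) * P by ncring.
  rewrite -FP (mulrA F F P) FF; have -> : F * P - F * P * P = F * (P - P * P) by ncring.
  by rewrite PP subrr mulr0.
have := piso_sum o1 o2 e1 e2 h h'; rewrite qF -mulrDr subrKC mulr1 => H.
exists (a + a' + (1 - F)), (b + b' + (1 - F)).
have [Da Db ab ba Fa aF Fb bF] := H.
have [h1 h2 h3 h4 h5 h6 h7 h8] := h; have [k1 k2 k3 k4 k5 k6 k7 k8] := h'.
have G0 x : F * x = x -> (1 - F) * x = 0 by move=> e; rewrite mulrBl mul1r e subrr.
have G1 x : x * F = x -> x * (1 - F) = 0 by move=> e; rewrite mulrBr mulr1 e subrr.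
have GG : (1 - F) * (1 - F) = 1 - F by rewrite mulrBl mul1r (G1 F FF) subr0.
split; first split; try exact: DD.
- by rewrite mulrDl (mulrDr (a + a')) (mulrDr (1 - F)) ab (G1 _ aF) (G0 _ Fb) GG addr0 add0r subrKC.
- by rewrite mulrDl (mulrDr (b + b')) (mulrDr (1 - F)) ba (G1 _ bF) (G0 _ Fa) GG addr0 add0r subrKC.
split.
  have aP : a * P = a by rewrite -{1}h6 -!mulrA PP h6.
  have a'P : a' * P = 0.
    rewrite -{1}k6 -!mulrA; have -> : (1 - P) * P = P - P * P by ncring.
    by rewrite PP subrr !mulr0.
  have GP : (1 - F) * P = P * (1 - F) by rewrite mulrBl mulrBr FP mul1r mulr1.
  have -> : (a + a' + (1 - F)) * P = a + (1 - F) * P by rewrite !mulrDl aP a'P addr0.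
  have ab0 : a * b' = 0.
    by rewrite -h6 -k7 mulrA -(mulrA a) e1 mulr0 mul0r.
  have Fbb : (1 - F) * P * (b + b') = 0 by rewrite GP -mulrA (G0 _ Fb) mulr0.
  have aF' : a * F = a.
    by rewrite -{1}h6 -!mulrA -FP (mulrA F F) FF h6.
  rewrite mulrDl (mulrDr a) (mulrDr a) (mulrDr ((1 - F) * P)) Fbb h3 ab0 (G1 _ aF') !addr0 add0r.
  by rewrite GP -mulrA GG.
have -> : a + a' + (1 - F) - 1 = (a + a') - F by ncring.
rewrite mulrBr Fa FF mulrBl aF; congr (_ - _); exact: esym.
Qed.
End PIso.

Section PullIso.
Context {R : realType} {p : R} (p1 : 1 <= p) {I : choiceType}.
Local Notation B := (bop I p1).
Variable ctl : I -> I -> Prop.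
Definition ctls (T : B) := forall i j, mcoef T i j != 0 -> ctl i j.

Lemma hotel_piso (W A : pred I) (phi : I -> I) :
    (forall i, A i -> W i) -> (forall i, W i -> A (phi i)) ->
    (forall i j, W i -> W j -> phi i = phi j -> i = j) ->
    (forall i, ctl i i) -> (forall i, W i -> ctl i (phi i)) -> (forall i j, ctl i j -> ctl j i) ->
  exists a b : B, piso ctls (chi p1 W) (chi p1 A) a b.
Proof.
move=> AW WA inj cr cp cs; have [h [hA hi hs hh]] := hotel AW WA inj.
have ch i : W i -> ctl i (h i) by move=> Wi; case: (hh i) => ->; [exact: cr|exact: cp].
have [g hg] : exists g : I -> I, forall a, A a -> W (g a) /\ h (g a) = a.
  have ex a : exists i, A a -> W i /\ h i = a.
    by have [/hs[i Wi e]|nA] := boolP (A a); [exists i|exists a].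
  by exists (fun a => projT1 (cid (ex a))) => a; exact: projT2 (cid (ex a)).
have s1 i i' j : (if W i then Some (h i) else None) = Some j -> (if W i' then Some (h i') else None) = Some j -> i = i'.
  by case: ifP => // Wi [<-]; case: ifP => // Wi' [e]; apply: hi.
have s2 i i' j : (if A i then Some (g i) else None) = Some j -> (if A i' then Some (g i') else None) = Some j -> i = i'.
  by case: ifP => // Ai [<-]; case: ifP => // Ai' [e]; rewrite -(hg i Ai).2 -(hg i' Ai').2 e.
have gh i : W i -> g (h i) = i by move=> Wi; have [Wg e] := hg _ (hA i Wi); exact: hi.
have ext (S T : B) : (forall u i, S u i = T u i) -> S = T.
  by move=> e; apply: mcoef_ext => i j; exact: e.
exists (pull p1 (Pinj s1)), (pull p1 (Pinj s2)); split.
- move=> i j; rewrite mcoef_pull /=; case: (boolP (W i)) => Wi; last by rewrite eqxx.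
  by case: (Some (h i) =P Some j) => [[<-] _|_]; [exact: ch|rewrite eqxx].
- move=> i j; rewrite mcoef_pull /=; case: (boolP (A i)) => Ai; last by rewrite eqxx.
  case: (Some (g i) =P Some j) => [[<-] _|_]; last by rewrite eqxx.
  by have [Wg e] := hg i Ai; apply: cs; rewrite -{2}e; exact: ch.
- apply: ext => u i; rewrite bopME chiE pullE /=; case: (boolP (W i)) => // Wi.
  by rewrite /pull_fun /= hA // gh.
- apply: ext => u i; rewrite bopME chiE pullE /=; case: (boolP (A i)) => // Ai.
  by have [Wg e] := hg i Ai; rewrite /pull_fun /= Wg e.
- by apply: ext => u i; rewrite bopME chiE pullE /=; case: (W i).
- by apply: ext => u i; rewrite bopME [LHS]pullE [RHS]pullE /=; case: (boolP (W i)) => // Wi; rewrite /pull_fun /= hA.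
- by apply: ext => u i; rewrite bopME chiE pullE /=; case: (A i).
by apply: ext => u i; rewrite bopME [LHS]pullE [RHS]pullE /=; case: (boolP (A i)) => // Ai; rewrite /pull_fun /= (hg i Ai).1.
Qed.
End PullIso.

(** * Block invertibles do not contribute *)

Section Window.
Context {R : realType} {X : metricType R} {p : R} (p1 : 1 <= p).
Local Notation I := ((X * bool) * int)%type.
Local Notation B := (bop I p1).
Implicit Types (i j : I) (T : B).

(** The coordinates are a point of X, one of two copies of X and a position in Z. DZ consists of
    the limits of operators of finite propagation in X and in Z. *)
Definition ctlZ (n : nat) i j : Prop :=
  mdist i.1.1 j.1.1 <= n%:R /\ `|i.2 - j.2| <= n%:Z.
Definition DZ : B -> Prop := @supp_cl R p p1 I ctlZ.
Definition posZ : pred I := fun i => 0 <= i.2.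
Definition winZ (N : nat) : pred I := fun i => `|i.2| <= N%:Z.
Definition PZ : B := chi p1 posZ.
Definition FZ (N : nat) : B := chi p1 (winZ N).

Lemma ctlZ_refl n i : ctlZ n i i.
Proof. by rewrite /ctlZ mdistxx subrr normr0; split. Qed.

Lemma ctlZ_sym n i j : ctlZ n i j -> ctlZ n j i.
Proof. by rewrite /ctlZ metric_sym distrC. Qed.

Lemma ctlZ_mono n m i j : (n <= m)%N -> ctlZ n i j -> ctlZ m i j.
Proof.
move=> nm [h1 h2]; split; [apply: le_trans h1 _|apply: le_trans h2 _]; rewrite ?ler_nat //.
Qed.

Lemma ctlZ_trans n m i j k : ctlZ n i j -> ctlZ m j k -> ctlZ (n + m) i k.
Proof.
move=> [h1 h2] [k1 k2]; split.
  by apply: le_trans (metric_triangle _ j.1.1 _) _; rewrite natrD; exact: lerD.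
apply: le_trans (ler_distD j.2 _ _) _; rewrite PoszD; exact: lerD.
Qed.

Lemma DZ_csub : csub (@opnorm R I p p1) DZ.
Proof. exact: supp_cl_csub ctlZ_refl ctlZ_mono ctlZ_trans. Qed.

Lemma DZ_in n T : supp ctlZ n T -> DZ T. Proof. exact: supp_in. Qed.

Lemma supp_chi n (A : pred I) : supp ctlZ n (chi p1 A).
Proof.
move=> i j; rewrite mcoef_chi; have [->|_] := eqVneq i j; last by rewrite andbF eqxx.
by move=> _; exact: ctlZ_refl.
Qed.

Lemma DZ_chi (A : pred I) : DZ (chi p1 A). Proof. exact: DZ_in (@supp_chi 0 A). Qed.

Lemma opnorm_chi (A : pred I) : opnorm (chi p1 A) <= 1. Proof. exact: opnorm_pull. Qed.

Lemma opnorm_1chi (A : pred I) : opnorm (1 - chi p1 A) <= 1.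
Proof. by rewrite -chiC; exact: opnorm_pull. Qed.

Lemma chi_ext (A A' : pred I) : A =1 A' -> chi p1 A = chi p1 A'.
Proof. by move=> e; apply: mcoef_ext => i j; rewrite !mcoef_chi e. Qed.

Lemma chiD (A A' : pred I) : (forall i, ~~ (A i && A' i)) -> chi p1 A + chi p1 A' = chi p1 (fun i => A i || A' i).
Proof.
move=> d; apply: mcoef_ext => i j; rewrite mcoefD !mcoef_chi; have := d i.
by case: (A i); case: (A' i) => //= _; rewrite ?addr0 ?add0r.
Qed.

Lemma FZ_FZ N M : (N <= M)%N -> FZ N * FZ M = FZ N /\ FZ M * FZ N = FZ N.
Proof.
move=> NM; rewrite /FZ !chi_mul; split; apply: chi_ext => i; rewrite /winZ.
  by case: (boolP (_ <= N%:Z)) => //= h; apply: le_trans h _.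
by case: (boolP (_ <= N%:Z)) => //= h; rewrite ?andbF // andbT; apply: le_trans h _.
Qed.

Lemma FZ_PZ N : FZ N * PZ = PZ * FZ N.
Proof. by rewrite /FZ /PZ !chi_mul; apply: chi_ext => i; rewrite andbC. Qed.

Lemma PZ_PZ : PZ * PZ = PZ. Proof. exact: chi_idem. Qed.

Lemma opnorm_pm (S T U : B) (e : R) : opnorm S <= 1 -> opnorm T <= e -> opnorm U <= 1 -> 0 <= e ->
  opnorm (S * T * U) <= e.
Proof.
move=> h1 h2 h3 e0; apply: le_trans (opnormM_le _ _) _; rewrite -[e]mulr1.
apply: ler_pM; [exact: opnorm_ge0|exact: opnorm_ge0| |exact: h3].
apply: le_trans (opnormM_le _ _) _; rewrite -[e]mul1r.
by apply: ler_pM; [exact: opnorm_ge0|exact: opnorm_ge0|exact: h1|exact: h2].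
Qed.

(** T is close to an operator that moves the integer coordinate by at most n, and then
    M = N + n serves. *)
Lemma bandZ T N (e : R) : DZ T -> 0 < e -> exists M0, forall M, (M0 <= M)%N ->
  opnorm ((1 - FZ M) * T * FZ N) <= e /\ opnorm (FZ N * T * (1 - FZ M)) <= e.
Proof.
move=> DT e0; have [n [S [hS hTS]]] := DT _ e0; exists (N + n)%N => M NM.
have z1 : (1 - FZ M) * S * FZ N = 0.
  apply: mcoef_ext => i j; rewrite mcoef0 /FZ mcoef_chir -chiC mcoef_chil.
  case: ifP => // hj; case: ifP => // hi; apply/eqP; apply: contraT => /hS [_ h].
  by move: hi hj; rewrite /winZ => hi hj; move: h hi hj NM; clear; lia.
have z2 : FZ N * S * (1 - FZ M) = 0.
  apply: mcoef_ext => i j; rewrite mcoef0 /FZ -chiC mcoef_chir mcoef_chil.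
  case: ifP => // hj; case: ifP => // hi; apply/eqP; apply: contraT => /hS [_ h].
  by move: hi hj; rewrite /winZ => hi hj; move: h hi hj NM; clear; lia.
split.
  have -> : (1 - FZ M) * T * FZ N = (1 - FZ M) * (T - S) * FZ N + (1 - FZ M) * S * FZ N by ncring.
  by rewrite z1 addr0; exact: opnorm_pm (opnorm_1chi _) hTS (opnorm_chi _) (ltW e0).
have -> : FZ N * T * (1 - FZ M) = FZ N * (T - S) * (1 - FZ M) + FZ N * S * (1 - FZ M) by ncring.
by rewrite z2 addr0; exact: opnorm_pm (opnorm_chi _) hTS (opnorm_1chi _) (ltW e0).
Qed.

(** The commutator with the half-line of an operator that moves the integer coordinate by at
    most n lives in the window n. *)
Lemma edgeZ T (e : R) : DZ T -> 0 < e -> exists M0, forall M, (M0 <= M)%N ->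
  opnorm ((1 - FZ M) * (T * PZ - PZ * T)) <= e /\ opnorm ((T * PZ - PZ * T) * (1 - FZ M)) <= e.
Proof.
move=> DT e0; have e2 : 0 < e / 2 by rewrite divr_gt0.
have [n [S [hS hTS]]] := DT _ e2; exists n => M nM.
have cS i j : mcoef (S * PZ - PZ * S) i j = ((posZ j)%:R - (posZ i)%:R) * mcoef S i j.
  rewrite mcoefB /PZ mcoef_chir mcoef_chil mulrBl.
  by case: (posZ i); case: (posZ j); rewrite ?mul1r ?mul0r.
have z1 : (1 - FZ M) * (S * PZ - PZ * S) = 0.
  apply: mcoef_ext => i j; rewrite mcoef0 /FZ -chiC mcoef_chil cS.
  case: ifP => // hi; apply/eqP; apply: contraT; rewrite mulf_eq0 negb_or => /andP[h1 /hS [_ h]].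
  move: h1; rewrite subr_eq0 => h1; have {}h1 : posZ j != posZ i by apply: contra_neq h1 => ->.
  by move: hi h1; rewrite /winZ /posZ => hi h1; move: h hi h1 nM; clear; lia.
have z2 : (S * PZ - PZ * S) * (1 - FZ M) = 0.
  apply: mcoef_ext => i j; rewrite mcoef0 /FZ -chiC mcoef_chir cS.
  case: ifP => // hi; apply/eqP; apply: contraT; rewrite mulf_eq0 negb_or => /andP[h1 /hS [_ h]].
  move: h1; rewrite subr_eq0 => h1; have {}h1 : posZ j != posZ i by apply: contra_neq h1 => ->.
  by move: hi h1; rewrite /winZ /posZ => hi h1; move: h hi h1 nM; clear; lia.
have small : opnorm ((T - S) * PZ - PZ * (T - S)) <= e.
  apply: le_trans (opnormB_le _ _) _; rewrite (splitr e); apply: lerD.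
    by have := opnorm_pm (opnorm1_le _) hTS (opnorm_chi posZ) (ltW e2); rewrite mul1r.
  by have := opnorm_pm (opnorm_chi posZ) hTS (opnorm1_le _) (ltW e2); rewrite mulr1.
split.
  have -> : (1 - FZ M) * (T * PZ - PZ * T) =
    (1 - FZ M) * ((T - S) * PZ - PZ * (T - S)) * 1 + (1 - FZ M) * (S * PZ - PZ * S) by ncring.
  by rewrite z1 addr0; exact: opnorm_pm (opnorm_1chi _) small (opnorm1_le _) (ltW e0).
have -> : (T * PZ - PZ * T) * (1 - FZ M) =
    1 * ((T - S) * PZ - PZ * (T - S)) * (1 - FZ M) + (S * PZ - PZ * S) * (1 - FZ M) by ncring.
by rewrite z2 addr0; exact: opnorm_pm (opnorm1_le _) small (opnorm_1chi _) (ltW e0).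
Qed.

Definition KcZ := Kc (@opnorm R I p p1) DZ FZ.
Definition KsimZ := Ksim (@opnorm R I p p1) DZ PZ FZ.
Definition hnZ := bop_bnorm p1 (I := I).

Lemma ctls_csub (Rl : I -> I -> Prop) : (forall i, Rl i i) ->
  (forall i j k, Rl i j -> Rl j k -> Rl i k) -> csub (@opnorm R I p p1) (ctls Rl).
Proof.
move=> Rr Rt; have [h1 h2] := @supp_cl_csub R p p1 I (fun=> Rl) (fun=> Rr)
  (fun _ _ _ _ _ h => h) (fun _ _ _ _ _ => Rt _ _ _).
have cl T : @supp_cl R p p1 I (fun=> Rl) T -> ctls Rl T.
  move=> hT i j Tij; have c0 : 0 < normc (mcoef T i j) / 2.
    by rewrite divr_gt0 // lt_neqAle normc_ge0 andbT eq_sym; apply: contra_neq Tij => /eq0_normc.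
  have [n [S [hS d]]] := hT _ c0; apply: (hS i j); apply: contraT; rewrite negbK => /eqP S0.
  have := le_trans (normc_mcoef (T - S) i j) d; rewrite mcoefB S0 subr0.
  by move: c0; generalize (normc (mcoef T i j)); clear; intros; lra.
have inn T : ctls Rl T -> @supp_cl R p p1 I (fun=> Rl) T by move=> h; exact: (@supp_in R p p1 I (fun=> Rl) 0).
split; last by apply: cl; exact: h2.
case: h1 => a1 a2 a3 a4; split.
- exact: cl.
- by move=> S T /inn hS /inn hT; exact: (cl _ (a2 S T hS hT)).
- by move=> S T /inn hS /inn hT; exact: (cl _ (a3 S T hS hT)).
move=> T h; apply: cl; apply: a4 => e e0; have [S hS d] := h e e0.
by exists S; [exact: inn|exact: d].
Qed.

End Window.

(** The constants of the cut: h is the defect and d the distance. *)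
Lemma cut_small {R : realType} (C e h0 d : R) : 1 <= C ->
    e = (8 * (2 * C + 3) * (2 * C + 3) * C)^-1 -> 0 <= h0 -> h0 <= C * e ->
    d <= 2 * e + 2 * (2 * C + 3) * h0 ->
  [/\ 0 < e, 4 * h0 <= (2 * C + 3)^-1, 2 * ((1 + 2 * (C + 1)) * d) <= 1 & d <= 1].
Proof.
move=> C1 eE h0p h0e dle; pose K := 2 * C + 3; have K5 : 5 <= K by rewrite /K; lra.
have K0 : 0 < K by lra.
have C0 : 0 < C by lra.
have Q0 : 0 < 8 * K * K * C by rewrite !mulr_gt0.
have e0 : 0 < e by rewrite eE invr_gt0.
have eQ : e * (8 * K * K * C) = 1 by rewrite eE mulVf // gt_eqF.
have k1 : K * (C * e) * (8 * K) = 1 by rewrite -[RHS]eQ; ring.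
have Ce : C * e <= K * (C * e) by rewrite ler_peMl ?mulr_ge0 ?ltW //; lra.
have le1 : K * (C * e) <= (8 * K)^-1 by rewrite -[X in X <= _](mulfK (_ : 8 * K != 0)) ?k1 ?mul1r // gt_eqF // mulr_gt0.
have iK : K^-1 <= 5^-1 by rewrite lef_pV2 ?posrE.
have i8 : (8 * K)^-1 = 8^-1 * K^-1 by rewrite invfM.
have iK0 : 0 < K^-1 by rewrite invr_gt0.
have ee : e <= C * e by rewrite ler_peMl // ltW.
have hK : K * h0 <= K * (C * e) by rewrite ler_wpM2l // ltW.
have k2 : K * (K * (C * e)) = 8^-1.
  by have : K * (K * (C * e)) * 8 = 1 by [rewrite -[RHS]k1; ring]; lra.
have kk : K * e <= 5^-1 * (K * (K * (C * e))).
  have a1 : C * e <= 5^-1 * K * (C * e).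
    by rewrite ler_peMl ?mulr_ge0 ?(ltW C0) ?(ltW e0) //; lra.
  have -> : 5^-1 * (K * (K * (C * e))) = K * (5^-1 * K * (C * e)) by ring.
  by apply: ler_wpM2l; [exact: ltW|exact: le_trans ee a1].
have kd : K * d <= 2 * (K * e) + 2 * (K * (K * h0)).
  have -> : 2 * (K * e) + 2 * (K * (K * h0)) = K * (2 * e + 2 * K * h0) by ring.
  by rewrite ler_wpM2l // ltW.
have khh : K * (K * h0) <= K * (K * (C * e)) by rewrite ler_wpM2l // ltW.
split=> //; first by rewrite -/K; lra.
  have -> : 1 + 2 * (C + 1) = K by rewrite /K; ring.
  by lra.
by move: dle; rewrite -/K; lra.
Qed.

Lemma cut_pos {R : realType} (C : R) : 1 <= C ->
  [/\ 0 < (8 * (2 * C + 3) * (2 * C + 3) * C)^-1, 0 < 2 * C + 3 & (2 * C + 3)^-1 <= 2^-1].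
Proof.
move=> C1; have C0 : 0 < C by lra.
have K0 : 0 < 2 * C + 3 by lra.
split=> //; first by rewrite invr_gt0 !mulr_gt0.
by rewrite lef_pV2 ?posrE //; lra.
Qed.

Section BlockKsim.
Context {R : realType} {X : metricType R} {p : R} (p1 : 1 <= p).
Local Notation I := ((X * bool) * int)%type.
Local Notation B := (bop I p1).
Local Notation DZ := (@DZ R X p p1).
Local Notation FZ := (@FZ R X p p1).
Local Notation PZ := (@PZ R X p p1).
Local Notation hn := (hnZ p1 (X := X)).
Local Notation hD := (DZ_csub p1 (X := X)).
Variables (bgX : bounded_geometry X) (naX : ~ amenable X).
Variables (E : X -> X -> Prop) (r : R).
Hypotheses (Er : forall x, E x x) (Es : forall x y, E x y -> E y x)
  (Et : forall x y z, E x y -> E y z -> E x z) (Eb : forall x y, E x y -> mdist x y <= r).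

Let FnZ N : opnorm (1 - FZ N) <= 1. Proof. exact: opnorm_1chi. Qed.
Let relE (i j : I) := E i.1.1 j.1.1.
Let DE (T : B) := DZ T /\ ctls relE T.

Let relW (N : nat) (i j : I) := i = j \/ [/\ relE i j, winZ N i & winZ N j].

Lemma relW_classes N : exists n, exists2 cls : I -> seq I, classes n cls &
  forall i j, (j \in cls i) <-> relW N i j.
Proof.
have [Nb [Nb0 hb]] := ball_card bgX r.
pose zs := [seq Posz k | k <- iota 0 N.+1] ++ [seq - (Posz k) | k <- iota 0 N.+1].
have zsP (k : int) : `|k| <= N%:Z -> k \in zs.
  move=> hk; rewrite mem_cat; case: k hk => k hk.
    by apply/orP; left; apply/mapP; exists k => //; rewrite mem_iota add0n /= ltnS -lez_nat.
  apply/orP; right; apply/mapP; exists k.+1; last by rewrite NegzE.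
  by rewrite mem_iota add0n /= ltnS -lez_nat; move: hk; clear; lia.
pose S (i : I) : seq I := i :: [seq (xb, k) | xb <- [seq (x, b) | x <- ball i.1.1 r, b <- [:: true; false]], k <- zs].
exists (Nb * 2 * size zs).+1; apply: rel_classes.
- by move=> i; left.
- by move=> i j [->|[h1 h2 h3]]; [left|right; split=> //; exact: Es].
- move=> i j k [->|[h1 h2 h3]] // [<-|[k1 k2 k3]]; first by right.
  by right; split=> //; exact: Et h1 k1.
move=> i; exists (S i).
  have -> : size (S i) = (#|` ball i.1.1 r| * 2 * size zs).+1.
    by rewrite /S [LHS]/(size (_ :: _)) -[LHS]/(size _).+1 !size_allpairs.
  rewrite ltnS leq_mul2r; apply/orP; right.
  by rewrite leq_mul2r; apply/orP; right; exact: hb.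
move=> j [->|[h1 h2 h3]]; rewrite /S inE ?eqxx //; apply/orP; right.
case: j h1 h3 => [[y b] k] h1 h3; apply/allpairsP; exists ((y, b), k); split; [|exact: zsP|by []].
apply/allpairsP; exists (y, b); split=> //=; last by case: (b).
by rewrite (ballE bgX); exact: Eb.
Qed.

Lemma DE_csub : csub (@opnorm R I p p1) DE.
Proof. by apply: csub_cap hD _; apply: ctls_csub => [i|i j k]; [exact: Er|exact: Et]. Qed.

Lemma DE_chi (A : pred I) : DE (chi p1 A).
Proof.
split; first exact: DZ_chi.
move=> i j; rewrite mcoef_chi; have [->|_] := eqVneq i j; last by rewrite andbF eqxx.
by move=> _; exact: Er.
Qed.

(** By spread, the finitely many copies of X in the window inject in the copy in the slot z
    with bounded displacement, and the hotel turns this injection into a partial isomorphism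
    with A, which contains the slot. *)
Lemma window_piso (M : nat) (z : int) (A : pred I) : `|z| <= M%:Z ->
    (forall i, A i -> winZ M i) -> (forall x, A ((x, true), z)) ->
  exists a b : B, piso DZ (FZ M) (chi p1 A) a b.
Proof.
move=> zM AW Az; pose m := (2 * (2 * M).+1)%N.
have [s s0 [f [fs fi]]] := spread bgX naX m.
pose idx (i : I) := (i.1.2 + 2 * `|(i.2 + M%:Z)%R|)%N.
have idx_lt i : winZ M i -> (idx i < m)%N.
  by rewrite /winZ /idx /m; case: (i.1.2) => /=; clear; lia.
have idx_inj i j : winZ M i -> winZ M j -> idx i = idx j -> i.1.2 = j.1.2 /\ i.2 = j.2.
  by rewrite /winZ /idx; case: (i.1.2); case: (j.1.2) => /=; clear; move=> h1 h2 h3; split=> //; lia.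
pose phi (i : I) : I := ((f i.1.1 (idx i), true), z).
have [n [hn1 hn2]] : exists n : nat, s <= n%:R /\ (2 * M <= n)%N.
  exists (maxn (Num.bound s) (2 * M)); split; last exact: leq_maxr.
  apply: (@le_trans _ _ (Num.bound s)%:R); last by rewrite ler_nat leq_maxl.
  exact/ltW/archi_boundP.
have := @hotel_piso R p p1 I (ctlZ n) (winZ M) A phi AW (fun i _ => Az _).
case.
- move=> [[x b] k] [[y c] l] wi wj [e]; have [exy ei] := fi _ _ _ _ (idx_lt _ wi) (idx_lt _ wj) e.
  by have [/= e1 e2] := idx_inj _ _ wi wj ei; rewrite /= in exy; rewrite exy e1 e2.
- exact: ctlZ_refl.
- move=> i wi; split; first by apply: le_trans (fs _ _) _; exact: hn1.
  by move: wi zM hn2; rewrite /winZ /=; clear; lia.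
- exact: ctlZ_sym.
move=> a [b [h1 h2 h3 h4 h5 h6 h7 h8]]; exists a, b.
by split=> //; apply: DZ_in; eassumption.
Qed.

(** In the window M + 1 the idempotent q + (1 - FZ M) PZ contains the copies of X at the
    position M + 1 and misses those at the position - (M + 1). So this idempotent and its complement
    in the window are equivalent to coordinate projections that contain a copy of X, that is,
    both are equivalent to the whole window; the same holds for PZ, and glue applies. *)
Lemma window_idem (M : nat) (q : B) : ctls relE q -> q * q = q -> FZ M * q * FZ M = q ->
  KsimZ (q + (1 - FZ M) * PZ).
Proof.
move=> Eq qq Fq; set F := FZ M; have [q2 q2E] : exists q2 : B, q2 = F - q by exists (F - q).
have FF : F * F = F by exact: chi_idem.
have Fq1 : F * q = q by rewrite -{1}Fq !mulrA FF.
have qF1 : q * F = q by rewrite -{1}Fq -!mulrA FF !mulrA.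
have q22 : q2 * q2 = q2 by rewrite q2E mulrBl !mulrBr FF Fq1 qF1 qq subrr subr0.
have [n [cls hc clsP]] := relW_classes M.
have Fcoef (T : B) i j : F * T = T -> T * F = T -> mcoef T i j != 0 -> winZ M i /\ winZ M j.
  move=> h1 h2; rewrite -h1 -h2 /F /FZ mulrA mcoef_chir mcoef_chil.
  by case: (winZ M i); case: (winZ M j); rewrite ?eqxx.
have eq1 : esupp cls q.
  by move=> i j qij; apply/clsP; right; have [? ?] := Fcoef _ _ _ Fq1 qF1 qij; split=> //; exact: Eq.
have eF : esupp cls F.
  move=> i j; rewrite mcoef_chi; have [->|_] := eqVneq i j; last by rewrite andbF eqxx.
  by move=> _; exact: cl_self hc j.
have eq2 : esupp cls q2 by rewrite q2E; exact: (csB (cs_csub0 (esupp_closed p1 hc)) eF eq1).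
have Fq2 : F * q2 = q2 by rewrite q2E mulrBr FF Fq1.
have q2F : q2 * F = q2 by rewrite q2E mulrBl FF qF1.
have eD (T : B) : esupp cls T -> DZ T.
  move=> eT; apply: (@DZ_in _ _ _ _ (maxn (Num.bound `|r|) (2 * M))) => i j /eT /clsP[->|[h1 h2 h3]].
    exact: ctlZ_refl.
  split.
    apply: le_trans (Eb h1) _; apply: (@le_trans _ _ (Num.bound `|r|)%:R); last by rewrite ler_nat leq_maxl.
    by apply: le_trans (ler_norm r) _; apply/ltW/archi_boundP.
  by move: h2 h3; rewrite /winZ; clear; lia.
have [A [x [y [[ex ey xy yx] [qx xA yq Ay Arow]]]]] := block_split hc eq1 qq.
have [A2 [x2 [y2 [[ex2 ey2 xy2 yx2] [qx2 xA2 yq2 Ay2 A2row]]]]] := block_split hc eq2 q22.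
have p1' : piso DZ q (chi p1 A) x y by split=> //; exact: eD.
have p2' : piso DZ q2 (chi p1 A2) x2 y2 by split=> //; exact: eD.
have AW i : A i -> winZ M i by move=> /Arow[j h]; have [] := Fcoef _ _ _ Fq1 qF1 h.
have A2W i : A2 i -> winZ M i by move=> /A2row[j h]; have [] := Fcoef _ _ _ Fq2 q2F h.
(* the slots added to q and to its complement in the window *)
pose sp : pred I := fun i => i.2 == M.+1%:Z; pose sm : pred I := fun i => i.2 == - M.+1%:Z.
have rf (S : pred I) : piso DZ (chi p1 S) (chi p1 S) (chi p1 S) (chi p1 S).
  by apply: piso_refl; [exact: DZ_chi|exact: chi_idem].
have chi0 (S S' : pred I) : (forall i, ~~ (S i && S' i)) -> chi p1 S * chi p1 S' = 0.
  by move=> h; rewrite chi_mul; apply: mcoef_ext => i j; rewrite mcoef_chi mcoef0 (negbTE (h i)).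
have dFp i : ~~ (winZ M i && sp i) by rewrite /winZ /sp; clear; lia.
have dFm i : ~~ (winZ M i && sm i) by rewrite /winZ /sm; clear; lia.
have dpm i : ~~ (sp i && sm i) by rewrite /sp /sm; clear; lia.
have swap (S S' : pred I) : (forall i, ~~ (S i && S' i)) -> forall i, ~~ (S' i && S i).
  by move=> h i; rewrite andbC.
have sub (S S' S2 : pred I) : (forall i, S i -> S' i) -> (forall i, ~~ (S' i && S2 i)) -> forall i, ~~ (S i && S2 i).
  by move=> h1 h2 i; apply: contra (h2 i) => /andP[/h1 -> ->].
have kl (T : B) (S : pred I) : T * F = T -> (forall i, ~~ (winZ M i && S i)) -> T * chi p1 S = 0.
  by move=> h1 h2; rewrite -h1 -mulrA chi0 ?mulr0.
have kr (T : B) (S : pred I) : F * T = T -> (forall i, ~~ (winZ M i && S i)) -> chi p1 S * T = 0.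
  by move=> h1 h2; rewrite -h1 mulrA chi0 ?mul0r //; exact: swap.
have DM := csM hD; have DD := csD hD.
have P1 := piso_sum DD (kl q sp qF1 dFp) (kr q sp Fq1 dFp) (chi0 _ _ (sub _ _ _ AW dFp))
  (chi0 _ _ (swap _ _ (sub _ _ _ AW dFp))) p1' (rf sp).
have P2 := piso_sum DD (kl q2 sm q2F dFm) (kr q2 sm Fq2 dFm) (chi0 _ _ (sub _ _ _ A2W dFm))
  (chi0 _ _ (swap _ _ (sub _ _ _ A2W dFm))) p2' (rf sm).
rewrite (chiD _ (sub _ _ _ AW dFp)) in P1; rewrite (chiD _ (sub _ _ _ A2W dFm)) in P2.
have winS i : winZ M i -> winZ M.+1 i by rewrite /winZ; clear; lia.
have [a1 [b1 H1]] : exists a b : B, piso DZ (FZ M.+1) (chi p1 (fun i => A i || sp i)) a b.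
  apply: (@window_piso _ M.+1%:Z) => [|i /orP[/AW/winS //|]|x0].
  - by [].
  - by rewrite /sp /winZ; clear; lia.
  - by rewrite /sp eqxx orbT.
have [a2 [b2 H2]] : exists a b : B, piso DZ (FZ M.+1) (FZ M.+1 * PZ) a b.
  rewrite /FZ /PZ chi_mul; apply: (@window_piso _ M.+1%:Z) => [|i /andP[]|x0] //.
  by rewrite /posZ /winZ /=; clear; lia.
have [a3 [b3 H3]] : exists a b : B, piso DZ (FZ M.+1) (chi p1 (fun i => A2 i || sm i)) a b.
  apply: (@window_piso _ (- M.+1%:Z)) => [|i /orP[/A2W/winS //|]|x0].
  - by rewrite normrN.
  - by rewrite /sm /winZ; clear; lia.
  - by rewrite /sm eqxx orbT.
have [a4 [b4 H4]] : exists a b : B, piso DZ (FZ M.+1) (FZ M.+1 * (1 - PZ)) a b.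
  rewrite /FZ /PZ -chiC chi_mul; apply: (@window_piso _ (- M.+1%:Z)) => [|i /andP[]|x0] //.
  by rewrite /posZ /winZ /=; clear; lia.
have Q1 := piso_trans DM P1 (piso_trans DM (piso_sym H1) H2).
have Q2 := piso_trans DM P2 (piso_trans DM (piso_sym H3) H4).
have FM1 : FZ M.+1 = F + chi p1 sp + chi p1 sm.
  rewrite /F /FZ (chiD _ dFp) chiD; last by move=> i; rewrite /winZ /sp /sm; clear; lia.
  by apply: chi_ext => i; rewrite /winZ /sp /sm; clear; lia.
have D1F : DZ (1 - FZ M.+1) by apply: (csB hD); [exact: cs1 hD|exact: DZ_chi].
have qqF : q + chi p1 sp + (q2 + chi p1 sm) = FZ M.+1 by rewrite FM1 q2E; ncring.
have o1 : (q + chi p1 sp) * (q2 + chi p1 sm) = 0.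
  have qq2 : q * q2 = 0 by rewrite q2E mulrBr qF1 qq subrr.
  by rewrite mulrDl !mulrDr (kl q sm qF1 dFm) (kr q2 sp Fq2 dFp) (chi0 _ _ dpm) qq2 !addr0.
have o2 : (q2 + chi p1 sm) * (q + chi p1 sp) = 0.
  have qq2 : q2 * q = 0 by rewrite q2E mulrBl Fq1 qq subrr.
  by rewrite mulrDl !mulrDr (kl q2 sp q2F dFp) (kr q sm Fq1 dFm) (chi0 _ _ (swap _ _ dpm)) qq2 !addr0.
have [k [k' [ik [e kc]]]] := glue DD D1F (chi_idem p1 (winZ M.+1)) (PZ_PZ p1 (X := X)) (FZ_PZ p1 M.+1) qqF o1 o2 Q1 Q2.
exists k, k'; split; first exact: ik.
  case: ik => Dk _ _ _; apply: (Kc_corner hn (@FZ_FZ R X p p1) _ kc).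
  exact: (csB hD Dk (cs1 hD)).
rewrite e -addrA; congr (_ + _).
have -> : (1 - FZ M.+1) * PZ = (1 - F) * PZ - chi p1 sp * PZ - chi p1 sm * PZ by rewrite FM1; ncring.
have -> : chi p1 sp * PZ = chi p1 sp.
  by rewrite /PZ chi_mul; apply: chi_ext => i; rewrite /sp /posZ; clear; lia.
have -> : chi p1 sm * PZ = 0 by rewrite /PZ chi0 // => i; rewrite /sm /posZ; clear; lia.
by rewrite subr0 subrKC.
Qed.

(** Cutting the conjugate of PZ to a window leaves an idempotent with blocks of finite size. *)
Lemma block_Ksim (c c' : B) : DE c -> DE c' -> c * c' = 1 -> c' * c = 1 -> KsimZ (c * PZ * c').
Proof.
move=> Dc Dc' h1 h2; have ic : inv2 DZ c c' by split=> //; [case: Dc|case: Dc'].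
have hE := DE_csub; set g := c * PZ * c'.
have DP : DZ PZ by exact: DZ_chi.
have DF N : DZ (FZ N) by exact: DZ_chi.
have DEg : DE g by exact: (csM hE (csM hE Dc (DE_chi _)) Dc').
have gg : g * g = g.
  have -> : g * g = c * PZ * (c' * c) * PZ * c' by rewrite /g !mulrA.
  by rewrite h2 mulr1 -(mulrA c) PZ_PZ.
have Kg : KcZ (g - PZ).
  exact: (Kc_sim hn hD DP FnZ (@bandZ R X p p1) (@edgeZ R X p p1) ic).
pose C := opnorm g + 1; have C1 : 1 <= C by rewrite /C lerDr; exact: opnorm_ge0.
have gC : opnorm g <= C by rewrite /C lerDl.
pose e := (8 * (2 * C + 3) * (2 * C + 3) * C)^-1.
have [e0 K0 r2] : [/\ 0 < e, 0 < 2 * C + 3 & (2 * C + 3)^-1 <= 2^-1] by exact: cut_pos.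
have [_ hK] := Kg; have [M hM] := hK _ e0; have [n1 n2] := hM _ (leqnn M).
set F := FZ M in n1 n2; have FF : F * F = F by exact: chi_idem.
have FP : F * PZ = PZ * F by exact: FZ_PZ.
pose f := F * g * F.
have fC : opnorm f <= C by exact: opnorm_pm (opnorm_chi _ _) gC (opnorm_chi _ _) (le_trans ler01 C1).
have fd : f * f - f = - (F * g * ((1 - F) * (g - PZ)) * F).
  have -> : - (F * g * ((1 - F) * (g - PZ)) * F) = F * g * F * g * F - F * (g * g) * F + F * g * (1 - F) * (PZ * F) by ncring.
  rewrite -FP (mulrA (F * g * (1 - F))) -(mulrA (F * g) (1 - F) F) (_ : (1 - F) * F = 0); last first.
    by rewrite mulrBl mul1r FF subrr.
  rewrite mulr0 mul0r addr0 gg /f; have -> : F * g * F * (F * g * F) = F * g * (F * F) * g * F by rewrite !mulrA.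
  by rewrite FF.
have h0e : opnorm (f * f - f) <= C * e.
  rewrite fd opnormN.
  have := opnorm_pm (opnorm1_le p1) (_ : opnorm (F * g * ((1 - F) * (g - PZ))) <= C * e) (opnorm_chi p1 (winZ M)).
  rewrite mul1r; apply; last by rewrite mulr_ge0 ?(ltW e0) // (le_trans ler01 C1).
  apply: le_trans (opnormM_le _ _) _.
  apply: ler_pM; [exact: opnorm_ge0|exact: opnorm_ge0| |exact: n1].
  have := opnorm_pm (opnorm_chi p1 (winZ M)) gC (opnorm1_le p1) (le_trans ler01 C1).
  by rewrite mulr1.
have h0p : 0 <= opnorm (f * f - f) by exact: opnorm_ge0.
have [_ r4 _ _] := cut_small C1 (erefl : e = _) h0p h0e (lexx _).
have rK : (2 * C + 3) * (2 * C + 3)^-1 <= 1 by rewrite mulfV ?gt_eqF.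
have [q [qq _ ql]] := newton_lim hn fC C1 r4 rK.
have hq0 := ql 0; rewrite expr0 mulr1 /= in hq0.
pose D' (T : B) := DE T /\ F * T * F = T.
have hD' : csub0 (@opnorm R I p p1) D'.
  have [c1 c2 c3 c4] := cs_csub0 hE.
  have cutE (T : B) : F * T * F = T -> F * T = T /\ T * F = T.
    by move=> h; split; rewrite -{1}h; [rewrite !mulrA FF|rewrite -!mulrA FF !mulrA].
  split.
  - by split; [exact: c1|rewrite mulr0 mul0r].
  - by move=> S T [DS hS] [DT hT]; split; [exact: c2|rewrite mulrBr mulrBl hS hT].
  - move=> S T [DS /cutE[hS _]] [DT /cutE[_ hT]]; split; first exact: c3.
    by rewrite mulrA hS -mulrA hT.
  move=> T h; split; first by apply: c4 => e' e'0; have [S [DS _] d] := h e' e'0; exists S.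
  apply/subr0_eq; apply: (nrm_small_eps hn) => e' e'0.
  have [S [_ hS] d] := h (e' / 2) (divr_gt0 e'0 (ltr0Sn _ 1)).
  have -> : F * T * F - T = F * (T - S) * F - (T - S) + (F * S * F - S) by ncring.
  rewrite hS subrr addr0; apply: le_trans (opnormB_le _ _) _; rewrite (splitr e'); apply: lerD; last exact: d.
  exact: opnorm_pm (opnorm_chi _ _) d (opnorm_chi _ _) (divr_ge0 (ltW e'0) (ler0n _ 2)).
have D'f : D' f.
  split; last by rewrite /f !mulrA FF -!mulrA FF.
  exact: (csM hE (csM hE (DE_chi _) DEg) (DE_chi _)).
have [DEq Fq] : D' q.
  apply: (cs_lim hD' (newton_it_in hD' D'f) (C := 2 * (2 * C + 3) * opnorm (f * f - f))) => n.
  apply: le_trans (ql n) _; apply: ler_wpM2l; first by rewrite !mulr_ge0 // ltW.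
  by apply: pow_le => //; rewrite invr_ge0 ltW.
have Fq1 : F * q = q by rewrite -{1}Fq !mulrA FF.
have qF1 : q * F = q by rewrite -{1}Fq -!mulrA FF !mulrA.
pose g2 := q + (1 - F) * PZ.
have GP : (1 - F) * PZ = PZ * (1 - F) by rewrite mulrBl mulrBr FP mul1r mulr1.
have g22 : g2 * g2 = g2.
  rewrite /g2 mulrDl !mulrDr qq; have -> : q * ((1 - F) * PZ) = (q - q * F) * PZ by ncring.
  rewrite qF1 subrr mul0r addr0 GP; have -> : PZ * (1 - F) * q = PZ * (q - F * q) by ncring.
  rewrite Fq1 subrr mulr0 add0r -GP; have -> : (1 - F) * PZ * ((1 - F) * PZ) = (1 - F) * (PZ * (1 - F)) * PZ by rewrite !mulrA.
  rewrite -GP !mulrA; have -> : (1 - F) * (1 - F) = 1 - F by rewrite mulrBl mul1r mulrBr mulr1 FF subrr subr0.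
  by rewrite -(mulrA (1 - F)) PZ_PZ.
have dist : opnorm (g - g2) <= 2 * e + 2 * (2 * C + 3) * opnorm (f * f - f).
  have -> : g - g2 = ((1 - F) * (g - PZ) + F * ((g - PZ) * (1 - F)) * 1) - (q - f) + (PZ * F - F * PZ) * (1 - F).
    rewrite /g2 /f; have -> : q + (1 - F) * PZ = q + PZ - F * PZ by ncring.
    have -> : (PZ * F - F * PZ) * (1 - F) = PZ * F - PZ * (F * F) - F * PZ + F * PZ * F by ncring.
    rewrite FF; have -> : (1 - F) * (g - PZ) + F * ((g - PZ) * (1 - F)) * 1 = g - PZ - F * g * F + F * PZ * F by ncring.
    have -> : F * PZ * F = PZ * (F * F) by rewrite FP mulrA.
    by rewrite FF FP; ncring.
  rewrite FP subrr mul0r addr0; apply: le_trans (opnormB_le _ _) _; apply: lerD; last exact: hq0.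
  have -> : 2 * e = e + e by ring.
  apply: le_trans (opnormD_le _ _) _; apply: lerD; first exact: n1.
  exact: opnorm_pm (opnorm_chi _ _) n2 (opnorm1_le _) (ltW e0).
have [_ _ d1 d2] := cut_small C1 (erefl : e = _) h0p h0e dist.
have DEg2 : DE g2.
  exact: (csD hE DEq (csM hE (csB hE (cs1 hE) (DE_chi _)) (DE_chi _))).
have g2C : opnorm g2 <= C + 1.
  apply: le_trans (nrm_tri hn g2 g) _; apply: lerD; first exact: gC.
  by have := d2; rewrite (nrmBC hn).
have Kd : KcZ (g - g2).
  have -> : g - g2 = (g - PZ) - (q - F * PZ) by rewrite /g2; ncring.
  apply: (KcB hn hD); first exact: Kg.
  apply: (Kc_corner hn (@FZ_FZ R X p p1) (N := M)).
    exact: (csB hD (proj1 DEq) (csM hD (DF M) DP)).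
  rewrite -/F mulrBr mulrBl Fq1 qF1; congr (_ - _).
  by rewrite mulrA FF -mulrA -FP mulrA FF.
have [z [z' [iz _ _ hz ez]]] := near_conj hn hD FnZ (@bandZ R X p p1) hD
  (fun T h => h) (proj1 DEg) (proj1 DEg2) gg g22 g2C d1 Kd.
have -> : g = z' * g2 * z by case: iz => _ _ _ z2; rewrite -mulrA -ez mulrA z2 mul1r.
apply: (Ksim_K hn hD FnZ (@bandZ R X p p1) (inv2_sym iz)).
  exact: (Kc1V hn hD FnZ (@bandZ R X p p1) iz hz).
exact: window_idem (proj2 DEq) qq Fq.
Qed.
End BlockKsim.

(** * Support of the terms of the factorization *)

Lemma m2_sub1 (B : pzRingType) (eu : bool -> bool -> B) a b c d :
  eu true true + eu false false = 1 -> m2 eu a b c d - 1 = m2 eu (a - 1) b c (d - 1).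
Proof. by move=> e; rewrite /m2 -[X in _ - X]e; ncring. Qed.

Section ClosedTerms.
Context {R : realType} {B : pzRingType} {nrm : B -> R}.
Variables (eu : bool -> bool -> B) (tz : int -> B) (a h : B) (D : B -> Prop).
Hypotheses (hD : csub nrm D) (Dt : forall m, D (tz m)) (De : forall b c, D (eu b c)).
Local Notation f := (es_f a h).
Local Notation k := (es_k a h).

Let DD x y : D x -> D y -> D (x + y). Proof. exact: (csD hD). Qed.
Let DN x : D x -> D (- x). Proof. exact: (csN hD). Qed.
Let DM x y : D x -> D y -> D (x * y). Proof. exact: (csM hD). Qed.
Let D1 : D 1. Proof. exact: (cs1 hD). Qed.
Ltac cst := repeat first [exact: Dt|exact: De|exact: D1|assumption|apply: DD|apply: DN|apply: DM].

Lemma m2_in x y z w : D x -> D y -> D z -> D w -> D (m2 eu x y z w).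
Proof. by move=> *; rewrite /m2; cst. Qed.

Lemma es_v0_in : D f -> D (es_v0 eu tz a h) /\ D (es_v0' eu tz a h).
Proof.
move=> Df; rewrite /es_v0 /es_v0' /es_nu /es_al /es_be /es_k.
by move: Df; generalize (es_f a h) => F DF; split; apply: m2_in; cst.
Qed.

Lemma es_w_in : D a -> D h -> D (es_w eu tz a h) /\ D (es_w' eu tz a h).
Proof.
move=> Da Dh; rewrite /es_w /es_w' /es_nu /es_al /es_be /es_ua /es_ba /es_g /es_kJ /es_f.
by split; apply: m2_in; cst.
Qed.
End ClosedTerms.

Section Touch.
Context {B : pzRingType}.
Variables (eu : bool -> bool -> B) (tz : int -> B) (a h : B) (Prp Tch : nat -> B -> Prop).
(** Prp k holds for operators of propagation at most k units, Tch n for those whose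
    nonzero entries lie within n units of the complement of h. *)
Record touch : Prop := Touch {
  tp_t : forall m, Prp 0 (tz m); tp_e : forall b c, Prp 0 (eu b c); tp_1 : Prp 0 1;
  tp_h : Prp 0 h; tp_a : Prp 1 a;
  tp_D : forall k x y, Prp k x -> Prp k y -> Prp k (x + y);
  tp_N : forall k x, Prp k x -> Prp k (- x);
  tp_M : forall k l x y, Prp k x -> Prp l y -> Prp (k + l) (x * y);
  tp_mono : forall k l x, (k <= l)%N -> Prp k x -> Prp l x }.
Record touch' : Prop := Touch' {
  tt_h : Tch 0 (1 - h);
  tt_D : forall k x y, Tch k x -> Tch k y -> Tch k (x + y);
  tt_N : forall k x, Tch k x -> Tch k (- x);
  tt_Ml : forall k l x y, Prp k x -> Tch l y -> Tch (k + l) (x * y);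
  tt_Mr : forall k l x y, Tch l x -> Prp k y -> Tch (l + k) (x * y);
  tt_mono : forall k l x, (k <= l)%N -> Tch k x -> Tch l x }.
Hypotheses (hp : touch) (ht : touch').
Local Notation f := (es_f a h).
Local Notation kJ := (es_kJ a h).
Local Notation g := (es_g a h).

Let p1h : Prp 0 (1 - h). Proof. exact: (tp_D hp (tp_1 hp) (tp_N hp (tp_h hp))). Qed.
Let pw k l x : (k <= l)%N -> Prp k x -> Prp l x. Proof. exact: (tp_mono hp). Qed.
Let tw k l x : (k <= l)%N -> Tch k x -> Tch l x. Proof. exact: (tt_mono ht). Qed.

Lemma prp_f : Prp 1 f.
Proof. exact: (tp_M hp (tp_M hp (tp_h hp) (tp_a hp)) (tp_h hp)). Qed.
Lemma prp_kJ : Prp 2 kJ.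
Proof. exact: (tp_M hp (tp_M hp (tp_M hp (tp_M hp (tp_h hp) (tp_a hp)) p1h) (tp_a hp)) (tp_h hp)). Qed.
Lemma tch_kJ : Tch 2 kJ.
Proof.
exact: (tt_Mr ht (tt_Mr ht (tt_Ml ht (tp_M hp (tp_h hp) (tp_a hp)) (tt_h ht)) (tp_a hp)) (tp_h hp)).
Qed.
Lemma tch_g : Tch 1 g.
Proof.
apply: (tt_D ht); first exact: (tt_Mr ht (tt_h ht) (tp_a hp)).
exact: (tt_Ml ht (tp_M hp (tp_h hp) (tp_a hp)) (tt_h ht)).
Qed.
Let pc z m : Prp 1 z -> Prp 1 (1 - z + tz m * z).
Proof.
move=> hz; apply: (tp_D hp); last exact: (tp_M hp (tp_t hp m) hz).
by apply: (tp_D hp); [exact: (pw _ (tp_1 hp))|exact: (tp_N hp hz)].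
Qed.
Let pnu : Prp 0 (es_nu tz).
Proof.
rewrite /es_nu; apply: (tp_D hp); last exact: (tp_N hp (tp_t hp _)).
apply: (tp_D hp); last exact: (tp_N hp (tp_t hp _)).
exact: (tp_D hp (tp_1 hp) (tp_1 hp)).
Qed.
Let pt m : Prp 0 (tz m - 1). Proof. exact: (tp_D hp (tp_t hp m) (tp_N hp (tp_1 hp))). Qed.

(** Both kJ and g have a factor that passes through 1 - h, whence their support near the
    complement of h. *)
Lemma tch_gens : [/\ Tch 5 kJ, Tch 5 (f * kJ), Tch 5 (kJ * f) & Tch 5 (kJ * f * kJ)].
Proof.
split; first exact: (tw _ tch_kJ).
- exact: (tw _ (tt_Ml ht prp_f tch_kJ)).
- exact: (tw _ (tt_Mr ht tch_kJ prp_f)).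
exact: (tt_Mr ht (tt_Mr ht tch_kJ prp_f) prp_kJ).
Qed.

Lemma tch_m2 n x y z w : Tch n x -> Tch n y -> Tch n z -> Tch n w -> Tch n (m2 eu x y z w).
Proof.
have me u b c : Tch n u -> Tch n (u * eu b c).
  by move=> hu; rewrite -[n]addn0; exact: (tt_Mr ht hu (tp_e hp b c)).
by move=> h1 h2 h3 h4; rewrite /m2; do ![apply: (tt_D ht)|exact: me].
Qed.

Lemma tch_w : eu true true + eu false false = 1 ->
  Tch 5 (es_w eu tz a h - 1) /\ Tch 5 (es_w' eu tz a h - 1).
Proof.
move=> e1; have pf := prp_f; have tk := tch_kJ; have tg := tch_g.
have pa := pc (-1) pf; have pb := pc 1 pf; have qa := pc 1 (tp_a hp); have qb := pc (-1) (tp_a hp).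
have tnk : Tch 2 (es_nu tz * kJ) by exact: (tt_Ml ht pnu tk).
have cl x y z : Tch 5 y -> Tch 5 z -> x = 1 - y + z -> Tch 5 (x - 1).
  move=> hy hz ->; have -> : 1 - y + z - 1 = - y + z by ncring.
  exact: (tt_D ht (tt_N ht hy) hz).
have T5 k x : Tch k x -> (k <= 5)%N -> Tch 5 x by move=> hx hk; exact: (tw hk hx).
rewrite !m2_sub1 //; split; apply: tch_m2.
- apply: cl (T5 _ _ tnk isT) _ erefl.
  exact: (T5 _ _ (tt_Ml ht (pt 1) (tt_Mr ht tg pa)) isT).
- exact: (T5 _ _ (tt_Ml ht qa tnk) isT).
- exact: (T5 _ _ (tt_N ht (tt_Ml ht qb tnk)) isT).
- apply: (cl _ (es_nu tz * kJ) ((tz (-1) - 1) * (g * es_al tz a h) + es_ba tz a * (es_nu tz * kJ) * es_al tz a h)).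
  + exact: (T5 _ _ tnk isT).
  + apply: (tt_D ht); first exact: (T5 _ _ (tt_Ml ht (pt _) (tt_Mr ht tg pb)) isT).
    exact: (T5 _ _ (tt_Mr ht (tt_Ml ht qb tnk) pb) isT).
  by rewrite /es_w addrA.
- apply: (cl _ (es_nu tz * kJ) ((tz (-1) - 1) * (es_al tz a h * g) + es_nu tz * kJ * es_al tz a h * es_ba tz a)).
  + exact: (T5 _ _ tnk isT).
  + apply: (tt_D ht); first exact: (T5 _ _ (tt_Ml ht (pt _) (tt_Ml ht pb tg)) isT).
    exact: (T5 _ _ (tt_Mr ht (tt_Mr ht tnk pb) qb) isT).
  by rewrite addrA.
- exact: (T5 _ _ (tt_N ht (tt_Mr ht tnk qa)) isT).
- exact: (T5 _ _ (tt_Mr ht tnk qb) isT).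
apply: cl (T5 _ _ tnk isT) _ erefl.
exact: (T5 _ _ (tt_Ml ht (pt 1) (tt_Ml ht pa tg)) isT).
Qed.
End Touch.

(** The matrix qJ as a polynomial in the shift and in four operators, each of which has blocks
    for both decompositions; evaluated at a point of the circle it is the symbol of qJ. *)
Definition es_rq (B : pzRingType) (eu : bool -> bool -> B) (t t' k1 k2 k3 k4 : B) : B :=
  let nu := 1 + 1 - t - t' in
  m2 eu (1 - nu * (nu * (k1 * k1)))
    (nu * (k1 - k2 + t * k2) + nu * (nu * (k1 * k1 - k4 + t * k4)))
    (nu * (k1 - k3 + t' * k3)) (nu * (nu * (k1 * k1))).

Lemma es_qJ_rq {R : realType} (B : pzRingType) (nrm : B -> R) eu tz (E a h : B) C e :
    edata nrm eu tz E a h C e ->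
  es_qJ eu tz a h = es_rq eu (tz 1) (tz (-1)) (es_kJ a h) (es_f a h * es_kJ a h)
    (es_kJ a h * es_f a h) (es_kJ a h * es_f a h * es_kJ a h).
Proof.
move=> hd; have htz := ed_t hd; have ta := ed_ta hd; have th := ed_th hd.
have tf : tcomm tz (es_f a h) by do 2! [apply: tcommM => //].
have t1 : tcomm tz (1 - h) by apply: tcommB => // m; rewrite mulr1 mul1r.
have tk : tcomm tz (es_kJ a h) by do 4! [apply: tcommM => //].
rewrite /es_qJ /es_rq /es_al /es_be /es_nu.
move: tf tk; generalize (es_f a h) (es_kJ a h) => f k tf tk; congr (m2 eu _ _ _ _).
all: by lring tz htz.
Qed.

Ltac appt hn e0 := repeat first [eassumption | apply: (app_add hn)
  | apply: (app_opp hn) | apply: (app_mul hn)].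

Lemma es_rq_lip {R : realType} (Kg : R) : exists2 K : R, 0 <= K &
  forall (B : pzRingType) (nrm : B -> R) (eu : bool -> bool -> B) (t t' s s' k1 k2 k3 k4 : B) (e : R),
    bnorm nrm -> (forall b c, nrm (eu b c) <= 1) -> 0 <= e ->
    nrm t <= 1 -> nrm t' <= 1 -> nrm s <= 1 -> nrm s' <= 1 -> nrm (t - s) <= e -> nrm (t' - s') <= e ->
    nrm k1 <= Kg -> nrm k2 <= Kg -> nrm k3 <= Kg -> nrm k4 <= Kg ->
  nrm (es_rq eu t t' k1 k2 k3 k4 - es_rq eu s s' k1 k2 k3 k4) <= K * e.
Proof.
suff [K hK] : exists K : R, forall (B : pzRingType) (nrm : B -> R) (eu : bool -> bool -> B)
    (t t' s s' k1 k2 k3 k4 : B) (e : R),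
    bnorm nrm -> (forall b c, nrm (eu b c) <= 1) -> 0 <= e ->
    app nrm e t s 1 -> app nrm e t' s' 1 -> app nrm e 1 1 1 ->
    app nrm e k1 k1 Kg -> app nrm e k2 k2 Kg -> app nrm e k3 k3 Kg -> app nrm e k4 k4 Kg ->
    app nrm e (es_rq eu t t' k1 k2 k3 k4) (es_rq eu s s' k1 k2 k3 k4) K.
  exists `|K|; first exact: normr_ge0.
  move=> B nrm eu t t' s s' k1 k2 k3 k4 e hn un e0 h1 h2 h3 h4 h5 h6 h7 h8 h9 h10.
  have ar x (C : R) : nrm x <= C -> app nrm e x x C by move=> h; apply: app_refl.
  have at1 x y : nrm x <= 1 -> nrm y <= 1 -> nrm (x - y) <= e -> app nrm e x y 1.
    by move=> u v w; split; rewrite ?mul1r.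
  have [_ _ h] := hK _ _ _ _ _ _ _ _ _ _ _ _ hn un e0 (at1 _ _ h1 h3 h5) (at1 _ _ h2 h4 h6)
    (ar _ _ (nrm1 hn)) (ar _ _ h7) (ar _ _ h8) (ar _ _ h9) (ar _ _ h10).
  by apply: le_trans h _; apply: ler_wpM2r => //; exact: ler_norm.
eexists; move=> B nrm eu t t' s s' k1 k2 k3 k4 e hn un e0 ht ht' H1 hk1 hk2 hk3 hk4.
by rewrite /es_rq /=; apply: (app_m2 hn un e0); appt hn e0.
Qed.

(** * Matrix units, symbols and shifts *)

Section Units.
Context {R : realType} {p : R} (p1 : 1 <= p) {X : choiceType}.
Local Notation J := (X * bool)%type.

Lemma mu_pinj (b c : bool) (k k' j : bool) : (if k == b then Some c else None) = Some j ->
  (if k' == b then Some c else None) = Some j -> k = k'.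
Proof. by case: eqP => // -> _; case: eqP => // ->. Qed.

Definition mu (b c : bool) : bop J p1 := pullK p1 (Pinj (@mu_pinj b c)).

Lemma muE b c u x k : mu b c u (x, k) = if k == b then u (x, c) else 0.
Proof. by rewrite /mu pullKE /=; case: (k == b). Qed.

Let ext (S T : bop J p1) : (forall u x k, S u (x, k) = T u (x, k)) -> S = T.
Proof. by move=> e; apply: mcoef_ext => -[x k] j; exact: e. Qed.

Lemma muM b c b' c' : mu b c * mu b' c' = if c == b' then mu b c' else 0.
Proof.
apply: ext => u x k; rewrite bopME muE; case: (boolP (k == b)) => kb.
  by rewrite muE; case: (c == b'); rewrite ?muE ?kb ?bop0E ?ellp0E.
by case: (c == b'); rewrite ?muE ?(negbTE kb) ?bop0E ?ellp0E.
Qed.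

Lemma mu_1 : mu true true + mu false false = 1.
Proof. by apply: ext => u x k; rewrite bopDE ellpDE !muE bop1E; case: k; rewrite ?addr0 ?add0r. Qed.

Lemma mu_nrm b c : opnorm (mu b c) <= 1. Proof. exact: opnorm_pullK. Qed.

Lemma mu_chi : mu true true = chi p1 (fun i : J => i.2).
Proof. by apply: ext => u x k; rewrite muE chiE /=; case: k. Qed.

Lemma mcoef_mu b c i j : mcoef (mu b c) i j != 0 -> i.1 = j.1.
Proof. by rewrite mcoef_pullK; case: (i.1 =P j.1) => // _; rewrite eqxx. Qed.
End Units.

Section Instances.
Context {R : realType} {p : R} (p1 : 1 <= p) {X : choiceType}.
Local Notation J := (X * bool)%type.
Local Notation I := (J * int)%type.

(** The powers of the point zc x of the circle, which is substituted for the shift. *)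
Definition tz1 (x : R) (m : int) : bop J p1 := scal p1 J (zc (x * m%:~R)).
Definition mu2 (b c : bool) : bop I p1 := lift (mu p1 b c).

Lemma opnorm_tz1 x m : opnorm (tz1 x m) <= 1.
Proof. by apply: le_trans (opnorm_scal _ _ _) _; rewrite normc_zc. Qed.

Lemma tz1_unit x : laurent_unit (tz1 x).
Proof.
split; first by rewrite /tz1 mulr0 zc0 scal1.
by move=> m n; rewrite /tz1 intrD mulrDr zcD scalM.
Qed.

Variables (E a h : bop X p1) (C e : R).
Hypotheses (EE : E * E = E) (hh : h * h = h) (hn : opnorm h <= 1) (e0 : 0 <= e)
  (Ea : app (@opnorm R X p p1) e a E C).

Lemma app_lift (K : choiceType) : app (@opnorm R (X * K)%type p p1) e (lift a) (lift E) C.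
Proof.
case: Ea => h1 h2 h3; split.
- exact: le_trans (opnorm_lift _) h1.
- exact: le_trans (opnorm_lift _) h2.
by rewrite -liftB; exact: le_trans (opnorm_lift _) h3.
Qed.

Lemma edata1 x : edata (@opnorm R J p p1) (mu p1 (X := X)) (tz1 x) (lift E) (lift a) (lift h) C e.
Proof.
have sc (T : bop J p1) : tcomm (tz1 x) T by move=> m; exact: scalC.
have lu (T : bop X p1) : ucomm (mu p1 (X := X)) (lift T) by move=> b c; exact: lift_pullK.
split; [exact: bop_bnorm|exact: muM|exact: mu_1|exact: mu_nrm|exact: tz1_unit|exact: opnorm_tz1| | | | | | | | | | | |].
- by move=> m b c; exact: scalC.
- exact: sc.
- exact: sc.
- exact: sc.
- exact: lu.
- exact: lu.
- exact: lu.
- by rewrite -liftM EE.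
- by rewrite -liftM hh.
- exact: le_trans (opnorm_lift _) hn.
- exact: e0.
exact: app_lift.
Qed.
End Instances.

Section Instance2.
Context {R : realType} {p : R} (p1 : 1 <= p) {X : choiceType}.
Local Notation J := (X * bool)%type.
Local Notation I := (J * int)%type.
Variables (E a h : bop X p1) (C e : R).
Hypotheses (EE : E * E = E) (hh : h * h = h) (hn : opnorm h <= 1) (e0 : 0 <= e)
  (Ea : app (@opnorm R X p p1) e a E C).

Lemma edata2 : edata (@opnorm R I p p1) (mu2 p1 (X := X)) (@sh R p p1 J)
  (lift (lift E : bop J p1)) (lift (lift a : bop J p1)) (lift (lift h : bop J p1)) C e.
Proof.
have sc (T : bop J p1) : tcomm (@sh R p p1 J) (lift T) by move=> m; rewrite lift_sh.
have lu (T : bop X p1) : ucomm (mu2 p1 (X := X)) (lift (lift T : bop J p1)).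
  by move=> b c; rewrite /mu2 -!liftM; congr (lift _); exact: lift_pullK.
have [_ _ _ _ _ _ _ _ _ _ _ _ _ E1 h1 n1 _ A1] := edata1 EE hh hn e0 Ea 0.
split; [exact: bop_bnorm| | | |exact: sh_unit|exact: opnorm_sh| | | | | | | | | | | |].
- move=> b c b' c'; rewrite /mu2 -liftM muM; case: (c == b') => //.
  by rewrite -[X in lift X](subrr 0) liftB subrr.
- by rewrite /mu2 -liftD mu_1 lift1.
- by move=> b c; apply: le_trans (opnorm_lift _) _; exact: mu_nrm.
- by move=> m b c; rewrite /mu2 lift_sh.
- exact: sc.
- exact: sc.
- exact: sc.
- exact: lu.
- exact: lu.
- exact: lu.
- by rewrite -liftM E1.
- by rewrite -liftM h1.
- exact: le_trans (opnorm_lift _) n1.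
- exact: e0.
exact: app_lift.
Qed.
End Instance2.

(** * Propagation and the pieces of the space *)

Lemma mcoefM_ex {R : realType} {p : R} (p1 : 1 <= p) (T : choiceType) (S U : bop T p1) i k :
  mcoef (S * U) i k != 0 -> exists2 j, mcoef S i j != 0 & mcoef U j k != 0.
Proof.
move=> h; apply: contrapT => no; case/eqP: h.
have -> : mcoef (S * U) i k = S (U (ellp_delta p1 k)) i by [].
apply: bop_coef0 => j jk; have [//|ij] := eqVneq (mcoef S i j) 0.
by case: no; exists j.
Qed.

Lemma mcoefD_ex {R : realType} {p : R} (p1 : 1 <= p) (T : choiceType) (S U : bop T p1) i k :
  mcoef (S + U) i k != 0 -> mcoef S i k != 0 \/ mcoef U i k != 0.
Proof.
by rewrite mcoefD; have [->|h] := eqVneq (mcoef S i k) 0; [rewrite add0r; right|left].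
Qed.

Section PrpTch.
Context {R : realType} {X : metricType R} {p : R} (p1 : 1 <= p) {T : choiceType} (pr : T -> X).
Variables (U0 : pred X) (s0 : R).
Local Notation B := (bop T p1).
Implicit Types S U : B.
Hypothesis s00 : 0 <= s0.

Definition prp (k : nat) S := forall i j, mcoef S i j != 0 -> mdist (pr i) (pr j) <= k%:R * s0.
Definition tch (k : nat) S := forall i j, mcoef S i j != 0 -> exists w,
  [/\ ~~ U0 w, mdist (pr i) w <= k%:R * s0 & mdist w (pr j) <= k%:R * s0].
Definition dom0 S := forall i j, mcoef S i j != 0 -> U0 (pr i) /\ U0 (pr j).

Lemma prpD k S U : prp k S -> prp k U -> prp k (S + U).
Proof. by move=> h1 h2 i j /mcoefD_ex[/h1|/h2]. Qed.
Lemma prpN k S : prp k S -> prp k (- S).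
Proof. by move=> h i j; rewrite mcoefN oppr_eq0 => /h. Qed.
Lemma prpM k l S U : prp k S -> prp l U -> prp (k + l) (S * U).
Proof.
move=> h1 h2 i k' /mcoefM_ex[j /h1 a /h2 b]; apply: le_trans (metric_triangle _ (pr j) _) _.
by rewrite natrD mulrDl; exact: lerD.
Qed.
Lemma kmono k l : (k <= l)%N -> k%:R * s0 <= l%:R * s0.
Proof. by move=> kl; rewrite ler_wpM2r // ler_nat. Qed.
Lemma prp_mono k l S : (k <= l)%N -> prp k S -> prp l S.
Proof. by move=> kl h i j /h a; apply: le_trans a (kmono kl). Qed.
Lemma prp0 S : (forall i j, mcoef S i j != 0 -> pr i = pr j) -> prp 0 S.
Proof. by move=> h i j /h ->; rewrite mdistxx mul0r. Qed.
Lemma prp_1 : prp 0 (1 : B).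
Proof. by apply: prp0 => i j; rewrite mcoef1; case: (i =P j) => [->|] //; rewrite eqxx. Qed.
Lemma prp_chi (A : pred T) : prp 0 (chi p1 A).
Proof. by apply: prp0 => i j; rewrite mcoef_chi; case: (i =P j) => [->|] //; rewrite andbF eqxx. Qed.

Lemma tchD k S U : tch k S -> tch k U -> tch k (S + U).
Proof. by move=> h1 h2 i j /mcoefD_ex[/h1|/h2]. Qed.
Lemma tchN k S : tch k S -> tch k (- S).
Proof. by move=> h i j; rewrite mcoefN oppr_eq0 => /h. Qed.
Lemma tch_mono k l S : (k <= l)%N -> tch k S -> tch l S.
Proof.
move=> kl h i j /h[w [a b c]]; exists w; split=> //; [apply: le_trans b _|apply: le_trans c _]; exact: kmono.
Qed.
Lemma tchMl k l S U : prp k S -> tch l U -> tch (k + l) (S * U).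
Proof.
move=> h1 h2 i k' /mcoefM_ex[j /h1 a /h2[w [b c d]]]; exists w; split=> //.
  by apply: le_trans (metric_triangle _ (pr j) _) _; rewrite natrD mulrDl; exact: lerD.
by apply: le_trans d (kmono _); rewrite leq_addl.
Qed.
Lemma tchMr k l S U : tch l S -> prp k U -> tch (l + k) (S * U).
Proof.
move=> h1 h2 i k' /mcoefM_ex[j /h1[w [a b c]] /h2 d]; exists w; split=> //.
  by apply: le_trans b (kmono _); rewrite leq_addr.
by apply: le_trans (metric_triangle _ (pr j) _) _; rewrite natrD mulrDl; exact: lerD.
Qed.

Lemma dom0_sandwich S (A : pred T) : (forall i, A i = U0 (pr i)) -> dom0 (chi p1 A * S * chi p1 A).
Proof.
move=> h i j; rewrite mcoef_chir mcoef_chil !h.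
by case: (U0 (pr i)); case: (U0 (pr j)); rewrite ?eqxx.
Qed.

Lemma tch_1chi (A : pred T) : (forall i, A i = U0 (pr i)) -> tch 0 (1 - chi p1 A).
Proof.
move=> h i j; rewrite -chiC mcoef_chi h; case: (i =P j) => [<-|]; last by rewrite andbF eqxx.
by case: (boolP (U0 (pr i))) => [|u _]; [rewrite eqxx|exists (pr i); rewrite mdistxx mul0r].
Qed.

Lemma touch_prp (eu : bool -> bool -> B) (tz : int -> B) (a : B) (A : pred T) :
    (forall m, prp 0 (tz m)) -> (forall b c, prp 0 (eu b c)) -> prp 1 a -> (forall i, A i = U0 (pr i)) ->
  touch eu tz a (chi p1 A) prp /\ touch' (chi p1 A) prp tch.
Proof.
move=> ht he ha hA; split; split=> //.
- exact: prp_1.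
- exact: prp_chi.
- exact: prpD.
- exact: prpN.
- exact: prpM.
- exact: prp_mono.
- exact: tch_1chi.
- exact: tchD.
- exact: tchN.
- exact: tchMl.
- exact: tchMr.
exact: tch_mono.
Qed.
End PrpTch.

Section Pieces.
Context {R : realType} {X : metricType R}.
Implicit Types (x y z w : X) (V : set (set X)).

Definition near_piece (s : R) (A : set X) x := exists2 w, A w & mdist x w <= s.
(** x and y lie in the s-neighbourhood of one piece. *)
Definition piece_rel V (s : R) x y := x = y \/
  exists A, [/\ V A, near_piece s A x & near_piece s A y].

Lemma separated_dist V r A A' a b : separated_family r V -> V A -> V A' -> A a -> A' b ->
  mdist a b <= r -> A = A'.
Proof.
move=> hV VA VA' Aa A'b h; apply: contrapT => ne; have := hV _ _ VA VA' ne.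
have : (set_dist A A' <= (mdist a b)%:E)%E.
  by apply: ereal_inf_lbound; exists a => //; exists b.
move=> h1 h2; have := lt_le_trans h2 h1; rewrite lte_fin => h3.
by have := lt_le_trans h3 h; rewrite ltxx.
Qed.

Variables (V : set (set X)) (r s : R).
Hypotheses (s0 : 0 <= s) (rs : 2 * s <= r) (hV : separated_family r V).

Lemma piece_refl x : piece_rel V s x x. Proof. by left. Qed.
Lemma piece_sym x y : piece_rel V s x y -> piece_rel V s y x.
Proof. by move=> [->|[A [h1 h2 h3]]]; [left|right; exists A]. Qed.
Lemma piece_trans x y z : piece_rel V s x y -> piece_rel V s y z -> piece_rel V s x z.
Proof.
move=> [->|[A [h1 h2 [w Aw yw]]]] // [<-|[A' [k1 [w' A'w' yw'] k3]]]; first by right; exists A; split=> //; exists w.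
right; exists A; split=> //; rewrite (_ : A = A') //.
apply: (separated_dist hV h1 k1 Aw A'w'); apply: le_trans (metric_triangle w y w') _.
apply: le_trans rs; rewrite metric_sym mulr2n mulrDl mul1r; exact: lerD.
Qed.

Lemma piece_bounded : uniformly_bounded V -> exists2 rho : R, 0 <= rho & forall x y, piece_rel V s x y -> mdist x y <= rho.
Proof.
move=> [D hD]; exists (s + `|D| + s) => [|x y]; first by rewrite !addr_ge0.
move=> [->|[A [VA [w Aw xw] [w' Aw' yw']]]]; first by rewrite mdistxx !addr_ge0.
have hw : mdist w w' <= `|D|.
  apply: le_trans (ler_norm D); rewrite -lee_fin; apply: le_trans (hD _ VA).
  by apply: ereal_sup_ubound; exists w => //; exists w'.
apply: le_trans (metric_triangle x w' y) _; apply: lerD; last by rewrite metric_sym.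
by apply: le_trans (metric_triangle x w w') _; exact: lerD.
Qed.

(** Points of the union of the pieces at a distance at most r are in the same piece. *)
Lemma piece_close x y (U : set X) : \bigcup_(A in V) A = U -> U x -> U y -> mdist x y <= r -> piece_rel V s x y.
Proof.
move=> <- [A VA Ax] [A' VA' A'y] h; right; exists A; split=> //; first by exists x => //; rewrite mdistxx.
by rewrite (separated_dist hV VA VA' Ax A'y h); exists y => //; rewrite mdistxx.
Qed.

Lemma piece_touch x y w (U : set X) : \bigcup_(A in V) A = U -> U w -> mdist x w <= s -> mdist w y <= s ->
  piece_rel V s x y.
Proof.
move=> <- [A VA Aw] h1 h2; right; exists A; split=> //; exists w => //.
by rewrite metric_sym.
Qed.
End Pieces.

Lemma asdim1 {R : realType} (X : metricType R) (r : R) : asdim_le X 1 -> 0 < r ->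
  exists (U0 : pred X) (V0 V1 : set (set X)),
  [/\ \bigcup_(A in V0) A = [set x | U0 x], \bigcup_(A in V1) A = [set x | ~~ U0 x],
      uniformly_bounded V0, uniformly_bounded V1 & separated_family r V0 /\ separated_family r V1].
Proof.
move=> h r0; have [U [tU cU hU]] := h _ r0.
have [V0 [e0 b0 d0]] := hU ord0; have [V1 [e1 b1 d1]] := hU ord_max.
exists (fun x => `[< U ord0 x >]), V0, V1; split=> //.
  by rewrite e0; apply/seteqP; split=> x /= h'; apply/asboolP.
rewrite e1; apply/seteqP; split=> x /= h'.
  apply/asboolPn => h0; have := tU ord0 ord_max I I.
  by move=> /(_ (ex_intro _ x (conj h0 h'))) /(congr1 val).
have [i _ Ui] : (\bigcup_(i in [set: 'I_2]) U i) x by rewrite cU.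
have [e|i0] := eqVneq i ord0; first by rewrite e in Ui; move: h' => /asboolPn; case.
rewrite (_ : ord_max = i) //; apply/val_inj => /=; case: i i0 {Ui} => [[|[|k]] hk] //=.
Qed.

(** * The index of the shift on the range of an idempotent *)

Lemma lift_chi {R : realType} {p : R} (p1 : 1 <= p) (X K : choiceType) (A : pred X) :
  lift (chi p1 A) = chi p1 (fun i : X * K => A i.1) :> bop (X * K)%type p1.
Proof.
apply: mcoef_ext => i j; rewrite mcoef_lift !mcoef_chi; case: i j => [x k] [y l] /=.
rewrite xpair_eqE; case: (k =P l) => _; rewrite ?andbT ?andbF //.
Qed.

Lemma ctlsM {R : realType} {p : R} (p1 : 1 <= p) (T : choiceType) (Rl : T -> T -> Prop) (S U : bop T p1) :
  (forall i j k, Rl i j -> Rl j k -> Rl i k) -> ctls Rl S -> ctls Rl U -> ctls Rl (S * U).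
Proof. by move=> tr h1 h2 i k /mcoefM_ex[j /h1 a /h2 b]; exact: tr a b. Qed.

Section PieceSupport.
Context {R : realType} {X : metricType R} {p : R} (p1 : 1 <= p) {T : choiceType} (pr : T -> X).
Variables (U0 : pred X) (V0 V1 : set (set X)) (s0 r : R) (A : pred T).
Variables (eu : bool -> bool -> bop T p1) (tz : int -> bop T p1) (a : bop T p1).
Local Notation s := (5%:R * s0).
Hypotheses (s00 : 0 <= s0) (rs : 2 * s <= r) (sep0 : separated_family r V0) (sep1 : separated_family r V1)
  (c0 : \bigcup_(B in V0) B = [set x | U0 x]) (c1 : \bigcup_(B in V1) B = [set x | ~~ U0 x])
  (AU : forall i, A i = U0 (pr i)).
Hypotheses (ht : forall m, prp pr s0 0 (tz m)) (he : forall b c, prp pr s0 0 (eu b c)) (ha : prp pr s0 1 a).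
Local Notation h := (chi p1 A).
Definition pieceT V (i j : T) := piece_rel V s (pr i) (pr j).

Let s5 : 0 <= s. Proof. by rewrite mulr_ge0. Qed.
Let ks k : (k <= 5)%N -> k%:R * s0 <= r.
Proof.
move=> k5; apply: le_trans rs; apply: le_trans (kmono s00 k5) _.
by rewrite ler_peMl // ler1n.
Qed.

Lemma dom0_ctl k (S : bop T p1) : (k <= 5)%N -> dom0 pr U0 S -> prp pr s0 k S -> ctls (pieceT V0) S.
Proof.
move=> k5 d q i j Sij; have [di dj] := d _ _ Sij.
by apply: (piece_close s5 sep0 c0 di dj); apply: le_trans (q _ _ Sij) (ks k5).
Qed.

Lemma tch_ctl (S : bop T p1) : tch pr U0 s0 5 S -> ctls (pieceT V1) S.
Proof. by move=> d i j /d[w [w1 w2 w3]]; exact: (piece_touch c1 w1 w2 w3). Qed.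

Let tp := touch_prp s00 ht he ha AU.

Lemma f_ctl0 : ctls (pieceT V0) (es_f a h).
Proof.
apply: (@dom0_ctl 1) => //; first exact: dom0_sandwich.
exact: (prp_f tp.1).
Qed.

Lemma kJ_ctl0 : ctls (pieceT V0) (es_kJ a h).
Proof.
apply: (@dom0_ctl 2) => //; last exact: (prp_kJ tp.1).
have -> : es_kJ a h = h * (a * (1 - h) * a) * h by rewrite /es_kJ !mulrA.
exact: dom0_sandwich.
Qed.

(** All four operators are sandwiched between factors h and have a factor that passes through
    the other half, so they are controlled by the pieces of either half. *)
Lemma gens_ctl : let P (S : bop T p1) := ctls (pieceT V0) S /\ ctls (pieceT V1) S in
  [/\ P (es_kJ a h), P (es_f a h * es_kJ a h), P (es_kJ a h * es_f a h) & P (es_kJ a h * es_f a h * es_kJ a h)].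
Proof.
have [t1 t2 t3 t4] := tch_gens tp.1 tp.2.
have tr i j k : pieceT V0 i j -> pieceT V0 j k -> pieceT V0 i k by exact: (piece_trans rs sep0).
have hf := f_ctl0; have hk := kJ_ctl0.
have hkf := ctlsM tr hk hf.
split; split; try exact: tch_ctl.
- exact: hk.
- exact: ctlsM tr hf hk.
- exact: hkf.
exact: ctlsM tr hkf hk.
Qed.

Lemma w_ctl : eu true true + eu false false = 1 ->
  ctls (pieceT V1) (es_w eu tz a h) /\ ctls (pieceT V1) (es_w' eu tz a h).
Proof.
move=> e1; have [/tch_ctl h1 /tch_ctl h2] := tch_w tp.1 tp.2 e1.
have c (S : bop T p1) : ctls (pieceT V1) (S - 1) -> ctls (pieceT V1) S.
  move=> hS i j; have [->|ij] := eqVneq i j; first by move=> _; exact: piece_refl.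
  have := hS i j; rewrite mcoefB mcoef1 (negbTE ij) subr0; exact.
by split; exact: c.
Qed.
End PieceSupport.

Section LoopRep.
Context {R : realType} {p : R} (p1 : 1 <= p) {X : choiceType}.
Local Notation J := (X * bool)%type.
Variables (n : nat) (cls : J -> seq J) (hc : classes n cls).

Lemma Rep_tz1 : Rep hc 1 (sh p1 1) (fun x => tz1 p1 x 1) /\ Rep hc 1 (sh p1 (-1)) (fun x => tz1 p1 x (-1)).
Proof.
split.
  rewrite (_ : (fun x => _) = (fun x => scal p1 J (zc x))); first exact: Rep_t.
  by apply/funext => x; rewrite /tz1 mulr1.
rewrite (_ : (fun x => _) = (fun x => scal p1 J (zc (- x)))); first exact: Rep_t'.
by apply/funext => x; rewrite /tz1 intrN mulrN1.
Qed.

Lemma RepD_max d d' (S S' : bop (J * int)%type p1) (G G' : R -> bop J p1) : Rep hc d S G -> Rep hc d' S' G' ->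
  Rep hc (maxn d d') (S + S') (fun x => G x + G' x).
Proof. by move=> h1 h2; apply: RepD; [apply: Rep_mono h1; exact: leq_maxl|apply: Rep_mono h2; exact: leq_maxr]. Qed.

Lemma Rep_rq (g1 g2 g3 g4 : bop J p1) : esupp cls g1 -> esupp cls g2 -> esupp cls g3 -> esupp cls g4 ->
    (forall b c, esupp cls (mu p1 b c)) ->
  exists d, Rep hc d (es_rq (mu2 p1 (X := X)) (sh p1 1) (sh p1 (-1)) (lift g1) (lift g2) (lift g3) (lift g4))
    (fun x => es_rq (mu p1 (X := X)) (tz1 p1 x 1) (tz1 p1 x (-1)) g1 g2 g3 g4).
Proof.
move=> e1 e2 e3 e4 em; have [rt rt'] := Rep_tz1.
have c1 := Rep_const hc e1; have c2 := Rep_const hc e2; have c3 := Rep_const hc e3; have c4 := Rep_const hc e4.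
have one := Rep1 p1 hc.
have nu := RepD_max (RepD_max (RepD_max one one) (RepN rt)) (RepN rt').
have c11 := RepM nu (RepM nu (RepM c1 c1)).
have a11 := RepD_max one (RepN c11).
have a12 := RepD_max (RepM nu (RepD_max (RepD_max c1 (RepN c2)) (RepM rt c2)))
  (RepM nu (RepM nu (RepD_max (RepD_max (RepM c1 c1) (RepN c4)) (RepM rt c4)))).
have a21 := RepM nu (RepD_max (RepD_max c1 (RepN c3)) (RepM rt' c3)).
have m b c := Rep_const hc (em b c).
by eexists; exact: (RepD_max (RepD_max (RepD_max (RepM a11 (m true true)) (RepM a12 (m true false)))
  (RepM a21 (m false true))) (RepM c11 (m false false))).
Qed.
End LoopRep.

Lemma es_rq_one (B : pzRingType) (eu : bool -> bool -> B) k1 k2 k3 k4 :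
  es_rq eu 1 1 k1 k2 k3 k4 = eu true true.
Proof.
rewrite /es_rq /=; have -> : 1 + 1 - 1 - 1 = 0 :> B by ncring.
by rewrite !mul0r subr0 addr0 m2_Pi.
Qed.

Lemma near_idem_defect {R : realType} (B : pzRingType) (nrm : B -> R) (hn : bnorm nrm) e (q q' : B) (K : R) :
  q * q = q -> app nrm e q q' K -> nrm (q' * q' - q') <= (2 * K + 1) * (K * e).
Proof.
move=> qq [h1 h2 h3].
have -> : q' * q' - q' = (q - q') - (q' * (q - q') + (q - q') * q) + (q * q - q) by ncring.
rewrite qq subrr addr0; have n0 := nrm_ge0 hn (q - q').
have e1 : nrm (q' * (q - q')) <= K * (K * e).
  apply: le_trans (nrmM hn _ _) _; apply: ler_pM; [exact: nrm_ge0 hn _|exact: n0|exact: h2|exact: h3].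
have e2 : nrm ((q - q') * q) <= K * e * K.
  apply: le_trans (nrmM hn _ _) _; apply: ler_pM; [exact: n0|exact: nrm_ge0 hn _|exact: h3|exact: h1].
apply: le_trans (nrmB hn _ _) _; apply: le_trans (lerD h3 (le_trans (nrmD hn _ _) (lerD e1 e2))) _.
have -> : K * e + (K * (K * e) + K * e * K) = (2 * K + 1) * (K * e) by ring.
exact: lexx.
Qed.

Lemma app_weaken {R : realType} (B : pzRingType) (nrm : B -> R) e e' (x y : B) (K K' : R) :
  0 <= e -> 0 <= K' -> K <= K' -> e <= e' -> app nrm e x y K -> app nrm e' x y K'.
Proof.
move=> e0 K0 KK ee [h1 h2 h3]; split; [exact: le_trans h1 KK|exact: le_trans h2 KK|].
by apply: le_trans h3 _; apply: le_trans (ler_wpM2r e0 KK) (ler_wpM2l K0 ee).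
Qed.

Lemma perturb_const {R : realType} (Q : R) : 1 <= Q -> exists2 dl : R, 0 < dl &
  [/\ Q * dl <= 2^-1, dl <= Q, 3 * Q ^+ 2 * dl <= Q & 2 * ((17 * Q ^+ 2) * (7 * Q ^+ 3 * dl)) <= 1].
Proof.
move=> Q1; have Q0 : 0 < Q by exact: lt_le_trans ltr01 Q1.
have q5 : 0 < Q ^+ 5 by exact: exprn_gt0.
pose t : R := 10^-1 * 10^-1 * 3^-1; have t0 : 0 < t by rewrite /t; lra.
exists (t / Q ^+ 5); first by rewrite divr_gt0.
have dlE : Q ^+ 5 * (t / Q ^+ 5) = t by rewrite mulrC divfK // gt_eqF.
have d0 : 0 < t / Q ^+ 5 by rewrite divr_gt0.
have pw m : (m <= 5)%N -> Q ^+ m * (t / Q ^+ 5) <= t.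
  by move=> m5; rewrite -[X in _ <= X]dlE; apply: ler_wpM2r; [exact: ltW|exact: ler_weXn2l].
move: d0 dlE pw; generalize (t / Q ^+ 5) => dl d0 dlE pw.
have p0 := pw 0 isT; have p1 := pw 1 isT; have p2 := pw 2 isT; rewrite expr0 in p0; rewrite expr1 in p1.
split; [by rewrite /t in p1 *; lra|by rewrite /t in p0 *; lra|by rewrite /t in p2 *; lra|].
have -> : 2 * (17 * Q ^+ 2 * (7 * Q ^+ 3 * dl)) = 2 * 17 * 7 * (Q ^+ 5 * dl) by ring.
by rewrite dlE /t; lra.
Qed.

Lemma perturb_sum {R : realType} (a b u x Q : R) : a <= u + b -> b <= x -> u <= Q -> x <= Q -> a <= 2 * Q.
Proof. by move=> *; lra. Qed.

Lemma perturb_df {R : realType} (Q dl : R) : 1 <= Q -> 0 <= dl ->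
  dl * 1 * Q + 2 * Q * 1 * (3 * Q ^+ 2 * dl) <= 7 * Q ^+ 3 * dl.
Proof.
move=> Q1 d0; have -> : dl * 1 * Q + 2 * Q * 1 * (3 * Q ^+ 2 * dl) = (Q ^+ 1 + 6 * Q ^+ 3) * dl by ring.
apply: ler_wpM2r => //; have : Q ^+ 1 <= Q ^+ 3 by exact: ler_weXn2l.
by generalize (Q ^+ 1) (Q ^+ 3); clear => a b h; lra.
Qed.

Lemma perturb_fin {R : realType} (Q d x : R) : 1 <= Q -> 0 <= d -> d <= x ->
  2 * ((17 * Q ^+ 2) * x) <= 1 -> 2 * ((1 + 2 * (4 * Q ^+ 2)) * d) <= 1.
Proof.
move=> Q1 d0 dx; apply: le_trans; rewrite ler_pM2l //; have q2 : 1 <= Q ^+ 2 by exact: exprn_ege1.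
by apply: ler_pM => //; move: q2; generalize (Q ^+ 2); clear => a h; lra.
Qed.

(** Conjugates of P by nearby invertible elements are close. *)
Lemma perturb {R : realType} {X : metricType R} {p : R} (p1 : 1 <= p)
    (U U' : bop (X * bool * int)%type p1) : inv2 (@DZ R X p p1) U U' ->
  exists C dl : R, 0 < dl /\ forall c, DZ c -> opnorm (c - U) <= dl ->
    (exists c', inv2 (@DZ R X p p1) c c') /\ forall c', inv2 (@DZ R X p p1) c c' ->
    opnorm (c * PZ p1 * c') <= C /\
    2 * ((1 + 2 * C) * opnorm (U * PZ p1 * U' - c * PZ p1 * c')) <= 1.
Proof.
move=> iU; pose Q := 1 + opnorm U + opnorm U'.
have u0 : 0 <= opnorm U by exact: opnorm_ge0.
have u0' : 0 <= opnorm U' by exact: opnorm_ge0.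
have [Q1 UQ UQ'] : [/\ 1 <= Q, opnorm U <= Q & opnorm U' <= Q].
  by rewrite /Q; move: u0 u0'; generalize (opnorm U) (opnorm U'); clear => a b h1 h2; split; lra.
have Q0 : 0 < Q by exact: lt_le_trans ltr01 Q1.
have hn := hnZ p1 (X := X); have hD := DZ_csub p1 (X := X).
have [dl dl0 [k1 k2 k3 k4]] := perturb_const Q1.
exists (4 * Q ^+ 2), dl; split; first exact: dl0.
move=> c Dc cU; have [DU DU' UU U'U] := iU.
have small : opnorm U' * opnorm (c - U) <= 2^-1.
  exact: le_trans (ler_pM u0' (opnorm_ge0 _) UQ' cU) k1.
have [x' [Dx' cx x'c hx]] := near_inv hn hD DU DU' Dc UU U'U small.
split; first by exists x'; exact: (And4 Dc Dx' cx x'c).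
move=> c' [_ Dc' cc c'c].
have xc : x' = c' by rewrite -[x']mul1r -c'c -mulrA cx mulr1.
rewrite {x' cx Dx' x'c}xc in hx.
have hc' : opnorm (c' - U') <= 3 * Q ^+ 2 * dl.
  apply: le_trans hx _; apply: ler_pM; [|exact: opnorm_ge0| |exact: cU].
    by rewrite mulr_ge0 // exprn_ge0.
  by apply: ler_wpM2l => //; apply: pow_le u0' UQ'.
have cQ : opnorm c <= 2 * Q.
  exact: perturb_sum (nrm_tri hn c U) cU UQ k2.
have P1 := opnorm_chi p1 (@posZ R X); rewrite -/(PZ p1) in P1.
have df : opnorm (U * PZ p1 * U' - c * PZ p1 * c') <= 7 * Q ^+ 3 * dl.
  have -> : U * PZ p1 * U' - c * PZ p1 * c' = - ((c - U) * PZ p1 * U') - c * PZ p1 * (c' - U') by ncring.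
  have e1 : opnorm ((c - U) * PZ p1 * U') <= dl * 1 * Q.
    apply: le_trans (opnormM_le _ _) _; apply: ler_pM; [exact: opnorm_ge0|exact: opnorm_ge0| |exact: UQ'].
    apply: le_trans (opnormM_le _ _) _; apply: ler_pM; [exact: opnorm_ge0|exact: opnorm_ge0|exact: cU|exact: P1].
  have e2 : opnorm (c * PZ p1 * (c' - U')) <= 2 * Q * 1 * (3 * Q ^+ 2 * dl).
    apply: le_trans (opnormM_le _ _) _; apply: ler_pM; [exact: opnorm_ge0|exact: opnorm_ge0| |exact: hc'].
    apply: le_trans (opnormM_le _ _) _; apply: ler_pM; [exact: opnorm_ge0|exact: opnorm_ge0|exact: cQ|exact: P1].
  apply: le_trans (opnormB_le _ _) _; rewrite opnormN; apply: le_trans (lerD e1 e2) _.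
  exact: perturb_df Q1 (ltW dl0).
have gC : opnorm (c * PZ p1 * c') <= 4 * Q ^+ 2.
  have -> : 4 * Q ^+ 2 = 2 * Q * 1 * (2 * Q) by ring.
  apply: le_trans (opnormM_le _ _) _; apply: ler_pM; [exact: opnorm_ge0|exact: opnorm_ge0| |].
    apply: le_trans (opnormM_le _ _) _; apply: ler_pM; [exact: opnorm_ge0|exact: opnorm_ge0|exact: cQ|exact: P1].
  exact: perturb_sum (nrm_tri hn c' U') hc' UQ' k3.
have sm := perturb_fin Q1 (opnorm_ge0 _) df k4.
by split; [exact: gC|exact: sm].
Qed.

Lemma Ksim_perturb {R : realType} {X : metricType R} {p : R} (p1 : 1 <= p)
    (U U' : bop (X * bool * int)%type p1) : inv2 (@DZ R X p p1) U U' ->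
  exists2 dl : R, 0 < dl & forall c c', inv2 (@DZ R X p p1) c c' ->
    KsimZ (c * PZ p1 * c') -> opnorm (c - U) <= dl -> KsimZ (U * PZ p1 * U').
Proof.
move=> iU; have [C [dl [dl0 h]]] := perturb iU; exists dl; first exact: dl0.
move=> c c' ic hc cU; have [Dc _ _ _] := ic; have [_ h'] := h c Dc cU; have [gC sm] := h' c' ic.
exact: (Ksim_near (hnZ p1 (X := X)) (DZ_csub p1 (X := X)) (DZ_chi _ _) (PZ_PZ p1 (X := X)) (fun N => opnorm_1chi p1 (winZ N)) (@bandZ R X p p1) (@edgeZ R X p p1) ic iU hc gC sm).
Qed.

(** The accuracy with which the idempotent has to be approximated. *)
Lemma accuracy {R : realType} (Kp K dl : R) : 1 <= Kp -> 1 <= K -> 0 < dl -> exists e h e' : R,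
  [/\ 0 < e, e <= 1, h = (2 * Kp + 1) * (Kp * e) & e' = (4 * (2 * Kp + 3) + 1) * h] /\
  [/\ 0 < h, 48 * (2 * Kp + 3) * h <= 1, K * e' <= 1, K * e' <= dl & e <= e'].
Proof.
move=> Kp1 K1 dl0; pose c := (2 * Kp + 1) * Kp.
have Kp0 : 0 < Kp by lra.
have c0 : 0 < c by rewrite mulr_gt0 //; lra.
pose b := 4 * (2 * Kp + 3) + 1; have b1 : 1 <= b by rewrite /b; lra.
pose x1 := 48 * (2 * Kp + 3) * c; pose x2 := K * (b * c); pose x3 := x2 / dl.
have x10 : 0 <= x1 by rewrite !mulr_ge0 // ?(ltW c0) //; lra.
have x20 : 0 <= x2 by rewrite !mulr_ge0 // ?(ltW c0) //; lra.
have x30 : 0 <= x3 by rewrite divr_ge0 // ltW.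
have S0 : 0 < 1 + (x1 + x2 + x3) by lra.
pose e := (1 + (x1 + x2 + x3))^-1.
have e0 : 0 < e by rewrite invr_gt0.
have le x : 0 <= x -> x <= x1 + x2 + x3 -> x * e <= 1.
  by move=> h0 h1; rewrite ler_pdivrMr // mul1r; lra.
have l1 := le x1 x10; have l2 := le x2 x20; have l3 := le x3 x30.
have e1 : e <= 1 by rewrite invf_le1 //; lra.
have cE : (2 * Kp + 1) * (Kp * e) = c * e by rewrite /c; ring.
have he0 : 0 < c * e by rewrite mulr_gt0.
exists e, ((2 * Kp + 1) * (Kp * e)), ((4 * (2 * Kp + 3) + 1) * ((2 * Kp + 1) * (Kp * e))).
split=> //; rewrite cE -/b; split=> //.
- by have : x1 * e <= 1 by [apply: l1; lra]; rewrite /x1 -!mulrA.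
- by have : x2 * e <= 1 by [apply: l2; lra]; rewrite /x2 -!mulrA.
- have : x3 * e <= 1 by apply: l3; lra.
  by rewrite /x3 mulrAC ler_pdivrMr // mul1r /x2 -!mulrA.
have c1 : 1 <= c by rewrite /c -[X in X <= _]mulr1; apply: ler_pM => //; lra.
have ee : e <= c * e by rewrite ler_peMl // ltW.
by apply: le_trans ee _; rewrite ler_peMl // ltW.
Qed.

Section UnitDef.
Context {R : realType} {X : metricType R} {p : R} (p1 : 1 <= p).
Local Notation J := (X * bool)%type.
Local Notation I := (J * int)%type.
Local Notation Pi := (mu2 p1 (X := X) true true).

(** On the first copy of X, the shift on the range of E and the identity on its kernel; the
    identity on the second copy. *)
Definition unitU (E : bop X p1) : bop I p1 :=
  es_du (mu2 p1 (X := X)) (@sh R p p1 J) (lift (lift E : bop J p1)) * Pi + (1 - Pi).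
Definition unitU' (E : bop X p1) : bop I p1 :=
  es_du' (mu2 p1 (X := X)) (@sh R p p1 J) (lift (lift E : bop J p1)) * Pi + (1 - Pi).

Lemma unit_pair (B : pzRingType) (x y P : B) : x * y = 1 -> x * P = P * x -> y * P = P * y -> P * P = P ->
  (x * P + (1 - P)) * (y * P + (1 - P)) = 1.
Proof.
move=> xy xP yP PP.
have -> : (x * P + (1 - P)) * (y * P + (1 - P)) = x * (P * y) * P + x * (P - P * P) + (y * P - P * (y * P)) + (1 - P - (P - P * P)) by ncring.
rewrite -yP PP (mulrA P y) -yP -!mulrA PP mulrA xy mul1r !subrr subr0 mulr0 !addr0.
by rewrite subrKC.
Qed.

Lemma DZ_ext (T : bop I p1) (n : nat) : (forall i j, mcoef T i j != 0 -> ctlZ n i j) -> DZ T.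
Proof. exact: DZ_in. Qed.

Lemma DZ_sh m : DZ (@sh R p p1 J m).
Proof.
apply: (@DZ_ext _ `|m|%N) => i j; rewrite mcoef_pullK /=; case: (i.1 =P j.1) => [e|_]; last by rewrite eqxx.
case: (Some _ =P _) => [[f] _|_]; last by rewrite eqxx.
by split; [rewrite e mdistxx|rewrite -f; clear; lia].
Qed.

Lemma DZ_mu2 b c : DZ (mu2 p1 (X := X) b c).
Proof.
apply: (@DZ_ext _ 0) => i j; rewrite mcoef_lift; case: (i.2 =P j.2) => [e|_]; last by rewrite eqxx.
by move=> /mcoef_mu f; split; rewrite ?f ?mdistxx // e subrr.
Qed.

Lemma mcoef_lift2 (T : bop X p1) i j : mcoef (lift (lift T : bop J p1) : bop I p1) i j != 0 ->
  mcoef T i.1.1 j.1.1 != 0 /\ i.2 = j.2.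
Proof.
rewrite mcoef_lift; case: (i.2 =P j.2) => [e|_]; last by rewrite eqxx.
by rewrite mcoef_lift; case: (i.1.2 =P j.1.2) => _; [|rewrite eqxx].
Qed.

Lemma DZ_lift2 (T : bop X p1) (r : R) : (forall x y, mcoef T x y != 0 -> mdist x y <= r) ->
  DZ (lift (lift T : bop J p1) : bop I p1).
Proof.
move=> h; apply: (@DZ_ext _ (Num.bound `|r|)) => i j /mcoef_lift2[/h a e]; split; last by rewrite e subrr.
apply: le_trans a _; apply: le_trans (ler_norm r) _; exact/ltW/archi_boundP.
Qed.

Lemma DZ_roe (E : bop X p1) : E \in roe_closure (p1:=p1) -> DZ (lift (lift E : bop J p1) : bop I p1).
Proof.
rewrite unfold_in => /asboolP hE; apply: (cs_cl (DZ_csub p1 (X := X))) => e e0.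
have [a /finite_propagationP[r r0 hr] aE] := hE e e0.
exists (lift (lift a : bop J p1)); first exact: DZ_lift2 hr.
rewrite -!liftB; apply: le_trans (opnorm_lift _) _; apply: le_trans (opnorm_lift _) _; exact: ltW aE.
Qed.

Lemma unit_inv (E : bop X p1) : E \in roe_closure (p1:=p1) -> E * E = E -> inv2 (@DZ R X p p1) (unitU E) (unitU' E).
Proof.
move=> roeE EE; have hD := DZ_csub p1 (X := X).
have Ea : app (@opnorm R X p p1) 1 E E (opnorm E) by apply: app_refl; [exact: bop_bnorm|exact: ler01|exact: lexx].
have hd := edata2 EE (mulr1 1) (opnorm1_le p1) ler01 Ea.
have DE := DZ_roe roeE; have D1 := cs1 hD.
have Du m : DZ (1 - lift (lift E : bop J p1) + @sh R p p1 J m * lift (lift E : bop J p1) : bop I p1).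
  exact: (csD hD (csB hD D1 DE) (csM hD (DZ_sh m) DE)).
have D0 := cs0 hD.
have Dm (x y : bop I p1) : DZ x -> DZ y -> DZ (m2 (mu2 p1 (X := X)) x 0 0 y * Pi + (1 - Pi)).
  move=> Dx Dy; apply: (csD hD); last exact: (csB hD D1 (DZ_mu2 _ _)).
  apply: (csM hD _ (DZ_mu2 _ _)).
  exact: (csD hD (csD hD (csD hD (csM hD Dx (DZ_mu2 _ _)) (csM hD D0 (DZ_mu2 _ _))) (csM hD D0 (DZ_mu2 _ _))) (csM hD Dy (DZ_mu2 _ _))).
have PP : Pi * Pi = Pi by exact: (ed_uM hd).
split.
- exact: (Dm _ _ (Du 1) (Du (-1))).
- exact: (Dm _ _ (Du (-1)) (Du 1)).
- exact: (unit_pair (es_duK hd) (es_du_Pi hd) (es_du'_Pi hd) PP).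
exact: (unit_pair (es_du'K hd) (es_du'_Pi hd) (es_du_Pi hd) PP).
Qed.
End UnitDef.

Lemma sum4_le {R : realType} (a b c d : R) : 0 <= a -> 0 <= b -> 0 <= c -> 0 <= d ->
  [/\ a <= a + b + c + d, b <= a + b + c + d, c <= a + b + c + d & d <= a + b + c + d].
Proof. by move=> *; split; lra. Qed.

Section UnitKsim.
Context {R : realType} {X : metricType R} {p : R} (p1 : 1 <= p).
Local Notation J := (X * bool)%type.
Local Notation I := (J * int)%type.
Local Notation eu := (mu2 p1 (X := X)).
Local Notation eu1 := (mu p1 (X := X)).
Local Notation Pi := (mu2 p1 (X := X) true true).
Local Notation tz := (@sh R p p1 J).
Local Notation DZ := (@DZ R X p p1).
Local Notation opn := (@opnorm R I p p1).
Hypothesis bgX : bounded_geometry X.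

Lemma prp_lift1 (a : bop X p1) (r0 : R) : (forall x y, mcoef a x y != 0 -> mdist x y <= r0) ->
  prp (fun i : J => i.1) r0 1 (lift a : bop J p1).
Proof.
move=> h i j; rewrite mcoef_lift mul1r; case: (i.2 =P j.2) => _; last by rewrite eqxx.
exact: h.
Qed.

Lemma prp_lift2 (a : bop X p1) (r0 : R) : (forall x y, mcoef a x y != 0 -> mdist x y <= r0) ->
  prp (fun i : I => i.1.1) r0 1 (lift (lift a : bop J p1) : bop I p1).
Proof. by move=> h i j /mcoef_lift2[/h a0 _]; rewrite mul1r. Qed.

Lemma prp_tz1 (r0 : R) m : prp (fun i : J => i.1) r0 0 (tz1 p1 0 m : bop J p1).
Proof.
apply: prp0 => i j; rewrite /tz1 -[X in mcoef X]mulr1 mcoef_scal mcoef1.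
by case: (i =P j) => [->|] //; rewrite mulr0 eqxx.
Qed.

Lemma prp_mu (r0 : R) b c : prp (fun i : J => i.1) r0 0 (eu1 b c).
Proof. by apply: prp0 => i j; exact: mcoef_mu. Qed.

Lemma prp_sh (r0 : R) m : prp (fun i : I => i.1.1) r0 0 (tz m).
Proof.
apply: prp0 => i j; rewrite mcoef_pullK /=; case: (i.1 =P j.1) => [->|] //; by rewrite eqxx.
Qed.

Lemma prp_mu2 (r0 : R) b c : prp (fun i : I => i.1.1) r0 0 (eu b c).
Proof.
apply: prp0 => i j; rewrite mcoef_lift; case: (i.2 =P j.2) => _; last by rewrite eqxx.
exact: mcoef_mu.
Qed.

Lemma prp0_piece (V : set (set X)) (r0 : R) (T : bop I p1) : prp (fun i : I => i.1.1) r0 0 T ->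
  ctls (pieceT (fun i : I => i.1.1) r0 V) T.
Proof.
move=> h i j /h; rewrite mul0r => d; left.
by apply: mdist_positivity; apply: le_anti; rewrite d mdist_ge0.
Qed.

(** The class of block operators over the pieces. *)
Definition Dpc (V : set (set X)) (r0 : R) (T : bop I p1) :=
  DZ T /\ ctls (pieceT (fun i : I => i.1.1) r0 V) T.

Lemma Dpc_csub V r0 r : 2 * (5%:R * r0) <= r -> separated_family r V ->
  csub opn (Dpc V r0).
Proof.
move=> rs sep; apply: (csub_cap (DZ_csub p1 (X := X))); apply: ctls_csub => [i|i j k].
  exact: piece_refl.
exact: (piece_trans rs sep).
Qed.

Variable E : bop X p1.

(** The halves and their pieces are chosen at a scale r larger than ten times the propagation
    r0 of a: the terms of the factorization are supported within 5 r0 of the pieces, and the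
    neighbourhoods of different pieces must not meet. *)
Section AtScale.
Variables (e h C Kp : R) (a : bop X p1) (r0 : R).
Local Notation r := (2 * (5%:R * r0) + 1).
Variables (U0 : pred X) (V0 V1 : set (set X)).
Hypotheses (r00 : 0 <= r0) (hr0 : forall x y, mcoef a x y != 0 -> mdist x y <= r0).
Hypotheses (c0 : \bigcup_(A in V0) A = [set x | U0 x]) (c1 : \bigcup_(A in V1) A = [set x | ~~ U0 x])
  (b0 : uniformly_bounded V0)
  (sep0 : separated_family r V0) (sep1 : separated_family r V1).
Local Notation hU := (chi p1 U0).
Local Notation a1 := (lift a : bop J p1).
Local Notation h1 := (lift hU : bop J p1).
Local Notation a2 := (lift a1 : bop I p1).
Local Notation h2 := (lift h1 : bop I p1).
Local Notation E2 := (lift (lift E : bop J p1) : bop I p1).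
Local Notation D0 := (Dpc V0 r0).
Local Notation D1 := (Dpc V1 r0).

Let rs : 2 * (5%:R * r0) <= r. Proof. by rewrite lerDl. Qed.
Let h1E : h1 = chi p1 (fun i : J => U0 i.1). Proof. exact: lift_chi. Qed.
Let h2E : h2 = chi p1 (fun i : I => U0 i.1.1). Proof. by rewrite h1E lift_chi. Qed.
Let hD0 : csub opn D0. Proof. exact: Dpc_csub rs sep0. Qed.
Let hD1 : csub opn D1. Proof. exact: Dpc_csub rs sep1. Qed.
Let hDZ := DZ_csub p1 (X := X).
Let s5 : 0 <= 5%:R * r0. Proof. by rewrite mulr_ge0. Qed.

Let Dsh V m : Dpc V r0 (tz m).
Proof. by split; [exact: DZ_sh|apply: prp0_piece; exact: prp_sh]. Qed.
Let Dmu V b c : Dpc V r0 (eu b c).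
Proof. by split; [exact: DZ_mu2|apply: prp0_piece; exact: prp_mu2]. Qed.
Let DZa : DZ a2. Proof. exact: DZ_lift2 hr0. Qed.
Let DZh : DZ h2. Proof. by rewrite h2E; exact: DZ_chi. Qed.

Lemma scale_v0 : D0 (es_v0 eu tz a2 h2) /\ D0 (es_v0' eu tz a2 h2).
Proof.
apply: (es_v0_in hD0 (Dsh V0) (Dmu V0)); split; first exact: (csM hDZ (csM hDZ DZh DZa) DZh).
rewrite h2E; exact: (f_ctl0 r00 rs sep0 c0 (fun i : I => erefl) (@prp_sh r0) (@prp_mu2 r0) (prp_lift2 hr0)).
Qed.

Lemma scale_w : D1 (es_w eu tz a2 h2) /\ D1 (es_w' eu tz a2 h2).
Proof.
rewrite h2E; have [w1 w2] := es_w_in hDZ (@DZ_sh R X p p1) (@DZ_mu2 R X p p1) DZa (DZ_chi p1 (fun i : I => U0 i.1.1)).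
have m1 : eu true true + eu false false = 1 by rewrite /mu2 -liftD mu_1 lift1.
have [u1 u2] := w_ctl r00 c1 (fun i : I => erefl (U0 i.1.1)) (@prp_sh r0) (@prp_mu2 r0) (prp_lift2 hr0) m1.
exact: (conj (conj w1 u1) (conj w2 u2)).
Qed.

Let EJ (i j : J) := pieceT (fun i : J => i.1) r0 V0 i j /\ pieceT (fun i : J => i.1) r0 V1 i j.

Lemma scale_classes : exists n, exists2 cls : J -> seq J, classes n cls & forall i j, (j \in cls i) <-> EJ i j.
Proof.
have [rho _ hrho] := piece_bounded s5 b0; have [N [N0 hN]] := ball_card bgX rho.
exists (N * 2)%N; apply: rel_classes.
- by move=> i; split; exact: piece_refl.
- by move=> i j [u v]; split; exact: piece_sym.
- move=> i j k [u v] [u' v']; split; first exact: (piece_trans rs sep0 u u').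
  exact: (piece_trans rs sep1 v v').
move=> i; exists [seq (x, b) | x <- ball i.1 rho, b <- [:: true; false]].
  by rewrite size_allpairs leq_mul2r; apply/orP; right; exact: hN.
move=> [y b] [u _]; apply/allpairsP; exists (y, b); split=> /=; last by [].
  by rewrite (ballE bgX); exact: hrho.
by case: (b).
Qed.

(** The matrix qJ is the value at the shift of a loop of almost idempotent block operators. At
    the point 1 of the circle nu vanishes, so the loop starts at Pi. *)
Lemma scale_loop : edata opn eu tz E2 a2 h2 C e ->
    (forall x, edata (@opnorm R J p p1) eu1 (tz1 p1 x) (lift E : bop J p1) a1 h1 C e) ->
    (forall (B : pzRingType) (nrm : B -> R) (eu : bool -> bool -> B) (tz : int -> B) (E a h : B) (e : R),
      edata nrm eu tz E a h C e -> app nrm e (es_q eu tz a h) (es_qJ eu tz a h) Kp) ->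
    1 <= Kp -> 0 < h -> h = (2 * Kp + 1) * (Kp * e) -> 48 * (2 * Kp + 3) * h <= 1 ->
  exists Y Y', [/\ D0 Y /\ D1 Y, D0 Y' /\ D1 Y', Y * Y' = 1, Y' * Y = 1 &
    opnorm (Y * Pi * Y' - es_qJ eu tz a2 h2) <= (4 * (2 * Kp + 3) + 1) * h].
Proof.
move=> hd2 hd1 hap Kp1 hp hE hsm.
have [n [cls hc clsE]] := scale_classes.
pose DJ (T : bop I p1) := D0 T /\ D1 T.
have hDJ : csub opn DJ by exact: (csub_cap hD0 hD1).
have gJ := gens_ctl r00 rs sep0 c0 c1 (fun i : J => erefl (U0 i.1)) (@prp_tz1 r0) (@prp_mu r0) (prp_lift1 hr0).
rewrite -h1E /= in gJ; case: gJ => -[g10 g11] [g20 g21] [g30 g31] [g40 g41].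
have es (T : bop J p1) : ctls (pieceT (fun i : J => i.1) r0 V0) T -> ctls (pieceT (fun i : J => i.1) r0 V1) T -> esupp cls T.
  by move=> u v i j Tij; apply/clsE; split; [exact: u|exact: v].
have em b c : esupp cls (eu1 b c).
  by move=> i j /mcoef_mu ij; apply/clsE; split; left.
have [d hR] := Rep_rq hc (es _ g10 g11) (es _ g20 g21) (es _ g30 g31) (es _ g40 g41) em.
have SE : es_rq eu (tz 1) (tz (-1)) (lift (es_kJ a1 h1)) (lift (es_f a1 h1 * es_kJ a1 h1))
    (lift (es_kJ a1 h1 * es_f a1 h1)) (lift (es_kJ a1 h1 * es_f a1 h1 * es_kJ a1 h1)) = es_qJ eu tz a2 h2.
  rewrite (es_qJ_rq hd2).
  have kE : lift (es_kJ a1 h1) = es_kJ a2 h2 by rewrite /es_kJ !liftM liftB lift1.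
  have fE : lift (es_f a1 h1) = es_f a2 h2 by rewrite /es_f !liftM.
  have e2 : lift (es_f a1 h1 * es_kJ a1 h1) = es_f a2 h2 * es_kJ a2 h2 by rewrite [LHS]liftM fE kE.
  have e3 : lift (es_kJ a1 h1 * es_f a1 h1) = es_kJ a2 h2 * es_f a2 h2 by rewrite [LHS]liftM fE kE.
  by rewrite kE e2 e3 [lift (_ * _ * _)]liftM e3 kE.
rewrite SE in hR.
pose G x := es_rq eu1 (tz1 p1 x 1) (tz1 p1 x (-1)) (es_kJ a1 h1) (es_f a1 h1 * es_kJ a1 h1)
    (es_kJ a1 h1 * es_f a1 h1) (es_kJ a1 h1 * es_f a1 h1 * es_kJ a1 h1).
have GE x : G x = es_qJ eu1 (tz1 p1 x) a1 h1 by rewrite (es_qJ_rq (hd1 x)).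
have [rho0 _ hrho] := piece_bounded s5 b0.
have DJl (T : bop J p1) : esupp cls T -> DJ (lift T).
  move=> eT; have sup i j : mcoef (lift T : bop I p1) i j != 0 -> EJ i.1 j.1 /\ i.2 = j.2.
    rewrite mcoef_lift; case: (i.2 =P j.2) => e2; last by rewrite eqxx.
    by move=> /eT /clsE.
  have DT : DZ (lift T).
    apply: (@DZ_ext _ _ _ _ _ (Num.bound `|rho0|)) => i j /sup[[u _] e2]; split; last by rewrite e2 subrr.
    apply: le_trans (hrho _ _ u) _; apply: le_trans (ler_norm rho0) _; exact/ltW/archi_boundP.
  by split; split; [exact: DT|move=> i j /sup[[u v] _]|exact: DT|move=> i j /sup[[u v] _]].
pose Kg := opnorm (es_kJ a1 h1) + opnorm (es_f a1 h1 * es_kJ a1 h1) + opnorm (es_kJ a1 h1 * es_f a1 h1)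
  + opnorm (es_kJ a1 h1 * es_f a1 h1 * es_kJ a1 h1).
have [L hL0 hL] := es_rq_lip Kg.
have [kg1 kg2 kg3 kg4] : [/\ opnorm (es_kJ a1 h1) <= Kg, opnorm (es_f a1 h1 * es_kJ a1 h1) <= Kg,
    opnorm (es_kJ a1 h1 * es_f a1 h1) <= Kg & opnorm (es_kJ a1 h1 * es_f a1 h1 * es_kJ a1 h1) <= Kg].
  have := opnorm_ge0 (es_kJ a1 h1); have := opnorm_ge0 (es_f a1 h1 * es_kJ a1 h1).
  have := opnorm_ge0 (es_kJ a1 h1 * es_f a1 h1); have := opnorm_ge0 (es_kJ a1 h1 * es_f a1 h1 * es_kJ a1 h1).
  by move=> k4 k3 k2 k1; exact: sum4_le k1 k2 k3 k4.
have pi0 : 0 <= 4 * pi :> R by rewrite mulr_ge0 // pi_ge0.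
have tzl x y m : `|m%:~R : R| = 1 -> opnorm (tz1 p1 x m - tz1 p1 y m : bop J p1) <= 4 * pi * `|x - y|.
  move=> hm; rewrite /tz1 -scalB; apply: le_trans (opnorm_scal _ _ _) _; apply: le_trans (zc_lip _ _) _.
  by rewrite -mulrBl normrM hm mulr1.
have m1 : `|1%:~R : R| = 1 by rewrite normr1.
have m1' : `|(-1)%:~R : R| = 1 by rewrite intrN normrN normr1.
have Lip x y : 0 <= x <= 1 -> 0 <= y <= 1 -> opnorm (G x - G y) <= L * (4 * pi) * `|x - y|.
  move=> _ _; rewrite -mulrA.
  exact: (hL _ _ _ _ _ _ _ _ _ _ _ _ (bop_bnorm p1 (I := J)) (mu_nrm p1 (X := X)) (mulr_ge0 pi0 (normr_ge0 _))
    (opnorm_tz1 _ _ _) (opnorm_tz1 _ _ _) (opnorm_tz1 _ _ _) (opnorm_tz1 _ _ _) (tzl x y _ m1) (tzl x y _ m1') kg1 kg2 kg3 kg4).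
have G0 : G 0 = chi p1 (fun i : J => i.2).
  have t0 m : tz1 p1 0 m = 1 :> bop J p1 by rewrite /tz1 mul0r zc0 scal1.
  by rewrite /G !t0 es_rq_one mu_chi.
have hG x : 0 <= x <= 1 -> opnorm (G x) <= Kp /\ opnorm (G x * G x - G x) <= h.
  move=> _; have A := hap _ _ _ _ _ _ _ _ (hd1 x); rewrite GE; split; first by case: A => _ A2 _; exact: A2.
  rewrite hE; exact: (near_idem_defect (bop_bnorm p1 (I := J)) (es_q_idem (hd1 x)) A).
have A := hap _ _ _ _ _ _ _ _ hd2.
have S1 : opnorm (es_qJ eu tz a2 h2) <= Kp by case: A => _ A2 _; exact: A2.
have S2 : opnorm (es_qJ eu tz a2 h2 * es_qJ eu tz a2 h2 - es_qJ eu tz a2 h2) <= h.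
  rewrite hE; exact: (near_idem_defect (bop_bnorm p1 (I := I)) (es_q_idem hd2) A).
have DJs m : DJ (tz m) by split; exact: Dsh.
have [Y [Y' [[Y0 Y1] [Y0' Y1'] YY Y'Y hY]]] := loop_trivial (A := fun i : J => i.2) hDJ DJl DJs Kp1 (mulr_ge0 hL0 pi0) hp hsm hR S1 S2 hG Lip G0.
exists Y, Y'; split; [by split|by split|exact: YY|exact: Y'Y|].
by rewrite -mu_chi in hY.
Qed.

End AtScale.
End UnitKsim.

(** The invertible element of an idempotent does not contribute to the index: it is close to
    a product of invertible elements with blocks, over the pieces of the two halves. *)
Lemma unit_Ksim {R : realType} {X : metricType R} {p : R} (p1 : 1 <= p)
    (bgX : bounded_geometry X) (naX : ~ amenable X) (adX : asdim_le X 1) (E : bop X p1) :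
  E \in roe_closure (p1 := p1) -> E * E = E -> KsimZ (unitU E * PZ p1 * unitU' E).
Proof.
move=> roeE EE; pose C := opnorm E + 1; have C1 : 1 <= C by rewrite lerDr; exact: opnorm_ge0.
have [K1 [K2 [K3 [K4 [K5 hK]]]]] := es_bounds C.
pose Kp := 1 + `|K1|; pose M := Kp + `|K2| + `|K3| + `|K4| + `|K5|.
have [Kp1 M1 KpM] : [/\ 1 <= Kp, 1 <= M & Kp <= M].
  rewrite /M /Kp; have := normr_ge0 K1; have := normr_ge0 K2; have := normr_ge0 K3; have := normr_ge0 K4; have := normr_ge0 K5.
  by move: `|K1| `|K2| `|K3| `|K4| `|K5|; clear => a b c d f h1 h2 h3 h4 h5; split; lra.
have [M1' M2 M3 M4 M5] : [/\ K1 <= Kp, K2 <= M, K3 <= M, K4 <= M & K5 <= M].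
  rewrite /M /Kp; have := normr_ge0 K1; have := normr_ge0 K2; have := normr_ge0 K3; have := normr_ge0 K4; have := normr_ge0 K5.
  have := ler_norm K1; have := ler_norm K2; have := ler_norm K3; have := ler_norm K4; have := ler_norm K5.
  by move: `|K1| `|K2| `|K3| `|K4| `|K5|; clear => a b c d f *; split; lra.
have M0 : 0 <= M by exact: le_trans ler01 M1.
have Kp0 : 0 <= Kp by exact: le_trans ler01 Kp1.
have [K K1' hasm] := assembly M1.
have [dl dl0 hdl] := Ksim_perturb (unit_inv roeE EE).
have [e [h [e' [[e0 e1 hE eE] [h0 hsm Ke1 Kedl ee]]]]] := accuracy Kp1 K1' dl0.
have [a /finite_propagationP[r0 r00 hr0] aE] : exists2 a : bop X p1, finite_propagation a & opnorm (E - a) < e.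
  by move: roeE; rewrite unfold_in => /asboolP /(_ e e0).
have r0' : 0 < 2 * (5%:R * r0) + 1 by rewrite ltr_wpDl // !mulr_ge0.
have [U0 [V0 [V1 [c0 c1 b0 b1 [sep0 sep1]]]]] := asdim1 adX r0'.
have s5 : 0 <= 5%:R * r0 by rewrite mulr_ge0.
have rs : 2 * (5%:R * r0) <= 2 * (5%:R * r0) + 1 by rewrite lerDl.
have Ea : app (@opnorm R X p p1) e a E C.
  have d : opnorm (a - E) <= e by rewrite opnormBC; exact: ltW aE.
  split.
  - apply: le_trans (nrm_tri (bop_bnorm p1 (I := X)) a E) _; apply: lerD; first exact: lexx.
    exact: le_trans d e1.
  - by rewrite lerDl.
  by apply: le_trans d _; rewrite ler_peMl // ltW.
have hU := chi_idem p1 U0; have hn : opnorm (chi p1 U0) <= 1 by exact: opnorm_pull.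
have hd1 x := edata1 EE hU hn (ltW e0) Ea x.
have hd2 := edata2 EE hU hn (ltW e0) Ea.
have e0' : 0 <= e' by exact: le_trans (ltW e0) ee.
have hap (B : pzRingType) (nrm : B -> R) eu tz (E0 a0 h1 : B) e2 : edata nrm eu tz E0 a0 h1 C e2 ->
    app nrm e2 (es_q eu tz a0 h1) (es_qJ eu tz a0 h1) Kp.
  move=> hd; have [B1 _ _ _ _] := hK _ _ _ _ _ _ _ _ hd.
  exact: (app_weaken (ed_e0 hd) Kp0 M1' (lexx _) B1).
have [B1 B2 B3 B4 B5] := hK _ _ _ _ _ _ _ _ hd2.
have [Y [Y' [[Y0 Y1] [Y0' Y1'] YY Y'Y hY]]] :=
  scale_loop bgX r00 hr0 c0 c1 b0 sep0 sep1 hd2 hd1 hap Kp1 h0 hE hsm.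
rewrite -eE in hY.
have [v0 v0'] := scale_v0 r00 hr0 c0 sep0.
have [w w'] := scale_w r00 hr0 c1.
have hD0 := Dpc_csub p1 rs sep0; have hD1 := Dpc_csub p1 rs sep1.
pose J := (X * bool)%type; pose I := (J * int)%type.
pose eu := mu2 p1 (X := X); pose tz := @sh R p p1 J.
have DPi V : Dpc V r0 (eu true true).
  by split; [exact: DZ_mu2|apply: prp0_piece; exact: prp_mu2].
have hasmd := AsmData (hnZ p1 (X := X)) hD0 hD1
  (And4 (DPi V0) (DPi V1) (ed_uM hd2 true true true true) (ed_un hd2 true true))
  (And4 v0 v0' (es_v0K hd2) (es_v0'K hd2)) (conj (le_trans B4 M4) (le_trans B5 M5))
  (And4 (es_duK hd2) (es_du'K hd2) (es_du_Pi hd2) (es_du'_Pi hd2))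
  (And4 w w' (app_weaken (ltW e0) M0 M2 ee B2) (app_weaken (ltW e0) M0 M3 ee B3))
  (And4 Y0 Y0' Y1 Y1') (And3 YY Y'Y erefl)
  (app_weaken (ltW e0) M0 (le_trans M1' KpM) ee B1) hY e0'.
have [u0 [u0' [u1 [u1' [[D0u D0u' uu0 uu0'] [D1u D1u' uu1 uu1'] near]]]]] := hasm _ _ _ _ _ _ _ _ _ _ _ _ _ _ _ _ hasmd Ke1.
have [rho0 _ hr0'] := piece_bounded s5 b0; have [rho1 _ hr1'] := piece_bounded s5 b1.
have K0 := block_Ksim bgX naX (@piece_refl R X V0 _) (@piece_sym R X V0 _) (piece_trans rs sep0) hr0' D0u D0u' uu0 uu0'.
have K1'' := block_Ksim bgX naX (@piece_refl R X V1 _) (@piece_sym R X V1 _) (piece_trans rs sep1) hr1' D1u D1u' uu1 uu1'.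
have i0 : inv2 (@DZ R X p p1) u0 u0' := And4 (proj1 D0u) (proj1 D0u') uu0 uu0'.
have i1 : inv2 (@DZ R X p p1) u1 u1' := And4 (proj1 D1u) (proj1 D1u') uu1 uu1'.
have hn2 := hnZ p1 (X := X); have hD := DZ_csub p1 (X := X).
apply: (hdl (u1 * u0) (u0' * u1')).
- exact: (inv2M hD i1 i0).
- exact: (Ksim_mul hn2 hD (fun N => opnorm_1chi p1 (winZ N)) (@bandZ R X p p1) i1 i0 K1'' K0).
exact: le_trans near Kedl.
Qed.

(** * From the index to projections *)

(** With t the shift, P the half-line and Z the origin: the conjugate of P by the invertible
    element of E0 loses the part of E0 at the origin. *)
Lemma conj_alg (B : pzRingType) (Q P E0 t t' Z : B) : t * P * t' = P - Z ->
    t * E0 = E0 * t -> t' * E0 = E0 * t' -> t * Q = Q * t -> t' * Q = Q * t' ->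
    E0 * P = P * E0 -> Q * P = P * Q -> E0 * Q = Q * E0 -> E0 * E0 = E0 -> Q * Q = Q ->
  ((1 - E0 + t * E0) * Q + (1 - Q)) * P * ((1 - E0 + t' * E0) * Q + (1 - Q)) = P - Z * E0 * Q.
Proof.
move=> sP c1 c2 c3 c4 EP QP EQ E2 QQ.
have q1 : (1 - Q) * Q = 0 by rewrite mulrBl mul1r QQ subrr.
have q2 : Q * (1 - Q) = 0 by rewrite mulrBr mulr1 QQ subrr.
have cm (x : B) : x * Q = Q * x -> x * (1 - Q) = (1 - Q) * x by move=> e; rewrite mulrBr mulrBl e mulr1 mul1r.
have xQ (s : B) : s * Q = Q * s -> (1 - E0 + s * E0) * Q = Q * (1 - E0 + s * E0).
  by move=> e; rewrite mulrDl mulrDr mulrBl mulrBr -!mulrA EQ !mulrA e mulr1 mul1r.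
have [u1 u2] := (xQ t c3, xQ t' c4); set x := 1 - E0 + t * E0; set y := 1 - E0 + t' * E0.
rewrite -/x in u1; rewrite -/y in u2.
have -> : (x * Q + (1 - Q)) * P * (y * Q + (1 - Q)) =
    x * P * y * Q + (1 - Q) * P.
  have -> : (x * Q + (1 - Q)) * P * (y * Q + (1 - Q)) =
    x * (Q * P) * (y * Q) + x * (Q * P) * (1 - Q) + (1 - Q) * P * (y * Q) + (1 - Q) * P * (1 - Q) by ncring.
  rewrite QP u2 -(mulrA x (P * Q)) -(mulrA P Q) (mulrA Q Q) QQ -u2.
  rewrite -(mulrA x (P * Q) (1 - Q)) -(mulrA P Q (1 - Q)) q2 !mulr0 addr0.
  rewrite -(cm P (esym QP)) -!mulrA (mulrA (1 - Q) y) -(cm y u2) -(mulrA y) q1 !mulr0 addr0.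
  by rewrite (_ : (1 - Q) * (1 - Q) = 1 - Q) // mulrBl mul1r q2 subr0.
have -> : x * P * y = P - (P - t * P * t') * E0.
  rewrite /x /y; have -> : (1 - E0 + t * E0) * P * (1 - E0 + t' * E0) =
     (1 - E0) * (P * (1 - E0)) + (1 - E0) * P * (t' * E0) + t * (E0 * P) * (1 - E0) + t * (E0 * P) * (t' * E0) by ncring.
  have e0 : E0 * (1 - E0) = 0 by rewrite mulrBr mulr1 E2 subrr.
  have e1 : (1 - E0) * E0 = 0 by rewrite mulrBl mul1r E2 subrr.
  have ep : (1 - E0) * P = P * (1 - E0) by rewrite mulrBl mulrBr EP mul1r mulr1.
  rewrite EP -ep (mulrA (1 - E0)) (_ : (1 - E0) * (1 - E0) = 1 - E0); last by rewrite mulrBl mul1r e0 subr0.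
  rewrite c2 ep -(mulrA P (1 - E0)) (mulrA (1 - E0) E0) e1 mul0r mulr0 addr0.
  rewrite -(mulrA t (P * E0)) -(mulrA P E0 (1 - E0)) e0 !mulr0 addr0.
  have -> : t * (P * E0) * (E0 * t') = t * P * (E0 * E0) * t' by rewrite !mulrA.
  by rewrite E2 -(mulrA _ E0) -c2; ncring.
rewrite sP; have -> : (P - (P - (P - Z)) * E0) * Q + (1 - Q) * P = P - Z * E0 * Q + (P * Q - Q * P) by ncring.
by rewrite QP subrr addr0.
Qed.

Section Cut.
Context {R : realType} {X : metricType R} {p : R} (p1 : 1 <= p).
Local Notation J := (X * bool)%type.
Local Notation I := (J * int)%type.
Local Notation B := (bop I p1).
Local Notation Pi := (mu2 p1 (X := X) true true).
Local Notation DZ := (@DZ R X p p1).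
Local Notation FZ := (@FZ R X p p1).
Local Notation PZ := (@PZ R X p p1).

(** The idempotent E placed at the origin. *)
Definition slotE (E : bop X p1) : B := chi p1 (fun i : I => i.2 == 0) * lift (lift E : bop J p1) * Pi.

Lemma Pi_chi : Pi = chi p1 (fun i : I => i.1.2).
Proof. by rewrite /mu2 mu_chi lift_chi. Qed.

Lemma mcoef_slotE (E : bop X p1) i j : mcoef (slotE E) i j =
  if [&& i.2 == 0, j.2 == 0, i.1.2 & j.1.2] then mcoef E i.1.1 j.1.1 else 0.
Proof.
rewrite /slotE Pi_chi mcoef_chir mcoef_chil mcoef_lift mcoef_lift.
case: i j => [[x b] k] [[y c] l] /=.
have [->|hk] := eqVneq k 0; last by rewrite if_same.
have -> : (0 == l) = (l == 0) by rewrite eq_sym.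
by case: b; case: c; rewrite /= ?andbF ?andbT ?if_same.
Qed.

Lemma sh_PZ : (@sh R p p1 J 1) * PZ * (@sh R p p1 J (-1)) = PZ - chi p1 (fun i : I => i.2 == 0).
Proof.
have ext (S T : B) : (forall u i, S u i = T u i) -> S = T.
  by move=> e; apply: mcoef_ext => i j; exact: e.
apply: ext => u [j k]; rewrite !bopME bopBE ellpBE /PZ shE !chiE shE /posZ /=.
have -> : (k - 1 - -1 = k)%R by ring.
have [->|k0] := eqVneq k 0; first by rewrite /= subrr.
by rewrite subr0; have -> : (0 <= k - 1) = (0 <= k) by move: k0; clear; lia.
Qed.

Lemma unit_conj (E : bop X p1) : E * E = E -> unitU E * PZ * unitU' E = PZ - slotE E.
Proof.
move=> EE; have Ea : app (@opnorm R X p p1) 1 E E (opnorm E) by apply: app_refl; [exact: bop_bnorm|exact: ler01|exact: lexx].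
have hd := edata2 EE (mulr1 1) (opnorm1_le p1) ler01 Ea.
have PP : Pi * Pi = Pi by exact: (ed_uM hd).
have mP (x y : B) : m2 (mu2 p1 (X := X)) x 0 0 y * Pi = x * Pi.
  have := ed_uM hd; move: (mu2 p1 (X := X)) => eu euM; rewrite /m2 !mulrDl -!mulrA !euM /=.
  by rewrite !mul0r mulr0 !addr0.
pose E0 : B := lift (lift E : bop J p1).
have UE : unitU E = (1 - E0 + @sh R p p1 J 1 * E0) * Pi + (1 - Pi) by congr (_ + _); exact: mP.
have UE' : unitU' E = (1 - E0 + @sh R p p1 J (-1) * E0) * Pi + (1 - Pi) by congr (_ + _); exact: mP.
have EP : E0 * PZ = PZ * E0.
  by apply: mcoef_ext => i j; rewrite /PZ mcoef_chir mcoef_chil mcoef_lift; case: (i.2 =P j.2) => e; rewrite ?if_same // /posZ e.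
have PiP : Pi * PZ = PZ * Pi by rewrite Pi_chi /PZ !chi_mul; apply: chi_ext => i; rewrite andbC.
have cE m : @sh R p p1 J m * E0 = E0 * @sh R p p1 J m by rewrite /E0 lift_sh.
rewrite UE UE'; exact: (conj_alg sh_PZ (cE 1) (cE (-1)) (ed_tu hd 1 true true) (ed_tu hd (-1) true true) EP PiP (ed_uE hd true true) (ed_E hd) PP).
Qed.

(** A similarity by 1 + Kc can be cut so as to commute with a window. *)
Lemma cut_sim (g : B) : KsimZ g -> (forall N, FZ N * g = g * FZ N) -> exists N V V',
  [/\ inv2 DZ V V', FZ N * V = V * FZ N, FZ N * V' = V' * FZ N & g = V * PZ * V'].
Proof.
move=> [k [k' [ik [_ hk] gE]]] gF; have hn := hnZ p1 (X := X); have hD := DZ_csub p1 (X := X).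
have [C [dl [dl0 hdl]]] := perturb ik; have [Dk Dk' kk k'k] := ik.
have dl2 : 0 < dl / 2 by rewrite divr_gt0.
have [N hN] := hk _ dl2; have [n1 n2] := hN _ (leqnn N); set F := FZ N in n1 n2.
have FF : F * F = F by exact: chi_idem.
pose k2 := 1 + F * (k - 1) * F.
have DF : DZ F by exact: DZ_chi.
have Dk2 : DZ k2.
  exact: (csD hD (cs1 hD) (csM hD (csM hD DF (csB hD Dk (cs1 hD))) DF)).
have d : opnorm (k2 - k) <= dl.
  have -> : k2 - k = - ((1 - F) * (k - 1)) - F * ((k - 1) * (1 - F)) * 1 by rewrite /k2; ncring.
  apply: le_trans (opnormB_le _ _) _; rewrite opnormN (splitr dl); apply: lerD; first exact: n1.
  exact: opnorm_pm (opnorm_chi _ _) n2 (opnorm1_le _) (ltW dl2).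
have [[k2' ik2] hC] := hdl k2 Dk2 d; have [gC sm] := hC _ ik2.
have [_ Dk2' kk2 kk2'] := ik2.
have Fk2 : k2 * F = F * k2.
  have -> : k2 * F = F + F * (k - 1) * (F * F) by rewrite /k2; ncring.
  have -> : F * k2 = F + F * F * (k - 1) * F by rewrite /k2; ncring.
  by rewrite FF.
have Fk2' : k2' * F = F * k2'.
  have -> : k2' * F = k2' * (F * k2) * k2' by rewrite -!mulrA kk2 mulr1.
  by rewrite -Fk2 !mulrA kk2' mul1r.
have PF : PZ * F = F * PZ by rewrite -FZ_PZ.
have cF := csub_comm hn F; have hD' := csub_cap hD cF.
have DP : DZ PZ by exact: DZ_chi.
have idem (c c' : B) : c' * c = 1 -> c * PZ * c' * (c * PZ * c') = c * PZ * c'.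
  move=> e; have -> : c * PZ * c' * (c * PZ * c') = c * PZ * (c' * c) * PZ * c' by rewrite !mulrA.
  by rewrite e mulr1 -(mulrA c) PZ_PZ.
have Kd : KcZ (k * PZ * k' - k2 * PZ * k2').
  have -> : k * PZ * k' - k2 * PZ * k2' = (k * PZ * k' - PZ) - (k2 * PZ * k2' - PZ) by ncring.
  apply: (KcB hn hD).
    exact: (Kc_sim hn hD DP (fun N => opnorm_1chi p1 (winZ N)) (@bandZ R X p p1) (@edgeZ R X p p1) ik).
  exact: (Kc_sim hn hD DP (fun N => opnorm_1chi p1 (winZ N)) (@bandZ R X p p1) (@edgeZ R X p p1) ik2).
have D'g : DZ (k * PZ * k') /\ k * PZ * k' * F = F * (k * PZ * k').
  split; first exact: (csM hD (csM hD Dk DP) Dk').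
  by rewrite -gE; exact: esym (gF N).
have D'g2 : DZ (k2 * PZ * k2') /\ k2 * PZ * k2' * F = F * (k2 * PZ * k2').
  split; first exact: (csM hD (csM hD Dk2 DP) Dk2').
  exact: (csM cF (csM cF Fk2 PF) Fk2').
have [z [z' [iz Dz Dz' _ ez]]] := near_conj hn hD (fun N => opnorm_1chi p1 (winZ N)) (@bandZ R X p p1) hD'
  (fun T h => proj1 h) D'g D'g2 (idem _ _ k'k) (idem _ _ kk2') gC sm Kd.
exists N, (z' * k2), (k2' * z); split.
- exact: (inv2M hD (inv2_sym iz) ik2).
- exact: esym (csM cF (proj2 Dz') Fk2).
- exact: esym (csM cF Fk2' (proj2 Dz)).
case: iz => _ _ _ z2; rewrite gE.
have -> : z' * k2 * PZ * (k2' * z) = z' * (k2 * PZ * k2' * z) by rewrite !mulrA.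
by rewrite -ez mulrA z2 mul1r.
Qed.
End Cut.

(** * Matrices over the uniform Roe algebra *)

Section Labels.
Variable N : nat.
(** The positions of a window of Z, each taken twice, number the rows of the matrices. *)
Definition nlab := (2 * (2 * N).+1)%N.
Definition lab (a : 'I_nlab) : bool * int := (odd a, (a./2)%:Z - N%:Z).

Lemma lab_inj : injective lab.
Proof.
move=> a b [e1 e2]; apply: val_inj => /=; rewrite -[val a]odd_double_half -[val b]odd_double_half e1.
by congr (_ + _.*2)%N; move: e2; clear; lia.
Qed.

Lemma lab_onto (k : bool * int) : `|k.2| <= N%:Z -> exists a, lab a = k.
Proof.
case: k => b i hi; have h : (b + (`|(i + N%:Z)%R|).*2 < nlab)%N.
  by rewrite /nlab -muln2; move: hi; case: b => /=; clear; lia.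
exists (Ordinal h); rewrite /lab /= oddD odd_double addbF; congr (_, _); first by case: (b).
by rewrite halfD odd_double andbF add0n doubleK; move: hi => /=; case: (b) => /=; lia.
Qed.

Lemma lab_win a : `|(lab a).2| <= N%:Z.
Proof. by case: a => a ha; move: (ha); rewrite /lab /= /nlab; clear; have := odd_double_half a; lia. Qed.
End Labels.

Section Entries.
Context {R : realType} {X : metricType R} {p : R} (p1 : 1 <= p).
Local Notation J := (X * bool)%type.
Local Notation I := (J * int)%type.
Local Notation B := (bop I p1).
Local Notation A := (uniform_roe X p1).
Local Notation DZ := (@DZ R X p p1).
Local Notation FZ := (@FZ R X p p1).
Implicit Types (k l : bool * int) (S T : B).

Definition qent k l S : bop X p1 := ent k.1 l.1 (ent k.2 l.2 S).

Lemma mcoef_qent k l S x y : mcoef (qent k l S) x y = mcoef S ((x, k.1), k.2) ((y, l.1), l.2).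
Proof. by rewrite /qent !mcoef_ent. Qed.

Lemma qentB k l S T : qent k l (S - T) = qent k l S - qent k l T.
Proof. by rewrite /qent !entB. Qed.

Lemma qent_sum k l (K : Type) (s : seq K) (P : pred K) (f : K -> B) :
  qent k l (\sum_(a <- s | P a) f a) = \sum_(a <- s | P a) qent k l (f a).
Proof. by rewrite /qent !ent_sum. Qed.

Lemma qent_roe k l S : DZ S -> qent k l S \in roe_closure (p1 := p1).
Proof.
move=> DS; rewrite unfold_in; apply/asboolP => e e0.
have e2 : 0 < e / 2 by rewrite divr_gt0.
have [n [T [hT ST]]] := DS _ e2; exists (qent k l T).
  apply/finite_propagationP; exists n%:R => // x y; rewrite mcoef_qent => /hT[h _].
  exact: h.
rewrite -qentB; apply: le_lt_trans (opnorm_ent _ _ _) _; apply: le_lt_trans (opnorm_ent _ _ _) _.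
by apply: le_lt_trans ST _; rewrite ltr_pdivrMr // mulr_natr mulr2n ltrDl.
Qed.

(** The projection onto one copy of X. *)
Definition copy k : B := chi p1 (fun i : I => (i.1.2, i.2) == k).

Lemma qent_copy k l m S T : qent k l (S * copy m * T) = qent k m S * qent m l T.
Proof.
apply: mcoef_ext => x y.
rewrite -[RHS]/(qent k m S (qent m l T (ellp_delta p1 y)) x).
rewrite -[LHS]/(S (copy m (T (embed l.2 (embed l.1 (ellp_delta p1 y))))) ((x, k.1), k.2)).
rewrite /qent !entE; case: m => m1 m2 /=.
congr (S _ _); apply: ellp_ext => -[[z b] i]; rewrite chiE embedE /= xpair_eqE.
rewrite /pull_fun /=; case: (b =P m1) => [->|_]; case: (i =P m2) => [->|_] //=.
Qed.

Variable N : nat.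
Lemma FZ_sum : FZ N = \sum_(a < nlab N) copy (lab a).
Proof.
apply: mcoef_ext => i j; rewrite mcoef_sum mcoef_chi.
under eq_bigr => a _ do rewrite mcoef_chi.
have [->|ij] := eqVneq i j; last by rewrite andbF big1 // => a _; rewrite andbF.
under eq_bigr => a _ do rewrite andbT.
rewrite andbT; case: (boolP (winZ N j)) => wj.
  have [a ea] := @lab_onto N (j.1.2, j.2) wj.
  rewrite (bigD1 a) //= ea eqxx big1 ?addr0 // => c ca.
  by rewrite -ea (inj_eq (@lab_inj N)) eq_sym (negbTE ca).
rewrite big1 // => a _; case: eqP => // e; case/negP: wj.
by rewrite /winZ -[j.2]/((j.1.2, j.2).2) e lab_win.
Qed.

Definition roe (T : bop X p1) : A := insubd 0 T.
Lemma roeK (T : bop X p1) : T \in roe_closure (p1 := p1) -> val (roe T) = T.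
Proof. by move=> h; rewrite /roe val_insubd h. Qed.

(** The window of S as a matrix over the uniform Roe algebra. *)
Definition phi S : 'M[A]_(nlab N) := \matrix_(a, b) roe (qent (lab a) (lab b) S).

Lemma val_sum (K : Type) (s : seq K) (P : pred K) (f : K -> A) :
  val (\sum_(a <- s | P a) f a) = \sum_(a <- s | P a) val (f a).
Proof. exact: (big_morph val (fun _ _ => erefl) erefl). Qed.

Lemma val_phi S a b : DZ S -> val (phi S a b) = qent (lab a) (lab b) S.
Proof. by move=> DS; rewrite mxE roeK //; exact: qent_roe. Qed.

Let hD := DZ_csub p1 (X := X).

Lemma phiM S T : DZ S -> DZ T -> S * FZ N = S -> phi S *m phi T = phi (S * T).
Proof.
move=> DS DT SF; apply/matrixP => a b; apply: val_inj.
rewrite val_phi; last exact: (csM hD DS DT).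
rewrite [X in val X]mxE val_sum -{2}SF FZ_sum mulr_sumr mulr_suml qent_sum; apply: eq_bigr => c _.
by rewrite qent_copy -(val_phi _ _ DS) -(val_phi _ _ DT).
Qed.

Lemma phiB S T : DZ S -> DZ T -> phi (S - T) = phi S - phi T.
Proof.
move=> DS DT; apply/matrixP => a b; apply: val_inj.
rewrite val_phi; last exact: (csB hD DS DT).
by rewrite qentB -(val_phi _ _ DS) -(val_phi _ _ DT) [X in _ = val X]mxE [X in _ = val (_ + X)]mxE.
Qed.
End Entries.

(** * The triviality of K0 *)

(** If an idempotent s is equivalent both to t and to the sum of t and e, then e is
    absorbed by the class of t. *)
Lemma absorbed (A : pzRingType) (m : nat) (s t x y : 'M[A]_m) (c : 'M[A]_(m, 1)) (r : 'M[A]_(1, m))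
    (e : 'M[A]_1) (ss : s *m s = s) (tt : t *m t = t) (ee : e *m e = e) :
  x *m y = s -> y *m x = t -> t *m c = 0 -> r *m t = 0 -> r *m c = e -> t + c *m r = s ->
  exists k : Vmon A, (\pi_(Vmon A) (mk_idemp ee) + k = k)%qT.
Proof.
move=> xy yx tc rt rc tcr.
have st : mvn_equiv (mk_idemp ss) (mk_idemp tt) by exists x, y.
have ste : mvn_equiv (mk_idemp ss) (idemp_sum (mk_idemp tt) (mk_idemp ee)).
  exists (row_mx t c), (col_mx t r); split.
    by rewrite mul_row_col tt tcr.
  by rewrite mul_col_row tt tc rt rc.
exists (\pi_(Vmon A) (mk_idemp tt))%qT; rewrite addrC.
have /VmonP e1 := st; have /VmonP e2 := ste.
by rewrite -[RHS]e1 e2 pi_Vmon_add.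
Qed.

Lemma roeM {R : realType} {X : metricType R} {p : R} (p1 : 1 <= p) (S T : bop X p1) :
  S \in roe_closure (p1 := p1) -> T \in roe_closure (p1 := p1) ->
  val (roe S * roe T : uniform_roe X p1) = S * T.
Proof.
move=> hS hT; have e1 := roeK hS; have e2 := roeK hT.
by move: (roe S) (roe T) e1 e2 => s t <- <-.
Qed.

Section Final.
Context {R : realType} {X : metricType R} {p : R} (p1 : 1 <= p).
Local Notation J := (X * bool)%type.
Local Notation I := (J * int)%type.
Local Notation B := (bop I p1).
Local Notation A := (uniform_roe X p1).
Local Notation DZ := (@DZ R X p p1).
Local Notation FZ := (@FZ R X p p1).
Local Notation PZ := (@PZ R X p p1).
Variables (bgX : bounded_geometry X) (naX : ~ amenable X) (adX : asdim_le X 1).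
Local Open Scope quotient_scope.
Local Notation pV := (\pi_(Vmon A)).

Lemma scalar_idem (e : A) : e * e = e -> e%:M *m e%:M = e%:M :> 'M[A]_1.
Proof. by move=> ee; apply/matrixP => i j; rewrite mxE big_ord1 !mxE !ord1 eqxx !mulr1n ee. Qed.

(** The finite part of PZ is equivalent both to the difference with the idempotent placed
    at the origin, and to the sum of this difference and of the idempotent. *)
Lemma idem_absorbed (e : A) (ee : e * e = e) : exists k : Vmon A, pV (mk_idemp (scalar_idem ee)) + k = k.
Proof.
pose E : bop X p1 := val e; have roeE : E \in roe_closure (p1 := p1) by exact: (valP e).
have EE : E * E = E by exact: (congr1 val ee).
have hD := DZ_csub p1 (X := X).
have K := unit_Ksim bgX naX adX roeE EE; rewrite (unit_conj EE) in K.
pose eh := slotE E.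
have DE : DZ eh by exact: (csM hD (csM hD (DZ_chi _ _) (DZ_roe roeE)) (DZ_mu2 _ _ _)).
have Fl N : FZ N * eh = eh.
  apply: mcoef_ext => i j; rewrite mcoef_chil mcoef_slotE; case: ifP => // /negbT h.
  case: ifP => // /and4P[/eqP i0 _ _ _]; case/negP: h; by rewrite /winZ i0 normr0.
have Fr N : eh * FZ N = eh.
  apply: mcoef_ext => i j; rewrite mcoef_chir mcoef_slotE; case: ifP => // /negbT h.
  case: ifP => // /and4P[_ /eqP i0 _ _]; case/negP: h; by rewrite /winZ i0 normr0.
have gF N : FZ N * (PZ - eh) = (PZ - eh) * FZ N by rewrite mulrBr mulrBl Fl Fr FZ_PZ.
have [N [V [V' [iV FV FV' gE]]]] := cut_sim K gF; have [DV DV' VV V'V] := iV.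
pose F := FZ N; have FF : F * F = F by exact: chi_idem.
have DF : DZ F by exact: DZ_chi.
have DP : DZ PZ by exact: DZ_chi.
have FP : F * PZ = PZ * F by exact: FZ_PZ.
have PP := PZ_PZ p1 (X := X).
(* V conjugates PZ to PZ - eh and commutes with F, so x and y give the equivalence of the
   finite parts S and T. *)
pose S := F * PZ; pose T := F * (PZ - eh); pose x := PZ * V' * F; pose y := F * V * PZ.
have DS : DZ S by exact: (csM hD DF DP).
have DT : DZ T by exact: (csM hD DF (csB hD DP DE)).
have Dx : DZ x by exact: (csM hD (csM hD DP DV') DF).
have Dy : DZ y by exact: (csM hD (csM hD DF DV) DP).
have xF : x * F = x by rewrite /x -mulrA FF.
have yF : y * F = y by rewrite /y -mulrA -FP mulrA -(mulrA F V F) -FV !mulrA FF.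
have xy : x * y = S.
  have -> : x * y = PZ * V' * (F * F) * V * PZ by rewrite /x /y !mulrA.
  rewrite FF -(mulrA PZ) -FV' (mulrA PZ F) -(mulrA (PZ * F)) V'V mulr1.
  by rewrite -FP -mulrA PP.
have yx : y * x = T.
  have -> : y * x = F * (V * (PZ * PZ) * V') * F by rewrite /x /y !mulrA.
  by rewrite PP -gE -mulrA -gF mulrA FF.
have SF : S * F = S by rewrite /S -mulrA -FP mulrA FF.
have TF : T * F = T by rewrite /T -mulrA -gF mulrA FF.
have SS : S * S = S by rewrite {2}/S mulrA SF /S -mulrA PP.
have TT : T * T = T.
  by rewrite -yx mulrA -(mulrA y x y) xy (_ : y * S = y) // /S mulrA yF /y -mulrA PP.
have pS := phiM DS DS SF; rewrite SS in pS.
have pT := phiM DT DT TF; rewrite TT in pT.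
have XY : phi N x *m phi N y = phi N S := etrans (phiM Dx Dy xF) (congr1 (phi N) xy).
have YX : phi N y *m phi N x = phi N T := etrans (phiM Dy Dx yF) (congr1 (phi N) yx).
have [a0 ea0] : exists a : 'I_(nlab N), lab a = (true, 0 : int) by apply: lab_onto; rewrite normr0.
pose c : 'M[A]_(nlab N, 1) := \matrix_(a, b) (if a == a0 then e else 0).
pose r : 'M[A]_(1, nlab N) := \matrix_(a, b) (if b == a0 then e else 0).
have rc : r *m c = e%:M.
  apply/matrixP => a b; rewrite [LHS]mxE [RHS]mxE !ord1 eqxx mulr1n (bigD1 a0) //= !mxE eqxx ee big1 ?addr0 //.
  by move=> d /negbTE da; rewrite !mxE da mul0r.
have cr : c *m r = phi N eh.
  apply/matrixP => a b; apply: val_inj; rewrite (val_phi _ _ DE) [X in val X]mxE big_ord1 [X in val (X * _)]mxE [X in val (_ * X)]mxE.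
  apply: mcoef_ext => u v; rewrite mcoef_qent mcoef_slotE /=.
  have la d : ((lab d).2 == 0) && (lab d).1 = (d == a0).
    rewrite -(inj_eq (@lab_inj N)) ea0; case: (lab d) => d1 d2; rewrite xpair_eqE /= andbC; congr (_ && _).
    by case: d1.
  have -> : [&& (lab a).2 == 0, (lab b).2 == 0, (lab a).1 & (lab b).1] = (a == a0) && (b == a0).
    by rewrite -!la; case: (_ == 0); case: (_ == 0); rewrite ?andbF ?andbT.
  case: (a == a0); case: (b == a0) => /=; last first.
  - by rewrite mul0r.
  - by rewrite mul0r.
  - by rewrite mulr0.
  exact: (congr1 (fun z : A => mcoef (val z) u v) ee).
have re : e%:M *m r = r by rewrite -rc; apply/matrixP => a b; rewrite rc mxE big_ord1 !mxE !ord1 eqxx mulr1n; case: eqP; rewrite ?mulr0.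
have ce : c *m e%:M = c by apply/matrixP => a b; rewrite mxE big_ord1 !mxE !ord1 eqxx mulr1n; case: eqP; rewrite ?mul0r.
have P1 : PZ * eh = eh.
  apply: mcoef_ext => i j; rewrite mcoef_chil mcoef_slotE; case: ifP => // /negbT h'.
  case: ifP => // /and4P[/eqP i0 _ _ _]; case/negP: h'; by rewrite /posZ i0.
have P2 : eh * PZ = eh.
  apply: mcoef_ext => i j; rewrite mcoef_chir mcoef_slotE; case: ifP => // /negbT h'.
  case: ifP => // /and4P[_ /eqP i0 _ _]; case/negP: h'; by rewrite /posZ i0.
have ehh : eh * eh = eh.
  have h : (PZ - eh) * (PZ - eh) = PZ - eh.
    have -> : (PZ - eh) * (PZ - eh) = V * (PZ * (V' * V) * PZ) * V' by rewrite gE !mulrA.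
    by rewrite V'V mulr1 PP gE.
  have -> : eh * eh = (PZ - eh) * (PZ - eh) - PZ * PZ + PZ * eh + eh * PZ by ncring.
  by rewrite h PP P1 P2; ncring.
have Te : T * eh = 0 by rewrite /T -mulrA mulrBl P1 ehh subrr mulr0.
have eT : eh * T = 0 by rewrite /T mulrA Fr mulrBr P2 ehh subrr.
have phi0 : phi N (0 : B) = 0 by have := phiB N DS DS; rewrite !subrr.
have pTe : phi N T *m c = 0.
  have -> : c = phi N eh *m c by rewrite -cr -mulmxA rc ce.
  by rewrite mulmxA (phiM DT DE TF) Te phi0 mul0mx.
have peT : r *m phi N T = 0.
  have -> : r = r *m phi N eh by rewrite -cr mulmxA rc re.
  by rewrite -mulmxA (phiM DE DT (Fr N)) eT phi0 mulmx0.
have TE : T = S - eh by rewrite /T mulrBr Fl.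
have e4 : phi N T = phi N S - phi N eh := etrans (congr1 (phi N) TE) (phiB N DS DE).
have pTS : phi N T + c *m r = phi N S := etrans (congr2 (fun a b => a + b) e4 cr) (subrK (phi N eh) (phi N S)).
exact: (absorbed pS pT (scalar_idem ee) XY YX pTe peT rc pTS).
Qed.

(** Matrices over the algebra embed in the algebra: n copies of X fit in X. *)
Lemma corner (n : nat) : exists (r : 'M[A]_(1, n)) (c : 'M[A]_(n, 1)), c *m r = 1%:M.
Proof.
have [s s0 [f [fs fi]]] := spread bgX naX n.
have j1 (k : 'I_n) (x x' y : X) : Some (f x k) = Some y -> Some (f x' k) = Some y -> x = x'.
  by move=> [<-] [/esym e]; have [] := fi _ _ _ _ (ltn_ord k) (ltn_ord k) e.
pose g (k : 'I_n) (y : X) : option X := match pselect (exists x, f x k = y) with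
  | left h => Some (projT1 (cid h)) | right _ => None end.
have gP k y x : g k y = Some x -> f x k = y.
  by rewrite /g; case: pselect => // h [<-]; exact: projT2 (cid h).
have gf (k l : 'I_n) x : g k (f x l) = if l == k then Some x else None.
  rewrite /g; case: pselect => [h|h].
    have e := projT2 (cid h); have [e1 e2] := fi _ _ _ _ (ltn_ord k) (ltn_ord l) e.
    by rewrite e1 (_ : l == k) //; apply/eqP/val_inj.
  by case: eqP => // e; case: h; exists x; rewrite e.
have j2 (k : 'I_n) (x x' y : X) : g k x = Some y -> g k x' = Some y -> x = x'.
  by move=> /gP <- /gP <-.
pose V' k : bop X p1 := pull p1 (Pinj (j1 k)); pose V k : bop X p1 := pull p1 (Pinj (j2 k)).
have rV' k : V' k \in roe_closure (p1 := p1).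
  rewrite unfold_in; apply/asboolP => e e0; exists (V' k); last by rewrite subrr opnorm0.
  apply/finite_propagationP; exists s => // x y; rewrite mcoef_pull /=.
  by case: (Some (f x k) =P Some y) => [[<-] _|_]; [exact: fs|rewrite eqxx].
have rV k : V k \in roe_closure (p1 := p1).
  rewrite unfold_in; apply/asboolP => e e0; exists (V k); last by rewrite subrr opnorm0.
  apply/finite_propagationP; exists s => // x y; rewrite mcoef_pull /=.
  by case: (g k x =P Some y) => [/gP <- _|_]; [rewrite metric_sym; exact: fs|rewrite eqxx].
have VV k l : V' k * V l = if k == l then 1 else 0.
  apply: mcoef_ext => x y; rewrite -[LHS]/(V' k (V l (ellp_delta p1 y)) x).
  rewrite /V' pullE /= /pull_fun /= gf eq_sym; case: (l =P k) => e.
    by rewrite mcoef1.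
  by rewrite mcoef0.
exists (\row_k roe (V k)), (\col_k roe (V' k)).
apply/matrixP => k l; rewrite mxE big_ord1 !mxE; apply: val_inj.
transitivity (V' k * V l); first exact: (roeM (rV' k) (rV l)).
by rewrite VV; case: (k == l).
Qed.

(** With c r = 1 from corner, the idempotent u is equivalent to r u c. *)
Lemma idem_to_one (u : idemp A) : exists (e : A) (ee : e * e = e), mvn_equiv u (mk_idemp (scalar_idem ee)).
Proof.
case: u => n [m hm]; have mm : m *m m = m by exact/eqP.
have [r [c cr]] := corner n.
pose w := r *m m *m c; have ww : w *m w = w.
  by rewrite /w -!mulmxA (mulmxA c r) cr mul1mx (mulmxA m m) mm.
have wE : w = (w 0 0)%:M by apply/matrixP => i j; rewrite !ord1 [RHS]mxE eqxx mulr1n.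
have ee : w 0 0 * w 0 0 = w 0 0.
  by have := congr1 (fun M : 'M[A]_1 => M ord0 ord0) ww; rewrite [LHS]mxE big_ord1.
exists (w 0 0), ee; exists (m *m c), (r *m m); split.
  by rewrite /idemp_mx /= -mulmxA (mulmxA c r) cr mul1mx mm.
by rewrite /idemp_mx /= -wE /w mulmxA -(mulmxA r m m) mm.
Qed.

Lemma V_absorbed (v : Vmon A) : exists k, v + k = k.
Proof.
elim/quotW: v => u; have [e [ee h]] := idem_to_one u.
by have [k hk] := idem_absorbed ee; exists k; have /VmonP -> := h.
Qed.
End Final.

Theorem corollaryD (R : realType) (X : metricType R)
    (bgX : bounded_geometry X) (naX : ~ amenable X) (adX : asdim_le X 1)
    (p : R) (p1 : 1 <= p) :
  forall z : K0 (uniform_roe X p1), z = 0.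
Proof.
elim/quotW => -[a b]; apply/grotP.
have [k hk] := V_absorbed bgX naX adX a; have [l hl] := V_absorbed bgX naX adX b.
exists (k + l); rewrite /= addr0 add0r.
by rewrite addrA hk [k + l]addrC addrA hl addrC.
Qed.
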